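(* Let $X_1,X_2,\dots$ be independent identically distributed random vectors in $\mathbb R^2$ and $S_k:=X_1+\dots+X_k$, $k\ge1$. Assume that $\mathbb P(X_1\in h)=0$ for every affine line $h\subset\mathbb R^2$, and that $X_1$ has zero mean and a finite covariance matrix $\Sigma$. Let $U$ be a random vector distributed uniformly over the unit circle $\mathbb S^1$, and let $R$ be the function defined in the context. Then $\mathbb E R(\Sigma^{-1/2}U)$ is finite and positive, and $$\mathbb P\bigl(0\notin\operatorname{conv}(S_1,\dots,S_n)\bigr)\sim \sqrt2\;\mathbb E R\bigl(\Sigma^{-1/2}U\bigr)\,\frac{\log n}{\sqrt{\pi n}},\qquad n\to\infty.$$
   Context: $a_n\sim b_n$ means $\lim_{n\to\infty}a_n/b_n=1$. The covariance matrix $\Sigma$ is non-degenerate because $X_1$ does not charge affine lines; $\Sigma^{-1/2}$ is the inverse of its symmetric positive definite square root. For non-zero $u\in\mathbb R^2$ put $H(u):=\{z\in\mathbb R^2:\langle z,u\rangle\ge0\}$, $T(u):=\inf\{k\ge1: S_k\notin H(u)\}$, and $$R(u):=-\frac{\mathbb E\langle S_{T(u)},u\rangle}{\sqrt{\langle\Sigma u,u\rangle}}.$$ The value $R(u)$ does not depend on $|u|$. *)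

(* Defs.v *)
From HB Require Import structures.
From mathcomp Require Import all_boot all_order all_algebra finmap.
From mathcomp Require Import all_classical all_reals all_analysis.

Set Implicit Arguments.
Unset Strict Implicit.
Unset Printing Implicit Defensive.

Import Order.TTheory GRing.Theory Num.Theory.
Import numFieldNormedType.Exports.

Local Open Scope classical_set_scope.
Local Open Scope ring_scope.

Section plane.
Context {R : realType}.
Implicit Types (u v z : R * R) (A S : 'M[R]_2).

(* Points of the plane are pairs: [R * R] carries the product (i.e. Borel)
   sigma-algebra. *)
Definition component (i : 'I_2) z : R := if i == 0 then z.1 else z.2.

Definition inner u v : R := u.1 * v.1 + u.2 * v.2.

Definition mxact A u : R * R :=
  (A 0 0 * u.1 + A 0 1 * u.2, A 1 0 * u.1 + A 1 1 * u.2).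

Definition affine_line (h : set (R * R)) : Prop :=
  exists a v, v != 0 /\ h = [set a + t *: v | t in [set: R]].

Definition half_plane u : set (R * R) := [set z | 0 <= inner z u].

Definition conv_hull (V : lmodType R) (B : set V) : set V :=
  smallest (@convex_set R V) B.

Definition spd_sqrt_of S A : Prop :=
  [/\ A^T = A, (forall u, u != 0 -> 0 < inner (mxact A u) u) & A *m A = S].

(* The default value 0 is only taken when [S] has no symmetric positive
   definite square root; otherwise the square root is unique. *)
Definition mxsqrt S : 'M[R]_2 := xget 0 [set A | spd_sqrt_of S A].

Definition mxinvsqrt S : 'M[R]_2 := invmx (mxsqrt S).

Lemma twopi_gt0 : 0 < 2 * pi :> R.
Proof. by rewrite mulr_gt0// pi_gt0. Qed.

(* Law of (cos t, sin t) for t uniform on [0, 2pi]: normalized arc length. *)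
Definition uniform_circle : set (R * R) -> \bar R :=
  pushforward (uniform_prob twopi_gt0) (fun t : R => (cos t, sin t)).

End plane.

Definition mutually_independent d d' (T : measurableType d)
    (T' : measurableType d') (R : realType) (P : probability T R)
    (X : nat -> {RV P >-> T'}) : Prop :=
  forall (J : {fset nat}) (B : nat -> set T'), (forall i, measurable (B i)) ->
  P (\bigcap_(i in [set` J]) (X i @^-1` B i))
    = (\prod_(i <- J) P (X i @^-1` B i))%E.

Definition identically_distributed d d' (T : measurableType d)
    (T' : measurableType d') (R : realType) (P : probability T R)
    (X : nat -> {RV P >-> T'}) : Prop :=
  forall i (B : set T'), measurable B ->
  distribution P (X i) B = distribution P (X 0%N) B.

Section random_walk.
Context d (T : measurableType d) (R : realType) (P : probability T R).
(* Steps are indexed from 0: [X i] is the (i+1)-st step. *)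
Variable X : nat -> {RV P >-> (R * R)%type}.
Implicit Types (u : R * R) (w : T).

Definition walk (k : nat) w : R * R := \sum_(i < k) X i w.

Definition covmx : 'M[R]_2 :=
  \matrix_(i, j) fine (covariance P (component i \o X 0%N) (component j \o X 0%N)).

(* [None] stands for an infinite exit time (infimum of the empty set). *)
Definition exit_time u w : option nat :=
  if pselect (exists k, (1 <= k)%N && (walk k w \notin half_plane u)) is left h
  then Some (ex_minn h) else None.

(* The value on the event of infinite exit time is a convention. *)
Definition walk_at_exit u w : R * R :=
  if exit_time u w is Some k then walk k w else 0.

(* Extended-real valued, so that finiteness of the expectation is not built in. *)
Definition Rfun u : \bar R :=
  (- 'E_P[fun w => inner (walk_at_exit u w) u]
     * (Num.sqrt (inner (mxact covmx u) u))^-1%:E)%E.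

Definition walk_hull (n : nat) w : set (R * R) :=
  conv_hull [set walk k w | k in [set k | (1 <= k <= n)%N]].

End random_walk.

(* Main.v *)
Require Import Defs.
From HB Require Import structures.
From mathcomp Require Import all_boot all_order all_algebra finmap.
From mathcomp Require Import all_classical all_reals all_analysis.
From mathcomp Require Import measurable_realfun.
From mathcomp Require Import ring lra zify.

Set Implicit Arguments.
Unset Strict Implicit.
Unset Printing Implicit Defensive.

Import Order.TTheory GRing.Theory Num.Theory.
Import numFieldNormedType.Exports.

Local Open Scope classical_set_scope.
Local Open Scope ring_scope.

(**
After the linear change of variables Sigma^(-1/2) the steps are isotropic.
Almost surely 0 is outside the hull of S_1, ..., S_n iff for exactly one k <= n
all S_j with j <= n satisfy det(S_k, S_j) >= 0.  Splitting the walk at that k and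
rotating its first k steps cyclically shows
   P(0 notin hull) = sum_(k <= n) (1/k) E q_(n-k)(S_k^perp),
where q_m(v) is the probability that <S_j, v> >= 0 for all j <= m.

Write M_n(v) = E[<S_n, v>; <S_j, v> >= 0 for j <= n], which increases to R(v).
For q and M one has sum_k q_k(-v) q_(n-k)(v) = 1 (time of the minimum, reversal) and
sum_(k <= n) b_k = sum_k M_k(v) q_(n-k)(-v) with b_k = E|<S_k, v>| / (2k) (expected
maximum, cyclic rotation).  The weights beta_k = C(2k, k) / 4^k satisfy
beta * beta = 1 and b_k ~ beta_k / sqrt 2, so q can be compared with beta by
convolution alone: sum_(m <= N) q_m(v) lies asymptotically between
sqrt 2 M_K(v) and 1 / (sqrt 2 M_K(-v)) times sum_(m <= N) beta_m, uniformly in v,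
and R(v) R(-v) = 1/2 closes the gap.

The direction of S_k equidistributes on the circle: by Lindeberg replacement
sector probabilities do not change asymptotically under rotations of the steps,
and E|<S_k, v>| is that of a simple random walk.  Hence the averages over S_k^perp
satisfy sum_(m <= N) E q_m(S_k^perp) ~ sqrt 2 ER sum_(m <= N) beta_m for k, N large,
monotonicity in m turns this into E q_m(S_k^perp) ~ sqrt 2 ER beta_m, and the
harmonic weights 1/k produce log n, while beta_n ~ 1 / sqrt (pi n).
*)

(** * Laws of i.i.d. step sequences *)

(** The weights beta_k are the coefficients of (1 - x)^(-1/2). For a symmetric law the identity
    q(-v) * q(v) = 1 reads q * q = 1 and forces q = beta. In general beta is the reference sequence,
    and R(v) R(-v) = 1/2 replaces the common value 1/sqrt 2 of the symmetric case. The obstacle is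
    uniformity in the direction. Equidistribution averages continuous functions only, and R is
    merely an increasing limit of the M_K. Each M_K is continuous, since almost surely no S_j with j
    > 0 lies on a given line through 0. Therefore K stays fixed in both bounds on the partial sums
    of q; they are first averaged over the direction of S_k, and only then does K grow, by dominated
    convergence on the circle. There 1 / (sqrt 2 M_K(-v)) decreases to sqrt 2 R(v), the limit of the
    lower bound. No limit law for S_n enters. The reference walk has steps (+-h, +-h) and an
    explicit mean absolute value. Anticoncentration near lines follows from the slow growth of
    E|S_n|, and directions equidistribute because the reference walk is the same for every rotation
    of the steps. *)

Section step_sequences.
Context (R : realType).

(** Finite-dimensional boxes form an intersection-stable generator, so a finite measure on step
    sequences is determined by its values on them. *)
Definition cylinders : set (set (nat -> R * R)) :=
  [set A | exists n (B : nat -> set (R * R)), (forall i, measurable (B i)) /\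
    A = [set x : _ | forall i, (i < n)%N -> B i (x i)]].

Definition steps : Type := g_sigma_algebraType cylinders.
HB.instance Definition _ := Measurable.on steps.

Definition step (x : steps) (i : nat) : R * R := (x : nat -> R * R) i.

Lemma measurable_step i : measurable_fun setT (fun x : steps => step x i).
Proof.
move=> _ A mA; rewrite setTI; apply: sub_sigma_algebra.
exists i.+1, (fun j => if j == i then A else setT); split.
  by move=> j; case: ifP.
apply/seteqP; split => x /=.
  by move=> Ax j _; case: eqP => // ->.
by move/(_ i (leqnn _)); rewrite eqxx.
Qed.

Lemma measurable_steps d (T : measurableType d) (f : T -> steps) :
  (forall i, measurable_fun setT (fun t => step (f t) i)) ->
  measurable_fun setT f.
Proof.
move=> mf; apply: (@measurability _ _ T steps setT f (cylinders : set (set steps))) => //.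
move=> _ [_ [n [B [mB ->]]] <-]; rewrite setTI.
have -> : f @^-1` [set x : steps | forall i, (i < n)%N -> B i (step x i)] =
    \bigcap_(i in `I_n) ((fun t => step (f t) i) @^-1` B i) by [].
apply: fin_bigcap_measurable => // i _.
by rewrite -[X in measurable X]setTI; exact: mf.
Qed.

Lemma setI_closed_cylinders : setI_closed cylinders.
Proof.
move=> _ _ [n [A [mA ->]]] [m [B [mB ->]]].
exists (maxn n m), (fun i => (if (i < n)%N then A i else setT) `&`
  (if (i < m)%N then B i else setT)); split.
  by move=> i; apply: measurableI; case: ifP.
apply/seteqP; split => x /=.
  by move=> [hA hB] i _; split; case: ifP => // h; [exact: hA|exact: hB].
move=> h; split => i ilt.
- by have [] := h i (leq_trans ilt (leq_maxl _ _)); rewrite ilt.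
- by have [_] := h i (leq_trans ilt (leq_maxr _ _)); rewrite ilt.
Qed.

Lemma steps_measure_unique (m1 m2 : {measure set steps -> \bar R}) :
  (m1 setT < +oo)%E -> (forall A, cylinders A -> m1 A = m2 A) ->
  forall A, measurable A -> m1 A = m2 A.
Proof.
move=> m1oo m12 A mA.
have cT : cylinders setT.
  by exists 0%N, (fun=> setT); split => //; apply/seteqP.
apply: (@measure_unique _ _ steps cylinders (fun=> setT)) => //.
- exact: setI_closed_cylinders.
- by rewrite bigcup_const.
Qed.

(** Independence and equality of the marginals in one formula: every factor on the right is taken
    under the law of step 0. *)
Definition iid_law (mu : set steps -> \bar R) := forall n (B : nat -> set (R * R)),
  (forall i, measurable (B i)) ->
  mu [set x : steps | forall i, (i < n)%N -> B i (step x i)] =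
  (\prod_(i < n) mu [set x : steps | B i (step x 0%N)])%E.

End step_sequences.

Lemma product_setT d1 d2 (T1 : measurableType d1) (T2 : measurableType d2)
  (R : realType) (P1 : probability T1 R) (P2 : probability T2 R) :
  (P1 \x P2)%E setT = 1%E.
Proof.
by rewrite -setXTT product_measure1E//= !probability_setT mule1.
Qed.

Section laws.
Context (R : realType) (mu : probability (steps R) R).
Hypothesis mu_iid : iid_law mu.

(** Source of all changes of variables below: a random step sequence whose box probabilities factor
    as under [mu] has law [mu]. *)
Lemma law_eq d (T : measurableType d) (P : {measure set T -> \bar R}) (f : T -> steps R) :
  (P setT < +oo)%E -> measurable_fun setT f ->
  (forall n (B : nat -> set (R * R)), (forall i, measurable (B i)) ->
    P [set t | forall i, (i < n)%N -> B i (step (f t) i)] =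
    (\prod_(i < n) mu [set x : steps R | B i (step x 0%N)])%E) ->
  forall A, measurable A -> P (f @^-1` A) = mu A.
Proof.
move=> Poo mf fB A mA.
pose g : {mfun T >-> steps R} := mfun_Sub (mem_set mf).
have -> : P (f @^-1` A) = pushforward P g A by [].
apply: (@steps_measure_unique R (pushforward P g) mu) => //.
move=> _ [n [B [mB ->]]].
exact: etrans (fB n B mB) (esym (mu_iid n mB)).
Qed.

Definition restep (s : nat -> nat) (x : steps R) : steps R :=
  fun i => step x (s i).

Definition splice k (x y : steps R) : steps R :=
  fun i => if (i < k)%N then step x i else step y (i - k)%N.

Lemma step_splice k x y i : step (splice k x y) i =
  if (i < k)%N then step x i else step y (i - k)%N.
Proof. by []. Qed.

Lemma step_restep s x i : step (restep s x) i = step x (s i).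
Proof. by []. Qed.

Definition shiftn k : steps R -> steps R := restep (addn k).

Lemma measurable_restep s : measurable_fun setT (restep s).
Proof. by apply: measurable_steps => i; exact: measurable_step. Qed.

Lemma law_restep s A : injective s -> measurable A ->
  mu (restep s @^-1` A) = mu A.
Proof.
move=> inj_s mA; apply: (@law_eq _ _ mu (restep s)) => //.
- exact: (le_lt_trans (probability_le1 mu measurableT) (ltry 1)).
- exact: measurable_restep.
move=> n B mB.
pose N := (\max_(i < n) s i).+1.
have sN (i : 'I_n) : (s i < N)%N by rewrite ltnS; exact: (leq_bigmax i).
(* As [s] is injective, this is one of the [B i] when [j] is a value of [s] below [n], and the whole
   plane otherwise; the latter contributes a factor 1. *)
pose B' j := \bigcap_(i in [set i | (i < n)%N /\ s i = j]) B i.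
have mB' j : measurable (B' j).
  by apply: bigcap_measurableType => // i _; exact: mB.
have -> : [set t : steps R | forall i, (i < n)%N -> B i (step (restep s t) i)] =
    [set x : steps R | forall i, (i < N)%N -> B' i (step x i)].
  apply/seteqP; split => x /= h.
    by move=> j _ i [ilt <-]; exact: h.
  by move=> i ilt; apply: (h (s i)) => //; exact: (sN (Ordinal ilt)).
apply: etrans (mu_iid N mB') _; rewrite [RHS](partition_big (fun i : 'I_n => Ordinal (sN i)) predT)//=.
apply: eq_bigr => j _.
case: (pselect (exists i0 : 'I_n, s i0 = j)) => [[i0 si0]|nj].
  rewrite (big_pred1 i0); last first.
    move=> i /=; rewrite -val_eqE /= -si0; apply/eqP/eqP => [/inj_s/val_inj//|->//].
  congr (mu _); apply/seteqP; split => x /=.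
    by move=> /(_ i0); apply; split.
  by move=> Bx i [ilt]; rewrite -si0 => /inj_s ->.
rewrite big_pred0.
  rewrite -(probability_setT mu); congr (mu _); apply/seteqP; split => x //= _ i [ilt sij].
  by exfalso; apply: nj; exists (Ordinal ilt).
by move=> i; apply/negP => /eqP/(congr1 val) /= h; apply: nj; exists i.
Qed.

Lemma measurable_splice k : measurable_fun setT
  (fun z : steps R * steps R => splice k z.1 z.2).
Proof.
apply: measurable_steps => i; rewrite /splice {1}/step; case: (i < k)%N.
  by apply: (measurableT_comp (measurable_step i)) measurable_fst.
by apply: (measurableT_comp (measurable_step (i - k))) measurable_snd.
Qed.

(** The Markov property at the fixed time [k]: the steps after [k] may be redrawn independently. *)
Lemma law_splice k A : measurable A ->
  (mu \x mu)%E ((fun z => splice k z.1 z.2) @^-1` A) = mu A.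
Proof.
move=> mA.
apply: (@law_eq _ _ (mu \x mu)%E) => //.
- by rewrite [ltLHS](product_setT mu mu) ltry.
-
  exact: measurable_splice.
move=> n B mB.
pose C1 := [set x : steps R | forall i, (i < minn n k)%N -> B i (step x i)].
pose C2 := [set x : steps R | forall i, (i < n - k)%N -> B (k + i)%N (step x i)].
have mC1 : measurable C1.
  by apply: sub_sigma_algebra; exists (minn n k), B.
have mC2 : measurable C2.
  by apply: sub_sigma_algebra; exists (n - k)%N, (fun i => B (k + i)%N).
rewrite (_ : [set t | _] = C1 `*` C2); last first.
  apply/seteqP; split => -[x y] /=.
    move=> h; split => i; rewrite /= ?leq_min.
      by move=> /andP[ilt ik]; have := h i ilt; rewrite step_splice ik.
    rewrite ltn_subRL => ilt; have := h _ ilt.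
    by rewrite step_splice ltnNge leq_addr /= addKn.
  move=> [h1 h2] i ilt; rewrite step_splice; case: ltnP => ik.
    by apply: h1; rewrite leq_min ilt.
  have := h2 (i - k)%N; rewrite /= subnKC//; apply; lia.
have e1 := mu_iid (minn n k) mB.
have e2 := mu_iid (n - k)%N (fun i => mB (k + i)%N).
apply: etrans (product_measure1E _ _ mC1 mC2) _.
apply: etrans (congr2 mule e1 e2) _.
rewrite -(big_mkord xpredT (fun i => mu [set x : steps R | B i (step x 0%N)])).
rewrite -(big_mkord xpredT (fun i => mu [set x : steps R | B (k + i)%N (step x 0%N)])).
rewrite -[RHS](big_mkord xpredT (fun i => mu [set x : steps R | B i (step x 0%N)])).
case: (leqP k n) => kn.
  rewrite [RHS](big_cat_nat _ kn)//=; congr (_ * _)%E.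
  rewrite -[in RHS](add0n k) big_addn; apply: eq_bigr => i _; by rewrite addnC.
have -> : (n - k = 0)%N by lia.
by rewrite (big_geq (leqnn 0)) mule1.
Qed.

Lemma integral_restep (s : nat -> nat) (F : steps R -> \bar R) : injective s ->
  measurable_fun setT F -> (forall x, 0 <= F x)%E ->
  (\int[mu]_x F (restep s x) = \int[mu]_x F x)%E.
Proof.
move=> inj_s mF F0.
pose g : {mfun steps R >-> steps R} := mfun_Sub (mem_set (measurable_restep s)).
transitivity (\int[pushforward mu g]_x F x)%E.
  by rewrite ge0_integral_pushforward.
apply: eq_measure_integral => A mA _; exact: law_restep.
Qed.

Definition prefix_only T k (f : steps R -> T) :=
  forall x x', (forall i, (i < k)%N -> step x i = step x' i) -> f x = f x'.

Lemma splice_prefix T k (f : steps R -> T) x y :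
  prefix_only k f -> f (splice k x y) = f x.
Proof. by move=> pf; apply: pf => i ik; rewrite step_splice ik. Qed.

Lemma shiftn_splice k x y : shiftn k (splice k x y) = y.
Proof.
apply/funext => i; rewrite /shiftn /restep step_splice.
by rewrite ltnNge leq_addr /= addKn.
Qed.

(** Conditioning on the first [k] steps. Under [splice] the past, all that [F] sees of its first
    argument, comes from one copy and the future from the other, so Tonelli applies. *)
Lemma integral_splice k (F : steps R * steps R -> \bar R) :
  (forall y, prefix_only k (fun x => F (x, y))) ->
  measurable_fun setT F -> (forall z, 0 <= F z)%E ->
  (\int[mu]_x F (x, shiftn k x) = \int[mu]_x \int[mu]_y F (x, y))%E.
Proof.
move=> pF mF F0.
transitivity (\int[(mu \x mu)%E]_z F z)%E; last exact: fubini_tonelli1.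
pose g : {mfun (steps R * steps R)%type >-> steps R} :=
  mfun_Sub (mem_set (measurable_splice k)).
have mG : measurable_fun setT (fun x => F (x, shiftn k x)).
  apply: (measurableT_comp mF); apply: measurable_fun_pair => //.
  exact: measurable_restep.
transitivity (\int[pushforward (mu \x mu)%E g]_x F (x, shiftn k x))%E.
  apply: eq_measure_integral => A mA _; symmetry; exact: law_splice.
rewrite ge0_integral_pushforward//=.
  apply: eq_integral => z _; case: z => x y.
  by rewrite /= shiftn_splice (splice_prefix x y (pF y)).
exact: measurable_splice.
Qed.

End laws.

(** * Planar walks *)

Section deterministic_walk.
Context (R : realType).
Implicit Types (x y : steps R) (u v w : R * R).

Definition psum k x : R * R := \sum_(i < k) step x i.

(** The quarter turn; [inner w (perp v)] is the determinant det(v, w), positive when [w] lies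
    counterclockwise of [v]. *)
Definition perp v : R * R := (- v.2, v.1).

Definition sqn v : R := inner v v.

Lemma innerDl u v w : inner (u + v) w = inner u w + inner v w.
Proof. by rewrite /inner /=; ring. Qed.

Lemma innerBl u v w : inner (u - v) w = inner u w - inner v w.
Proof. by rewrite /inner /=; ring. Qed.

Lemma inner0l w : inner 0 w = 0.
Proof. by rewrite /inner /=; ring. Qed.

Lemma innerNr u v : inner u (- v) = - inner u v.
Proof. by rewrite /inner /=; ring. Qed.

Lemma innerC u v : inner u v = inner v u.
Proof. by rewrite /inner; ring. Qed.

Lemma innerZr a u v : inner u (a *: v) = a * inner u v.
Proof. by rewrite /inner /=; rewrite /GRing.scale /=; ring. Qed.

Lemma inner_perpC u v : inner u (perp v) = - inner v (perp u).
Proof. by rewrite /inner /=; ring. Qed.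

Lemma inner_perp_self u : inner u (perp u) = 0.
Proof. by rewrite /inner /=; ring. Qed.

Lemma sqn_ge0 v : 0 <= sqn v.
Proof. by rewrite /sqn /inner -!expr2 addr_ge0// sqr_ge0. Qed.

Lemma sqn_gt0 v : v != 0 -> 0 < sqn v.
Proof.
case: v => a b ab; rewrite lt_neqAle sqn_ge0 andbT eq_sym.
apply: contra ab; rewrite /sqn /inner /= -!expr2 paddr_eq0 ?sqr_ge0//.
by rewrite !sqrf_eq0 => /andP[/eqP-> /eqP->].
Qed.

Lemma sqn_perp v : sqn (perp v) = sqn v.
Proof. by rewrite /sqn /inner /=; ring. Qed.

Lemma sqnN v : sqn (- v) = sqn v.
Proof. by rewrite /sqn /inner /=; ring. Qed.

Lemma sqnZ a v : sqn (a *: v) = a ^+ 2 * sqn v.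
Proof. by rewrite /sqn /inner /=; rewrite /GRing.scale /=; ring. Qed.

Lemma perp_eq0 v : (perp v == 0) = (v == 0).
Proof.
case: v => a b; rewrite /perp /=.
by apply/eqP/eqP => -[] => [/eqP|->] => [|->]; rewrite ?oppr0// oppr_eq0 => /eqP-> ->.
Qed.

Lemma unit_neq0 v : sqn v = 1 -> v != 0.
Proof.
move=> v1; apply/eqP => v0; move: v1; rewrite v0 /sqn inner0l => /eqP.
by rewrite eq_sym oner_eq0.
Qed.

Lemma psum0 x : psum 0 x = 0.
Proof. by rewrite /psum big_ord0. Qed.

Lemma psumS k x : psum k.+1 x = psum k x + step x k.
Proof. by rewrite /psum big_ord_recr. Qed.

Lemma psum1 x : psum 1 x = step x 0.
Proof. by rewrite psumS psum0 add0r. Qed.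

Lemma psum_prefix j k : (j <= k)%N -> prefix_only k (psum j).
Proof.
move=> jk x x' xx'; apply: eq_bigr => i _; apply: xx'.
exact: leq_trans (ltn_ord i) jk.
Qed.

Lemma step_shiftn k x i : step (shiftn k x) i = step x (k + i)%N.
Proof. by []. Qed.

Lemma psum_shiftn k j x : psum j (shiftn k x) = psum (k + j)%N x - psum k x.
Proof.
elim: j => [|j IH]; first by rewrite psum0 addn0 subrr.
by rewrite psumS IH addnS psumS step_shiftn addrAC.
Qed.

(** Time reversal of the first [k] steps. Later indices are fixed, so that the map is injective on
    all indices and preserves the law. *)
Definition revn k i := if (i < k)%N then (k.-1 - i)%N else i.

Lemma revn_inj k : injective (revn k).
Proof. by move=> i j; rewrite /revn; do 2 case: ifP; lia. Qed.

Lemma psum_rev k j x : (j <= k)%N ->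
  psum j (restep (revn k) x) = psum k x - psum (k - j)%N x.
Proof.
elim: j => [_|j IH jk]; first by rewrite psum0 subn0 subrr.
rewrite psumS IH ?(ltnW jk)// step_restep /revn jk.
rewrite (_ : (k - j)%N = (k - j.+1).+1); last by lia.
rewrite psumS (_ : (k.-1 - j)%N = (k - j.+1)%N); last by lia.
by rewrite opprD addrA subrK.
Qed.

(** Cyclic rotation of the first [k] steps, again fixing the later ones; it preserves S_k. *)
Definition rotn k i :=
  if (i.+1 < k)%N then i.+1 else if (i < k)%N then 0%N else i.

Lemma rotn_inj k : injective (rotn k).
Proof. by move=> i j; rewrite /rotn; repeat (case: ifP => ?); lia. Qed.

Lemma psum_rot k j x : (j < k)%N ->
  psum j (restep (rotn k) x) = psum j.+1 x - step x 0.
Proof.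
elim: j => [_|j IH jk]; first by rewrite psum0 psum1 subrr.
by rewrite psumS IH ?(ltnW jk)// step_restep /rotn jk [in RHS]psumS addrAC.
Qed.

Lemma psum_rot_full k x : psum k (restep (rotn k) x) = psum k x.
Proof.
case: k => [|k]; first by rewrite !psum0.
by rewrite psumS psum_rot// step_restep /rotn ltnn ltnSn subrK.
Qed.

Lemma unique_argmin (s : nat -> R) n :
  (forall i j, (i < j <= n)%N -> s i != s j) ->
  exists2 k0 : 'I_n.+1, (forall j, (j <= n)%N -> s k0 <= s j) &
    forall k : 'I_n.+1, (forall j, (j <= n)%N -> s k <= s j) -> k = k0.
Proof.
move=> sd.
have [k0 k0m] : exists k0 : 'I_n.+1, forall j, (j <= n)%N -> s k0 <= s j.
  elim: n sd => [|n IH] sd.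
    by exists ord0 => j; rewrite leqn0 => /eqP->.
  have [|k0 k0m] := IH; first by move=> i j /andP[ij jn]; apply: sd; rewrite ij leqW.
  have [h|h] := leP (s k0) (s n.+1).
    exists (widen_ord (leqnSn _) k0) => j /=; rewrite leq_eqVlt => /orP[/eqP->//|].
    by rewrite ltnS; exact: k0m.
  exists ord_max => j /=; rewrite leq_eqVlt => /orP[/eqP->//|].
  by rewrite ltnS => jn; apply: (le_trans (ltW h)); exact: k0m.
exists k0 => // k km; apply/val_inj => /=.
have e : s k = s k0.
  by apply/eqP; rewrite eq_le k0m ?km// -ltnS.
have [h|h|//] := ltngtP k k0.
- have := sd k k0; rewrite h -ltnS ltn_ord => /(_ isT); by rewrite e eqxx.
- have := sd k0 k; rewrite h -ltnS ltn_ord => /(_ isT); by rewrite e eqxx.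
Qed.

Lemma measurable_psum k : measurable_fun setT (psum k).
Proof.
elim: k => [|k IH].
  by rewrite (_ : psum 0 = cst 0)//; apply/funext => x; rewrite psum0.
rewrite (_ : psum k.+1 = fun x => ((psum k x).1 + (step x k).1, (psum k x).2 + (step x k).2)).
  have ms := @measurable_step R k.
  apply: measurable_fun_pair; apply: measurable_funD;
    by [apply: (measurableT_comp measurable_fst)|apply: (measurableT_comp measurable_snd)].
by apply/funext => x; rewrite psumS.
Qed.

Lemma measurable_inner d (T : measurableType d) (f g : T -> R * R) :
  measurable_fun setT f -> measurable_fun setT g ->
  measurable_fun setT (fun t => inner (f t) (g t)).
Proof.
move=> mf mg; apply: measurable_funD; apply: measurable_funM;
  by [apply: (measurableT_comp measurable_fst)|apply: (measurableT_comp measurable_snd)].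
Qed.

Lemma measurable_perp d (T : measurableType d) (f : T -> R * R) :
  measurable_fun setT f -> measurable_fun setT (fun t => perp (f t)).
Proof.
move=> mf; apply: measurable_fun_pair.
  by apply: measurableT_comp => //; apply: (measurableT_comp measurable_snd).
by apply: (measurableT_comp measurable_fst).
Qed.

Lemma measurable_forall_le d (T : measurableType d) (n : nat) (f g : nat -> T -> R) :
  (forall j, measurable_fun setT (f j)) -> (forall j, measurable_fun setT (g j)) ->
  measurable [set x : T | forall j, (j <= n)%N -> f j x <= g j x].
Proof.
move=> mf mg.
rewrite (_ : [set x : T | _] = \bigcap_(j in `I_n.+1) [set x : T | f j x <= g j x])//.
apply: fin_bigcap_measurable => // j _.
rewrite -[X in measurable X]setTI.
have -> : [set x : T | f j x <= g j x] = (fun t : T => f j t <= g j t) @^-1` [set true].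
  by apply/seteqP; split.
exact: measurable_fun_ler.
Qed.

End deterministic_walk.

(** * Integration on a probability space *)

Section probability_tools.
Context d (T : measurableType d) (R : realType) (P : probability T R).

Lemma integrable_bounded (f : T -> R) M : measurable_fun setT f ->
  (forall x, `|f x| <= M) -> P.-integrable setT (EFin \o f).
Proof.
move=> mf fM; apply: measurable_bounded_integrable => //.
  by rewrite (le_lt_trans (probability_le1 P measurableT))// ltry.
exists M; split; first exact: num_real.
by move=> y My x _ /=; exact: le_trans (fM x) (ltW My).
Qed.

Lemma ae_eq_Rintegral (f g : T -> R) :
  measurable_fun setT f -> measurable_fun setT g ->
  {ae P, forall x, f x = g x} -> \int[P]_x f x = \int[P]_x g x.
Proof.
move=> mf mg fg; congr fine; apply: ae_eq_integral => //.
- exact/measurable_EFinP.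
- exact/measurable_EFinP.
- by apply: filterS fg => x /= ->.
Qed.

Lemma Rintegral_sum n (f : nat -> T -> R) :
  (forall k, P.-integrable setT (EFin \o f k)) ->
  P.-integrable setT (EFin \o (fun x => \sum_(k < n) f k x)) /\
  \int[P]_x (\sum_(k < n) f k x) = \sum_(k < n) \int[P]_x f k x.
Proof.
move=> fi; elim: n => [|n [IH1 IH2]].
  split.
    apply: (@integrable_bounded _ 0); last by move=> x; rewrite big_ord0 normr0.
    rewrite (_ : (fun x => _) = cst 0)//.
    by apply/funext => x; rewrite big_ord0.
  by under eq_Rintegral do rewrite big_ord0; rewrite big_ord0 Rintegral_cst// mul0r.
have e : (fun x => \sum_(k < n.+1) f k x) = (fun x => \sum_(k < n) f k x + f n x).
  by apply/funext => x; rewrite big_ord_recr.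
rewrite e; split.
  exact: (integrableD measurableT IH1 (fi n)).
by rewrite RintegralD// IH2 big_ord_recr.
Qed.

Lemma Rintegral_indic A : measurable A -> \int[P]_x \1_A x = fine (P A).
Proof. by move=> mA; rewrite /Rintegral integral_indic// setIT. Qed.

Lemma integrable_indic A : measurable A -> P.-integrable setT (EFin \o (\1_A : T -> R)).
Proof.
move=> mA; apply: (@integrable_bounded _ 1); first exact: measurable_indic.
by move=> x; rewrite indicE; case: (_ \in _); rewrite ?normr1 ?normr0.
Qed.

Lemma sum_prob_ae n (A : nat -> set T) B :
  (forall k, measurable (A k)) -> measurable B ->
  {ae P, forall x, \sum_(k < n) \1_(A k) x = \1_B x :> R} ->
  \sum_(k < n) fine (P (A k)) = fine (P B).
Proof.
move=> mA mB AB.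
have [i1 i2] := @Rintegral_sum n (fun k => \1_(A k)) (fun k => integrable_indic (mA k)).
rewrite -Rintegral_indic// -(ae_eq_Rintegral _ _ AB).
- by rewrite i2; apply: eq_bigr => k _; rewrite Rintegral_indic.
- by apply/measurable_EFinP; exact: (measurable_int P).
- exact: measurable_indic.
Qed.

End probability_tools.

(** * Conditioning on the past, and null events *)

Section walk_laws.
Context (R : realType) (mu : probability (steps R) R).
Hypothesis mu_iid : iid_law mu.
Implicit Types (v : R * R) (x : steps R).

Lemma Rintegral_restep (s : nat -> nat) (F : steps R -> R) : injective s ->
  measurable_fun setT F -> \int[mu]_x F (restep s x) = \int[mu]_x F x.
Proof.
move=> inj_s mF; congr fine.
have mF' : measurable_fun setT (EFin \o F) by exact/measurable_EFinP.
rewrite integralE [in RHS]integralE; congr (_ - _)%E.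
- have h := integral_restep mu_iid (F := ((EFin \o F)^\+)%E) inj_s (measurable_funepos mF').
  rewrite -[RHS]h; last by move=> x; exact: funepos_ge0.
  by apply: eq_integral => x _; rewrite !funeposE.
- have h := integral_restep mu_iid (F := ((EFin \o F)^\-)%E) inj_s (measurable_funeneg mF').
  rewrite -[RHS]h; last by move=> x; exact: funeneg_ge0.
  by apply: eq_integral => x _; rewrite !funenegE.
Qed.

Lemma prob_restep (s : nat -> nat) A : injective s -> measurable A ->
  fine (mu (restep s @^-1` A)) = fine (mu A).
Proof. by move=> inj_s mA; congr fine; exact: law_restep. Qed.

Lemma Rintegral_splice k (F : steps R * steps R -> R) :
  (forall y, prefix_only k (fun x => F (x, y))) ->
  measurable_fun setT F -> (forall z, 0 <= F z) ->
  (forall x, mu.-integrable setT (EFin \o (fun y => F (x, y)))) ->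
  \int[mu]_x F (x, shiftn k x) = \int[mu]_x \int[mu]_y F (x, y).
Proof.
move=> pF mF F0 iF; congr fine.
rewrite (@integral_splice _ mu mu_iid k (EFin \o F)).
- apply: eq_integral => x _; rewrite /Rintegral fineK//.
  exact: (integrable_fin_num measurableT (iF x)).
- by move=> y x x' xx' /=; congr EFin; exact: pF.
- exact/measurable_EFinP.
- by move=> z; rewrite lee_fin.
Qed.

Lemma Rintegral_indep k (f g : steps R -> R) : prefix_only k f ->
  measurable_fun setT f -> measurable_fun setT g ->
  (forall x, 0 <= f x) -> (forall x, 0 <= g x) ->
  mu.-integrable setT (EFin \o f) -> mu.-integrable setT (EFin \o g) ->
  \int[mu]_x (f x * g (shiftn k x)) = \int[mu]_x f x * \int[mu]_x g x.
Proof.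
move=> pf mf mg f0 g0 fi gi.
rewrite (@Rintegral_splice k (fun z => f z.1 * g z.2)).
- rewrite -RintegralZr//; apply: eq_Rintegral => x _ /=.
  by rewrite RintegralZl.
- by move=> y x x' xx' /=; rewrite (pf _ _ xx').
- by apply: measurable_funM;
    [apply: (measurableT_comp mf)|apply: (measurableT_comp mg)].
- by move=> z; rewrite mulr_ge0.
- move=> x /=; rewrite (_ : _ \o _ = fun y => (f x)%:E * (EFin \o g) y)%E//.
  exact: integrableZl.
Qed.

Lemma prob_indep k A B : prefix_only k (A : steps R -> Prop) ->
  measurable A -> measurable B ->
  fine (mu (A `&` shiftn k @^-1` B)) = fine (mu A) * fine (mu B).
Proof.
move=> pA mA mB.
have mB' : measurable (shiftn k @^-1` B).
  by rewrite -[X in measurable X]setTI; exact: measurable_restep.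
rewrite -!Rintegral_indic//; last exact: measurableI.
rewrite -(@Rintegral_indep k).
- apply: eq_Rintegral => x _; rewrite indicI; congr (_ * _).
- by move=> x x' xx'; rewrite !indicE /in_mem /= /mem /=; congr (nat_of_bool _)%:R;
    congr asbool; exact: pA.
- exact: measurable_indic.
- exact: measurable_indic.
- by move=> x; rewrite indicE.
- by move=> x; rewrite indicE.
- exact: integrable_indic.
- exact: integrable_indic.
Qed.

Hypothesis mu_null : forall (v : R * R) (c : R), v != 0 ->
  mu [set x | inner (step x 0) v = c] = 0%E.

(** Once the first [k] steps are fixed, the condition places the next, fresh step on a fixed line,
    which has probability 0; Fubini integrates this over the past. *)
Lemma step_null k (a : steps R -> R * R) (c : steps R -> R) :
  prefix_only k a -> prefix_only k c ->
  measurable_fun setT a -> measurable_fun setT c ->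
  {ae mu, forall x, a x != 0} ->
  {ae mu, forall x, inner (step x k) (a x) != c x}.
Proof.
move=> pa pc ma mc an.
pose N : set (steps R * steps R) := [set z | inner (step z.2 0) (a z.1) = c z.1].
have mN : measurable N.
  rewrite -[X in measurable X]setTI.
  have -> : N = (fun z => inner (step z.2 0) (a z.1) == c z.1) @^-1` [set true].
    by apply/seteqP; split => z /= /eqP.
  apply: measurable_fun_eqr => //.
    apply: measurable_inner.
      exact: (measurableT_comp (measurable_step 0) measurable_snd).
    exact: (measurableT_comp ma measurable_fst).
  exact: (measurableT_comp mc measurable_fst).
have mN' : measurable [set x : steps R | inner (step x k) (a x) = c x].
  rewrite -[X in measurable X]setTI.
  have -> : [set x : steps R | inner (step x k) (a x) = c x] =
      (fun x => inner (step x k) (a x) == c x) @^-1` [set true].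
    by apply/seteqP; split => z /= /eqP.
  apply: measurable_fun_eqr => //; apply: measurable_inner => //.
  exact: measurable_step.
exists [set x : steps R | inner (step x k) (a x) = c x]; split => //; last first.
  by move=> x /= /negP; rewrite negbK => /eqP.
have -> : mu [set x : steps R | inner (step x k) (a x) = c x] =
    (\int[mu]_x (\1_N (x, shiftn k x))%:E)%E.
  transitivity (\int[mu]_x (\1_[set x : steps R | inner (step x k) (a x) = c x] x)%:E)%E.
    by rewrite integral_indic// setIT.
  apply: eq_integral => x _; rewrite !indicE; congr ((nat_of_bool _)%:R)%:E.
  by apply/idP/idP; rewrite !inE /N/= step_shiftn addn0.
have mN1 : measurable_fun setT (fun z => (\1_N z)%:E : \bar R).
  by apply/measurable_EFinP; exact: measurable_indic.
rewrite (integral_splice mu_iid (F := fun z => (\1_N z)%:E))//.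
- rewrite (@ge0_ae_eq_integral _ _ _ mu setT _ (cst 0%E))//.
  + by rewrite integral_cst// mul0e.
  + apply: (@measurable_fun_fubini_tonelli_F _ _ _ _ _ mu (fun z => (\1_N z)%:E)) => //.
  + by move=> x _; apply: integral_ge0 => y _; rewrite lee_fin indicE.
  + apply: filterS an => x ax _.
    transitivity (\int[mu]_y (\1_[set y : steps R | inner (step y 0) (a x) = c x] y)%:E)%E.
      by apply: eq_integral => y _; rewrite !indicE.
    rewrite integral_indic ?setIT//; first exact: mu_null.
    have := @measurable_xsection _ _ _ _ N x mN.
    by rewrite xsectionE.
- move=> y x x' xx' /=; rewrite !indicE; congr ((nat_of_bool _)%:R)%:E.
  by apply/idP/idP; rewrite !inE /N/= (pa _ _ xx') (pc _ _ xx').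
Qed.

Lemma psum_null v i j : v != 0 -> (i < j)%N ->
  {ae mu, forall x, inner (psum i x) v != inner (psum j x) v}.
Proof.
case: j => // j v0 ij.
have := @step_null j (fun=> v) (fun x => inner (psum i x - psum j x) v).
move=> /(_ (fun _ _ _ => erefl)) h.
apply: filterS (h _ _ _ _) => [x||||].
- by rewrite /= innerBl psumS innerDl; apply: contra => /eqP->; rewrite addrAC subrr add0r.
- by move=> x x' xx'; rewrite (psum_prefix (leqnn j) xx') (@psum_prefix _ i j _ _ _ xx').
- exact: measurable_cst.
- rewrite (_ : (fun x => _) = (fun x => inner (psum i x) v - inner (psum j x) v)).
    by apply: measurable_funB; apply: measurable_inner => //; exact: measurable_psum.
  by apply/funext => x; rewrite innerBl.
- exact: aeW.
Qed.

Lemma psum_neq0 j : (0 < j)%N -> {ae mu, forall x, psum j x != 0}.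
Proof.
move=> j0; have e0 : (1, 0) != 0 :> R * R by rewrite xpair_eqE oner_eq0.
apply: filterS (psum_null e0 j0) => x; rewrite psum0 inner0l eq_sym.
by apply: contra => /eqP->; rewrite inner0l.
Qed.

(** Equality would mean det(S_k, S_j - S_i) = 0. The last step enters only through S_k, because j <
    k, and S_j - S_i is almost surely a nonzero vector of the past, so [step_null] applies to the
    last step. *)
Lemma psum_cyc i j k : (i < j < k)%N ->
  {ae mu, forall x, inner (psum i x) (perp (psum k x)) !=
                    inner (psum j x) (perp (psum k x))}.
Proof.
case: k => [|k] /andP[ij]; rewrite ?ltn0// ltnS => jk.
have mB : measurable_fun setT (fun x : steps R => psum j x - psum i x).
  have -> : (fun x : steps R => psum j x - psum i x) = psum (j - i) \o shiftn i.
    by apply/funext => x /=; rewrite psum_shiftn subnKC// ltnW.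
  apply: measurableT_comp; [exact: measurable_psum|exact: measurable_restep].
have pB : prefix_only k (fun x : steps R => psum j x - psum i x).
  move=> x x' xx'; rewrite (@psum_prefix _ i k _ _ _ xx') ?(psum_prefix jk xx')//.
  exact: leq_trans (ltnW ij) jk.
have := @step_null k (fun x => perp (psum j x - psum i x))
   (fun x => - inner (psum k x) (perp (psum j x - psum i x))).
move=> h; apply: filterS (h _ _ _ _ _) => [x|||||].
- rewrite psumS; apply: contra => /eqP e; rewrite -addr_eq0.
  rewrite -innerDl addrC inner_perpC oppr_eq0 innerBl subr_eq0; exact/eqP.
- by move=> x x' xx'; rewrite (pB _ _ xx').
- by move=> x x' xx'; rewrite (pB _ _ xx') (psum_prefix (leqnn k) xx').
- exact: measurable_perp.
- apply: measurableT_comp => //; apply: measurable_inner; first exact: measurable_psum.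
  exact: measurable_perp.
- have e0 : (1, 0) != 0 :> R * R by rewrite xpair_eqE oner_eq0.
  apply: filterS (psum_null e0 ij) => x; rewrite perp_eq0 subr_eq0.
  by apply: contra => /eqP->.
Qed.

Lemma psum_det i j : (0 < i < j)%N ->
  {ae mu, forall x, inner (psum j x) (perp (psum i x)) != 0}.
Proof.
move=> /andP[i0 ij]; have h := @psum_cyc 0 i j; rewrite i0 ij in h.
apply: filterS (h isT) => x; by rewrite psum0 inner0l inner_perpC eq_sym oppr_eq0.
Qed.

End walk_laws.

(** * Fluctuation identities in a fixed direction *)

Section fluctuation.
Context (R : realType) (mu : probability (steps R) R).
Hypothesis mu_iid : iid_law mu.
Hypothesis mu_null : forall (v : R * R) (c : R), v != 0 ->
  mu [set x | inner (step x 0) v = c] = 0%E.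
Hypothesis mu_int1 : mu.-integrable setT (fun x => ((step x 0).1)%:E).
Hypothesis mu_int2 : mu.-integrable setT (fun x => ((step x 0).2)%:E).
Hypothesis mu_mean1 : \int[mu]_x (step x 0).1 = 0.
Hypothesis mu_mean2 : \int[mu]_x (step x 0).2 = 0.
Implicit Types (v : R * R) (x : steps R).

Definition stay n v : set (steps R) :=
  [set x | forall j, (j <= n)%N -> 0 <= inner (psum j x) v].

Definition stayp n v : R := fine (mu (stay n v)).

Definition argmin k n v : set (steps R) :=
  [set x | forall j, (j <= n)%N -> inner (psum k x) v <= inner (psum j x) v].

Lemma measurable_proj k v : measurable_fun setT (fun x => inner (psum k x) v).
Proof. by apply: measurable_inner => //; exact: measurable_psum. Qed.

Lemma measurable_stay n v : measurable (stay n v).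
Proof.
apply: (@measurable_forall_le _ _ _ n (fun _ _ => 0)) => j //.
exact: measurable_proj.
Qed.

Lemma measurable_argmin k n v : measurable (argmin k n v).
Proof.
apply: (@measurable_forall_le _ _ _ n (fun _ x => inner (psum k x) v)
  (fun j x => inner (psum j x) v)) => j; exact: measurable_proj.
Qed.

(** Seen from a time [k] of minimal projection, the future stays on the side of [v]; the past,
    reversed, stays on the side of [- v] ([argmin_rev]). *)
Lemma argmin_split k n v : (k <= n)%N ->
  argmin k n v = argmin k k v `&` shiftn k @^-1` stay (n - k) v.
Proof.
move=> kn; apply/seteqP; split => x /=.
  move=> h; split => j jk; first by apply: h; exact: leq_trans jk kn.
  by rewrite psum_shiftn innerBl subr_ge0; apply: h; lia.
move=> [h1 h2] j jn; have [jk|/ltnW kj] := leqP j k; first exact: h1.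
have := h2 (j - k)%N; rewrite psum_shiftn innerBl subr_ge0 subnKC//; apply; lia.
Qed.

Lemma argmin_prefix k v : prefix_only k (argmin k k v : steps R -> Prop).
Proof.
move=> x x' xx'; apply/propext; split => h j jk; have := h j jk;
  by rewrite (psum_prefix (leqnn k) xx') (psum_prefix jk xx').
Qed.

Lemma argmin_rev k v : argmin k k v = restep (revn k) @^-1` stay k (- v).
Proof.
apply/seteqP; split => x /= h j jk.
  by rewrite psum_rev// innerNr oppr_ge0 innerBl subr_le0; apply: h; exact: leq_subr.
have := h (k - j)%N (leq_subr _ _).
by rewrite psum_rev ?leq_subr// innerNr oppr_ge0 innerBl subr_le0 subKn.
Qed.

Lemma stayp_ge0 n v : 0 <= stayp n v.
Proof. by rewrite fine_ge0. Qed.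

Lemma stayp_le1 n v : stayp n v <= 1.
Proof.
rewrite /stayp -lee_fin fineK ?fin_num_measure//; last exact: measurable_stay.
exact: probability_le1 (measurable_stay _ _).
Qed.

Lemma stay0 v : stay 0 v = setT.
Proof. by apply/seteqP; split => x //= _ j; rewrite leqn0 => /eqP->; rewrite psum0 inner0l. Qed.

Lemma stayp0 v : stayp 0 v = 1.
Proof. by rewrite /stayp stay0 probability_setT. Qed.

Lemma stayS_sub n m v : (n <= m)%N -> stay m v `<=` stay n v.
Proof. by move=> nm x h j jn; apply: h; exact: leq_trans jn nm. Qed.

Lemma stayp_noninc n m v : (n <= m)%N -> stayp m v <= stayp n v.
Proof.
move=> nm; apply: fine_le.
- by rewrite fin_num_measure//; exact: measurable_stay.
- by rewrite fin_num_measure//; exact: measurable_stay.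
- apply: le_measure; rewrite ?inE; [exact: measurable_stay|exact: measurable_stay|].
  exact: stayS_sub.
Qed.

Lemma ae_distinct v : v != 0 ->
  {ae mu, forall x, forall i j, (i < j)%N -> inner (psum i x) v != inner (psum j x) v}.
Proof.
move=> v0; apply: ae_foralln => i; apply: ae_foralln => j.
have [ij|ji] := ltnP i j; last by apply: aeW.
by apply: filterS (psum_null mu_iid mu_null v0 ij) => x h _.
Qed.

Lemma ae_argmin n v : v != 0 -> {ae mu, forall x, exists2 k0 : 'I_n.+1,
  argmin k0 n v x & forall k : 'I_n.+1, argmin k n v x -> k = k0}.
Proof.
move=> /ae_distinct; apply: filterS => x xd.
by apply: (@unique_argmin _ (fun j => inner (psum j x) v)) => i j /andP[ij _]; exact: xd.
Qed.

Lemma sum_indic_unique (f : nat -> R) n (A : nat -> set (steps R)) x (k0 : 'I_n.+1) :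
  A k0 x -> (forall k : 'I_n.+1, A k x -> k = k0) ->
  \sum_(k < n.+1) f k * \1_(A k) x = f k0.
Proof.
move=> A0 Au; rewrite (bigD1 k0)//= indicE mem_set// mulr1 big1 ?addr0//.
move=> k kk0; rewrite indicE memNset ?mulr0// => Akx.
by move/eqP: kk0; apply; exact: Au.
Qed.

Lemma stayp_conv n v : v != 0 ->
  \sum_(k < n.+1) stayp k (- v) * stayp (n - k) v = 1.
Proof.
move=> v0.
transitivity (\sum_(k < n.+1) fine (mu (argmin k n v))).
  apply: eq_bigr => k _; rewrite argmin_split; last by rewrite -ltnS.
  rewrite (prob_indep mu_iid); first last.
  - exact: measurable_stay.
  - exact: measurable_argmin.
  - exact: argmin_prefix.
  rewrite argmin_rev (prob_restep mu_iid)//; first exact: revn_inj.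
  exact: measurable_stay.
rewrite (@sum_prob_ae _ _ _ mu n.+1 (fun k => argmin k n v) setT)//.
- by rewrite probability_setT.
- by move=> k; exact: measurable_argmin.
apply: filterS (ae_argmin n v0) => x [k0 k0m k0u].
rewrite indicT -[RHS](@sum_indic_unique (fun=> 1) n (fun k => argmin k n v) x k0)//.
by apply: eq_bigr => k _; rewrite mul1r.
Qed.

Lemma integrable_step_coord i :
  mu.-integrable setT (EFin \o (fun x => (step x i).1)) /\
  mu.-integrable setT (EFin \o (fun x => (step x i).2)).
Proof.
have ri : injective (addn i) by exact: addnI.
split; apply/integrableP; split.
- apply/measurable_EFinP; apply: (measurableT_comp measurable_fst).
  exact: measurable_step.
- have := @integral_restep _ mu mu_iid (addn i) (fun x => `|(step x 0).1%:E|%E) ri.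
  rewrite (_ : (fun x => `|((step (restep (addn i) x) 0).1)%:E|%E) =
    fun x => `|((step x i).1)%:E|%E); last first.
    by apply/funext => x; rewrite step_restep addn0.
  move=> ->; first by case/integrableP: mu_int1.
  + by apply: measurableT_comp => //; case/integrableP: mu_int1.
  + by [].
- apply/measurable_EFinP; apply: (measurableT_comp measurable_snd).
  exact: measurable_step.
- have := @integral_restep _ mu mu_iid (addn i) (fun x => `|(step x 0).2%:E|%E) ri.
  rewrite (_ : (fun x => `|((step (restep (addn i) x) 0).2)%:E|%E) =
    fun x => `|((step x i).2)%:E|%E); last first.
    by apply/funext => x; rewrite step_restep addn0.
  move=> ->; first by case/integrableP: mu_int2.
  + by apply: measurableT_comp => //; case/integrableP: mu_int2.
  + by [].
Qed.

Lemma integrable_step i v :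
  mu.-integrable setT (EFin \o (fun x => inner (step x i) v)).
Proof.
have [i1 i2] := integrable_step_coord i.
exact: (integrableD measurableT (integrableZr measurableT v.1 i1)
  (integrableZr measurableT v.2 i2)).
Qed.

Lemma inner_sum n x v : inner (psum n x) v = \sum_(i < n) inner (step x i) v.
Proof.
elim: n => [|n IH]; first by rewrite psum0 inner0l big_ord0.
by rewrite psumS innerDl IH big_ord_recr.
Qed.

Lemma integrable_proj n v :
  mu.-integrable setT (EFin \o (fun x => inner (psum n x) v)).
Proof.
rewrite (_ : (fun x => inner (psum n x) v) =
  fun x => \sum_(i < n) inner (step x i) v).
  by have [] := @Rintegral_sum _ _ _ mu n _ (fun i => integrable_step i v).
by apply/funext => x; rewrite inner_sum.
Qed.

Lemma integrable_mul_indic (f : steps R -> R) A : measurable A ->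
  mu.-integrable setT (EFin \o f) ->
  mu.-integrable setT (EFin \o (fun x => f x * \1_A x)).
Proof.
move=> mA fi; apply: (le_integrable measurableT _ _ fi).
  apply/measurable_EFinP; apply: measurable_funM; last exact: measurable_indic.
  by apply/measurable_EFinP; case/integrableP: fi.
move=> x _ /=; rewrite lee_fin normrM indicE.
by case: (_ \in _); rewrite ?normr1 ?mulr1// normr0 mulr0.
Qed.

Fixpoint smax (s : nat -> R) n := if n is m.+1 then Num.max (smax s m) (s n) else s 0%N.

Lemma smax_ge s n j : (j <= n)%N -> s j <= smax s n.
Proof.
elim: n => [|n IH]; first by rewrite leqn0 => /eqP->.
rewrite leq_eqVlt => /orP[/eqP->|]; first by rewrite /= le_max lexx orbT.
by rewrite ltnS => /IH h /=; rewrite le_max h.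
Qed.

Lemma smax_attained s n : exists2 j, (j <= n)%N & smax s n = s j.
Proof.
elim: n => [|n [j jn e]] /=; first by exists 0%N.
have [h|h] := leP (s n.+1) (smax s n).
  by exists j; rewrite ?leqW// e.
by exists n.+1.
Qed.

Definition wmax n v x := smax (fun j => inner (psum j x) v) n.

Lemma wmax_ge0 n v x : 0 <= wmax n v x.
Proof.
by apply: le_trans (smax_ge (fun j => inner (psum j x) v) (leq0n n)); rewrite psum0 inner0l.
Qed.

Lemma measurable_wmax n v : measurable_fun setT (wmax n v).
Proof.
elim: n => [|n IH]; first exact: measurable_proj.
by apply: measurable_maxr => //; exact: measurable_proj.
Qed.

Lemma integrable_wmax n v : mu.-integrable setT (EFin \o wmax n v).
Proof.
have [h _] := @Rintegral_sum _ _ _ mu n.+1 (fun j x => `|inner (psum j x) v|)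
   (fun j => integrable_norm (integrable_proj j v)).
apply: (le_integrable measurableT _ _ h).
  by apply/measurable_EFinP; exact: measurable_wmax.
move=> x _; rewrite /= lee_fin ger0_norm ?wmax_ge0//.
rewrite ger0_norm ?sumr_ge0//.
have [j jn e] := smax_attained (fun j => inner (psum j x) v) n.
rewrite /wmax e (bigD1 (Ordinal (jn : (j < n.+1)%N)))//=.
by rewrite (le_trans (ler_norm _))// lerDl sumr_ge0.
Qed.

(** With a positive endpoint, time 0 is beaten by time n + 1, so the maximum runs over the times 1,
    ..., n + 1. Removing the first step turns these into the times 0, ..., n of the rotated walk. *)
Lemma wmax_rot n v x : 0 < inner (psum n.+1 x) v ->
  wmax n.+1 v x = inner (step x 0) v + wmax n v (restep (rotn n.+1) x).
Proof.
move=> s0; apply/eqP; rewrite eq_le; apply/andP; split.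
  have [j jn e] := smax_attained (fun j => inner (psum j x) v) n.+1.
  rewrite /wmax e; case: j jn {e} => [_|j jn].
    rewrite psum0 inner0l; apply: (le_trans (ltW s0)).
    have := smax_ge (fun j => inner (psum j (restep (rotn n.+1) x)) v) (leqnn n).
    by rewrite psum_rot// innerBl lerBlDl.
  have := smax_ge (fun j => inner (psum j (restep (rotn n.+1) x)) v) (jn : (j <= n)%N).
  by rewrite psum_rot// innerBl lerBlDl.
have [j jn e] := smax_attained (fun j => inner (psum j (restep (rotn n.+1) x)) v) n.
rewrite /wmax e psum_rot// innerBl addrC subrK.
exact: (smax_ge (fun j => inner (psum j x) v)).
Qed.

Lemma wmax_nonpos n v x : inner (psum n.+1 x) v <= 0 -> wmax n.+1 v x = wmax n v x.
Proof.
move=> s0; rewrite /wmax /=; apply/max_idPl.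
exact: le_trans s0 (wmax_ge0 n v x).
Qed.

Definition posev n v : set (steps R) := [set x | 0 < inner (psum n x) v].

Lemma measurable_posev n v : measurable (posev n v).
Proof.
rewrite -[X in measurable X]setTI.
have -> : posev n v = (fun x => 0 < inner (psum n x) v) @^-1` [set true] by apply/seteqP; split.
apply: measurable_fun_ltr => //; exact: measurable_proj.
Qed.

Lemma posev_rot n v x : \1_(posev n v) (restep (rotn n) x) = \1_(posev n v) x :> R.
Proof.
rewrite !indicE; congr ((nat_of_bool _)%:R); apply/idP/idP;
by rewrite !inE /posev /= psum_rot_full.
Qed.

(** The event [posev] depends on the endpoint only, which rotation preserves; so each step has the
    same mean on it. *)
Lemma Rintegral_step_posev n i v : (i < n)%N ->
  \int[mu]_x (inner (step x i) v * \1_(posev n v) x) =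
  \int[mu]_x (inner (step x 0) v * \1_(posev n v) x).
Proof.
elim: i => // i IH iN; rewrite -IH ?(ltnW iN)//.
rewrite -(@Rintegral_restep _ mu mu_iid (rotn n) (fun x => inner (step x i) v * \1_(posev n v) x)).
- by apply: eq_Rintegral => x _; rewrite posev_rot step_restep /rotn iN.
- exact: rotn_inj.
- apply: measurable_funM; last by apply: measurable_indic; exact: measurable_posev.
  apply: measurable_inner => //; exact: measurable_step.
Qed.

Definition posmean n v : R := \int[mu]_x (inner (psum n x) v * \1_(posev n v) x).

Lemma posmean_step n v :
  posmean n v = n%:R * \int[mu]_x (inner (step x 0) v * \1_(posev n v) x).
Proof.
rewrite /posmean.
transitivity (\int[mu]_x \sum_(i < n) (inner (step x i) v * \1_(posev n v) x)).
  by apply: eq_Rintegral => x _; rewrite inner_sum mulr_suml.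
have [_ ->] := @Rintegral_sum _ _ _ mu n (fun i x => inner (step x i) v * \1_(posev n v) x)
  (fun i => integrable_mul_indic (measurable_posev n v) (integrable_step i v)).
rewrite (eq_bigr (fun=> \int[mu]_x (inner (step x 0) v * \1_(posev n v) x))).
  by rewrite sumr_const card_ord mulr_natl.
by move=> i _; exact: Rintegral_step_posev.
Qed.

(** One step of the Spitzer-Kac formula. On a positive endpoint the maximum gains the first step,
    whose mean there is the (n + 1)-st part of [posmean]; on the complement the new time changes
    nothing. *)
Lemma wmax_incr n v :
  \int[mu]_x wmax n.+1 v x = \int[mu]_x wmax n v x + posmean n.+1 v / n.+1%:R.
Proof.
have mP := measurable_posev n.+1 v.
have mF : measurable_fun setT (fun x => wmax n v x * \1_(posev n.+1 v) x).
  by apply: measurable_funM; [exact: measurable_wmax|exact: measurable_indic].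
have i1 := integrable_mul_indic mP (integrable_wmax n v).
have i2 := integrable_mul_indic mP (integrable_step 0 v).
have i3 : mu.-integrable setT (EFin \o (fun x => wmax n v x * (1 - \1_(posev n.+1 v) x))).
  rewrite (_ : (fun x => _) = (fun x => wmax n v x - wmax n v x * \1_(posev n.+1 v) x)).
    exact: (integrableB measurableT (integrable_wmax n v) i1).
  by apply/funext => x; rewrite mulrBr mulr1.
have i4 : mu.-integrable setT (EFin \o (fun x => wmax n v (restep (rotn n.+1) x) *
    \1_(posev n.+1 v) x)).
  rewrite (_ : (fun x => _) = (fun x => wmax n.+1 v x * \1_(posev n.+1 v) x -
      inner (step x 0) v * \1_(posev n.+1 v) x)).
    exact: (integrableB measurableT (integrable_mul_indic mP (integrable_wmax n.+1 v)) i2).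
  apply/funext => x; rewrite indicE.
  case: (boolP (x \in posev n.+1 v)); rewrite ?mulr0 ?subr0// !mulr1 inE => /wmax_rot->.
  by rewrite addrC addKr.
transitivity (\int[mu]_x (wmax n v x * (1 - \1_(posev n.+1 v) x) +
   (inner (step x 0) v * \1_(posev n.+1 v) x +
    wmax n v (restep (rotn n.+1) x) * \1_(posev n.+1 v) x))).
  apply: eq_Rintegral => x _; rewrite indicE.
  case: (boolP (x \in posev n.+1 v)) => h.
    by rewrite subrr mulr0 add0r !mulr1; apply: wmax_rot; rewrite inE in h.
  rewrite subr0 mulr1 !mulr0 !addr0; apply: wmax_nonpos.
  by rewrite leNgt; apply/negP => h'; move/negP: h; apply; rewrite inE.
rewrite RintegralD//; last exact: (integrableD measurableT i2 i4).
rewrite RintegralD//.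
have -> : \int[mu]_x (wmax n v (restep (rotn n.+1) x) * \1_(posev n.+1 v) x) =
    \int[mu]_x (wmax n v x * \1_(posev n.+1 v) x).
  rewrite -(Rintegral_restep mu_iid (@rotn_inj n.+1) mF).
  by apply: eq_Rintegral => x _; rewrite posev_rot.
rewrite posmean_step mulrAC divff ?pnatr_eq0// mul1r [X in _ + X]addrC addrA.
congr (_ + _); rewrite -RintegralD//; apply: eq_Rintegral => x _.
by rewrite mulrBr mulr1 subrK.
Qed.

Lemma mean_wmax n v :
  \int[mu]_x wmax n v x = \sum_(k < n) posmean k.+1 v / k.+1%:R.
Proof.
elim: n => [|n IH]; last by rewrite wmax_incr IH big_ord_recr.
rewrite big_ord0; transitivity (\int[mu]_(_ in setT) (0:R)).
  by apply: eq_Rintegral => x _; rewrite /wmax /= psum0 inner0l.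
by rewrite Rintegral_cst// mul0r.
Qed.

(** The M_n(v) of the overview. *)
Definition staymean n v : R := \int[mu]_x (inner (psum n x) v * \1_(stay n v) x).

(** The maximum along [v] is attained where the projection on [- v] is minimal. The walk up to that
    time, reversed, stays on the side of [v] and ends at the maximum; the future stays on the side
    of [- v]. *)
Lemma mean_wmax_conv n v : v != 0 ->
  \int[mu]_x wmax n v x = \sum_(k < n.+1) staymean k v * stayp (n - k) (- v).
Proof.
move=> v0.
have Nv0 : - v != 0 by rewrite oppr_eq0.
have fi k := integrable_mul_indic (measurable_argmin k n (- v)) (integrable_proj k v).
have [i1 i2] := @Rintegral_sum _ _ _ mu n.+1
  (fun k x => inner (psum k x) v * \1_(argmin k n (- v)) x) fi.
rewrite (@ae_eq_Rintegral _ _ _ mu _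
  (fun x => \sum_(k < n.+1) inner (psum k x) v * \1_(argmin k n (- v)) x)).
- rewrite i2; apply: eq_bigr => k _.
  have kn : (k <= n)%N by rewrite -ltnS.
  pose f x := inner (psum k x) v * \1_(argmin k k (- v)) x.
  have f0 x : 0 <= f x.
    rewrite /f indicE; case: (boolP (_ \in _)); rewrite ?mulr0// mulr1 inE => h.
    have := h 0%N (leq0n _); by rewrite psum0 inner0l innerNr oppr_le0.
  have mf : measurable_fun setT f.
    apply: measurable_funM; first exact: measurable_proj.
    apply: measurable_indic; exact: measurable_argmin.
  have mS := measurable_stay (n - k) (- v).
  have -> : staymean k v = \int[mu]_x f x.
    rewrite /staymean -(Rintegral_restep mu_iid (@revn_inj k)).
      apply: eq_Rintegral => x _; rewrite /f psum_rev// subnn psum0 subr0; congr (_ * _).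
      by rewrite argmin_rev opprK !indicE.
    apply: measurable_funM; first exact: measurable_proj.
    apply: measurable_indic; exact: measurable_stay.
  rewrite /stayp -Rintegral_indic// -(@Rintegral_indep _ mu mu_iid k)//.
  + apply: eq_Rintegral => x _; rewrite argmin_split// indicI /f mulrA; congr (_ * _).
  + move=> x x' xx'; rewrite /f (psum_prefix (leqnn k) xx') !indicE; congr (_ * (nat_of_bool _)%:R).
    have e := argmin_prefix (- v) xx'.
    by apply/idP/idP; rewrite !inE e.
  + exact: integrable_mul_indic (measurable_argmin _ _ _) (integrable_proj _ _).
  + exact: integrable_indic.
- exact: measurable_wmax.
- by apply/measurable_EFinP; exact: (measurable_int mu).
- apply: filterS (ae_argmin n Nv0) => x [k0 k0m k0u].
  rewrite (@sum_indic_unique (fun k => inner (psum k x) v) n (fun k => argmin k n (- v)) x k0)//.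
  apply/eqP; rewrite eq_le; apply/andP; split; last first.
    by apply: (smax_ge (fun j => inner (psum j x) v)); rewrite -ltnS.
  have [j jn e] := smax_attained (fun j => inner (psum j x) v) n.
  by rewrite /wmax e; have := k0m j jn; rewrite !innerNr lerN2.
Qed.

Lemma mean_step v : \int[mu]_x inner (step x 0) v = 0.
Proof.
have [i1 i2] := integrable_step_coord 0.
rewrite /inner RintegralD//; first last.
- exact: (integrableZr measurableT v.2 i2).
- exact: (integrableZr measurableT v.1 i1).
by rewrite !RintegralZr// mu_mean1 mu_mean2 !mul0r addr0.
Qed.

(** Martingale property: on [stay n] a further centred step leaves the mean unchanged, and passing
    to [stay n.+1] only removes the values at which the walk has just left the half-plane. *)
Lemma staymean_incr n v :
  staymean n.+1 v = staymean n v +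
    \int[mu]_x (- inner (psum n.+1 x) v * \1_(stay n v `\` stay n.+1 v) x).
Proof.
have mS := measurable_stay n v; have mS' := measurable_stay n.+1 v.
have j1 := integrable_mul_indic mS (integrable_proj n v).
have j2 := integrable_mul_indic mS (integrable_step n v).
have j3 := integrable_mul_indic mS' (integrable_proj n.+1 v).
have j4 := integrable_mul_indic mS (integrable_proj n.+1 v).
have e1 : \int[mu]_x (inner (step x n) v * \1_(stay n v) x) = 0.
  (* [Rintegral_indep] concerns nonnegative factors, so the step is split into its positive and
     negative parts; [h] stands for either. *)
  have ind (h : R -> R) : measurable_fun setT h -> (forall t, 0 <= h t <= `|t|) ->
    mu.-integrable setT (EFin \o (fun x => h (inner (step x 0) v))) /\
    \int[mu]_x (\1_(stay n v) x * h (inner (step x n) v)) =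
      stayp n v * \int[mu]_x h (inner (step x 0) v).
    move=> mh h0.
    have hi : mu.-integrable setT (EFin \o (fun x => h (inner (step x 0) v))).
      apply: (le_integrable measurableT _ _ (integrable_step 0 v)).
        apply/measurable_EFinP/measurableT_comp => //.
        by apply: measurable_inner => //; exact: measurable_step.
      by move=> x _ /=; rewrite lee_fin ger0_norm; have /andP[] := h0 (inner (step x 0) v).
    split => //.
    rewrite /stayp -Rintegral_indic// -(@Rintegral_indep _ mu mu_iid n)//.
    + by apply: eq_Rintegral => x _; rewrite step_shiftn addn0.
    + move=> x x' xx'; rewrite !indicE; congr ((nat_of_bool _)%:R).
      by apply/idP/idP; rewrite !inE => H j jn; have := H j jn;
        rewrite (psum_prefix jn xx').
    + apply: (measurableT_comp mh).
      by apply: measurable_inner => //; exact: measurable_step.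
    + by move=> x; have /andP[] := h0 (inner (step x 0) v).
    + exact: integrable_indic.
  have [p1 p2] := ind (fun t => Num.max t 0) ltac:(by apply: measurable_maxr)
    ltac:(by move=> t; rewrite le_max lexx orbT ge_max ler_norm normr_ge0).
  have [n1 n2] := ind (fun t => Num.max (- t) 0) ltac:(by apply: measurable_maxr => //; exact: measurableT_comp)
    ltac:(by move=> t; rewrite le_max lexx orbT ge_max -normrN ler_norm normr_ge0).
  have pn t : t = Num.max t 0 - Num.max (- t) 0 :> R.
    by case: (lerP t 0) => h; case: (lerP (- t) 0) => h'; lra.
  have si (h : R -> R) : measurable_fun setT h -> (forall t, 0 <= h t <= `|t|) ->
     mu.-integrable setT (EFin \o (fun x => \1_(stay n v) x * h (inner (step x n) v))).
    move=> mh h0; apply: (le_integrable measurableT _ _ (integrable_step n v)).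
      apply/measurable_EFinP/measurable_funM; first exact: measurable_indic.
      apply: measurableT_comp => //.
      by apply: measurable_inner => //; exact: measurable_step.
    move=> x _ /=; rewrite lee_fin ger0_norm.
      rewrite indicE; have /andP[h1 h2] := h0 (inner (step x n) v).
      by case: (_ \in _); rewrite ?mul1r ?mul0r.
    by rewrite mulr_ge0//; have /andP[] := h0 (inner (step x n) v).
  transitivity (\int[mu]_x (\1_(stay n v) x * Num.max (inner (step x n) v) 0 -
     \1_(stay n v) x * Num.max (- inner (step x n) v) 0)).
    by apply: eq_Rintegral => x _; rewrite -mulrBr -pn mulrC.
  rewrite RintegralB//; first last.
  - by apply: (si (fun t => Num.max (- t) 0)); [apply: measurable_maxr => //; exact: measurableT_comp|move=> t; rewrite le_max lexx orbT ge_max -normrN ler_norm normr_ge0].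
  - by apply: (si (fun t => Num.max t 0)); [apply: measurable_maxr|move=> t; rewrite le_max lexx orbT ge_max ler_norm normr_ge0].
  rewrite p2 n2 -mulrBr -RintegralB//.
  rewrite (_ : Rintegral _ _ _ = \int[mu]_x inner (step x 0) v) ?mean_step ?mulr0//.
  by rewrite -[RHS](mean_step v); apply: eq_Rintegral => x _; rewrite -pn.
have e2 : staymean n v = \int[mu]_x (inner (psum n.+1 x) v * \1_(stay n v) x).
  rewrite -[LHS]addr0 -e1 /staymean -RintegralD//.
  by apply: eq_Rintegral => x _; rewrite -mulrDl -innerDl -psumS.
rewrite e2 /staymean -RintegralD//.
  apply: eq_Rintegral => x _.
  have sub : stay n.+1 v x -> stay n v x by apply: stayS_sub.
  rewrite !indicE in_setD; case: (boolP (x \in stay n.+1 v)) => h; case: (boolP (x \in stay n v)) => h' /=; rewrite ?mulr0 ?mulr1 ?addr0 ?mulN1r ?subrr//.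
  by rewrite inE in h; exfalso; move/negP: h'; apply; rewrite inE; exact: sub.
apply: integrable_mul_indic; first exact: measurableD.
rewrite (_ : _ \o _ = (fun x => (-1)%:E * (EFin \o (fun x => inner (psum n.+1 x) v)) x)%E).
  have h := integrableZl measurableT (-1) (integrable_proj n.+1 v).
  exact: h.
by apply/funext => x /=; rewrite -EFinM mulN1r.
Qed.

Lemma staymean_nondec n m v : (n <= m)%N -> staymean n v <= staymean m v.
Proof.
move=> /subnKC <-; elim: (m - n)%N => [|k IH]; first by rewrite addn0.
rewrite addnS staymean_incr; apply: (le_trans IH); rewrite lerDl.
apply: Rintegral_ge0 => x _; rewrite indicE; case: (boolP (_ \in _)); rewrite ?mulr0//.
rewrite inE mulr1 => -[h1 h2]; rewrite oppr_ge0 leNgt; apply/negP => h3; apply: h2 => j.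
by rewrite leq_eqVlt => /orP[/eqP->|]; [exact: ltW|rewrite ltnS; exact: h1].
Qed.

Lemma staymean0 v : staymean 0 v = 0.
Proof.
rewrite /staymean; transitivity (\int[mu]_(_ in setT) (0:R)).
  by apply: eq_Rintegral => x _; rewrite psum0 inner0l mul0r.
by rewrite Rintegral_cst// mul0r.
Qed.

End fluctuation.

(** * The convex hull of the walk *)

Section planar_hull.
Context (R : realType).
Implicit Types (u v w : R * R) (p : nat -> R * R).

(** For nonzero [v]: the open half-plane to the left of [v] together with the open ray of [v].
    Leaving out 0 and the opposite ray makes this a convex cone that avoids 0. *)
Definition first_ray v w : Prop :=
  0 < inner w (perp v) \/ inner w (perp v) = 0 /\ 0 < inner w v.

Lemma convE (t : {i01 R}) (v w : @convex_lmodType R (R * R)%type) :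
  conv t v w = t%:num *: (v : R * R) + (1 - t%:num) *: (w : R * R).
Proof. by []. Qed.

Lemma convex_comb (A : set (R * R)) v w (s t : R) : @convex_set R (R * R)%type A ->
  A v -> A w -> 0 <= s -> 0 <= t -> 0 < s + t ->
  A ((s + t)^-1 *: (s *: v + t *: w)).
Proof.
move=> cA Av Aw s0 t0 st.
have l0 : 0 <= s / (s + t) by rewrite divr_ge0// ltW.
have l1 : s / (s + t) <= 1 by rewrite ler_pdivrMr// mul1r lerDl.
have := cA v w (Itv01 l0 l1); rewrite !inE => /(_ Av Aw).
congr (A _); rewrite scalerDr !scalerA.
rewrite convE /=.
have e : 1 - s / (s + t) = (s + t)^-1 * t.
  by rewrite -[1](@mulfV _ (s + t)) ?gt_eqF// -mulrBl addrC addKr mulrC.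
by rewrite -e [_ * s]mulrC.
Qed.

Lemma hull_comb3 (B : set (R * R)) u v w (a b c : R) :
  B u -> B v -> B w -> 0 <= a -> 0 <= b -> 0 <= c -> 0 < a + b + c ->
  a *: u + b *: v + c *: w = 0 -> conv_hull B 0.
Proof.
move=> Bu Bv Bw a0 b0 c0 abc e A [cA BA].
have [bc0|bc0] := eqVneq (b + c) 0.
  have b00 : b = 0 by apply/eqP; rewrite eq_le b0 andbT -bc0 lerDl.
  have c00 : c = 0 by rewrite b00 add0r in bc0.
  move: e; rewrite b00 c00 !scale0r !addr0 => /eqP.
  rewrite scaler_eq0; rewrite b00 c00 !addr0 in abc; rewrite gt_eqF//= => /eqP <-.
  exact: BA.
have bc : 0 < b + c by rewrite lt_neqAle eq_sym bc0 addr_ge0.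
have Aq := convex_comb cA (BA _ Bv) (BA _ Bw) b0 c0 bc.
have abc' : 0 < a + (b + c) by rewrite addrA.
have := convex_comb cA (BA _ Bu) Aq a0 (ltW bc) abc'.
move=> h; suff -> : 0 = (a + (b + c))^-1 *: (a *: u +
  (b + c) *: ((b + c)^-1 *: (b *: v + c *: w))) by exact: h.
by rewrite scalerA mulfV// scale1r (addrA (a *: u)) e scaler0.
Qed.

Lemma convex_first_ray v : @convex_set R (R * R)%type (first_ray v).
Proof.
move=> w1 w2 t; rewrite !inE.
have t0 : 0 <= t%:num by [].
have t1 : t%:num <= 1 by [].
have e z : inner (conv t w1 w2) z = t%:num * inner w1 z + (1 - t%:num) * inner w2 z.
  by rewrite convE /inner /= /GRing.scale /=; ring.
rewrite /first_ray !e; move: (t%:num) t0 t1 => s s0 s1.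
move: (inner w1 _) (inner w2 _) (inner w1 v) (inner w2 v) => d1 d2 i1 i2.
have [->|sn0] := eqVneq s 0; first by rewrite !mul0r !add0r !subr0 !mul1r.
have [->|sn1] := eqVneq s 1; first by rewrite !mul1r !subrr !mul0r !addr0.
have sp : 0 < s by rewrite lt_neqAle eq_sym sn0.
have sq : 0 < 1 - s by rewrite subr_gt0 lt_neqAle sn1.
move=> [h1|[h1 h1']] [h2|[h2 h2']].
- by left; rewrite addr_gt0// mulr_gt0.
- by left; rewrite h2 mulr0 addr0 mulr_gt0.
- by left; rewrite h1 mulr0 add0r mulr_gt0.
- by right; rewrite h1 h2 !mulr0 addr0; split => //; rewrite addr_gt0// mulr_gt0.
Qed.

(** A finite set whose hull avoids 0 spans an angle smaller than pi and thus has a clockwise-most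
    direction, here found without angles, by orientation tests alone. *)
Lemma zero_notin_hullP p n : (0 < n)%N ->
  ~ conv_hull [set p k | k in [set k | (1 <= k <= n)%N]] 0 <->
  exists k, (1 <= k <= n)%N /\ forall j, (1 <= j <= n)%N -> first_ray (p k) (p j).
Proof.
move=> n0; set B := (X in conv_hull X).
have Bp i : (1 <= i <= n)%N -> B (p i) by move=> h; exists i.
split => [h0|[k [_ h]] h0]; last first.
  have := @smallest_sub _ (@convex_set R (R * R)%type) B (first_ray (p k)).
  move=> /(_ (@convex_first_ray _)) h1.
  have BC : B `<=` first_ray (p k) by move=> _ [j jn <-]; exact: h.
  have [] := h1 BC 0 h0; rewrite inner0l ?ltxx//.
  by case=> _; rewrite inner0l ltxx.
(* Three points a, b, c that turn around 0 contain it in their triangle, since det(b, c) a + det(c,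
   a) b + det(a, b) c = 0 has positive weights. *)
have det3 i j l : (1 <= i <= n)%N -> (1 <= j <= n)%N -> (1 <= l <= n)%N ->
    0 < inner (p j) (perp (p i)) -> 0 < inner (p l) (perp (p j)) ->
    0 < inner (p i) (perp (p l)) -> False.
  move=> ib jb lb h1 h2 h3; apply: h0.
  apply: (@hull_comb3 _ (p i) (p j) (p l) (inner (p l) (perp (p j)))
     (inner (p i) (perp (p l))) (inner (p j) (perp (p i)))); rewrite ?ltW//; try exact: Bp.
    by apply: addr_gt0 => //; exact: addr_gt0.
  move: (p i) (p j) (p l) => [a1 a2] [b1 b2] [c1 c2].
  by apply: injective_projections; rewrite /inner /= /GRing.scale /=; ring.
have pn0 i : (1 <= i <= n)%N -> p i != 0.
  move=> ib; apply/eqP => pi0; apply: h0; rewrite -pi0 => A [_]; apply; exact: Bp.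
have collin v w : inner w (perp v) = 0 -> sqn v *: w = inner w v *: v.
  case: v => a b; case: w => c d; rewrite /sqn /inner /= => e.
  have e' : d * a = c * b by move: e; rewrite mulrN addrC => /eqP; rewrite subr_eq0 => /eqP.
  rewrite /GRing.scale /=; congr (_, _); rewrite /GRing.scale /=.
    by transitivity (a * a * c + b * (c * b)); [ring|rewrite -e'; ring].
  by transitivity (a * (d * a) + b * b * d); [ring|rewrite e'; ring].
(* Two points on opposite rays would have 0 on the segment between them. *)
have col i j : (1 <= i <= n)%N -> (1 <= j <= n)%N -> inner (p j) (perp (p i)) = 0 ->
    0 < inner (p j) (p i).
  move=> ib jb e; rewrite ltNge; apply/negP => le0; apply: h0.
  apply: (@hull_comb3 _ (p j) (p i) (p i) (sqn (p i)) (- inner (p j) (p i)) 0);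
    try exact: Bp; rewrite ?sqn_ge0 ?oppr_ge0//.
    by rewrite addr0 ltr_pwDl// ?sqn_gt0 ?pn0// oppr_ge0.
  by rewrite collin// scale0r addr0 scaleNr subrr.
(* Scan for the clockwise-most point: a new point replaces the current one as soon as it lies
   strictly clockwise of it. *)
have main m : (0 < m <= n)%N -> exists k, (1 <= k <= m)%N /\
    forall j, (1 <= j <= m)%N -> 0 <= inner (p j) (perp (p k)).
  elim: m => // m IH /andP[_ mn].
  case: m IH mn => [|m] IH mn.
    exists 1%N; split=> // j; rewrite -eqn_leq => /eqP <-; by rewrite inner_perp_self.
  have [k [/andP[k1 km] kj]] := IH (ltnW mn).
  have kb : (1 <= k <= n)%N by rewrite k1 (leq_trans km)// ltnW.
  have mb : (1 <= m.+2 <= n)%N by rewrite mn.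
  have [h|h] := leP 0 (inner (p m.+2) (perp (p k))).
    exists k; split; first by rewrite k1 leqW.
    move=> j /andP[j1]; rewrite leq_eqVlt => /orP[/eqP->//|]; rewrite ltnS => jm.
    by apply: kj; rewrite j1.
  have h' : 0 < inner (p k) (perp (p m.+2)) by rewrite inner_perpC oppr_gt0.
  exists m.+2; split; first by rewrite leqnn.
  move=> j /andP[j1]; rewrite leq_eqVlt => /orP[/eqP->|]; first by rewrite inner_perp_self.
  rewrite ltnS => jm; rewrite leNgt; apply/negP => hj.
  have jb : (1 <= j <= n)%N by rewrite j1 (leq_trans jm)// ltnW.
  have hj' : 0 < inner (p m.+2) (perp (p j)) by rewrite inner_perpC oppr_gt0.
  have kj0 : 0 <= inner (p j) (perp (p k)) by apply: kj; rewrite j1 jm.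
  (* A point p_j strictly counterclockwise of p_k would close a triangle around 0. Otherwise p_j is
     on the ray of p_k, hence on the same side of the new point, against [hj']. *)
  have [e|e] := eqVneq (inner (p j) (perp (p k))) 0; last first.
    by apply: (det3 m.+2 k j) => //; rewrite lt_neqAle eq_sym e.
  have i0 := col k j kb jb e.
  have := congr1 (fun z => inner z (perp (p m.+2))) (collin _ _ e).
  have iZ a z y : inner (a *: z) y = a * inner z y by rewrite innerC innerZr innerC.
  rewrite !iZ => /eqP; rewrite lt_eqF//.
  rewrite (@lt_trans _ _ 0)//; last by rewrite mulr_gt0.
  by rewrite pmulr_rlt0// sqn_gt0 ?pn0.
have [|k [kn kj]] := main n; first by rewrite n0 leqnn.
exists k; split => // j jn; have [e|e] := eqVneq (inner (p j) (perp (p k))) 0.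
  by right; split => //; exact: col.
by left; rewrite lt_neqAle eq_sym e kj.
Qed.

End planar_hull.

(** * The clockwise-most position and cyclic rotation *)

Section frames.
Context (R : realType) (mu : probability (steps R) R).
Hypothesis mu_iid : iid_law mu.
Hypothesis mu_null : forall (v : R * R) (c : R), v != 0 ->
  mu [set x | inner (step x 0) v = c] = 0%E.
Implicit Types (v : R * R) (x : steps R).

Definition frame n k : set (steps R) :=
  [set x | forall j, (j <= n)%N -> 0 <= inner (psum j x) (perp (psum k x))].

(** Times 0 and k both project to 0 on the normal of S_k, so the projections form a closed cycle of
    k values. Rotating the steps moves the starting point of the cycle; this permutes the k events
    and produces the factor 1/k. *)
Definition cycmin r k : set (steps R) :=
  [set x | forall j, (j <= k.-1)%N ->
    inner (psum r x) (perp (psum k x)) <= inner (psum j x) (perp (psum k x))].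

(** The averages E q_m(S_k^perp) of the overview. *)
Definition sweep k m : R := \int[mu]_x stayp mu m (perp (psum k x)).

Lemma measurable_frame_proj j k :
  measurable_fun setT (fun x => inner (psum j x) (perp (psum k x))).
Proof.
by apply: measurable_inner; [|apply: measurable_perp]; exact: measurable_psum.
Qed.

Lemma measurable_frame n k : measurable (frame n k).
Proof.
apply: (@measurable_forall_le _ _ _ n (fun _ _ => 0)) => j //.
exact: measurable_frame_proj.
Qed.

Lemma measurable_cycmin r k : measurable (cycmin r k).
Proof.
apply: (@measurable_forall_le _ _ _ k.-1
  (fun _ x => inner (psum r x) (perp (psum k x)))
  (fun j x => inner (psum j x) (perp (psum k x)))) => j; exact: measurable_frame_proj.
Qed.

Lemma frame_cycmin k : frame k k = cycmin 0 k.
Proof.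
apply/seteqP; split => x /= h j jk.
  by rewrite psum0 inner0l; apply: h; rewrite (leq_trans jk)// leq_pred.
have [->|jk'] := eqVneq j k; first by rewrite inner_perp_self.
by have := h j; rewrite psum0 inner0l; apply; lia.
Qed.

Lemma frame_split n k x : (k <= n)%N ->
  frame n k x <-> frame k k x /\ stay (n - k) (perp (psum k x)) (shiftn k x).
Proof.
move=> kn; split => [h|[h1 h2] j jn].
  split => j jk; first by apply: h; exact: leq_trans jk kn.
  by rewrite psum_shiftn innerBl inner_perp_self subr0; apply: h; lia.
have [jk|/ltnW kj] := leqP j k; first exact: h1.
have := h2 (j - k)%N; rewrite psum_shiftn innerBl inner_perp_self subr0 subnKC//.
by apply; lia.
Qed.

Lemma cycmin_rot r k x : (r.+1 < k)%N ->
  cycmin r k (restep (rotn k) x) <-> cycmin r.+1 k x.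
Proof.
case: k => // k rk; rewrite /cycmin /= psum_rot_full psum_rot; last by lia.
have e j : (j <= k)%N -> psum j (restep (rotn k.+1) x) = psum j.+1 x - step x 0.
  by move=> jk; rewrite psum_rot.
split => h j jk; last first.
  rewrite e// !innerBl lerD2r.
  have [->|jk'] := eqVneq j k; last by apply: h; lia.
  by have := h 0%N (leq0n _); rewrite psum0 inner0l inner_perp_self.
case: j jk => [_|j jk].
  have := h k (leqnn _); rewrite e// !innerBl lerD2r.
  by rewrite inner_perp_self psum0 inner0l.
by have := h j (ltnW jk); rewrite e ?(ltnW jk)// !innerBl lerD2r.
Qed.

Lemma measurable_stay_graph m :
  measurable [set z : (R * R) * steps R | stay m z.1 z.2].
Proof.
apply: (@measurable_forall_le _ _ _ m (fun _ _ => 0)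
  (fun j (z : (R * R) * steps R) => inner (psum j z.2) z.1)) => j //.
apply: measurable_inner => //.
exact: (measurableT_comp (measurable_psum j) measurable_snd).
Qed.

Lemma measurable_stayp m : measurable_fun setT (stayp mu m : R * R -> R).
Proof.
have h := @measurable_fun_xsection _ _ _ _ R mu _ (measurable_stay_graph m).
have -> : stayp mu m = fine \o (mu \o xsection [set z : (R * R) * steps R | stay m z.1 z.2]).
  apply/funext => v /=; rewrite /stayp; congr (fine (mu _)).
  by rewrite xsectionE.
by apply: measurableT_comp h => //; exact: measurable_fine.
Qed.

Lemma measurable_stayp_perp k m :
  measurable_fun setT (fun x => stayp mu m (perp (psum k x))).
Proof.
apply: (measurableT_comp (measurable_stayp m)).
by apply: measurable_perp; exact: measurable_psum.
Qed.

Lemma stayp_bound m v : `|stayp mu m v| <= 1.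
Proof. by rewrite ger0_norm ?stayp_ge0// stayp_le1. Qed.

Lemma prob_frame_split n k : (k <= n)%N -> fine (mu (frame n k)) =
  \int[mu]_x (\1_(frame k k) x * stayp mu (n - k) (perp (psum k x))).
Proof.
move=> kn; rewrite -Rintegral_indic; last exact: measurable_frame.
have mG : measurable [set z : steps R * steps R |
    stay (n - k) (perp (psum k z.1)) z.2].
  apply: (@measurable_forall_le _ _ _ (n - k)%N (fun _ _ => 0)
    (fun j (z : steps R * steps R) => inner (psum j z.2) (perp (psum k z.1)))) => j //.
  apply: measurable_inner.
    exact: (measurableT_comp (measurable_psum j) measurable_snd).
  apply: measurable_perp; exact: (measurableT_comp (measurable_psum k) measurable_fst).
set G := [set z | _] in mG.
transitivity (\int[mu]_x (\1_(frame k k) x * \1_G (x, shiftn k x))).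
  apply: eq_Rintegral => x _.
  rewrite !indicE -natrM mulnb; congr (nat_of_bool _)%:R.
  apply/idP/andP; rewrite !inE => /frame_split; exact.
rewrite (@Rintegral_splice _ mu mu_iid k (fun z => \1_(frame k k) z.1 * \1_G z)).
- apply: eq_Rintegral => x _ /=.
  have mGx : measurable [set y | G (x, y)].
    by have := @measurable_xsection _ _ _ _ G x mG; rewrite xsectionE.
  rewrite RintegralZl//.
    congr (_ * _); rewrite /stayp -Rintegral_indic; last exact: measurable_stay.
    by apply: eq_Rintegral => y _; rewrite !indicE; congr (nat_of_bool _)%:R;
      apply/idP/idP; rewrite !inE.
  rewrite (_ : (fun y => _) = \1_[set y | G (x, y)]).
    exact: integrable_indic.
  by apply/funext => y; rewrite !indicE; congr (nat_of_bool _)%:R;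
      apply/idP/idP; rewrite !inE.
- move=> y x x' xx' /=; rewrite !indicE; congr ((nat_of_bool _)%:R * (nat_of_bool _)%:R).
    by apply/idP/idP; rewrite !inE => h j jk; have := h j jk;
      rewrite (psum_prefix (leqnn k) xx') (psum_prefix jk xx').
  by apply/idP/idP; rewrite !inE /G /= (psum_prefix (leqnn k) xx').
- apply: measurable_funM; last exact: measurable_indic.
  apply: (measurableT_comp _ measurable_fst).
  by apply: measurable_indic; exact: measurable_frame.
- by move=> z; rewrite mulr_ge0// indicE.
- move=> x /=.
  have mGx : measurable [set y | G (x, y)].
    by have := @measurable_xsection _ _ _ _ G x mG; rewrite xsectionE.
  apply: (@integrable_bounded _ _ _ _ _ 1).
    apply: measurable_funM => //.
    rewrite (_ : (fun y => _) = \1_[set y | G (x, y)]); first exact: measurable_indic.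
    by apply/funext => y; rewrite !indicE; congr (nat_of_bool _)%:R;
      apply/idP/idP; rewrite !inE.
  by move=> y; rewrite !indicE; case: (_ \in _); case: (_ \in _);
    rewrite ?mulr1 ?mulr0 ?mul0r ?normr0 ?normr1.
Qed.

(** The factor [stayp] depends on S_k only and is invariant under rotation, so each event
    [cycmin r k] carries the same integral; almost surely exactly one of the k events occurs. *)
Lemma prob_frame n k : (0 < k <= n)%N ->
  fine (mu (frame n k)) = k%:R^-1 * sweep k (n - k).
Proof.
move=> /andP[k0 kn]; rewrite prob_frame_split// frame_cycmin.
pose F r x := \1_(cycmin r k) x * stayp mu (n - k) (perp (psum k x)).
have mF r : measurable_fun setT (F r).
  apply: measurable_funM; last exact: measurable_stayp_perp.
  by apply: measurable_indic; exact: measurable_cycmin.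
have iF r : mu.-integrable setT (EFin \o F r).
  apply: (@integrable_bounded _ _ _ _ _ 1) => // x.
  rewrite /F normrM indicE; case: (_ \in _); rewrite ?normr1 ?normr0 ?mul1r ?mul0r//.
  exact: stayp_bound.
have FE r : (r < k)%N -> \int[mu]_x F r x = \int[mu]_x F 0%N x.
  elim: r => // r IH rk; rewrite -IH ?(ltnW rk)//.
  rewrite -(Rintegral_restep mu_iid (@rotn_inj k) (mF r)).
  apply: eq_Rintegral => x _; rewrite /F psum_rot_full; congr (_ * _).
  rewrite !indicE; congr (nat_of_bool _)%:R.
  by apply/idP/idP; rewrite !inE => /(cycmin_rot _ rk).
have [i1 i2] := @Rintegral_sum _ _ _ mu k F iF.
suff : sweep k (n - k) = \sum_(r < k) \int[mu]_x F r x.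
  rewrite (eq_bigr (fun=> \int[mu]_x F 0%N x)); last by move=> r _; exact: FE.
  rewrite sumr_const card_ord => ->.
  by rewrite -(mulr_natl (\int[mu]_x F 0%N x)) mulrA mulVf ?mul1r// pnatr_eq0 -lt0n.
rewrite -i2 /sweep; apply: ae_eq_Rintegral.
- exact: measurable_stayp_perp.
- by apply/measurable_EFinP; exact: (measurable_int mu).
have : {ae mu, forall x i j, (i < j <= k.-1)%N ->
    inner (psum i x) (perp (psum k x)) != inner (psum j x) (perp (psum k x))}.
  apply: ae_foralln => i; apply: ae_foralln => j.
  have [ij|ji] := boolP (i < j <= k.-1)%N; last by apply: aeW.
  have ijk : (i < j < k)%N by move: ij k0; lia.
  by apply: filterS (psum_cyc mu_iid mu_null ijk) => x h _.
apply: filterS => x /(@unique_argmin _ (fun j => inner (psum j x) (perp (psum k x)))).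
move=> [r0 r0m r0u]; rewrite -mulr_suml.
have ek : k.-1.+1 = k by rewrite prednK.
have := @sum_indic_unique _ (fun=> 1) k.-1 (fun r => cycmin r k) x r0 r0m r0u.
rewrite -(big_mkord xpredT (fun r => 1 * \1_(cycmin r k) x)) ek big_mkord => h.
rewrite (_ : \sum_(r < k) _ = 1) ?mul1r// -[RHS]h.
by apply: eq_bigr => r _; rewrite mul1r.
Qed.

Definition nohull n : set (steps R) := [set x | exists k, (1 <= k <= n)%N /\
  forall j, (1 <= j <= n)%N -> first_ray (psum k x) (psum j x)].

Lemma measurable_nohull n : measurable (nohull n).
Proof.
have -> : nohull n = \bigcup_(k in [set k | (1 <= k <= n)%N])
    \bigcap_(j in [set j | (1 <= j <= n)%N]) [set x | first_ray (psum k x) (psum j x)].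
  by apply/seteqP; split => x /= [k]; [case|] => k1 h; exists k => //; split.
apply: bigcup_measurable => k _; apply: bigcap_measurableType => j _.
have -> : [set x : steps R | first_ray (psum k x) (psum j x)] =
   [set x | (fun x => 0 < inner (psum j x) (perp (psum k x))) x] `|`
   ([set x | (fun x => inner (psum j x) (perp (psum k x)) == 0) x] `&`
    [set x | (fun x => 0 < inner (psum j x) (psum k x)) x]).
  apply/seteqP; split => x; rewrite /first_ray /=.
    by move=> [h|[/eqP h h']]; [left|right].
  by move=> [h|[/eqP h h']]; [left|right].
have mT (f : steps R -> bool) : measurable_fun setT f -> measurable [set x | f x].
  move=> mf; have h : measurable [set true] by [].
  have := mf measurableT [set true] h; rewrite setTI.
  by congr (measurable _); apply/seteqP; split.
apply: measurableU; [|apply: measurableI]; apply: mT.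
- by apply: measurable_fun_ltr => //; exact: measurable_frame_proj.
- by apply: measurable_fun_eqr => //; exact: measurable_frame_proj.
- by apply: measurable_fun_ltr => //; apply: measurable_inner; exact: measurable_psum.
Qed.

(** Two distinct times with the frame property would have determinants of both weak signs, hence 0,
    which almost surely does not happen; so the frame events are disjoint up to a null set. *)
Lemma prob_nohull n : (0 < n)%N -> fine (mu (nohull n)) =
  \sum_(k < n) k.+1%:R^-1 * sweep k.+1 (n - k.+1).
Proof.
move=> n0; rewrite -(@sum_prob_ae _ _ _ mu n (fun k => frame n k.+1)).
- by apply: eq_bigr => k _; rewrite prob_frame// ltn_ord.
- by move=> k; exact: measurable_frame.
- exact: measurable_nohull.
have h1 : {ae mu, forall x i j, (0 < i < j)%N -> inner (psum j x) (perp (psum i x)) != 0}.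
  apply: ae_foralln => i; apply: ae_foralln => j.
  have [ij|ji] := boolP (0 < i < j)%N; last by apply: aeW.
  by apply: filterS (psum_det mu_iid mu_null ij) => x h _.
have h2 : {ae mu, forall x i, (0 < i)%N -> psum i x != 0}.
  apply: ae_foralln => i.
  have [i0|] := boolP (0 < i)%N; last by move=> _; apply: aeW.
  by apply: filterS (psum_neq0 mu_iid mu_null i0) => x h _.
apply: filterS2 h1 h2 => x h1 h2.
have det0 i j : (0 < i)%N -> (0 < j)%N -> i != j ->
    inner (psum j x) (perp (psum i x)) != 0.
  move=> i0 j0; rewrite neq_ltn => /orP[ij|ji]; first by apply: h1; rewrite i0.
  by rewrite inner_perpC oppr_eq0; apply: h1; rewrite j0.
have fr k : (0 < k <= n)%N -> (forall j, (1 <= j <= n)%N ->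
    first_ray (psum k x) (psum j x)) <-> frame n k x.
  move=> /andP[k0 kn]; split => h j jn.
    case: j jn => [|j] jn; first by rewrite psum0 inner0l.
    by have [/ltW//|[-> _]] := h j.+1 jn.
  have [->|jk] := eqVneq j k; last first.
    left; rewrite lt_neqAle eq_sym det0// 1?eq_sym//; [|lia]. by apply: h; lia.
  by right; rewrite inner_perp_self; split => //; exact/sqn_gt0/h2.
have [hn|hn] := boolP (x \in nohull n); rewrite indicE.
  move: (hn); rewrite inE => -[k [kn kj]].
  have k1n : (k.-1 < n)%N by move: kn; lia.
  rewrite hn (bigD1 (Ordinal k1n))//= (_ : k.-1.+1 = k); last by move: kn; lia.
  rewrite indicE mem_set/=; last exact/fr.
  rewrite big1 ?addr0// => i ik.
  rewrite indicE memNset//= => fi.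
  have i1 : (0 < i.+1 <= n)%N by rewrite ltn_ord.
  have ik' : i.+1 != k.
    apply: contra ik => /eqP ik; rewrite -val_eqE /= -ik; exact/eqP.
  have a1 := (fr k kn).1 kj i.+1 (ltn_ord i).
  have a2 : 0 <= inner (psum k x) (perp (psum i.+1 x)) by apply: fi; move: kn; lia.
  have := det0 i.+1 k isT; rewrite ik'; case/andP: kn => -> _ => /(_ isT isT).
  by apply/negP; rewrite negbK eq_le a2 andbT inner_perpC oppr_le0.
rewrite (negbTE hn) big1// => i _; rewrite indicE memNset// => fi.
move/negP: hn; apply; rewrite inE; exists i.+1; split; first by rewrite ltn_ord.
by apply/fr => //; rewrite ltn_ord.
Qed.

End frames.

(** * Convolution with the central binomial weights *)

Section null_sequences.
Context (R : realType).
Implicit Types (u w : nat -> R).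

Definition null_seq u := forall e : R, 0 < e ->
  exists N, forall n, (N <= n)%N -> `|u n| <= e.

Lemma null_seqP u : null_seq u <-> u @ \oo --> (0 : R).
Proof.
split => [h|/cvgrPdist_le h e e0].
  apply/cvgrPdist_le => e e0; have [N hN] := h e e0.
  by near=> n; rewrite sub0r normrN; apply: hN; near: n; exists N.
have [N _ hN] := h e e0; exists N => n Nn.
by have := hN n Nn; rewrite sub0r normrN.
Unshelve. all: by end_near. Qed.

Lemma null_seqD u w : null_seq u -> null_seq w -> null_seq (fun n => u n + w n).
Proof. by move=> /null_seqP hu /null_seqP hw; apply/null_seqP; rewrite -[0]addr0; exact: cvgD. Qed.

Lemma null_seqZ c u : null_seq u -> null_seq (fun n => c * u n).
Proof.
move=> /null_seqP hu; apply/null_seqP; rewrite -[0](mulr0 c).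
by apply: cvgM => //; exact: cvg_cst.
Qed.

Lemma null_seq_le u w : (exists N, forall n, (N <= n)%N -> `|u n| <= w n) ->
  null_seq w -> null_seq u.
Proof.
move=> [N uw] hw e e0; have [M hM] := hw e e0; exists (maxn N M) => n.
rewrite geq_max => /andP[Nn Mn]; apply: (le_trans (uw n Nn)).
exact: le_trans (ler_norm _) (hM n Mn).
Qed.

Lemma null_seq_inv_sqrt : null_seq (fun n => (Num.sqrt n.+1%:R)^-1).
Proof.
move=> e e0; have [N hN] : exists N, (e ^-2 <= N%:R).
  by exists (Num.bound (e ^- 2)); rewrite ltW// archi_boundP// invr_ge0 sqr_ge0.
exists N => n Nn; rewrite ger0_norm ?invr_ge0 ?sqrtr_ge0//.
rewrite invf_ple ?posrE ?sqrtr_gt0//.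
rewrite -(@ler_pXn2r _ 2) ?nnegrE ?invr_ge0 ?sqrtr_ge0 ?ltW// sqr_sqrtr// exprVn.
by rewrite (le_lt_trans hN)// ltr_nat.
Qed.

End null_sequences.

Section central_binomial.
Context (R : realType).
Implicit Types (f g h : nat -> R) (n k : nat).

Definition conv f g n : R := \sum_(k < n.+1) f k * g (n - k)%N.

(** Convolutions are coefficients of products of truncated power series, so commutativity and
    associativity come from the polynomial ring. *)
Lemma conv_coef f g N n : (n < N)%N ->
  conv f g n = ((\poly_(i < N) f i) * (\poly_(i < N) g i))`_n.
Proof.
move=> nN; rewrite coefM; apply: eq_bigr => i _.
have iN : (i < N)%N by have := ltn_ord i; lia.
by rewrite !coef_poly iN (leq_ltn_trans (leq_subr _ _) nN).
Qed.

Lemma convC f g n : conv f g n = conv g f n.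
Proof. by rewrite (conv_coef f g (ltnSn n)) (conv_coef g f (ltnSn n)) mulrC. Qed.

Lemma convA f g h n : conv f (conv g h) n = conv (conv f g) h n.
Proof.
set F := \poly_(i < n.+1) f i; set G := \poly_(i < n.+1) g i; set H := \poly_(i < n.+1) h i.
transitivity ((F * (G * H))`_n).
  rewrite coefM; apply: eq_bigr => i _.
  rewrite coef_poly ltn_ord (@conv_coef g h n.+1)//.
  by rewrite ltnS leq_subr.
rewrite mulrA coefM; apply: eq_bigr => i _.
by rewrite coef_poly ltnS leq_subr -(@conv_coef f g n.+1).
Qed.

Lemma conv1 f n : conv (fun=> 1) f n = \sum_(k < n.+1) f k.
Proof.
by rewrite convC; apply: eq_bigr => k _; rewrite mulr1.
Qed.

Lemma eq_conv f f' g g' n : (forall k, (k <= n)%N -> f k = f' k) ->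
  (forall k, (k <= n)%N -> g k = g' k) -> conv f g n = conv f' g' n.
Proof.
move=> ff gg; apply: eq_bigr => k _; rewrite ff ?gg//; first exact: leq_subr.
by rewrite -ltnS.
Qed.

Lemma psum_inj f g : (forall n, \sum_(k < n.+1) f k = \sum_(k < n.+1) g k) ->
  forall n, f n = g n.
Proof.
move=> fg [|n]; first by have := fg 0%N; rewrite !big_ord1.
by have := fg n.+1; rewrite big_ord_recr [in RHS]big_ord_recr /= fg => /addrI.
Qed.

(** The central binomial weights, given by the ratio of successive terms, the form used by
    inductions; [bin_beta] is the closed form. *)
Fixpoint beta n : R := if n is m.+1 then beta m * ((m%:R + 2^-1) / m.+1%:R) else 1.
Arguments beta : simpl never.

Lemma betaE n : beta n.+1 = beta n * ((n%:R + 2^-1) / n.+1%:R).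
Proof. by []. Qed.

Lemma betaS n : n.+1%:R * beta n.+1 = (n%:R + 2^-1) * beta n.
Proof.
by rewrite betaE mulrCA [_ * (_ / _)]mulrC divfK ?pnatr_eq0// mulrC.
Qed.

Lemma beta_gt0 n : 0 < beta n.
Proof.
elim: n => [|n IH]; first exact: ltr01.
by rewrite betaE mulr_gt0// divr_gt0// ltr_pwDr.
Qed.

Lemma beta_noninc n : beta n.+1 <= beta n.
Proof.
rewrite betaE ler_piMr//; first exact/ltW/beta_gt0.
by rewrite ler_pdivrMr// mul1r -[n.+1%:R]natr1 lerD2l invf_le1// ler1n.
Qed.

Lemma beta_le1 n : beta n <= 1.
Proof. by elim: n => // n IH; exact: le_trans (beta_noninc n) IH. Qed.

(** Weighting the sum by the index k and symmetrising k against n - k gives n/2 times the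
    convolution; [betaS] lowers the index and closes the induction. *)
Lemma beta_conv n : conv beta beta n = 1.
Proof.
elim: n => [|n IH]; first by rewrite /conv big_ord1 /beta mulr1.
have sym m : 2 * \sum_(k < m.+1) k%:R * (beta k * beta (m - k)%N) = m%:R * conv beta beta m.
  rewrite mulr_natl mulr2n {2}(reindex_inj rev_ord_inj) /= -big_split /= /conv mulr_sumr.
  apply: eq_bigr => k _; have km : (k <= m)%N by rewrite -ltnS.
  rewrite subSS subKn// natrB//; ring.
have n0 : n.+1%:R != 0 :> R by rewrite pnatr_eq0.
apply: (mulfI n0); rewrite -sym mulr1 big_ord_recl mul0r add0r.
transitivity (2 * \sum_(k < n.+1) (k%:R + 2^-1) * (beta k * beta (n - k)%N)).
  congr (_ * _); apply: eq_bigr => k _.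
  by rewrite lift0 subSS mulrA betaS mulrA.
have -> : \sum_(k < n.+1) (k%:R + 2^-1) * (beta k * beta (n - k)%N) =
   \sum_(k < n.+1) k%:R * (beta k * beta (n - k)%N) + 2^-1 * conv beta beta n.
  by rewrite /conv mulr_sumr -big_split; apply: eq_bigr => k _; rewrite /= mulrDl.
by rewrite mulrDr sym IH !mulr1 divff ?natr1// pnatr_eq0.
Qed.

Definition betasum n : R := \sum_(k < n.+1) beta k.

Lemma betasumS n : betasum n.+1 = betasum n + beta n.+1.
Proof. by rewrite /betasum big_ord_recr. Qed.

Lemma betasumE n : betasum n = (2 * n%:R + 1) * beta n.
Proof.
elim: n => [|n IH]; first by rewrite /betasum big_ord1 mulr0 add0r mul1r.
rewrite /betasum big_ord_recr /= -/(betasum n) IH.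
have := betaS n => h.
have -> : (2 * n%:R + 1) * beta n = 2 * (n.+1%:R * beta n.+1) by rewrite h; field.
ring.
Qed.

(* At [n = 0] the lower bound is the junk value [0^-1 = 0]. *)
Lemma beta_sqr_bounds n : (4 * n%:R)^-1 <= beta n ^+ 2 <= (2 * n%:R + 1)^-1.
Proof.
elim: n => [|n /andP[IH1 IH2]].
  by rewrite /beta !mulr0 add0r expr1n invr1 invr0 lexx ler01.
have n0 : 0 <= n%:R :> R by [].
have e : beta n.+1 = beta n * ((n%:R + 2^-1) / (n%:R + 1)) by rewrite betaE natr1.
rewrite e exprMn -[n.+1%:R]natr1; apply/andP; split.
  case: n n0 IH1 {IH2 e} => [|n] n0 IH1; first by rewrite /beta expr1n !add0r mulr1 divr1 mul1r expr2; lra.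
  have xp : 0 < n.+1%:R :> R by [].
  move: (n.+1%:R) xp IH1 => x xp IH1.
  apply: (@le_trans _ _ ((4 * x)^-1 * ((x + 2^-1) / (x + 1)) ^+ 2)); last first.
    by rewrite ler_wpM2r// sqr_ge0.
  have -> : (4 * x)^-1 * ((x + 2^-1) / (x + 1)) ^+ 2 =
      (x + 2^-1) ^+ 2 / (4 * x * (x + 1) ^+ 2) by field; lra.
  rewrite ler_pdivlMr; last nra.
  rewrite mulrC ler_pdivrMr; nra.
move: (n%:R) n0 IH2 => x x0 IH2.
apply: (@le_trans _ _ ((2 * x + 1)^-1 * ((x + 2^-1) / (x + 1)) ^+ 2)).
  by rewrite ler_wpM2r// sqr_ge0.
have -> : (2 * x + 1)^-1 * ((x + 2^-1) / (x + 1)) ^+ 2 =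
    (x + 2^-1) / (2 * (x + 1) ^+ 2) by field; lra.
rewrite ler_pdivrMr; last nra.
rewrite mulrC ler_pdivlMr; nra.
Qed.

Lemma sqrt_inv_le_beta n : (0 < n)%N -> (Num.sqrt n%:R)^-1 <= 2 * beta n.
Proof.
move=> n0; have /andP[h _] := beta_sqr_bounds n.
have np : 0 < n%:R :> R by rewrite ltr0n.
rewrite -(@ler_pXn2r _ 2) ?nnegrE ?invr_ge0 ?sqrtr_ge0//; last first.
  by rewrite mulr_ge0// ltW// beta_gt0.
rewrite exprVn sqr_sqrtr// exprMn; rewrite invfM in h.
have -> : n%:R^-1 = 2 ^+ 2 * (4^-1 * n%:R^-1) :> R by field; rewrite gt_eqF.
by rewrite ler_pM2l// exprn_gt0.
Qed.

Lemma sqrtS_inv_le_beta n : (Num.sqrt n.+1%:R)^-1 <= 2 * beta n.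
Proof.
case: n => [|n]; first by rewrite sqrtr1 invr1 /beta mulr1 ler1n.
apply: le_trans (sqrt_inv_le_beta (ltn0Sn n)).
by rewrite lef_pV2 ?posrE ?sqrtr_gt0// ler_sqrt// ler_nat.
Qed.

Lemma beta_le_sqrt n : beta n <= (Num.sqrt n.+1%:R)^-1.
Proof.
have /andP[_ h] := beta_sqr_bounds n.
rewrite -(@ler_pXn2r _ 2) ?nnegrE ?invr_ge0 ?sqrtr_ge0//; last exact/ltW/beta_gt0.
rewrite exprVn sqr_sqrtr// (le_trans h)// lef_pV2 ?posrE//.
by rewrite -natr1 lerD2r ler_peMl// ler1n.
Qed.

Lemma null_seq_beta : null_seq beta.
Proof.
apply: null_seq_le (@null_seq_inv_sqrt R); exists 0%N => n _.
by rewrite ger0_norm ?beta_le_sqrt// ltW// beta_gt0.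
Qed.

Lemma conv_ge0 f g n : (forall k, 0 <= f k) -> (forall k, 0 <= g k) -> 0 <= conv f g n.
Proof. by move=> f0 g0; apply: sumr_ge0 => k _; rewrite mulr_ge0. Qed.

Lemma le_conv f f' g g' n : (forall k, 0 <= f k <= f' k) -> (forall k, 0 <= g k <= g' k) ->
  conv f g n <= conv f' g' n.
Proof.
move=> ff gg; apply: ler_sum => k _.
have /andP[f0 f1] := ff k; have /andP[g0 g1] := gg (n - k)%N.
exact: ler_pM.
Qed.

Lemma convZl c f g n : conv (fun k => c * f k) g n = c * conv f g n.
Proof. by rewrite /conv mulr_sumr; apply: eq_bigr => k _; rewrite mulrA. Qed.

Lemma convZr c f g n : conv f (fun k => c * g k) n = c * conv f g n.
Proof. by rewrite convC convZl convC. Qed.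

Lemma convDl f f' g n : conv (fun k => f k + f' k) g n = conv f g n + conv f' g n.
Proof. by rewrite /conv -big_split; apply: eq_bigr => k _; rewrite /= mulrDl. Qed.

Lemma convDr f g g' n : conv f (fun k => g k + g' k) n = conv f g n + conv f g' n.
Proof. by rewrite convC convDl !(convC f). Qed.

Lemma conv_split f g n m : (m <= n.+1)%N -> conv f g n =
  \sum_(k < m) f k * g (n - k)%N + \sum_(k < n.+1 - m) f (m + k)%N * g (n - (m + k))%N.
Proof.
move=> mn; rewrite /conv -(big_mkord xpredT (fun k => f k * g (n - k)%N)).
rewrite (big_cat_nat _ mn)//= big_mkord; congr (_ + _).
rewrite -[in LHS](add0n m) big_addn big_mkord.
by apply: eq_bigr => k _; rewrite addnC.
Qed.

(** By [beta_conv] the products beta_k beta_(n-k) are a probability vector in k, and its mass on any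
    fixed initial segment tends to 0; so averages of a null sequence vanish in the limit. *)
Lemma null_conv_beta (eps : nat -> R) : null_seq eps ->
  (forall n, 0 <= eps n) ->
  null_seq (conv (fun k => eps k * beta k) beta).
Proof.
move=> eps0 epos e e0; have [K hK] := eps0 (e / 2) (divr_gt0 e0 (ltr0Sn _ 1)).
pose A := \sum_(k < K) eps k * beta k.
have A0 : 0 <= A by apply: sumr_ge0 => k _; rewrite mulr_ge0// ltW// beta_gt0.
have A1 : 0 < A + 1 by rewrite ltr_pwDr.
have [N hN] := null_seq_beta (divr_gt0 (divr_gt0 e0 (ltr0Sn R 1)) A1).
exists (K + N)%N => n Kn.
have b0 k := ltW (beta_gt0 k).
rewrite ger0_norm; last by apply: conv_ge0 => // k; rewrite mulr_ge0.
rewrite (@conv_split _ _ n K); last by lia.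
rewrite [e]splitr; apply: lerD.
  apply: (@le_trans _ _ (A * (e / 2 / (A + 1)))).
    rewrite /A mulr_suml; apply: ler_sum => k _.
    apply: ler_wpM2l; first by rewrite mulr_ge0.
    rewrite -[leLHS]ger0_norm//; apply: hN; have := ltn_ord k; lia.
  rewrite mulrCA ler_piMr//; first by rewrite ltW// divr_gt0.
  by rewrite ler_pdivrMr// mul1r lerDl.
rewrite -[leRHS]mulr1 -[X in _ * X](beta_conv n) (@conv_split beta beta n K); last by lia.
rewrite mulrDr; apply: (@le_trans _ _ (e / 2 * \sum_(k < n.+1 - K) beta (K + k)%N * beta (n - (K + k)))).
  rewrite mulr_sumr; apply: ler_sum => k _; rewrite mulrA; apply: ler_wpM2r => //.
  apply: ler_wpM2r => //; rewrite -[leLHS]ger0_norm//; apply: hK; exact: leq_addr.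
by rewrite lerDr mulr_ge0 ?divr_ge0 ?(ltW e0)//; apply: sumr_ge0 => k _; rewrite mulr_ge0.
Qed.

Lemma beta_mono n m : (n <= m)%N -> beta m <= beta n.
Proof.
by move=> /subnKC <-; elim: (m - n)%N => [|k IH]; rewrite ?addn0// addnS (le_trans (beta_noninc _)).
Qed.

Lemma betasum_ge_sqrt n : Num.sqrt n.+1%:R / 2 <= betasum n.
Proof.
rewrite betasumE.
apply: (@le_trans _ _ (n.+1%:R * ((Num.sqrt n.+1%:R)^-1 / 2))).
  rewrite mulrA ler_wpM2r// ?invr_ge0// -{2}(@sqr_sqrtr _ n.+1%:R)// expr2 mulfK// gt_eqF// sqrtr_gt0.
apply: ler_pM => //.
- by rewrite -natr1 lerD2r ler_peMl// ler1n.
- by rewrite ler_pdivrMr// mulrC sqrtS_inv_le_beta.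
Qed.

Lemma betasum_gt0 n : 0 < betasum n.
Proof.
apply: lt_le_trans (betasum_ge_sqrt n).
by rewrite divr_gt0// sqrtr_gt0.
Qed.

Lemma null_inv_betasum : null_seq (fun n => (betasum n)^-1).
Proof.
apply: null_seq_le (null_seqZ 2 (@null_seq_inv_sqrt R)); exists 0%N => n _.
rewrite ger0_norm; last by rewrite invr_ge0 ltW// betasum_gt0.
rewrite -[2]invrK -invfM lef_pV2 ?posrE ?betasum_gt0//.
by rewrite mulrC betasum_ge_sqrt.
Qed.

(** The same averaging with the probability vector beta_(n-k) / D_n, where D_n = [betasum n] is
    unbounded. *)
Lemma null_conv_beta_mean (eps : nat -> R) : null_seq eps -> (forall n, 0 <= eps n) ->
  null_seq (fun n => conv eps beta n / betasum n).
Proof.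
move=> eps0 epos e e0; have [K hK] := eps0 (e / 2) (divr_gt0 e0 (ltr0Sn _ 1)).
pose A := \sum_(k < K) eps k.
have A0 : 0 <= A by apply: sumr_ge0.
have A1 : 0 < A + 1 by rewrite ltr_pwDr.
have [N hN] := null_inv_betasum (divr_gt0 (divr_gt0 e0 (ltr0Sn R 1)) A1).
exists (K + N)%N => n Kn.
have b0 k := ltW (beta_gt0 k).
have D0 := betasum_gt0 n.
rewrite ger0_norm; last by rewrite divr_ge0 ?(ltW D0)//; exact: conv_ge0.
rewrite (@conv_split _ _ n K); last by lia.
rewrite mulrDl [e]splitr; apply: lerD.
  apply: (@le_trans _ _ (A * (e / 2 / (A + 1)))).
    apply: ler_pM; rewrite ?invr_ge0 ?(ltW D0)//.
    - by apply: sumr_ge0 => k _; rewrite mulr_ge0.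
    - by apply: ler_sum => k _; rewrite ler_piMr// beta_le1.
    - rewrite -[leLHS]ger0_norm ?invr_ge0 ?(ltW D0)//; apply: hN; lia.
  rewrite mulrCA ler_piMr//; first by rewrite ltW// divr_gt0.
  by rewrite ler_pdivrMr// mul1r lerDl.
rewrite ler_pdivrMr//.
apply: (@le_trans _ _ (e / 2 * \sum_(k < n.+1 - K) beta (n - (K + k)))).
  rewrite mulr_sumr; apply: ler_sum => k _; apply: ler_wpM2r => //.
  rewrite -[leLHS]ger0_norm//; apply: hK; exact: leq_addr.
apply: ler_wpM2l; first by rewrite divr_ge0// ltW.
have -> : betasum n = conv (fun=> 1) beta n by rewrite conv1.
rewrite (@conv_split _ _ n K); last by lia.
rewrite ler_wpDl//; first by apply: sumr_ge0 => k _; rewrite mul1r.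
by apply: ler_sum => k _; rewrite mul1r.
Qed.

End central_binomial.
Arguments beta : simpl never.

Section numeric_bounds.
Context (R : realFieldType).
Implicit Types s t x y : R.

Lemma renewal_bound_upper s e m k r x1 x2 : 0 < e -> 0 <= s <= 1 -> 0 < m ->
  m <= e / 2 -> m <= 1 -> 0 < x1 -> 0 < x2 -> x1 <= x2 + k -> k * 2 <= e / 2 * x2 ->
  r <= m / 2 -> 0 <= k -> r * x1 + x1 * s <= (s + e) * x2 :> R.
Proof.
move=> e0 /andP[s0 s1] m0 me m1 x10 x20 x12 hk hr k0.
have a1 : r * x1 <= m / 2 * x1 by rewrite ler_wpM2r// ltW.
have a2 : m * x1 <= m * (x2 + k) by rewrite ler_wpM2l// ltW.
have a3 : m * x2 <= e / 2 * x2 by rewrite ler_wpM2r// ltW.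
have a4 : m * k <= 1 * k by rewrite ler_wpM2r.
have a5 : x1 * s <= (x2 + k) * s by rewrite ler_wpM2r.
have a6 : k * s <= k * 1 by rewrite ler_wpM2l.
lra.
Qed.

(** Here [s] and [t] are sqrt 2 and its inverse, [x] and [y] ladder means in opposite directions;
    the last premise compares the two bounds for one partial sum of q. *)
Lemma limit_product_upper s t x y a e C : s * s = 2 -> s * t = 1 -> 0 < s ->
  0 <= y <= C -> 0 < a -> e = a * (2 + C) -> y * (s * x - a) <= t + a ->
  x * y <= 2^-1 + e :> R.
Proof.
move=> s2 s1 sp /andP[y0 yC] a0 ee h.
have ss : s <= 2 by nra.
have h' : s * (y * (s * x - a)) <= s * (t + a) by rewrite ler_pM2l.
have e1 : s * (y * (s * x - a)) = 2 * (x * y) - s * (y * a) by rewrite -s2; ring.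
have e2 : s * (t + a) = 1 + s * a by rewrite -s1; ring.
have e3 : s * (y * a) <= 2 * (y * a) by rewrite ler_wpM2r// mulr_ge0// ltW.
have e4 : s * a <= 2 * a by rewrite ler_wpM2r// ltW.
have e5 : y * a <= C * a by rewrite ler_wpM2r// ltW.
rewrite e1 e2 in h'; rewrite ee; lra.
Qed.

Lemma limit_product_lower s t x y a e C : s * s = 2 -> s * t = 1 -> 0 < s ->
  0 <= y <= C -> 0 < a -> e = a * (2 + C) -> t - a <= y * (s * x + a) ->
  2^-1 <= x * y + e :> R.
Proof.
move=> s2 s1 sp /andP[y0 yC] a0 ee h.
have ss : s <= 2 by nra.
have h' : s * (t - a) <= s * (y * (s * x + a)) by rewrite ler_pM2l.
have e1 : s * (y * (s * x + a)) = 2 * (x * y) + s * (y * a) by rewrite -s2; ring.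
have e2 : s * (t - a) = 1 - s * a by rewrite -s1; ring.
have e3 : s * (y * a) <= 2 * (y * a) by rewrite ler_wpM2r// mulr_ge0// ltW.
have e4 : s * a <= 2 * a by rewrite ler_wpM2r// ltW.
have e5 : y * a <= C * a by rewrite ler_wpM2r// ltW.
rewrite e1 e2 in h'; rewrite ee; lra.
Qed.

Lemma product_approx x y p r f C e : 0 < f -> p - f <= x -> r - f <= y ->
  0 <= x -> 0 <= r -> p <= C -> r <= C -> x <= p -> e = 2 * C * f ->
  x * y <= 2^-1 -> p * r <= 2^-1 + e :> R.
Proof.
move=> f0 px ry x0 r0 pC rC xp ee h.
have h1 : p * r <= (x + f) * r by rewrite ler_wpM2r; lra.
have h2 : x * r <= x * (y + f) by rewrite ler_wpM2l; lra.
have xC : x <= C by lra.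
have h3 : x * f <= C * f by rewrite ler_wpM2r// ltW.
have h4 : f * r <= f * C by rewrite ler_wpM2l// ltW.
rewrite ee; lra.
Qed.

End numeric_bounds.

(** * Comparison of survival probabilities with beta, uniformly in the direction *)

Section renewal_asymptotics.
Context (R : realType) (I : Type) (opp : I -> I).
Hypothesis oppK : forall v, opp (opp v) = v.
(* [q v n], [M v n] and [b v n] stand for the survival probabilities, the
   truncated ladder means and the Kac increments of the walk in direction [v]. *)
Variables (q M b : I -> nat -> R) (eps : nat -> R).
Hypothesis q_conv : forall v n, conv (q (opp v)) (q v) n = 1.
Hypothesis b_conv : forall v n,
  \sum_(k < n.+1) b v k = conv (M v) (q (opp v)) n.
Hypothesis q0 : forall v, q v 0%N = 1.
Hypothesis q_ge0 : forall v n, 0 <= q v n.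
Hypothesis q_mono : forall v n m, (n <= m)%N -> q v m <= q v n.
Hypothesis M0 : forall v, M v 0%N = 0.
Hypothesis M_mono : forall v n m, (n <= m)%N -> M v n <= M v m.
Hypothesis b0 : forall v, b v 0%N = 0.
Hypothesis b_ge0 : forall v k, 0 <= b v k.
Hypothesis b_le : forall v k, b v k <= beta R k.
Hypothesis eps0 : null_seq eps.
Hypothesis eps_ge0 : forall n, 0 <= eps n.
Hypothesis b_beta : forall v k, (0 < k)%N ->
  `|b v k - beta R k / Num.sqrt 2| <= eps k * beta R k.

Let sqrt2_gt0 : 0 < Num.sqrt 2 :> R. Proof. by rewrite sqrtr_gt0. Qed.
Let bt_ge0 k : 0 <= beta R k. Proof. exact/ltW/beta_gt0. Qed.
Local Notation be := (beta R).
Local Notation D := (betasum R).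

Definition qsum v n := \sum_(k < n.+1) q v k.

Lemma M_ge0 v n : 0 <= M v n.
Proof. by rewrite -(M0 v); exact: M_mono. Qed.

(** Convolving [b_conv] with q(v) cancels q(-v), by [q_conv]; what remains is an identity between
    partial sums. *)
Lemma kac_conv v n : M v n = conv (b v) (q v) n.
Proof.
move: n; apply: psum_inj => n; rewrite -!conv1.
transitivity (conv (conv (M v) (q (opp v))) (q v) n).
  rewrite -convA convC; by apply: eq_conv.
rewrite convA; apply: eq_conv => // k _.
by rewrite conv1 b_conv.
Qed.

(** Since q_0 = 1, the convolution b * q contains the term b_n itself, and b_n is positive uniformly
    in v once its relative error is small; monotonicity of M does the rest. *)
Lemma M_lower : exists K c, [/\ (0 < K)%N, 0 < c & forall v n, (K <= n)%N -> c <= M v n].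
Proof.
have e0 : 0 < (Num.sqrt 2)^-1 / 2 :> R by rewrite divr_gt0 ?invr_gt0.
have [K hK] := eps0 e0.
exists K.+1, (be K.+1 * ((Num.sqrt 2)^-1 / 2)); split => //.
  by rewrite mulr_gt0// beta_gt0.
move=> v n Kn; apply: le_trans (M_mono v Kn).
rewrite kac_conv /conv big_ord_recr /= subnn q0 mulr1.
apply: ler_wpDl; first by apply: sumr_ge0 => k _; rewrite mulr_ge0.
have := b_beta v (ltn0Sn K); rewrite ler_norml => /andP[+ _].
rewrite lerBrDl; apply: le_trans.
rewrite [eps _ * _]mulrC -mulrBr ler_pM2l ?beta_gt0//.
have h : eps K.+1 <= (Num.sqrt 2)^-1 / 2.
  by apply: le_trans (ler_norm _) (hK _ _).
move: h; move: ((Num.sqrt 2)^-1) (eps _) => s e h; lra.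
Qed.

(** In the identity for the sum of b(-v) up to n + K, each of q_0(v), ..., q_n(v) meets a factor
    M(-v) that is at least c; this bounds the partial sums. Monotonicity of q and D_n = (2n + 1)
    beta_n, with (2n + 1) / (n + 1) <= 2, turn this into a bound on terms. *)
Lemma q_upper : exists2 C, 0 < C & forall v,
  (forall n, q v n <= C * be n) /\ (forall n, qsum v n <= C * D n).
Proof.
have [K [c [K0 c0 hc]]] := M_lower.
have sumb v n : \sum_(k < n.+1) b v k <= D n.
  by apply: ler_sum => k _; exact: b_le.
have hQ v n : qsum v n * c <= D (n + K).
  apply: le_trans (sumb (opp v) (n + K)%N); rewrite b_conv oppK.
  rewrite convC (@conv_split _ _ _ _ n.+1); last by lia.
  apply: ler_wpDr; first by apply: sumr_ge0 => k _; rewrite mulr_ge0// M_ge0.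
  rewrite mulr_suml; apply: ler_sum => k _; apply: ler_wpM2l => //.
  by apply: hc; have := ltn_ord k; lia.
have DK n : D (n + K) <= (1 + K%:R) * D n.
  elim: K {K0 hc hQ} => [|K IH]; first by rewrite addn0 addr0 mul1r.
  rewrite addnS betasumS.
  have : be (n + K).+1 <= D n.
    rewrite /betasum big_ord_recl; apply: ler_wpDr; first exact: sumr_ge0.
    exact: beta_mono.
  by move=> h; rewrite -[K.+1%:R]natr1; apply: (le_trans (lerD IH h)); lra.
pose C := (1 + K%:R) / c.
have C0 : 0 < C by rewrite divr_gt0// ltr_pwDl.
have hQ' v n : qsum v n <= C * D n.
  rewrite /C mulrAC ler_pdivlMr//; exact: le_trans (hQ v n) (DK n).
clearbody C; exists (2 * C); first by rewrite mulr_gt0.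
move=> v; split => n; last first.
  apply: (le_trans (hQ' v n)); rewrite -mulrA ler_peMl ?ler1n//.
  by rewrite mulr_ge0 ?(ltW C0)// ltW// betasum_gt0.
have n0 : 0 < n.+1%:R :> R by [].
rewrite -(ler_pM2l n0).
apply: (@le_trans _ _ (qsum v n)).
  rewrite -[n.+1 in leLHS]card_ord -sumr_const mulr_suml; apply: ler_sum => k _.
  by rewrite mul1r; apply: q_mono; rewrite -ltnS.
apply: (le_trans (hQ' v n)).
rewrite betasumE mulrA mulrA; apply: ler_wpM2r => //.
rewrite -[n.+1%:R]natr1; lra.
Qed.

Lemma M_upper : exists2 C, 0 < C & forall v n, M v n <= C.
Proof.
have [C C0 hC] := q_upper; exists C => // v n.
rewrite kac_conv -[C]mulr1 -(beta_conv R n) -convZr.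
apply: le_conv => k; rewrite ?b_ge0 ?b_le ?q_ge0//=.
by have [h _] := hC v.
Qed.

Lemma M_error : exists2 rho, null_seq rho & (forall n, 0 <= rho n) /\
  forall v n, `|M v n - conv be (q v) n / Num.sqrt 2| <= rho n.
Proof.
have [C C0 hC] := q_upper.
exists (fun n => C / Num.sqrt 2 * be n + C * conv (fun k => eps k * be k) be n).
  apply: null_seqD; apply: null_seqZ; first exact: null_seq_beta.
  exact: null_conv_beta.
split.
  move=> n; apply: addr_ge0; apply: mulr_ge0 => //.
  - by apply: divr_ge0; apply: ltW.
  - exact: ltW.
  - by apply: conv_ge0 => // k; apply: mulr_ge0.
move=> v n; rewrite kac_conv mulrC -convZl.
rewrite /conv -sumrB; apply: (le_trans (ler_norm_sum _ _ _)).
have hq := (hC v).1.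
(* Index 0 stands apart: [b v 0] vanishes while beta_0 / sqrt 2 does not. It accounts for the first
   summand of the error. *)
rewrite big_ord_recl /= b0 mul0r add0r normrN subn0 mulr1.
rewrite big_ord_recl /= mulrDr addrA; apply: lerD.
  apply: ler_wpDr; first by rewrite !mulr_ge0// ltW.
  rewrite ger0_norm; last by apply: mulr_ge0 => //; rewrite invr_ge0 ltW.
  rewrite mulrAC [leLHS]mulrC; apply: ler_wpM2r => //.
rewrite mulr_sumr; apply: ler_sum => k _.
rewrite -mulrBl normrM (ger0_norm (q_ge0 _ _)).
apply: (@le_trans _ _ ((eps (bump 0 k) * be (bump 0 k)) * (C * be (n - bump 0 k)))).
  apply: ler_pM => //; rewrite [(Num.sqrt 2)^-1 * _]mulrC; exact: b_beta.
by rewrite [leLHS]mulrCA.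
Qed.

(** Up to an error M is beta * q / sqrt 2; a further convolution with beta turns beta * beta into 1,
    and so q into its partial sums. *)
Lemma conv_beta_M v N : conv be (M v) N =
  qsum v N / Num.sqrt 2 + conv be (fun n => M v n - conv be (q v) n / Num.sqrt 2) N.
Proof.
have -> : qsum v N / Num.sqrt 2 = conv be (fun n => conv be (q v) n / Num.sqrt 2) N.
  rewrite (@eq_conv _ be be _ (fun n => (Num.sqrt 2)^-1 * conv be (q v) n))//; last first.
    by move=> k _; rewrite mulrC.
  rewrite convZr convA mulrC; congr (_ * _).
  rewrite /qsum -conv1; apply: eq_conv => // k _; by rewrite beta_conv.
by rewrite -convDr; apply: eq_conv => // k _; rewrite addrC subrK.
Qed.

Lemma conv_beta_M_error : exists2 rho, null_seq rho & forall v N,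
  `|conv be (M v) N - qsum v N / Num.sqrt 2| <= rho N * D N.
Proof.
have [rho rho0 [rho_ge0 hrho]] := M_error.
exists (fun N => conv rho be N / D N); first exact: null_conv_beta_mean.
move=> v N; rewrite divfK ?gt_eqF ?betasum_gt0// conv_beta_M addrAC subrr add0r.
rewrite convC; apply: (le_trans (ler_norm_sum _ _ _)); apply: ler_sum => k _.
by rewrite normrM (ger0_norm (bt_ge0 _)); apply: ler_wpM2r.
Qed.

(** Monotonicity gives M_k >= M_K for k >= K, so beta * M is at least M_K D_N up to the first K
    terms. These cost at most C K, which is small against D_N. *)
Lemma qsum_lower K e : 0 < e -> exists N0, forall v N, (N0 <= N)%N ->
  (Num.sqrt 2 * M v K - e) * D N <= qsum v N.
Proof.
move=> e0; have [rho rho0 hrho] := conv_beta_M_error.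
have [C C0 hC] := M_upper.
have e1 : 0 < e / 2 / Num.sqrt 2 by rewrite !divr_gt0.
have [N1 h1] := rho0 _ e1.
have e2 : 0 < e / 2 / Num.sqrt 2 / (C * (K%:R + 1)) by rewrite !divr_gt0// mulr_gt0// ltr_wpDl.
have [N2 h2] := null_inv_betasum e2.
exists (K + N1 + N2)%N => v N NN.
have DN := betasum_gt0 R N.
have hM : M v K * D N - C * K%:R <= conv be (M v) N.
  rewrite convC (@conv_split _ _ _ _ K); last by lia.
  have -> : D N = conv (fun=> 1) be N by rewrite conv1.
  rewrite (@conv_split _ _ be N K); last by lia.
  rewrite mulrDr addrAC; apply: lerD.
    rewrite lerBlDr; apply: ler_wpDl.
      by apply: sumr_ge0 => k _; rewrite mulr_ge0// M_ge0.
    apply: ler_pM => //; first exact: M_ge0.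
      by apply: sumr_ge0 => k _; rewrite mul1r.
    rewrite -[K in leRHS]card_ord -sumr_const; apply: ler_sum => k _.
    by rewrite mul1r beta_le1.
  rewrite mulr_sumr; apply: ler_sum => k _; rewrite mul1r; apply: ler_wpM2r => //.
  by apply: M_mono; exact: leq_addr.
have hr : rho N <= e / 2 / Num.sqrt 2 by apply: le_trans (ler_norm _) (h1 _ _); move: NN; clear; lia.
have hD : C * K%:R <= e / 2 / Num.sqrt 2 * D N.
  have := h2 N; rewrite ger0_norm ?invr_ge0 ?(ltW DN)// => /(_ ltac:(move: NN; clear; lia)).
  rewrite ler_pdivlMr ?mulr_gt0 ?ltr_wpDl// -ler_pdivlMl ?invr_gt0// invrK [D N * _]mulrC.
  by apply: le_trans; rewrite ler_pM2l// lerDl.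
have := hrho v N; rewrite ler_norml => /andP[_ h3].
have h4 : M v K * D N - e / Num.sqrt 2 * D N <= qsum v N / Num.sqrt 2.
  have h5 : rho N * D N <= e / 2 / Num.sqrt 2 * D N by rewrite ler_wpM2r// ltW.
  have -> : e / Num.sqrt 2 = e / 2 / Num.sqrt 2 + e / 2 / Num.sqrt 2.
    by rewrite -mulrDl -splitr.
  rewrite mulrDl; lra.
move: h4; rewrite ler_pdivlMr//; apply: le_trans.
have -> : (M v K * D N - e / Num.sqrt 2 * D N) * Num.sqrt 2 =
   (Num.sqrt 2 * M v K - e / Num.sqrt 2 * Num.sqrt 2) * D N by ring.
by rewrite divfK ?gt_eqF.
Qed.

Lemma sumb_error : exists2 rho, null_seq rho & forall v N,
  `|\sum_(k < N.+1) b v k - D N / Num.sqrt 2| <= rho N * D N.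
Proof.
(* At index 0 the error is exactly 1/sqrt 2, as [b v 0] is 0. *)
pose ep n := if n is 0%N then (Num.sqrt 2)^-1 else eps n : R.
have ep0 n : 0 <= ep n by case: n => [|n] //=; rewrite invr_ge0 ltW.
have epn : null_seq ep.
  apply: null_seq_le eps0; exists 1%N => -[//|n] _.
  by rewrite ger0_norm.
exists (fun N => conv (fun k => ep k * be k) (fun=> 1) N / D N); last first.
  move=> v N; rewrite divfK ?gt_eqF ?betasum_gt0// mulr_suml -sumrB.
  apply: (le_trans (ler_norm_sum _ _ _)); apply: ler_sum => -[[|k] kN] _ /=.
    rewrite b0 sub0r normrN mulr1 mulrC ger0_norm//; apply: mulr_ge0 => //.
  by rewrite mulr1; exact: b_beta.
move=> e e0; have [K hK] := epn (e / 2) (divr_gt0 e0 (ltr0Sn _ 1)).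
pose A := \sum_(k < K) ep k * be k.
have A0 : 0 <= A by apply: sumr_ge0 => k _; rewrite mulr_ge0.
have A1 : 0 < A + 1 by rewrite ltr_pwDr.
have [N hN] := @null_inv_betasum R (e / 2 / (A + 1)) (divr_gt0 (divr_gt0 e0 (ltr0Sn R 1)) A1).
exists (K + N)%N => n Kn.
have D0 := betasum_gt0 R n.
rewrite ger0_norm; last first.
  by rewrite divr_ge0 ?(ltW D0)//; apply: conv_ge0 => // k; rewrite mulr_ge0.
rewrite (@conv_split _ _ _ n K); last by lia.
rewrite mulrDl [e]splitr; apply: lerD.
  rewrite (eq_bigr (fun k : 'I_K => ep k * be k)); last by move=> k _; rewrite mulr1.
  apply: (@le_trans _ _ (A * (e / 2 / (A + 1)))).
    apply: ler_wpM2l => //.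
    rewrite -[leLHS]ger0_norm ?invr_ge0 ?(ltW D0)//; apply: hN; lia.
  rewrite mulrCA ler_piMr//; first by rewrite ltW// divr_gt0.
  by rewrite ler_pdivrMr// mul1r lerDl.
rewrite ler_pdivrMr//.
have -> : D n = conv be (fun=> 1) n by rewrite convC conv1.
rewrite (@conv_split _ be _ n K); last by lia.
rewrite mulrDr ler_wpDl//.
  rewrite mulr_ge0 ?divr_ge0 ?(ltW e0)//; apply: sumr_ge0 => k _; by rewrite mulr1.
rewrite mulr_sumr; apply: ler_sum => k _; rewrite !mulr1; apply: ler_wpM2r => //.
rewrite -[leLHS]ger0_norm//; apply: hK; exact: leq_addr.
Qed.

(** Extending the sum of b(-v) to N + K makes every q_k(v) with k <= N meet some M_j(-v) with j >=
    K, hence at least M_K(-v). *)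
Lemma qsum_upper K e : 0 < e -> exists N0, forall v N, (N0 <= N)%N ->
  M (opp v) K * qsum v N <= ((Num.sqrt 2)^-1 + e) * D N.
Proof.
move=> e0; have [rho rho0 hrho] := sumb_error.
have e3 : 0 < e / 2 by rewrite divr_gt0.
have e4 : 0 < Num.min (e / 2) 1 by rewrite lt_min e3 ltr01.
have e5 : 0 < e / 2 / (K%:R * 2) \/ K = 0%N.
  by case: K => [|K]; [right|left; rewrite !divr_gt0// mulr_gt0].
have [N1 h1] := rho0 _ (divr_gt0 e4 (ltr0Sn R 1)).
have e6 : 0 < e / 2 / ((K%:R + 1) * 2) by rewrite !divr_gt0// mulr_gt0// ltr_wpDl.
have [N2 h2] := null_inv_betasum e6.
exists (N1 + N2)%N => v N NN.
have DN := betasum_gt0 R N.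
have hDK : D (N + K) <= D N + K%:R.
  elim: K {e5 e6 h2} => [|K IH]; first by rewrite addn0 addr0.
  rewrite addnS /betasum big_ord_recr /= -/(D (N + K)) -[K.+1%:R]natr1 addrA.
  by apply: lerD => //; exact: (beta_le1 R (N + K).+1).
have hD : K%:R * 2 <= e / 2 * D N.
  have := h2 N; rewrite ger0_norm ?invr_ge0 ?(ltW DN)// => /(_ ltac:(move: NN; clear; lia)).
  rewrite ler_pdivlMr ?mulr_gt0 ?ltr_wpDl// -ler_pdivlMl ?invr_gt0// invrK [D N * _]mulrC.
  by apply: le_trans; rewrite ler_pM2r// lerDl.
have hM : M (opp v) K * qsum v N <= \sum_(k < (N + K).+1) b (opp v) k.
  rewrite b_conv oppK convC (@conv_split _ _ _ _ N.+1); last by clear; lia.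
  apply: ler_wpDr; first by apply: sumr_ge0 => k _; rewrite mulr_ge0// M_ge0.
  rewrite mulrC mulr_suml; apply: ler_sum => k _; apply: ler_wpM2l => //.
  by apply: M_mono; move: (ltn_ord k); clear; lia.
apply: (le_trans hM).
have := hrho (opp v) (N + K)%N; rewrite ler_norml => /andP[_]; rewrite lerBlDr.
move=> /le_trans; apply.
have hr : rho (N + K)%N <= Num.min (e / 2) 1 / 2.
  by apply: le_trans (ler_norm _) (h1 _ _); move: NN; clear; lia.
apply: (@renewal_bound_upper _ _ e (Num.min (e / 2) 1) K%:R) => //.
- rewrite invr_ge0 (ltW sqrt2_gt0) invf_le1// -{1}[1]sqrtr1 ler_sqrt//.
  by rewrite ler1n.
- by rewrite ge_min lexx.
- by rewrite ge_min lexx orbT.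
- exact: betasum_gt0.
Qed.

Definition Mlim v := sup (range (M v)).

Lemma Mlim_ub v n : M v n <= Mlim v.
Proof.
have [C C0 hC] := M_upper.
apply: ub_le_sup; last by exists n.
by exists C => _ [k _ <-].
Qed.

Lemma Mlim_approx v e : 0 < e -> exists n, Mlim v - e <= M v n.
Proof.
move=> e0; have [C C0 hC] := M_upper.
have hs : has_sup (range (M v)).
  by split; [exists (M v 0%N), 0%N|exists C => _ [k _ <-]].
have [_ [n _ <-] h] := sup_adherent e0 hs.
by exists n; exact: ltW.
Qed.

Lemma Mlim_bounds : exists c C, [/\ 0 < c, 0 < C & forall v, c <= Mlim v <= C].
Proof.
have [K [c [_ c0 hc]]] := M_lower; have [C C0 hC] := M_upper.
exists c, C; split => // v; rewrite (le_trans (hc v K (leqnn K)) (Mlim_ub v K)) /=.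
apply: ge_sup; first by exists (M v 0%N), 0%N.
by move=> _ [k _ <-].
Qed.

Lemma qsum_Mlim v e : 0 < e -> exists N0, forall N, (N0 <= N)%N ->
  qsum v N <= (Num.sqrt 2 * Mlim v + e) * D N.
Proof.
move=> e0; have [rho rho0 hrho] := conv_beta_M_error.
have [N1 h1] := rho0 _ (divr_gt0 e0 sqrt2_gt0).
exists N1 => N N1N; have DN := betasum_gt0 R N.
have := hrho v N; rewrite ler_norml => /andP[h2 _].
have h3 : conv be (M v) N <= Mlim v * D N.
  rewrite convC /betasum -conv1 -convZl.
  apply: le_conv => k; rewrite ?M_ge0 ?mulr1 ?Mlim_ub ?bt_ge0 ?lexx//.
have h4 : rho N * D N <= e / Num.sqrt 2 * D N.
  by rewrite ler_wpM2r ?(ltW DN)//; apply: le_trans (ler_norm _) (h1 _ _).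
have h5 : qsum v N / Num.sqrt 2 <= (Mlim v + e / Num.sqrt 2) * D N by rewrite mulrDl; lra.
move: h5; rewrite ler_pdivrMr// => /le_trans; apply.
have -> : (Mlim v + e / Num.sqrt 2) * D N * Num.sqrt 2 =
   (Num.sqrt 2 * Mlim v + e / Num.sqrt 2 * Num.sqrt 2) * D N by ring.
by rewrite divfK ?gt_eqF.
Qed.

(** The two bounds for one partial sum of q give M_K(v) M_L(-v) <= 1/2 for all K and L. Conversely,
    bounding every M_k by its supremum in the same two convolution identities reverses both
    estimates. *)
Lemma Mlim_opp v : Mlim v * Mlim (opp v) = 2^-1.
Proof.
have [c [C [c0 C0 hcC]]] := Mlim_bounds.
have s2 : Num.sqrt 2 * Num.sqrt 2 = 2 :> R by rewrite -expr2 sqr_sqrtr.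
have s1 : Num.sqrt 2 * (Num.sqrt 2)^-1 = 1 :> R by rewrite mulfV// gt_eqF.
have sp := sqrt2_gt0.
have /andP[c1 C1] := hcC v; have /andP[c2 C2] := hcC (opp v).
apply/eqP; rewrite eq_le; apply/andP; split.
  have key K1 K2 : M v K1 * M (opp v) K2 <= 2^-1.
    apply/ler_addgt0Pr => e e0.
    pose e1 := e / (2 + C).
    have e10 : 0 < e1 by rewrite divr_gt0// addr_gt0.
    have [N1 h1] := qsum_lower K1 e10; have [N2 h2] := qsum_upper K2 e10.
    have a := h1 v (maxn N1 N2) (leq_maxl _ _).
    have b' := h2 v (maxn N1 N2) (leq_maxr _ _).
    have DN := betasum_gt0 R (maxn N1 N2).
    have m0 : 0 <= M (opp v) K2 by exact: M_ge0.
    have mC : M (opp v) K2 <= C := le_trans (Mlim_ub _ _) C2.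
    have := le_trans (ler_wpM2l m0 a) b'; rewrite mulrA ler_pM2r// => h.
    have ee : e = e1 * (2 + C) by rewrite divfK// gt_eqF// addr_gt0.
    by apply: (limit_product_upper s2 s1 sp _ e10 ee h); rewrite m0.
  apply/ler_addgt0Pr => e e0.
  have e1 : 0 < e / (2 * C) by rewrite divr_gt0// mulr_gt0.
  have [K1 h1] := @Mlim_approx v _ e1; have [K2 h2] := @Mlim_approx (opp v) _ e1.
  have := key K1 K2; have := Mlim_ub v K1; have := Mlim_ub (opp v) K2.
  have ee : e = 2 * C * (e / (2 * C)) by rewrite mulrC divfK// gt_eqF// mulr_gt0.
  have m1 := M_ge0 v K1; have m2 := M_ge0 (opp v) K2.
  move=> u1 u2 u3; apply: (@product_approx _ _ _ _ _ _ C e e1 h1 h2) => //.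
  exact: le_trans (ltW c0) c2.
apply/ler_addgt0Pr => e e0.
pose e1 := e / (2 + C).
have e10 : 0 < e1 by rewrite divr_gt0// addr_gt0.
have [N1 h1] := @qsum_Mlim v e1 e10.
have [rho rho0 hrho] := sumb_error; have [N2 h2] := rho0 _ e10.
pose N := maxn N1 N2; have DN := betasum_gt0 R N.
have a := h1 N (leq_maxl _ _).
have b' : \sum_(k < N.+1) b (opp v) k <= Mlim (opp v) * qsum v N.
  rewrite b_conv oppK /qsum -conv1 -convZl; apply: le_conv => k.
    by rewrite M_ge0 mulr1 Mlim_ub.
  by rewrite q_ge0 lexx.
have := hrho (opp v) N; rewrite ler_norml => /andP[d _].
have hr : rho N <= e1 by apply: le_trans (ler_norm _) (h2 _ (leq_maxr _ _)).
have hr' : rho N * D N <= e1 * D N by rewrite ler_wpM2r// ltW.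
have m0 : 0 <= Mlim (opp v) by exact: le_trans (ltW c0) c2.
have f1 : Mlim (opp v) * qsum v N <= Mlim (opp v) * ((Num.sqrt 2 * Mlim v + e1) * D N).
  exact: ler_wpM2l.
have f2 : ((Num.sqrt 2)^-1 - e1) * D N <= (Mlim (opp v) * (Num.sqrt 2 * Mlim v + e1)) * D N.
  rewrite -mulrA mulrBl; lra.
rewrite ler_pM2r// in f2.
have ee : e = e1 * (2 + C) by rewrite divfK// gt_eqF// addr_gt0.
by apply: (limit_product_lower s2 s1 sp _ e10 ee f2); rewrite m0.
Qed.

End renewal_asymptotics.

(** * Lindeberg replacement and simple random walk *)

Section smooth_functions.
Context (R : realType).
Implicit Types (z y : R * R) (f : R * R -> R) (h K : R).

Definition cubrem y : R := sqn y * Num.min 1 (Num.sqrt (sqn y)).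

(* The remainder is cubic near [0] but only quadratic at infinity, so that it is
   integrable under a second moment; [f11] and [f22] are half the second derivatives. *)
Definition smooth K f := exists f1 f2 f11 f12 f22 : R * R -> R, forall z y,
  `|f (z + y) - (f z + (f1 z * y.1 + f2 z * y.2) +
     (f11 z * y.1 ^+ 2 + f12 z * (y.1 * y.2) + f22 z * y.2 ^+ 2))| <= K * cubrem y.

(** Averaging over one step of the reference walk, uniform on the four points (+-h, +-h); each
    coordinate performs a simple random walk. *)
Definition rad h f z : R := 4^-1 *
  (f (z + (h, h)) + f (z + (h, - h)) + f (z + (- h, h)) + f (z + (- h, - h))).

Lemma cubrem_ge0 y : 0 <= cubrem y.
Proof. by rewrite mulr_ge0 ?sqn_ge0// le_min ler01 sqrtr_ge0. Qed.

Lemma cubrem_le y : cubrem y <= sqn y.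
Proof. by rewrite ler_piMr ?sqn_ge0// ge_min lexx. Qed.

Lemma measurable_cubrem d (T : measurableType d) (g : T -> R * R) :
  measurable_fun setT g -> measurable_fun setT (fun t => cubrem (g t)).
Proof.
move=> mg; have m1 : measurable_fun setT (fun t => sqn (g t)) by exact: measurable_inner.
apply: measurable_funM => //; apply: measurable_minr => //.
exact: (measurableT_comp (continuous_measurable_fun (@sqrt_continuous R))).
Qed.

Lemma smooth_rad h K f : smooth K f -> smooth K (rad h f).
Proof.
move=> [f1 [f2 [f11 [f12 [f22 H]]]]].
exists (rad h f1), (rad h f2), (rad h f11), (rad h f12), (rad h f22) => z y.
have H1 := H (z + (h, h)) y; have H2 := H (z + (h, - h)) y.
have H3 := H (z + (- h, h)) y; have H4 := H (z + (- h, - h)) y.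
rewrite /rad.
have e a : z + y + a = z + a + y by rewrite addrAC.
rewrite !e.
set A1 := (X in `|X| <= _) in H1; set A2 := (X in `|X| <= _) in H2.
set A3 := (X in `|X| <= _) in H3; set A4 := (X in `|X| <= _) in H4.
rewrite (_ : _ - _ = 4^-1 * (A1 + A2 + A3 + A4)); last by rewrite /A1 /A2 /A3 /A4; ring.
rewrite normrM ger0_norm ?invr_ge0//.
have n1 := ler_normD (A1 + A2 + A3) A4; have n2 := ler_normD (A1 + A2) A3.
have n3 := ler_normD A1 A2.
move: (cubrem y) `|A1| `|A2| `|A3| `|A4| `|A1 + A2| `|A1 + A2 + A3| `|A1 + A2 + A3 + A4| H1 H2 H3 H4 n1 n2 n3.
move=> *; lra.
Qed.

Lemma smooth_iter_rad h K f n : smooth K f -> smooth K (iter n (rad h) f).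
Proof. by move=> sf; elim: n => //= n; exact: smooth_rad. Qed.

Lemma rad_ge0 h f : (forall z, 0 <= f z) -> forall z, 0 <= rad h f z.
Proof. by move=> f0 z; rewrite mulr_ge0 ?invr_ge0// !addr_ge0. Qed.

Lemma iter_rad_ge0 h f n : (forall z, 0 <= f z) -> forall z, 0 <= iter n (rad h) f z.
Proof. by move=> f0; elim: n => //= n; exact: rad_ge0. Qed.

Lemma measurable_translate d (T : measurableType d) (g : T -> R * R) (a : R * R) :
  measurable_fun setT g -> measurable_fun setT (fun t => g t + a).
Proof.
move=> mg; rewrite (_ : (fun t => _) = (fun t => ((g t).1 + a.1, (g t).2 + a.2)))//.
apply: measurable_fun_pair; apply: measurable_funD => //;
  by [apply: (measurableT_comp measurable_fst)|apply: (measurableT_comp measurable_snd)].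
Qed.

Lemma measurable_rad h f : measurable_fun setT f -> measurable_fun setT (rad h f).
Proof.
move=> mf; apply: measurable_funM => //.
have mt a : measurable_fun setT (fun z : R * R => f (z + a)).
  by apply: (measurableT_comp mf); exact: measurable_translate.
by do 3 (apply: measurable_funD => //).
Qed.

Lemma measurable_iter_rad h f n : measurable_fun setT f -> measurable_fun setT (iter n (rad h) f).
Proof. by move=> mf; elim: n => //= n; exact: measurable_rad. Qed.

(** At most quadratic growth, which makes [f] integrable along the walk under a second moment. *)
Lemma smooth_growth K f : 0 <= K -> smooth K f ->
  forall z, exists2 A, 0 <= A & forall y, `|f (z + y)| <= A * (1 + sqn y).
Proof.
move=> K0 [f1 [f2 [f11 [f12 [f22 H]]]]] z.
exists (`|f z| + `|f1 z| + `|f2 z| + `|f11 z| + `|f12 z| + `|f22 z| + K).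
  by rewrite !addr_ge0.
move=> y; have := H z y; set t := (X in X <= _ -> _) => h0.
have sy : sqn y = y.1 ^+ 2 + y.2 ^+ 2 by rewrite /sqn /inner !expr2.
have s1 : 0 <= y.1 ^+ 2 by exact: sqr_ge0.
have s2 : 0 <= y.2 ^+ 2 by exact: sqr_ge0.
have h1 : `|f (z + y)| <= `|f z| + `|f1 z| * `|y.1| + `|f2 z| * `|y.2| +
   `|f11 z| * y.1 ^+ 2 + `|f12 z| * (`|y.1| * `|y.2|) + `|f22 z| * y.2 ^+ 2 + K * sqn y.
  have hK : K * cubrem y <= K * sqn y by rewrite ler_wpM2l// cubrem_le.
  have e1 : `|y.1| ^+ 2 = y.1 ^+ 2 by rewrite real_normK// num_real.
  have e2 : `|y.2| ^+ 2 = y.2 ^+ 2 by rewrite real_normK// num_real.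
  have m1 : `|f11 z * y.1 ^+ 2| = `|f11 z| * y.1 ^+ 2 by rewrite normrM normrX e1.
  have m2 : `|f22 z * y.2 ^+ 2| = `|f22 z| * y.2 ^+ 2 by rewrite normrM normrX e2.
  rewrite -m1 -m2 -!normrM.
  have ht : t <= K * sqn y := le_trans h0 hK.
  rewrite /t in ht; move: ht; set B := f z + _ + _ => ht.
  have : `|f (z + y)| <= `|B| + `|f (z + y) - B|.
    by rewrite -[X in `|X| <= _](subrKC B) ler_normD.
  have : `|B| <= `|f z| + `|f1 z * y.1| + `|f2 z * y.2| + `|f11 z * y.1 ^+ 2| +
     `|f12 z * (y.1 * y.2)| + `|f22 z * y.2 ^+ 2|.
    rewrite /B; apply: (le_trans (ler_normD _ _)); rewrite -!addrA.
    have a1 := ler_normD (f z) (f1 z * y.1 + f2 z * y.2).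
    have a2 := ler_normD (f1 z * y.1) (f2 z * y.2).
    have a3 := ler_normD (f11 z * y.1 ^+ 2) (f12 z * (y.1 * y.2) + f22 z * y.2 ^+ 2).
    have a4 := ler_normD (f12 z * (y.1 * y.2)) (f22 z * y.2 ^+ 2).
    lra.
  lra.
apply: (le_trans h1).
have b1 : `|y.1| <= 1 + sqn y.
  by rewrite sy -[y.1 ^+ 2]real_normK ?num_real//; move: `|y.1| s2 => u s2; nra.
have b2 : `|y.2| <= 1 + sqn y.
  by rewrite sy -[y.2 ^+ 2]real_normK ?num_real//; move: `|y.2| s1 => u s1; nra.
have b3 : `|y.1| * `|y.2| <= 1 + sqn y.
  rewrite sy -[y.1 ^+ 2]real_normK ?num_real// -[y.2 ^+ 2]real_normK ?num_real//.
  by move: `|y.1| `|y.2| => u w; nra.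
have b4 : y.1 ^+ 2 <= 1 + sqn y by rewrite sy; lra.
have b5 : y.2 ^+ 2 <= 1 + sqn y by rewrite sy; lra.
have b6 : sqn y <= 1 + sqn y by lra.
have b7 : 1 <= 1 + sqn y by rewrite lerDl sqn_ge0.
have c0 : `|f z| * 1 <= `|f z| * (1 + sqn y) by rewrite ler_wpM2l.
rewrite !mulrDl.
by repeat (apply: lerD); rewrite ?ler_wpM2l//; rewrite mulr1 in c0.
Qed.

Definition rot (e y : R * R) : R * R := (inner y e, inner y (perp e)).

Lemma rotD e y y' : rot e (y + y') = rot e y + rot e y'.
Proof. by rewrite /rot !innerDl. Qed.

Lemma sqn_rot e y : sqn (rot e y) = sqn e * sqn y.
Proof. by rewrite /rot /sqn /inner /=; ring. Qed.

(** The linear and the mixed terms cancel over the four points; the surviving term is the one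
    produced by any centred step with covariance h^2 times the identity. *)
Lemma rad_expand h K f f1 f2 f11 f12 f22 z :
  (forall z y, `|f (z + y) - (f z + (f1 z * y.1 + f2 z * y.2) +
     (f11 z * y.1 ^+ 2 + f12 z * (y.1 * y.2) + f22 z * y.2 ^+ 2))| <= K * cubrem y) ->
  `|rad h f z - (f z + h ^+ 2 * (f11 z + f22 z))| <= K * cubrem (h, h).
Proof.
move=> H.
have q1 : cubrem (h, - h) = cubrem (h, h) by rewrite /cubrem /sqn /inner /= mulrNN.
have q2 : cubrem (- h, h) = cubrem (h, h) by rewrite /cubrem /sqn /inner /= mulrNN.
have q3 : cubrem (- h, - h) = cubrem (h, h) by rewrite /cubrem /sqn /inner /= mulrNN.
have H1 := H z (h, h); have H2 := H z (h, - h).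
have H3 := H z (- h, h); have H4 := H z (- h, - h).
rewrite ?q1 ?q2 ?q3 /= in H1 H2 H3 H4.
set A1 := (X in `|X| <= _) in H1; set A2 := (X in `|X| <= _) in H2.
set A3 := (X in `|X| <= _) in H3; set A4 := (X in `|X| <= _) in H4.
rewrite (_ : _ - _ = 4^-1 * (A1 + A2 + A3 + A4)); last first.
  by rewrite /rad /A1 /A2 /A3 /A4; field.
rewrite normrM ger0_norm ?invr_ge0//.
have n1 := ler_normD (A1 + A2 + A3) A4; have n2 := ler_normD (A1 + A2) A3.
have n3 := ler_normD A1 A2.
move: (K * cubrem _) `|A1| `|A2| `|A3| `|A4| `|A1 + A2| `|A1 + A2 + A3| `|A1 + A2 + A3 + A4| H1 H2 H3 H4 n1 n2 n3.
move=> *; lra.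
Qed.

End smooth_functions.

Lemma dominated_Rintegral d (T : measurableType d) (R : realType) (P : probability T R)
    (f_ : nat -> T -> R) (f g : T -> R) :
  (forall n, measurable_fun setT (f_ n)) -> measurable_fun setT f ->
  {ae P, forall x, f_ ^~ x @ \oo --> f x} -> P.-integrable setT (EFin \o g) ->
  (forall n x, `|f_ n x| <= g x) ->
  (fun n => \int[P]_x f_ n x) @ \oo --> \int[P]_x f x.
Proof.
move=> mf_ mf cf ig fg.
have [|||||h1 _ h2] := @dominated_convergence _ _ _ P setT measurableT
  (fun n => EFin \o f_ n) (EFin \o f) (EFin \o g).
- by move=> n; exact/measurable_EFinP.
- exact/measurable_EFinP.
- by apply: filterS cf => x fx _; apply: cvg_EFin => //; exact: nearW.
- by [].
- by apply: aeW => x n _ /=; rewrite lee_fin.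
apply: fine_cvg; rewrite fineK//; exact: integrable_fin_num h1.
Qed.

Section lindeberg.
Context (R : realType) (mu : probability (steps R) R).
Hypothesis mu_iid : iid_law mu.
Hypothesis mu_int1 : mu.-integrable setT (fun x => ((step x 0).1)%:E).
Hypothesis mu_int2 : mu.-integrable setT (fun x => ((step x 0).2)%:E).
Hypothesis mu_mean1 : \int[mu]_x (step x 0).1 = 0.
Hypothesis mu_mean2 : \int[mu]_x (step x 0).2 = 0.
Hypothesis mu_sq : mu.-integrable setT (fun x => (sqn (step x 0))%:E).
Hypothesis mu_var : forall e, sqn e = 1 -> \int[mu]_x (inner (step x 0) e ^+ 2) = 1.
Hypothesis mu_cov : forall e, \int[mu]_x (inner (step x 0) e * inner (step x 0) (perp e)) = 0.

(** For n > 0 this is n times the mean [cubrem] of a step of the walk plus that of the reference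
    step, both scaled by 1/sqrt n ([lindE]). In this form the limit 0 is dominated convergence. *)
Definition lind n : R :=
  \int[mu]_x (sqn (step x 0) * Num.min 1 (Num.sqrt (sqn (step x 0)) / Num.sqrt n%:R)) +
  2 * Num.min 1 (Num.sqrt 2 / Num.sqrt n%:R).

Let msq : measurable_fun setT (fun x : steps R => sqn (step x 0)).
Proof. by apply: measurable_inner; exact: measurable_step. Qed.

Lemma integrable_dom (g : steps R -> R) A : measurable_fun setT g -> 0 <= A ->
  (forall x, `|g x| <= A * (1 + sqn (step x 0))) -> mu.-integrable setT (EFin \o g).
Proof.
move=> mg A0 gA.
have h1 : mu.-integrable setT (EFin \o (fun x => A * (1 + sqn (step x 0)))).
  have i1 : mu.-integrable setT (EFin \o (cst 1 : steps R -> R)).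
    by apply: (@integrable_bounded _ _ _ _ _ 1) => // x; rewrite normr1.
  have := integrableZl measurableT A (integrableD measurableT i1 mu_sq).
  by apply: eq_integrable => // x _ /=; rewrite -EFinD -EFinM.
apply: (le_integrable measurableT _ _ h1).
  exact/measurable_EFinP.
move=> x _ /=; rewrite lee_fin [leRHS]ger0_norm//.
by rewrite mulr_ge0// addr_ge0// sqn_ge0.
Qed.

Lemma integrable_sqn_psum n : mu.-integrable setT (EFin \o (fun x => sqn (psum n x))).
Proof.
have ms k : measurable_fun setT (fun x : steps R => sqn (step x k)).
  by apply: measurable_inner; exact: measurable_step.
have mp k : measurable_fun setT (fun x : steps R => sqn (psum k x)).
  by apply: measurable_inner; exact: measurable_psum.
have hk k : mu.-integrable setT (EFin \o (fun x => sqn (step x k))).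
  apply/integrableP; split; first exact/measurable_EFinP.
  have := @integral_restep _ mu mu_iid (addn k) (fun x => `|(sqn (step x 0))%:E|%E) (@addnI k).
  rewrite (_ : (fun x => `|(sqn (step (restep (addn k) x) 0))%:E|%E) =
    fun x => `|(sqn (step x k))%:E|%E); last first.
    by apply/funext => x; rewrite step_restep addn0.
  move=> -> //; first by case/integrableP: mu_sq.
  by apply: measurableT_comp => //; case/integrableP: mu_sq.
elim: n => [|n IH].
  apply: (@integrable_bounded _ _ _ _ _ 0) => // x.
  by rewrite psum0 /sqn inner0l normr0.
have h := integrableD measurableT (integrableZl measurableT 2 IH) (integrableZl measurableT 2 (hk n)).
apply: (le_integrable measurableT _ _ h); first exact/measurable_EFinP.
move=> x _; have -> : (2 * (EFin \o (fun x => sqn (psum n x))) x +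
    2 * (EFin \o (fun x => sqn (step x n))) x)%E = (2 * sqn (psum n x) + 2 * sqn (step x n))%:E.
  by [].
rewrite /= lee_fin ger0_norm ?sqn_ge0//.
rewrite [leRHS]ger0_norm ?addr_ge0 ?mulr_ge0 ?sqn_ge0//.
rewrite psumS /sqn /inner /=; move: (psum n x) (step x n) => [a b] [c d] /=.
rewrite -subr_ge0 (_ : _ - _ = (a - c) ^+ 2 + (b - d) ^+ 2); last by ring.
by rewrite addr_ge0 ?sqr_ge0.
Qed.

Lemma integrable_cubrem h : mu.-integrable setT (EFin \o (fun x => cubrem (h *: step x 0))).
Proof.
apply: (@integrable_dom _ (h ^+ 2)); last 2 first.
- exact: sqr_ge0.
- move=> x; rewrite ger0_norm ?cubrem_ge0// (le_trans (cubrem_le _))// sqnZ.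
  by rewrite ler_wpM2l ?sqr_ge0// lerDr.
apply: measurable_cubrem.
rewrite (_ : (fun x => _) = (fun x : steps R => (h * (step x 0).1, h * (step x 0).2)))//.
have ms := @measurable_step R 0.
apply: measurable_fun_pair; apply: measurable_funM => //.
- exact: (measurableT_comp measurable_fst ms).
- exact: (measurableT_comp measurable_snd ms).
Qed.

(** A rotated step is still centred with identity covariance, so its second-order expansion has the
    same mean as that of the reference step, for every unit vector [e]. *)
Lemma smooth_step h K (f : R * R -> R) e z : 0 <= K -> measurable_fun setT f ->
  smooth K f -> sqn e = 1 ->
  mu.-integrable setT (EFin \o (fun x => f (z + h *: rot e (step x 0)))) /\
  `|\int[mu]_x f (z + h *: rot e (step x 0)) - rad h f z| <=
    K * (\int[mu]_x cubrem (h *: step x 0) + cubrem (h, h)).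
Proof.
move=> K0 mf sf e1.
have sqh y : sqn (h *: rot e y) = h ^+ 2 * sqn y by rewrite sqnZ sqn_rot e1 mul1r.
have mr : measurable_fun setT (fun x : steps R => z + h *: rot e (step x 0)).
  rewrite (_ : (fun x => _) = (fun x => (h * inner (step x 0) e + z.1,
     h * inner (step x 0) (perp e) + z.2))); last first.
    by apply/funext => x; rewrite addrC.
  by apply: measurable_fun_pair; apply: measurable_funD => //; apply: measurable_funM => //;
    apply: measurable_inner => //; exact: measurable_step.
have fi : mu.-integrable setT (EFin \o (fun x => f (z + h *: rot e (step x 0)))).
  have [A A0 hA] := smooth_growth K0 sf z.
  apply: (@integrable_dom _ (A * (1 + h ^+ 2))).
  - exact: measurableT_comp mf mr.
  - by rewrite mulr_ge0// addr_ge0// sqr_ge0.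
  - move=> x; apply: (le_trans (hA _)); rewrite sqh -mulrA ler_wpM2l//.
    have := sqn_ge0 (step x 0); have := sqr_ge0 h; nra.
split => //.
have [f1 [f2 [f11 [f12 [f22 H]]]]] := sf.
have hr := @rad_expand _ h K f f1 f2 f11 f12 f22 z H.
pose L x := f z + (f1 z * (h * inner (step x 0) e) + f2 z * (h * inner (step x 0) (perp e))) +
   (f11 z * (h * inner (step x 0) e) ^+ 2 +
    f12 z * (h * inner (step x 0) e * (h * inner (step x 0) (perp e))) +
    f22 z * (h * inner (step x 0) (perp e)) ^+ 2).
have pe1 : sqn (perp e) = 1 by rewrite sqn_perp.
have bi (v : R * R) : sqn v = 1 -> forall y, inner y v ^+ 2 <= sqn y.
  move=> v1 y; rewrite -[leRHS]mul1r -v1 /sqn /inner; case: v {v1} => a b; case: y => c d /=.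
  rewrite -subr_ge0 (_ : _ - _ = (b * c - a * d) ^+ 2); last by ring.
  exact: sqr_ge0.
have mi v : measurable_fun setT (fun x : steps R => inner (step x 0) v).
  by apply: measurable_inner => //; exact: measurable_step.
have j0 : mu.-integrable setT (EFin \o (cst (f z) : steps R -> R)).
  by apply: (@integrable_bounded _ _ _ _ _ `|f z|).
have j1 v : mu.-integrable setT (EFin \o (fun x => inner (step x 0) v)).
  exact: integrable_step.
have j2 v : sqn v = 1 -> mu.-integrable setT (EFin \o (fun x => inner (step x 0) v ^+ 2)).
  move=> v1; apply: (@integrable_dom _ 1) => //; first exact: measurable_funX.
  move=> x; rewrite mul1r ger0_norm ?sqr_ge0// (le_trans (bi v v1 _))//; lra.
have j3 : mu.-integrable setT (EFin \o (fun x => inner (step x 0) e * inner (step x 0) (perp e))).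
  apply: (@integrable_dom _ 1) => //; first exact: measurable_funM.
  move=> x; rewrite mul1r normrM.
  have b1 := bi e e1 (step x 0); have b2 := bi (perp e) pe1 (step x 0).
  rewrite -[inner (step x 0) e ^+ 2]real_normK ?num_real// in b1.
  rewrite -[inner (step x 0) (perp e) ^+ 2]real_normK ?num_real// in b2.
  move: `|_| `|_| b1 b2 => u w b1 b2; nra.
have Li : mu.-integrable setT (EFin \o L) /\ \int[mu]_x L x = f z + h ^+ 2 * (f11 z + f22 z).
  pose L' x := f z + ((f1 z * h) * inner (step x 0) e + ((f2 z * h) * inner (step x 0) (perp e) +
    ((f11 z * h ^+ 2) * inner (step x 0) e ^+ 2 +
     ((f12 z * h ^+ 2) * (inner (step x 0) e * inner (step x 0) (perp e)) +
      (f22 z * h ^+ 2) * inner (step x 0) (perp e) ^+ 2)))).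
  have -> : L = L' by apply/funext => x; rewrite /L /L'; ring.
  have k1 := integrableZl measurableT (f1 z * h) (j1 e).
  have k2 := integrableZl measurableT (f2 z * h) (j1 (perp e)).
  have k3 := integrableZl measurableT (f11 z * h ^+ 2) (j2 e e1).
  have k4 := integrableZl measurableT (f12 z * h ^+ 2) j3.
  have k5 := integrableZl measurableT (f22 z * h ^+ 2) (j2 _ pe1).
  have k45 := integrableD measurableT k4 k5.
  have k345 := integrableD measurableT k3 k45.
  have k2345 := integrableD measurableT k2 k345.
  have k12345 := integrableD measurableT k1 k2345.
  split; first exact: (integrableD measurableT j0 k12345).
  rewrite /L' RintegralD// RintegralD// RintegralD// RintegralD// RintegralD//.
  rewrite !RintegralZl//; try exact: j1; try exact: j2; try exact: j3.
  have -> : \int[mu]_x f z = f z by rewrite Rintegral_cst//= probability_setT mulr1.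
  rewrite !(mean_step mu_iid mu_int1 mu_int2 mu_mean1 mu_mean2) mu_var// mu_var// mu_cov.
  ring.
have [Li1 Li2] := Li.
have ci : mu.-integrable setT (EFin \o (fun x => cubrem (h *: step x 0))).
  exact: integrable_cubrem.
have main : `|\int[mu]_x f (z + h *: rot e (step x 0)) - \int[mu]_x L x| <=
    K * \int[mu]_x cubrem (h *: step x 0).
  have dfi := integrableB measurableT fi Li1.
  rewrite -RintegralB//; apply: (le_trans (le_normr_Rintegral _ _)) => //.
  have kci := integrableZl measurableT K ci.
  rewrite -RintegralZl//.
  apply: le_Rintegral => //; first exact: integrable_norm.
  move=> x _; have := H z (h *: rot e (step x 0)).
  have -> : cubrem (h *: rot e (step x 0)) = cubrem (h *: step x 0).
    by rewrite /cubrem sqh sqnZ.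
  by apply: le_trans.
rewrite Li2 in main; rewrite mulrDr; apply: le_trans (lerD main hr).
rewrite [X in _ <= _ + X]distrC; exact: ler_distD.
Qed.

Lemma measurable_rot_psum h e k : measurable_fun setT (fun x : steps R => h *: rot e (psum k x)).
Proof.
rewrite (_ : (fun x => _) = (fun x : steps R => (h * inner (psum k x) e,
   h * inner (psum k x) (perp e))))//.
by apply: measurable_fun_pair; apply: measurable_funM => //;
  apply: measurable_inner => //; exact: measurable_psum.
Qed.

Lemma integrable_smooth_psum h K (f : R * R -> R) e k : 0 <= K -> measurable_fun setT f ->
  smooth K f -> sqn e = 1 ->
  mu.-integrable setT (EFin \o (fun x => f (h *: rot e (psum k x)))).
Proof.
move=> K0 mf sf e1; have [A A0 hA] := smooth_growth K0 sf 0.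
have i1 : mu.-integrable setT (EFin \o (cst 1 : steps R -> R)).
  by apply: (@integrable_bounded _ _ _ _ _ 1) => // x; rewrite normr1.
have i2 := integrableZl measurableT A (integrableD measurableT i1
  (integrableZl measurableT (h ^+ 2) (integrable_sqn_psum k))).
apply: (le_integrable measurableT _ _ i2).
  by apply/measurable_EFinP; apply: (measurableT_comp mf); exact: measurable_rot_psum.
move=> x _; have -> : (A%:E * ((EFin \o cst 1%R) x + (h ^+ 2)%:E * (EFin \o (fun x => sqn (psum k x))) x))%E =
    (A * (1 + h ^+ 2 * sqn (psum k x)))%:E by [].
rewrite /= lee_fin [leRHS]ger0_norm; last first.
  by rewrite mulr_ge0// addr_ge0// mulr_ge0 ?sqr_ge0 ?sqn_ge0.
by have := hA (h *: rot e (psum k x)); rewrite add0r sqnZ sqn_rot e1 mul1r.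
Qed.

Lemma lindeberg_swap h K (f : R * R -> R) e k : 0 <= K -> measurable_fun setT f ->
  (forall z, 0 <= f z) -> smooth K f -> sqn e = 1 ->
  `|\int[mu]_x f (h *: rot e (psum k.+1 x)) - \int[mu]_x rad h f (h *: rot e (psum k x))| <=
    K * (\int[mu]_x cubrem (h *: step x 0) + cubrem (h, h)).
Proof.
move=> K0 mf f0 sf e1.
pose F (z : steps R * steps R) := f (h *: rot e (psum k z.1) + h *: rot e (step z.2 0)).
have stepf z := smooth_step h z K0 mf sf e1.
have mF : measurable_fun setT F.
  apply: (measurableT_comp mf).
  rewrite (_ : (fun x => _) = (fun z : steps R * steps R =>
     (h * inner (psum k z.1) e + h * inner (step z.2 0) e,
      h * inner (psum k z.1) (perp e) + h * inner (step z.2 0) (perp e))))//.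
  have m1 : measurable_fun setT (fun z : steps R * steps R => psum k z.1).
    exact: (measurableT_comp (measurable_psum k) measurable_fst).
  have m2 : measurable_fun setT (fun z : steps R * steps R => step z.2 0).
    exact: (measurableT_comp (measurable_step 0) measurable_snd).
  by apply: measurable_fun_pair; apply: measurable_funD; apply: measurable_funM => //;
    exact: measurable_inner.
have -> : \int[mu]_x f (h *: rot e (psum k.+1 x)) = \int[mu]_x \int[mu]_y F (x, y).
  rewrite -(Rintegral_splice mu_iid (k := k))//.
  - apply: eq_Rintegral => x _; rewrite /F /= step_shiftn addn0 -scalerDr -rotD.
    by rewrite -psumS.
  - by move=> y x x' xx'; rewrite /F /= (psum_prefix (leqnn k) xx').
  - by move=> z; exact: f0.
  - by move=> x; have [] := stepf (h *: rot e (psum k x)).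
set c := \int[mu]_x cubrem _; set dl := K * _.
have sr := smooth_rad h sf; have mr := measurable_rad h mf.
have i2 := integrable_smooth_psum h k K0 mr sr e1.
have mI : measurable_fun setT (fun x => \int[mu]_y F (x, y)).
  apply: (measurableT_comp (@fine_measurable R setT measurableT)).
  apply: (@measurable_fun_fubini_tonelli_F _ _ _ _ _ mu (EFin \o F)).
    exact/measurable_EFinP.
  by move=> z /=; rewrite lee_fin; exact: f0.
have near x : `|\int[mu]_y F (x, y) - rad h f (h *: rot e (psum k x))| <= dl.
  by have [_] := stepf (h *: rot e (psum k x)).
have id : mu.-integrable setT (EFin \o (fun x => \int[mu]_y F (x, y) -
    rad h f (h *: rot e (psum k x)))).
  apply: (@integrable_bounded _ _ _ _ _ dl) => //; apply: measurable_funB => //.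
  by apply: (measurableT_comp mr); exact: measurable_rot_psum.
have i1 : mu.-integrable setT (EFin \o (fun x => \int[mu]_y F (x, y))).
  have := integrableD measurableT id i2; apply: eq_integrable => // x _ /=.
  by rewrite -EFinD subrK.
rewrite -RintegralB//; apply: (le_trans (le_normr_Rintegral measurableT id)).
rewrite [leRHS](_ : _ = \int[mu]_x (cst dl x)); last by rewrite Rintegral_cst//= probability_setT mulr1.
apply: le_Rintegral => //; first exact: integrable_norm.
apply: (@integrable_bounded _ _ _ _ _ `|dl|) => //.
Qed.

Lemma lindE n : (0 < n)%N -> lind n = n%:R *
  (\int[mu]_x cubrem ((Num.sqrt n%:R)^-1 *: step x 0) +
   cubrem ((Num.sqrt n%:R)^-1, (Num.sqrt n%:R)^-1)).
Proof.
move=> n0; set h := (Num.sqrt _)^-1.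
have h0 : 0 <= h by rewrite invr_ge0 sqrtr_ge0.
have nh : n%:R * h ^+ 2 = 1.
  by rewrite /h exprVn sqr_sqrtr// divff// pnatr_eq0 -lt0n.
have ch y : n%:R * cubrem (h *: y) = sqn y * Num.min 1 (Num.sqrt (sqn y) * h).
  rewrite /cubrem sqnZ sqrtrM ?sqr_ge0// sqrtr_sqr ger0_norm// [h * _]mulrC.
  set m := Num.min _ _; transitivity ((n%:R * h ^+ 2) * (sqn y * m)); first by ring.
  by rewrite nh mul1r.
rewrite mulrDr -RintegralZl//; last exact: integrable_cubrem.
congr (_ + _); first by apply: eq_Rintegral => x _; rewrite ch.
have -> : (h, h) = h *: (1, 1) by rewrite -{1 2}[h]mulr1.
have q2 : sqn (1, 1) = 2 :> R by rewrite /sqn /inner /= !mulr1.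
by rewrite ch q2.
Qed.

Lemma lindeberg n K (f : R * R -> R) e : (0 < n)%N -> 0 <= K -> measurable_fun setT f ->
  (forall z, 0 <= f z) -> smooth K f -> sqn e = 1 ->
  `|\int[mu]_x f ((Num.sqrt n%:R)^-1 *: rot e (psum n x)) -
    iter n (rad (Num.sqrt n%:R)^-1) f 0| <= K * lind n.
Proof.
move=> n0 K0 mf f0 sf e1; rewrite lindE//; set h := (Num.sqrt _)^-1.
set c := (X in K * (n%:R * X)).
(* Interpolation: [k] genuine steps followed by n - k reference steps. Consecutive values differ by
   one exchange. *)
pose a k := \int[mu]_x iter (n - k) (rad h) f (h *: rot e (psum k x)).
have -> : iter n (rad h) f 0 = a 0%N.
  rewrite /a subn0.
  have -> : (fun x => iter n (rad h) f (h *: rot e (psum 0 x))) = cst (iter n (rad h) f 0).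
    by apply/funext => x; rewrite psum0 /rot !inner0l (_ : (0, 0) = 0)// scaler0.
  by rewrite Rintegral_cst//= probability_setT mulr1.
have -> : \int[mu]_x f (h *: rot e (psum n x)) = a n by rewrite /a subnn.
have H k : (k <= n)%N -> `|a k - a 0%N| <= k%:R * (K * c).
  elim: k => [|k IH] kn; first by rewrite subrr normr0 mul0r.
  apply: (le_trans (ler_distD (a k) _ _)).
  rewrite -[k.+1%:R]natr1 mulrDl mul1r addrC lerD ?IH// 1?ltnW//.
  rewrite /a (_ : n - k = (n - k.+1).+1)%N; last by rewrite subnSK.
  apply: lindeberg_swap => //.
  - exact: measurable_iter_rad.
  - exact: iter_rad_ge0.
  - exact: smooth_iter_rad.
by have := H n (leqnn n); rewrite mulrCA.
Qed.

Lemma lind_ge0 n : 0 <= lind n.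
Proof.
have m0 a : 0 <= a -> 0 <= Num.min 1 (a / Num.sqrt n%:R) :> R.
  by move=> a0; rewrite le_min ler01 divr_ge0 ?sqrtr_ge0.
rewrite addr_ge0 ?mulr_ge0 ?m0 ?sqrtr_ge0//.
by apply: Rintegral_ge0 => x _; rewrite mulr_ge0 ?sqn_ge0 ?m0 ?sqrtr_ge0.
Qed.

Lemma null_lind : null_seq lind.
Proof.
have ns c : 0 <= c -> (fun n : nat => Num.min 1 (c / Num.sqrt n%:R)) @ \oo --> (0 : R).
  move=> c0; apply/null_seqP.
  apply: null_seq_le (null_seqZ (c * 2) (@null_seq_inv_sqrt R)).
  exists 1%N => n n1; rewrite ger0_norm; last by rewrite le_min ler01 divr_ge0 ?sqrtr_ge0.
  rewrite ge_min; apply/orP; right; rewrite -mulrA ler_wpM2l//.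
  have n0 : 0 < Num.sqrt (n%:R : R) by rewrite sqrtr_gt0 ltr0n.
  rewrite -[X in _ <= X]invf_div ler_pV2 ?inE ?unitfE ?divr_gt0 ?gt_eqF ?sqrtr_gt0 ?ltr0n//.
  have s4 : 2 = Num.sqrt 4 :> R.
    by rewrite (_ : 4 = 2 ^+ 2 :> R) ?sqrtr_sqr ?ger0_norm//; ring.
  rewrite ler_pdivrMr// s4 -sqrtrM//.
  rewrite ler_sqrt ?mulr_ge0//; rewrite -natrM ler_nat; lia.
apply/null_seqP; rewrite -[X in _ --> X]addr0; apply: cvgD; last first.
  by apply/null_seqP/null_seqZ/null_seqP; exact: ns (sqrtr_ge0 _).
rewrite (_ : 0 = \int[mu]_x (cst 0 x)); last by rewrite Rintegral_cst// mul0r.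
apply: (dominated_Rintegral (g := fun x => sqn (step x 0))) => //.
- move=> n; apply: measurable_funM => //; apply: measurable_minr => //.
  apply: measurable_funM => //.
  exact: (measurableT_comp (continuous_measurable_fun (@sqrt_continuous R)) msq).
- apply: aeW => x.
  by apply/null_seqP/null_seqZ/null_seqP; apply: ns; exact: sqrtr_ge0.
- move=> n x; rewrite ger0_norm; last first.
    by rewrite mulr_ge0 ?sqn_ge0// le_min ler01 divr_ge0 ?sqrtr_ge0.
  by rewrite ler_piMr ?sqn_ge0// ge_min lexx.
Qed.

End lindeberg.

(** * Taylor remainders *)

Section taylor.
Context (R : realType).
Implicit Types (f g F : R -> R) (C : R).

Lemma mean_value f f1 (a b : R) : (forall x : R, is_derive x 1 f (f1 x)) -> a <= b ->
  exists2 c, a <= c <= b & f b - f a = f1 c * (b - a).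
Proof.
move=> df ab; have [|c] := @MVT_segment R f f1 a b ab.
- apply: derivable_within_continuous => x _; exact: (@ex_derive _ _ _ _ _ _ _ (df x)).
- by rewrite in_itv/= => cab h; exists c.
Qed.

Lemma derive_lipschitz f f1 C : (forall x : R, is_derive x 1 f (f1 x)) ->
  (forall x, `|f1 x| <= C) -> forall x y, `|f x - f y| <= C * `|x - y|.
Proof.
move=> df fC x y; wlog xy : x y / y <= x.
  by case/orP: (le_total y x) => xy; [exact|rewrite distrC [X in _ * X]distrC; exact].
have [c _ ->] := mean_value df xy; by rewrite normrM ler_wpM2r.
Qed.

(** The mean value theorem is applied to the remainder and then to its derivative, so only the
    oscillation of the second derivative on [0, 1] is involved. *)
Lemma taylor2 F F1 F2 (B : R) : (forall x : R, is_derive x 1 F (F1 x)) ->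
  (forall x : R, is_derive x 1 F1 (F2 x)) ->
  (forall s, 0 <= s <= 1 -> `|F2 s - F2 0| <= B) ->
  `|F 1 - (F 0 + F1 0 + F2 0 / 2)| <= B.
Proof.
move=> d1 d2 FB.
pose v s := F1 s - F1 0 - s * F2 0.
pose u s := F s - F 0 - s * F1 0 - s ^+ 2 * (F2 0 / 2).
have du (x : R) : is_derive x 1 u (v x).
  by apply: is_derive_eq; rewrite /v /GRing.scale /=; field.
have dv (x : R) : is_derive x 1 v (F2 x - F2 0).
  by apply: is_derive_eq; rewrite /GRing.scale /=; ring.
have B0 : 0 <= B by apply: le_trans (FB 0 _); rewrite ?lexx ?ler01.
have [c /andP[c0 c1] uc] := mean_value du (@ler01 R).
have [c' /andP[c'0 c'c] vc] := mean_value dv c0.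
have -> : F 1 - (F 0 + F1 0 + F2 0 / 2) = v c.
  by move: uc; rewrite subr0 mulr1 => <-; rewrite /u; ring.
have -> : v c = (F2 c' - F2 0) * c.
  by move: vc; rewrite subr0 => <-; rewrite /v; ring.
rewrite normrM (ger0_norm c0) -[leRHS]mulr1 ler_pM//.
by apply: FB; rewrite c'0 (le_trans c'c).
Qed.

(** The bound on [g2] gives the quadratic remainder at infinity, its Lipschitz constant the cubic
    one near 0. The function itself may grow, as [sabs] does. *)
Definition nice C g g1 g2 := [/\ forall x : R, is_derive x 1 g (g1 x),
  forall x : R, is_derive x 1 g1 (g2 x), forall x, `|g1 x| <= C, forall x, `|g2 x| <= C &
  forall x y, `|g2 x - g2 y| <= C * `|x - y|].

Lemma nice_ge0 C g g1 g2 : nice C g g1 g2 -> 0 <= C.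
Proof. by case=> _ _ h _ _; exact: le_trans (h 0). Qed.

Lemma sqr_le_sqn1 (y : R * R) : y.1 ^+ 2 <= sqn y.
Proof. by rewrite /sqn /inner -!expr2 lerDl sqr_ge0. Qed.

Lemma inner_le_norm (y v : R * R) : sqn v = 1 -> `|inner y v| <= Num.sqrt (sqn y).
Proof.
move=> v1; rewrite -(sqrtr_sqr (inner y v)) ler_wsqrtr//.
rewrite -[leRHS]mul1r -v1 /sqn /inner; case: v {v1} => a b; case: y => c d /=.
rewrite -subr_ge0 (_ : _ - _ = (b * c - a * d) ^+ 2); last by ring.
exact: sqr_ge0.
Qed.

Lemma inner_sqr_le (y v : R * R) : sqn v = 1 -> inner y v ^+ 2 <= sqn y.
Proof.
move=> v1; rewrite -[inner y v ^+ 2]real_normK ?num_real//.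
by rewrite -[leRHS]sqr_sqrtr ?sqn_ge0// lerXn2r ?nnegrE ?sqrtr_ge0// inner_le_norm.
Qed.

Lemma min_bound (C a x : R) : 0 <= C -> 0 <= a -> 0 <= x -> x <= C -> x <= C * a ->
  x <= C * Num.min 1 a.
Proof. by move=> *; rewrite minr_pMr// mulr1 le_min; apply/andP. Qed.

Lemma smooth_ridge C g g1 g2 : nice C g g1 g2 -> smooth (2 * C) (fun z : R * R => g z.1).
Proof.
move=> nC; have C0 := nice_ge0 nC; case: nC => d1 d2 b1 b2 l2.
exists (fun z => g1 z.1), (fun=> 0), (fun z => g2 z.1 / 2), (fun=> 0), (fun=> 0) => z y.
pose F s := g (z.1 + s * y.1).
have dF (x : R) : is_derive x 1 F (g1 (z.1 + x * y.1) * y.1).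
  have h := is_derive1_comp (f := g) (g := fun s => z.1 + s * y.1) (x := x).
  have h2 : is_derive x 1 (fun s => z.1 + s * y.1) y.1.
    by apply: is_derive_eq; rewrite /GRing.scale /=; ring.
  exact: (h _ _ (d1 _) h2).
have dF1 (x : R) : is_derive x 1 (fun s => g1 (z.1 + s * y.1) * y.1) (g2 (z.1 + x * y.1) * y.1 ^+ 2).
  have h := is_derive1_comp (f := g1) (g := fun s => z.1 + s * y.1) (x := x).
  have h2 : is_derive x 1 (fun s => z.1 + s * y.1) y.1.
    by apply: is_derive_eq; rewrite /GRing.scale /=; ring.
  have h3 := h _ _ (d2 _) h2.
  by apply: is_derive_eq; rewrite /GRing.scale /=; ring.
have := @taylor2 F _ _ (2 * C * cubrem y) dF dF1.
rewrite /F /= !mul0r !addr0 !mul1r => h.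
rewrite [_ / 2 * _]mulrAC.
apply: h => s /andP[s0 s1].
rewrite -mulrBl normrM (ger0_norm (sqr_ge0 y.1)).
rewrite mulrC /cubrem [leRHS]mulrCA ler_pM ?sqr_ge0 ?sqr_le_sqn1//.
apply: min_bound; rewrite ?mulr_ge0 ?sqrtr_ge0//.
  by rewrite (le_trans (ler_normB _ _))// mulrDl mul1r lerD.
apply: (le_trans (l2 _ _)); rewrite addrAC subrr add0r normrM.
have yr : `|y.1| <= Num.sqrt (sqn y) by rewrite -(sqrtr_sqr y.1) ler_wsqrtr// sqr_le_sqn1.
apply: ler_pM; rewrite ?mulr_ge0//; first by rewrite ler_peMl// ler1n.
by rewrite (ger0_norm s0) -[leRHS]mul1r ler_pM.
Qed.

Lemma diff_prod_le C r (x x' y y' : R) : 0 <= C -> 0 <= r ->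
  `|x| <= C -> `|x'| <= C -> `|y| <= C -> `|y'| <= C ->
  `|x - x'| <= C * r -> `|y - y'| <= C * r ->
  `|x * y - x' * y'| <= 2 * C ^+ 2 * Num.min 1 r.
Proof.
move=> C0 r0 hx hx' hy hy' dx dy; apply: min_bound => //.
- by rewrite mulr_ge0 ?sqr_ge0.
- rewrite (le_trans (ler_normB _ _))// !normrM mulrDl mul1r expr2.
  by rewrite lerD ?ler_pM.
- rewrite (_ : _ - _ = (x - x') * y + x' * (y - y')); last by ring.
  rewrite (le_trans (ler_normD _ _))// !normrM.
  rewrite (_ : _ * r = (C * r) * C + C * (C * r)); last by ring.
  by rewrite lerD ?ler_pM.
Qed.

(** On the segment from z to z + y, of length r, the second derivative has terms of weights 1, 2, 1
    times r^2, and each of the three coefficients varies by at most 2 C^2 min(1, r); hence the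
    constant 8 C^2. *)
Lemma smooth_product C g g1 g2 k k1 k2 (a b : R * R) :
  nice C g g1 g2 -> nice C k k1 k2 -> (forall x, `|g x| <= C) -> (forall x, `|k x| <= C) ->
  sqn a = 1 -> sqn b = 1 ->
  smooth (8 * C ^+ 2) (fun z : R * R => g (inner z a) * k (inner z b)).
Proof.
move=> ng nk b0 c0 a1 b1; have C0 := nice_ge0 ng.
case: ng => dg dg1 bg1 bg2 lg2; case: nk => dk dk1 bk1 bk2 lk2.
have lg := derive_lipschitz dg bg1; have lg1 := derive_lipschitz dg1 bg2.
have lk := derive_lipschitz dk bk1; have lk1 := derive_lipschitz dk1 bk2.
pose A z := g2 (inner z a) * k (inner z b).
pose B z := g1 (inner z a) * k1 (inner z b).
pose D z := g (inner z a) * k2 (inner z b).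
pose P z := g1 (inner z a) * k (inner z b).
pose Q z := g (inner z a) * k1 (inner z b).
exists (fun z => P z * a.1 + Q z * b.1), (fun z => P z * a.2 + Q z * b.2),
  (fun z => (A z * a.1 ^+ 2 + 2 * B z * (a.1 * b.1) + D z * b.1 ^+ 2) / 2),
  (fun z => (A z * (2 * (a.1 * a.2)) + 2 * B z * (a.1 * b.2 + a.2 * b.1) + D z * (2 * (b.1 * b.2))) / 2),
  (fun z => (A z * a.2 ^+ 2 + 2 * B z * (a.2 * b.2) + D z * b.2 ^+ 2) / 2) => z y.
set p := inner y a; set q := inner y b.
pose X s := inner z a + s * p; pose Y s := inner z b + s * q.
have dX (x : R) : is_derive x 1 X p by apply: is_derive_eq; rewrite /GRing.scale /=; ring.
have dY (x : R) : is_derive x 1 Y q by apply: is_derive_eq; rewrite /GRing.scale /=; ring.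
have cX f f1 (d : forall x : R, is_derive x 1 f (f1 x)) (x : R) :
    is_derive x 1 (f \o X) (f1 (X x) * p) := is_derive1_comp (d _) (dX x).
have cY f f1 (d : forall x : R, is_derive x 1 f (f1 x)) (x : R) :
    is_derive x 1 (f \o Y) (f1 (Y x) * q) := is_derive1_comp (d _) (dY x).
pose F s := g (X s) * k (Y s).
pose F1 s := g1 (X s) * p * k (Y s) + g (X s) * (k1 (Y s) * q).
pose F2 s := p ^+ 2 * (g2 (X s) * k (Y s)) + 2 * (p * q) * (g1 (X s) * k1 (Y s)) +
  q ^+ 2 * (g (X s) * k2 (Y s)).
have dF (x : R) : is_derive x 1 F (F1 x).
  have e1 := cX _ _ dg x; have e2 := cY _ _ dk x.
  have := is_deriveM e1 e2; rewrite /F1 /GRing.scale /= => h.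
  by apply: is_derive_eq; ring.
have dF1 (x : R) : is_derive x 1 F1 (F2 x).
  have e1 := cX _ _ dg x; have e2 := cY _ _ dk x.
  have e3 := cX _ _ dg1 x; have e4 := cY _ _ dk1 x.
  have h1 := is_deriveM (is_deriveM e3 (is_derive_cst p x 1)) e2.
  have h2 := is_deriveM e1 (is_deriveM e4 (is_derive_cst q x 1)).
  have h := is_deriveD h1 h2.
  by apply: is_derive_eq; rewrite /F2 /GRing.scale /= !fctE /=; ring.
have := @taylor2 F F1 F2 (8 * C ^+ 2 * cubrem y) dF dF1.
rewrite {1}/F /F1 /F2 /X /Y !mul0r !mul1r !addr0 -!innerDl => h.
rewrite (_ : _ + _ + (_ + _ + _) = F 0 + (g1 (inner z a) * p * k (inner z b) +
   g (inner z a) * (k1 (inner z b) * q)) +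
   (p ^+ 2 * (g2 (inner z a) * k (inner z b)) + 2 * (p * q) * (g1 (inner z a) * k1 (inner z b)) +
    q ^+ 2 * (g (inner z a) * k2 (inner z b))) / 2); last first.
  by rewrite /F /X /Y !mul0r !addr0 /A /B /D /P /Q /p /q /inner; field.
rewrite /F /X /Y !mul0r !addr0 in h *; apply: h => s /andP[s0 s1].
set r := Num.sqrt (sqn y).
have r0 : 0 <= r by exact: sqrtr_ge0.
have pr : `|p| <= r by exact: inner_le_norm.
have qr : `|q| <= r by exact: inner_le_norm.
have lipX f : (forall x y, `|f x - f y| <= C * `|x - y|) ->
    `|f (inner z a + s * p) - f (inner z a)| <= C * r.
  move=> lf; apply: (le_trans (lf _ _)); rewrite addrAC subrr add0r ler_wpM2l//.
  by rewrite normrM ger0_norm// -[leRHS]mul1r ler_pM.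
have lipY f : (forall x y, `|f x - f y| <= C * `|x - y|) ->
    `|f (inner z b + s * q) - f (inner z b)| <= C * r.
  move=> lf; apply: (le_trans (lf _ _)); rewrite addrAC subrr add0r ler_wpM2l//.
  by rewrite normrM ger0_norm// -[leRHS]mul1r ler_pM.
have hA := diff_prod_le C0 r0 (bg2 _) (bg2 _) (c0 _) (c0 _) (lipX _ lg2) (lipY _ lk).
have hB := diff_prod_le C0 r0 (bg1 _) (bg1 _) (bk1 _) (bk1 _) (lipX _ lg1) (lipY _ lk1).
have hD := diff_prod_le C0 r0 (b0 _) (b0 _) (bk2 _) (bk2 _) (lipX _ lg) (lipY _ lk2).
rewrite /cubrem -/r; set m := Num.min 1 r in hA hB hD *.
have m0 : 0 <= m by rewrite le_min ler01.
set dA := _ - _ in hA; set dB := _ - _ in hB; set dD := _ - _ in hD.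
rewrite (_ : _ - _ = p ^+ 2 * dA + 2 * (p * q) * dB + q ^+ 2 * dD); last first.
  by rewrite /dA /dB /dD; ring.
rewrite (le_trans (ler_normD _ _))// (le_trans (lerD (ler_normD _ _) (lexx _)))//.
rewrite !normrM (ger0_norm (_ : 0 <= 2))//.
have rr : r * r = sqn y by rewrite -expr2 sqr_sqrtr ?sqn_ge0.
rewrite -rr (_ : 8 * C ^+ 2 * (r * r * m) = r * r * (2 * C ^+ 2 * m) +
   2 * (r * r) * (2 * C ^+ 2 * m) + r * r * (2 * C ^+ 2 * m)); last by ring.
by rewrite !lerD// !ler_pM ?mulr_ge0// ler_pM.
Qed.

End taylor.

(** * Smooth substitutes for the modulus and the indicator of the positive axis *)

Section test_functions.
Context (R : realType).
Implicit Types (t x y h : R).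

(** Within distance 1 of |t|, with the smoothed sign [sgnm] as derivative; with [wabs] as a second
    variable all higher derivatives are polynomials. *)
Definition sabs t := Num.sqrt (1 + t ^+ 2).
Definition wabs t := (sabs t)^-1.
Definition sgnm t := t * wabs t.

Lemma sabs_sqr t : sabs t ^+ 2 = 1 + t ^+ 2.
Proof. by rewrite sqr_sqrtr// addr_ge0 ?sqr_ge0. Qed.

Lemma sabs_ge1 t : 1 <= sabs t.
Proof. by rewrite -[leLHS](@sqrtr1 R) ler_wsqrtr// lerDl sqr_ge0. Qed.

Lemma sabs_gt0 t : 0 < sabs t. Proof. exact: lt_le_trans ltr01 (sabs_ge1 t). Qed.

Lemma sabs_bounds t : `|t| <= sabs t <= `|t| + 1.
Proof.
apply/andP; split.
  by rewrite -sqrtr_sqr ler_wsqrtr// lerDr.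
rewrite -[leRHS]ger0_norm ?addr_ge0// -sqrtr_sqr ler_wsqrtr//.
by rewrite sqrrD real_normK ?num_real// expr1n mulr1 [leRHS]addrC lerD2l lerDl mulrn_wge0.
Qed.

Lemma wabs_bounds t : 0 < wabs t <= 1.
Proof. by rewrite invr_gt0 sabs_gt0 invf_le1 ?sabs_gt0// sabs_ge1. Qed.

Lemma wabsE t : wabs t ^+ 2 * (1 + t ^+ 2) = 1.
Proof. by rewrite -sabs_sqr -exprMn mulVf ?expr1n// gt_eqF// sabs_gt0. Qed.

Lemma sgnm_bound t : `|sgnm t| <= 1.
Proof.
rewrite normrM [X in _ * X]ger0_norm; last by case/andP: (wabs_bounds t) => /ltW.
by rewrite ler_pdivrMr ?sabs_gt0// mul1r; case/andP: (sabs_bounds t).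
Qed.

Lemma derive_sabs (t : R) : is_derive t 1 sabs (sgnm t).
Proof.
have h0 : 0 < 1 + t ^+ 2 by rewrite ltr_pwDl// sqr_ge0.
have h1 : is_derive t 1 (fun s : R => 1 + s ^+ 2) (2 * t).
  by apply: is_derive_eq; rewrite /GRing.scale /=; ring.
have := @is_derive1_comp _ Num.sqrt (fun s => 1 + s ^+ 2) t _ _ (is_derive1_sqrt h0) h1.
rewrite (_ : _ * _ = sgnm t)//.
by rewrite /sgnm /wabs -/(sabs t); field; rewrite gt_eqF ?sabs_gt0.
Qed.

Lemma derive_wabs (t : R) : is_derive t 1 wabs (- t * wabs t ^+ 3).
Proof.
have s0 : sabs t != 0 by rewrite gt_eqF// sabs_gt0.
have d := derive_sabs t.
have := is_deriveV s0 d.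
rewrite (_ : _ *: _ = - t * wabs t ^+ 3)//.
by rewrite /GRing.scale /= /sgnm /wabs; field.
Qed.

Lemma derive_sgnm (t : R) : is_derive t 1 sgnm (wabs t ^+ 3).
Proof.
have d := derive_wabs t.
apply: is_derive_eq; rewrite /GRing.scale /=.
have e := wabsE t; rewrite -[RHS]mul1r.
transitivity (wabs t * (wabs t ^+ 2 * (1 + t ^+ 2)) - t ^+ 2 * wabs t ^+ 3).
  by rewrite e; ring.
by ring.
Qed.

Lemma derive_wabs3 (t : R) : is_derive t 1 (fun s => wabs s ^+ 3) (- 3 * (sgnm t * wabs t ^+ 4)).
Proof.
have d := derive_wabs t.
by apply: is_derive_eq; rewrite /GRing.scale /= /sgnm; ring.
Qed.

Lemma derive_sgnm_wabs4 (t : R) : is_derive t 1 (fun s => sgnm s * wabs s ^+ 4)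
  (wabs t ^+ 7 - 4 * (sgnm t ^+ 2 * wabs t ^+ 5)).
Proof.
have d := derive_wabs t; have d' := derive_sgnm t.
by apply: is_derive_eq; rewrite /GRing.scale /= /sgnm; ring.
Qed.

Lemma wabsX_bounds t n : 0 <= wabs t ^+ n <= 1.
Proof.
have /andP[/ltW h0 h1] := wabs_bounds t.
by rewrite exprn_ge0//= exprn_ile1.
Qed.

Lemma sgnm_wabs_bound t n : `|sgnm t * wabs t ^+ n| <= 1.
Proof.
have /andP[h0 h1] := wabsX_bounds t n.
by rewrite normrM -[leRHS]mul1r ler_pM ?sgnm_bound// ger0_norm.
Qed.

Lemma nice_sabs : nice 3 sabs sgnm (fun t => wabs t ^+ 3).
Proof.
split; [exact: derive_sabs|exact: derive_sgnm|move=> t|move=> t|].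
- by rewrite (le_trans (sgnm_bound t))// ler1n.
- have /andP[h0 h1] := wabsX_bounds t 3.
  by rewrite ger0_norm// (le_trans h1)// ler1n.
- apply: derive_lipschitz derive_wabs3 _ => t.
  by rewrite normrM normrN -[leRHS]mulr1 ler_pM ?sgnm_wabs_bound// ger0_norm.
Qed.

Definition sstep t := (1 + sgnm t) / 2.

Lemma sstep_ge0 t : 0 <= sstep t.
Proof. by have := sgnm_bound t; rewrite ler_norml /sstep => /andP[h _]; lra. Qed.

Lemma sstep_le1 t : sstep t <= 1.
Proof. by have := sgnm_bound t; rewrite ler_norml /sstep => /andP[_ h]; lra. Qed.

Lemma nice_sstep : nice 8 sstep (fun t => wabs t ^+ 3 / 2)
  (fun t => - (3 / 2) * (sgnm t * wabs t ^+ 4)).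
Proof.
split => [t|t|t|t|].
- have d := derive_sgnm t.
  by apply: is_derive_eq; rewrite /GRing.scale /=; ring.
- have d := derive_wabs3 t.
  by apply: is_derive_eq; rewrite /GRing.scale /=; field.
- have /andP[h0 h1] := wabsX_bounds t 3.
  by rewrite ger0_norm ?divr_ge0//; lra.
- have := sgnm_wabs_bound t 4; rewrite [X in _ -> X <= _]normrM normrN (ger0_norm (_ : 0 <= 3 / 2))//.
  by move: `|_| => u; lra.
- move=> x y; rewrite -mulrBr normrM normrN (ger0_norm (_ : 0 <= 3 / 2))//.
  have h t : `|wabs t ^+ 7 - 4 * (sgnm t ^+ 2 * wabs t ^+ 5)| <= 5.
    rewrite (le_trans (ler_normB _ _))//.
    have -> : `|4 * (sgnm t ^+ 2 * wabs t ^+ 5)| = 4 * `|sgnm t ^+ 2 * wabs t ^+ 5|.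
      by rewrite normrM ger0_norm.
    have /andP[a0 a1] := wabsX_bounds t 7; rewrite (ger0_norm a0).
    have : `|sgnm t ^+ 2 * wabs t ^+ 5| <= 1.
      by rewrite expr2 -mulrA normrM -[leRHS]mul1r ler_pM ?sgnm_bound ?sgnm_wabs_bound.
    by move: `|_| => u; lra.
  have := derive_lipschitz derive_sgnm_wabs4 h x y.
  by move: `|_| `|x - y| (normr_ge0 (x - y)) => u w; lra.
Qed.

(** Sharpening by [a] costs a third power, from the Lipschitz constant of the second derivative. *)
Lemma nice_scale C (g g1 g2 : R -> R) (a : R) : 1 <= a -> nice C g g1 g2 ->
  nice (C * a ^+ 3) (fun t => g (a * t)) (fun t => a * g1 (a * t)) (fun t => a ^+ 2 * g2 (a * t)).
Proof.
move=> a1 ng; have C0 := nice_ge0 ng; case: ng => d1 d2 b1 b2 l2.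
have a0 : 0 <= a by exact: le_trans a1.
have a3 n : (n <= 3)%N -> a ^+ n <= a ^+ 3 by move=> n3; rewrite ler_weXn2l.
have dl (x : R) : is_derive x 1 (fun t => a * t) a.
  by apply: is_derive_eq; rewrite /GRing.scale /=; ring.
split => [t|t|t|t|x y].
- by have := is_derive1_comp (d1 _) (dl t); rewrite mulrC.
- have h := is_derive1_comp (d2 _) (dl t).
  have := is_deriveM (is_derive_cst a t 1) h; rewrite /GRing.scale /= mulr0 addr0.
  by rewrite (_ : a * (_ * a) = a ^+ 2 * g2 (a * t))//; ring.
- by rewrite normrM (ger0_norm a0) [leLHS]mulrC ler_pM// -[leLHS]expr1 a3.
- by rewrite normrM (ger0_norm (exprn_ge0 2 a0)) [leLHS]mulrC ler_pM ?exprn_ge0// a3.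
- rewrite -mulrBr normrM ger0_norm ?exprn_ge0//.
  rewrite (_ : _ * `|x - y| = a ^+ 2 * (C * (a * `|x - y|))); last by ring.
  rewrite ler_wpM2l ?exprn_ge0// (le_trans (l2 _ _))// -mulrBr normrM.
  by rewrite (ger0_norm a0).
Qed.

(** The product (1 - sgnm)(1 + sgnm) is wabs^2 <= t^-2, and one of the factors is at least 1; the
    other is twice the error. *)
Lemma sstep_far t : t != 0 -> `|sstep t - (0 < t)%R%:R| <= t ^- 2.
Proof.
move=> t0.
have e : (1 - sgnm t) * (1 + sgnm t) = wabs t ^+ 2.
  rewrite -[LHS](_ : 1 - sgnm t ^+ 2 = _); last by ring.
  by rewrite -(wabsE t) /sgnm; ring.
have w2 : wabs t ^+ 2 <= t ^- 2.
  have /andP[w0 _] := wabs_bounds t.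
  rewrite -[leRHS]mul1r ler_pdivlMr ?exprn_even_gt0// -(wabsE t).
  by rewrite ler_pM2l ?exprn_gt0// lerDr.
apply: le_trans w2; rewrite -e.
have := sgnm_bound t; rewrite ler_norml /sstep => /andP[s1 s2].
have [tp|tn] := ltP 0 t.
  have sp : 0 <= sgnm t.
    by rewrite /sgnm mulr_ge0 ?ltW//; have /andP[] := wabs_bounds t.
  rewrite /= ler0_norm; last by lra.
  nra.
have sn : sgnm t <= 0.
  by rewrite /sgnm mulr_le0_ge0// ltW//; have /andP[] := wabs_bounds t.
rewrite /= subr0 ger0_norm; last by lra.
nra.
Qed.

End test_functions.

(** * Mean absolute value of simple random walk *)

Section binomial_walk.
Context (R : realType).
Implicit Types (g : nat -> R) (phi : R -> R) (h : R).

(** The mean of [g] under the binomial law with parameters n and 1/2; [j] counts the up-steps, and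
    2j - n is the position of the walk. *)
Definition bavg n g : R := 2^-1 ^+ n * \sum_(j < n.+1) 'C(n, j)%:R * g j.

Lemma bavg0 g : bavg 0 g = g 0%N.
Proof. by rewrite /bavg big_ord_recl big_ord0 expr0 bin0 !mul1r addr0. Qed.

Lemma bavgS n g : bavg n.+1 g = 2^-1 * (bavg n g + bavg n (fun j => g j.+1)).
Proof.
rewrite /bavg exprS -mulrA -mulrDr; congr (_ * (_ * _)).
rewrite big_ord_recl /= bin0.
under eq_bigr do rewrite /bump /= add1n binS natrD mulrDl.
rewrite big_split /= addrA; congr (_ + _).
rewrite [RHS]big_ord_recl bin0; congr (_ + _).
rewrite big_ord_recr /= bin_small// mul0r addr0.
by apply: eq_bigr => i _; rewrite /bump /= add1n.
Qed.

Lemma eq_bavg n g g' : (forall j, (j <= n)%N -> g j = g' j) -> bavg n g = bavg n g'.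
Proof.
move=> gg'; congr (_ * _); apply: eq_bigr => j _; rewrite gg'//.
by rewrite -ltnS.
Qed.

Lemma bavgD n g g' : bavg n (fun j => g j + g' j) = bavg n g + bavg n g'.
Proof.
rewrite /bavg -mulrDr -big_split /=; congr (_ * _).
by apply: eq_bigr => j _; rewrite mulrDr.
Qed.

Lemma bavgZ n c g : bavg n (fun j => c * g j) = c * bavg n g.
Proof.
rewrite /bavg [RHS]mulrCA [c * _]mulr_sumr; congr (_ * _).
by apply: eq_bigr => j _; rewrite mulrCA.
Qed.

Lemma le_bavg n g g' : (forall j, (j <= n)%N -> g j <= g' j) -> bavg n g <= bavg n g'.
Proof.
move=> gg'; rewrite ler_wpM2l ?exprn_ge0 ?invr_ge0//.
by apply: ler_sum => j _; rewrite ler_wpM2l ?gg'// -ltnS.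
Qed.

Lemma bavg1 n : bavg n (fun=> 1) = 1.
Proof.
by elim: n => [|n IH]; rewrite ?bavg0// bavgS IH; field.
Qed.

Lemma iter_rad_bavg h n phi (z : R * R) : iter n (rad h) (fun z => phi z.1) z =
  bavg n (fun j => phi (z.1 + (2 * j%:R - n%:R) * h)).
Proof.
elim: n z => [|n IH] z; first by rewrite bavg0 mulr0 subrr mul0r addr0.
rewrite iterS /rad !IH bavgS /=.
have -> : bavg n (fun j => phi (z.1 + h + (2 * j%:R - n%:R) * h)) =
    bavg n (fun j => phi (z.1 + (2 * j.+1%:R - n.+1%:R) * h)).
  by apply: eq_bavg => j _; congr phi; rewrite -[j.+1%:R]natr1 -[n.+1%:R]natr1; ring.
have -> : bavg n (fun j => phi (z.1 - h + (2 * j%:R - n%:R) * h)) =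
    bavg n (fun j => phi (z.1 + (2 * j%:R - n.+1%:R) * h)).
  by apply: eq_bavg => j _; congr phi; rewrite -[n.+1%:R]natr1; ring.
by field.
Qed.

Definition srw_abs n : R := bavg n (fun j => `|2 * j%:R - n%:R|).

Lemma bavg_delta m n : bavg n (fun j => (j == m)%:R) = 2^-1 ^+ n * 'C(n, m)%:R.
Proof.
rewrite /bavg; congr (_ * _).
have [nm|mn] := ltnP n m.
  rewrite bin_small// big1// => j _; rewrite (_ : (_ == _) = false) ?mulr0//.
  by apply/eqP => jm; move: (ltn_ord j); rewrite jm ltnS leqNgt nm.
rewrite (bigD1 (Ordinal (_ : (m < n.+1)%N)))//= eqxx mulr1 big1 ?addr0// => j jm.
rewrite (_ : (_ == _) = false) ?mulr0//; apply/negbTE; apply: contra jm => /eqP jm.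
by apply/eqP/val_inj.
Qed.

Lemma bin_beta m : 2^-1 ^+ m.*2 * 'C(m.*2, m)%:R = beta R m.
Proof.
elim: m => [|m IH]; first by rewrite bin0 expr0 mul1r.
have e1 : ((m.+1) * 'C(m.*2.+2, m.+1) = m.*2.+2 * 'C(m.*2.+1, m))%N by rewrite mul_bin_diag.
have e2 : (m.+1 * 'C(m.*2.+1, m) = m.*2.+1 * 'C(m.*2, m))%N.
  by rewrite [RHS](mul_bin_down m.*2.+1 m); congr (_ * _)%N; lia.
have e3 : (m.+1%:R * 'C(m.*2.+2, m.+1)%:R = m.*2.+2%:R * 'C(m.*2.+1, m)%:R :> R).
  by rewrite -!natrM e1.
have e4 : (m.+1%:R * 'C(m.*2.+1, m)%:R = m.*2.+1%:R * 'C(m.*2, m)%:R :> R).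
  by rewrite -!natrM e2.
have m0 : m.+1%:R != 0 :> R by rewrite pnatr_eq0.
have e5 : 'C(m.*2.+1, m)%:R = m.*2.+1%:R * 'C(m.*2, m)%:R / m.+1%:R :> R.
  by rewrite -e4 mulrAC divff// mul1r.
have e6 : 'C(m.*2.+2, m.+1)%:R = m.*2.+2%:R * 'C(m.*2.+1, m)%:R / m.+1%:R :> R.
  by rewrite -e3 mulrAC divff// mul1r.
have d1 : m.*2.+1%:R = 2 * m%:R + 1 :> R by rewrite -natr1 -mul2n natrM.
have d2 : m.*2.+2%:R = 2 * m%:R + 2 :> R by rewrite -natr1 d1; ring.
rewrite betaE doubleS e6 e5 -IH 2!exprS d1 d2 -[m.+1%:R]natr1.
by field; rewrite natr1.
Qed.

(** The mean of the modulus changes only from the position 0, and there by 1; at even n this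
    position has probability beta_(n/2). *)
Lemma srw_absS n : srw_abs n.+1 = srw_abs n + (if odd n then 0 else beta R n./2).
Proof.
have e : bavg n (fun j => (2 * j == n)%N%:R) = if odd n then 0 else beta R n./2.
  case: ifPn => on.
    rewrite -[RHS](mul0r (bavg n (fun=> 1))) -bavgZ; apply: eq_bavg => j _; rewrite mul0r.
    rewrite (_ : (_ == _) = false)//; apply/negP => /eqP jn.
    by move: on; rewrite -jn mul2n odd_double.
  rewrite -bin_beta -bavg_delta (even_halfK on).
  apply: eq_bavg => j _; congr (nat_of_bool _)%:R.
  by rewrite -[in LHS](even_halfK on) -mul2n eqn_pmul2l.
rewrite -e -bavgD {1}/srw_abs bavgS -bavgD -bavgZ; apply: eq_bavg => j _.
rewrite -[n.+1%:R]natr1 -[j.+1%:R]natr1.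
have -> : 2 * j%:R - (n%:R + 1) = (2 * j%:R - n%:R) - 1 :> R by ring.
have -> : 2 * (j%:R + 1) - (n%:R + 1) = (2 * j%:R - n%:R) + 1 :> R by ring.
case: eqP => [<-|/eqP jn].
  by rewrite natrM subrr sub0r add0r normrN normr1 normr0 add0r /=; field.
rewrite addr0; case: (ltngtP (2 * j)%N n) jn => // jn _.
  have h : 2 * j%:R + 1 <= n%:R :> R by rewrite -natrM -[1]/(1%:R) -natrD ler_nat addn1.
  rewrite !ler0_norm; [by field|lra..].
have h : n%:R + 1 <= 2 * j%:R :> R by rewrite -natrM -[1]/(1%:R) -natrD ler_nat addn1.
by rewrite !ger0_norm; [by field|lra..].
Qed.

Lemma srw_absE n : srw_abs n = n%:R * beta R n./2.
Proof.
have e : srw_abs 0 = 0 by rewrite /srw_abs bavg0 mulr0 subrr normr0.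
have h m : srw_abs m.*2 = m.*2%:R * beta R m.
  elim: m => [|m IH]; first by rewrite e mul0r.
  rewrite doubleS !srw_absS IH /= odd_double /= addr0 doubleK.
  have := betaS R m; rewrite -[m.*2.+2%:R]natr1 -[m.*2.+1%:R]natr1 -[m.+1%:R]natr1.
  by rewrite -mul2n natrM => b; lra.
case: (boolP (odd n)) => on; last by rewrite -{1 2}(even_halfK on) h.
have {1 2}-> : n = n./2.*2.+1 by rewrite -[LHS]odd_double_half on.
by rewrite srw_absS h odd_double /= doubleK -natr1 mulrDl mul1r.
Qed.

End binomial_walk.

(** * Wallis bounds for the central binomial weights *)

Section wallis.
Context (R : realType).
Implicit Types (t : R).

(** Two consecutive primitives are carried along because the reduction formula goes back two
    exponents. *)
Fixpoint cos_prim2 n t : R * R := if n is n'.+1 then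
  ((cos_prim2 n' t).2, (sin t * cos t ^+ n + n%:R * (cos_prim2 n' t).1) / n.+1%:R)
  else (t, sin t).

(* A primitive of the [n]-th power of the cosine, by the reduction formula. *)
Definition cos_prim n t := (cos_prim2 n t).1.

Lemma cos_prim_rec n t :
  cos_prim n.+2 t = (sin t * cos t ^+ n.+1 + n.+1%:R * cos_prim n t) / n.+2%:R.
Proof. by []. Qed.

Lemma derive_cos_prim n (t : R) : is_derive t 1 (cos_prim n) (cos t ^+ n).
Proof.
suff [] : is_derive t 1 (cos_prim n) (cos t ^+ n) /\
  is_derive t 1 (cos_prim n.+1) (cos t ^+ n.+1) by [].
elim: n => [|n [IH1 IH2]].
  split; first by rewrite expr0; exact: is_derive_id.
  by rewrite expr1; exact: is_derive_sin.
split=> //.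
have -> : cos_prim n.+2 = fun s => (sin s * cos s ^+ n.+1 + n.+1%:R * cos_prim n s) / n.+2%:R.
  by apply/funext.
have ds := is_derive_sin t; have dc := is_derive_cos t.
have dX : is_derive t 1 (fun s => cos s ^+ n.+1) (n.+1%:R * cos t ^+ n * - sin t).
  rewrite (_ : (fun s => cos s ^+ n.+1) = cos ^+ n.+1); last by apply/funext => s; rewrite fctE.
  exact: (is_deriveX n.+1 dc).
apply: is_derive_eq; rewrite /GRing.scale /=.
have s2 : sin t * sin t = 1 - cos t * cos t by rewrite -!expr2 -(cos2Dsin2 t); ring.
have n2 : n.+2%:R != 0 :> R by rewrite pnatr_eq0.
apply: (mulfI n2); move: n2; rewrite -[n.+2%:R]natr1 -[n.+1%:R]natr1 => n2.
rewrite !mulr0 add0r mulrA divff// mul1r.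
set c := cos t in s2 *; set s := sin t in s2 *.
transitivity (- (s * s) * ((n%:R + 1) * c ^+ n) + c * c ^+ n.+1 + (n%:R + 1) * c ^+ n).
  by ring.
by rewrite s2 !exprS; ring.
Qed.

Definition cos_int n : R := cos_prim n (pi / 2).

Lemma cos_intSS n : cos_int n.+2 = n.+1%:R / n.+2%:R * cos_int n.
Proof. by rewrite /cos_int cos_prim_rec cos_pihalf expr0n /= mulr0 add0r mulrAC. Qed.

Lemma cos_prim0 n : cos_prim n 0 = 0.
Proof.
suff [] : cos_prim n 0 = 0 /\ cos_prim n.+1 0 = 0 by [].
elim: n => [|n [IH1 IH2]]; first by rewrite /cos_prim /= sin0.
by split=> //; rewrite cos_prim_rec IH1 sin0 mul0r mulr0 addr0 mul0r.
Qed.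

Lemma cos_int_noninc n : cos_int n.+1 <= cos_int n.
Proof.
have p0 : 0 <= pi / 2 :> R by rewrite divr_ge0// pi_ge0.
have d (t : R) : is_derive t 1 (fun s => cos_prim n s - cos_prim n.+1 s)
    (cos t ^+ n - cos t ^+ n.+1).
  exact: (is_deriveB (derive_cos_prim n t) (derive_cos_prim n.+1 t)).
have [c /andP[c0 c1]] := mean_value d p0.
rewrite !cos_prim0 !subr0 => h; rewrite -subr_ge0 h mulr_ge0//.
have cc : 0 <= cos c by rewrite cos_ge0_pihalf// c1 andbT (le_trans _ c0)// oppr_le0.
by rewrite exprS -{1}[cos c ^+ n]mul1r -mulrBl mulr_ge0 ?exprn_ge0// subr_ge0 cos_le1.
Qed.

Lemma cos_int_even m : cos_int m.*2 = beta R m * (pi / 2).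
Proof.
elim: m => [|m IH]; first by rewrite mul1r.
rewrite doubleS cos_intSS IH betaE -[m.*2.+2%:R]natr1 -[m.*2.+1%:R]natr1 -[m.+1%:R]natr1.
rewrite -mul2n natrM; field.
by rewrite !natr1 -natrM !natr1 !pnatr_eq0.
Qed.

Lemma cos_int_odd m : cos_int m.*2.+1 = ((2 * m%:R + 1) * beta R m)^-1.
Proof.
elim: m => [|m IH].
  by rewrite mulr0 add0r /beta mul1r invr1 /cos_int /cos_prim /= sin_pihalf.
rewrite doubleS cos_intSS IH betaE -[m.*2.+3%:R]natr1 -[m.*2.+2%:R]natr1 -[m.*2.+1%:R]natr1.
rewrite -[m.+1%:R]natr1 -mul2n natrM.
have b0 := beta_gt0 R m; have m0 : 0 <= m%:R :> R by [].
move: (m%:R) (beta R m) b0 m0 => x y y0 x0; field.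
by rewrite !gt_eqF//; lra.
Qed.

(** The integrals with exponents 2m and 2m + 1 are explicit in beta_m and decrease with the
    exponent; the upper bound below compares 2m + 1 with 2m + 2. *)
Lemma beta_wallis_lower m : 2 / (pi * (2 * m%:R + 1)) <= beta R m ^+ 2.
Proof.
have := cos_int_noninc m.*2; rewrite cos_int_odd cos_int_even.
have b0 := beta_gt0 R m; have m0 : 0 <= m%:R :> R by [].
have p0 := pi_gt0 R.
move: (m%:R) (beta R m) b0 m0 => x y y0 x0 h.
have h1 : 0 < (2 * x + 1) * y by rewrite mulr_gt0//; lra.
rewrite -[X in X <= _]mul1r ler_pdivrMr// in h.
rewrite ler_pdivrMr; last by rewrite mulr_gt0//; lra.
rewrite (_ : y ^+ 2 * _ = 2 * (y * (pi / 2) * ((2 * x + 1) * y))); last by field.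
lra.
Qed.

Lemma beta_wallis_upper m : beta R m ^+ 2 <= 2 * (2 * m%:R + 2) / (pi * (2 * m%:R + 1) ^+ 2).
Proof.
have := cos_int_noninc m.*2.+1; rewrite -doubleS cos_int_odd cos_int_even betaE -[m.+1%:R]natr1.
have b0 := beta_gt0 R m; have m0 : 0 <= m%:R :> R by [].
have p0 := pi_gt0 R.
move: (m%:R) (beta R m) b0 m0 => x y y0 x0 h.
have h1 : 0 < (2 * x + 1) * y by rewrite mulr_gt0//; lra.
rewrite -[X in _ <= X]mul1r ler_pdivlMr// in h.
have h2 : 0 < pi * (2 * x + 1) ^+ 2 by rewrite mulr_gt0// exprn_gt0//; lra.
rewrite ler_pdivlMr//.
have h3 : 0 < 2 * (2 * x + 2) by lra.
have e : y * ((x + 2^-1) / (x + 1)) * (pi / 2) * ((2 * x + 1) * y) =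
  y ^+ 2 * (pi * (2 * x + 1) ^+ 2) / (2 * (2 * x + 2)) by field; lra.
by rewrite e ler_pdivrMr// mul1r in h.
Qed.

(** Used with p = pi, x = n, u = 2 floor(n/2) + 1, z = beta_(floor(n/2)) and y = sqrt 2 beta_n;
    likewise for [ratio_lower]. *)
Lemma ratio_upper (p x u z y : R) : 0 < p -> 1 <= x -> x <= u -> 0 < z -> 0 < y ->
  z ^+ 2 <= 2 * (u + 1) / (p * u ^+ 2) -> 4 / (p * (2 * x + 1)) <= y ^+ 2 ->
  z <= (1 + 4 / x) * y.
Proof.
move=> p0 x1 xu z0 y0 hz hy.
have xp : 0 < x by lra. have up : 0 < u by lra.
have c0 : 0 < 1 + 4 / x by rewrite addr_gt0// divr_gt0.
rewrite -(@ler_pXn2r _ 2)// ?nnegrE ?mulr_ge0 ?(ltW c0) ?(ltW y0) ?(ltW z0)// exprMn.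
apply: (le_trans hz); apply: (le_trans _ (ler_wpM2l (sqr_ge0 _) hy)).
have -> : 2 * (u + 1) / (p * u ^+ 2) = p^-1 * (2 * (u^-1 + u^-1 * u^-1)) by field; lra.
have -> : (1 + 4 / x) ^+ 2 * (4 / (p * (2 * x + 1))) =
  p^-1 * (4 * (x + 4) ^+ 2 / (x ^+ 2 * (2 * x + 1))) by field; lra.
rewrite ler_pM2l ?invr_gt0//.
have ux : u^-1 <= x^-1 by rewrite lef_pV2 ?posrE.
have ui : 0 <= u^-1 by rewrite invr_ge0 ltW.
apply: (@le_trans _ _ (2 * (x^-1 + x^-1 * x^-1))).
  by rewrite ler_wpM2l// lerD// ler_pM.
have -> : 2 * (x^-1 + x^-1 * x^-1) = 2 * (x + 1) * (2 * x + 1) / (x ^+ 2 * (2 * x + 1)).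
  by field; lra.
have x2 : 0 < 2 * x + 1 by lra.
by rewrite ler_pM2r ?invr_gt0 ?mulr_gt0//; nra.
Qed.

Lemma ratio_lower (p x u z y : R) : 0 < p -> 1 <= x -> 0 < u <= x + 1 -> 0 < z -> 0 < y ->
  2 / (p * u) <= z ^+ 2 -> y ^+ 2 <= 4 * (2 * x + 2) / (p * (2 * x + 1) ^+ 2) ->
  (1 - 4 / x) * y <= z.
Proof.
move=> p0 x1 /andP[up ux] z0 y0 hz hy.
have xp : 0 < x by lra.
have [c0|c0] := leP (1 - 4 / x) 0; first by nra.
rewrite -(@ler_pXn2r _ 2)// ?nnegrE ?mulr_ge0 ?(ltW c0) ?(ltW y0) ?(ltW z0)// exprMn.
apply: (le_trans _ hz); apply: (le_trans (ler_wpM2l (sqr_ge0 _) hy)).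
apply: (@le_trans _ _ (2 / (p * (x + 1)))); last first.
  rewrite ler_pM2l// lef_pV2 ?posrE ?mulr_gt0//; [by rewrite ler_pM2l|lra].
have -> : (1 - 4 / x) ^+ 2 * (4 * (2 * x + 2) / (p * (2 * x + 1) ^+ 2)) =
  (2 * (x + 1) * (x - 4)) ^+ 2 / (x * (2 * x + 1)) ^+ 2 * (2 / (p * (x + 1))) by field; lra.
rewrite -[leRHS]mul1r ler_wpM2r ?divr_ge0 ?mulr_ge0//; [lra|lra|].
have x4 : 0 < x - 4.
  have : 0 < (1 - 4 / x) * x by rewrite mulr_gt0.
  by rewrite mulrBl mul1r -mulrA mulVf ?mulr1 ?gt_eqF.
rewrite ler_pdivrMr ?mul1r ?exprn_gt0 ?mulr_gt0//; last by lra.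
rewrite ler_pXn2r// ?nnegrE ?mulr_ge0//; [nra|lra..].
Qed.

(** Converts the half index in [srw_absE] into beta_n; the sqrt 2 of the final constant enters
    here. *)
Lemma beta_half n : (0 < n)%N ->
  `|beta R n./2 - Num.sqrt 2 * beta R n| <= 4 / n%:R * (Num.sqrt 2 * beta R n).
Proof.
move=> n0.
have h1 : n%:R <= 2 * (n./2)%:R + 1 :> R.
  rewrite -natrM -[1]/(1%:R) -natrD ler_nat; lia.
have h2 : 2 * (n./2)%:R <= n%:R :> R by rewrite -natrM ler_nat; lia.
have p0 := pi_gt0 R.
have l1 := beta_wallis_lower n./2; have u1 := beta_wallis_upper n./2.
have l2 := beta_wallis_lower n; have u2 := beta_wallis_upper n.
have b1 := beta_gt0 R n./2; have b2 := beta_gt0 R n.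
have y0 : 0 < Num.sqrt 2 * beta R n by rewrite mulr_gt0// sqrtr_gt0.
have yy : (Num.sqrt 2 * beta R n) ^+ 2 = 2 * beta R n ^+ 2 by rewrite exprMn sqr_sqrtr.
have nx : 1 <= n%:R :> R by rewrite ler1n.
have hh : 0 <= (n./2)%:R :> R by [].
have e1 : 2 * (n./2)%:R + 2 = (2 * (n./2)%:R + 1) + 1 :> R by ring.
rewrite e1 in u1.
have up := ratio_upper p0 nx h1 b1 y0 u1.
have lo := @ratio_lower _ _ (2 * (n./2)%:R + 1) _ _ p0 nx _ b1 y0 l1.
have {}up : beta R n./2 <= (1 + 4 / n%:R) * (Num.sqrt 2 * beta R n).
  by apply: up; rewrite yy (_ : 4 / _ = 2 * (2 / (pi * (2 * n%:R + 1)))) ?ler_pM2l//; ring.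
have {}lo : (1 - 4 / n%:R) * (Num.sqrt 2 * beta R n) <= beta R n./2.
  apply: lo; first by lra.
  by rewrite yy (_ : 4 * _ / _ = 2 * (2 * (2 * n%:R + 2) / (pi * (2 * n%:R + 1) ^+ 2))) ?ler_pM2l//; ring.
rewrite ler_norml; rewrite mulrBl mul1r in lo; rewrite mulrDl mul1r in up.
by move: (4 / _ * _) lo up => c lo up; lra.
Qed.

End wallis.

(** Numerical core of [anticoncentration]: [s] and [t] are sqrt n and sqrt m, with s between J t and
    2 J t; [An], [Am], [Anm] are mean absolute values at n, m, n + m, and [p] is the probability of
    a strip. By the last premise m extra steps raise the mean by order t on the strip, while the
    total rise is of order t/J; so p is at most 32/J. *)
Lemma anticoncentration_bound (R : realFieldType) (J s t bn bnm bm u r p eps An Anm Am x y z : R) :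
  s * s = x -> t * t = y -> z = x + y ->
  1 <= J -> 48 / eps <= J -> 0 < eps -> 0 < s -> 0 < t -> t * J <= s -> s <= 2 * (t * J) ->
  0 <= p -> bn * s <= 1 -> 1 <= 2 * (bm * t) -> bnm <= bn -> 0 <= bn -> 0 <= bm ->
  u <= 2 * s -> r * r = 2 -> 0 < r ->
  `|An - r * x * bn| <= (8 * J ^+ 2)^-1 * s ->
  `|Anm - r * z * bnm| <= (8 * J ^+ 2)^-1 * u ->
  `|Am - r * y * bm| <= (8 * J ^+ 2)^-1 * t ->
  (Am - 2 * ((16 * J)^-1 * s)) * p <= Anm - An -> p <= eps.
Proof.
move=> <- <- -> J1 Je e0 s0 t0 tJ sJ p0 b1 b2 b3 bn0 bm0 us r2 r0.
rewrite !ler_norml => /andP[a1 _] /andP[_ a2] /andP[a3 _] key.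
have J0 : 0 < J by lra.
have [g ge] : exists g, g = J^-1 by exists J^-1.
have gJ : g * J = 1 by rewrite ge mulVf ?gt_eqF.
have g0 : 0 < g by rewrite ge invr_gt0.
have g1 : g <= 1 by rewrite ge invf_le1.
have e1 : (8 * J ^+ 2)^-1 = g * g / 8 by rewrite ge; field; rewrite gt_eqF.
have e2 : (16 * J)^-1 = g / 16 by rewrite ge; field; rewrite gt_eqF.
rewrite e1 in a1 a2 a3; rewrite e2 in key.
have rl : 1 <= r by nra.
have ru : r <= 3 / 2 by nra.
have tg : t <= g * s by rewrite -(ler_pM2r J0) mulrAC gJ mul1r.
have sg : g * s <= 2 * t.
  by rewrite -(ler_pM2r J0) mulrAC gJ mul1r -mulrA.
have h1 : r * (s * s + t * t) * bnm <= r * (s * s + t * t) * bn.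
  by rewrite ler_pM2l// mulr_gt0// addr_gt0// mulr_gt0.
have h2 : t * t * bn <= g * g * s.
  have : t * t <= (g * s) * (g * s) by rewrite ler_pM// ltW.
  move/(ler_wpM2r bn0) => /le_trans; apply.
  rewrite (_ : _ * bn = g * g * s * (bn * s)); last by ring.
  by rewrite -[leRHS]mulr1 ler_pM2l// !mulr_gt0.
have h3 : r * (t * t * bn) <= 3 / 2 * (g * g * s).
  rewrite ler_pM// ?mulr_ge0 ?(ltW t0)//; exact: ltW.
have h4 : g * g / 8 * u <= g * g / 8 * (2 * s).
  by rewrite ler_pM2l// divr_gt0// mulr_gt0.
have ggs : 0 <= g * g * s by rewrite !mulr_ge0// ltW.
have up : Anm - An <= 2 * (g * g * s) by lra.
have h5 : t <= 2 * (t * t * bm).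
  by rewrite (_ : 2 * _ = t * (2 * (bm * t))); [rewrite ler_peMr// ltW|ring].
have h6 : t * t * bm <= r * (t * t * bm).
  by rewrite ler_peMl// !mulr_ge0// ltW.
have h7 : g * g / 8 * t <= t / 8.
  have : g * g <= 1 by rewrite -[leRHS]mul1r ler_pM// ltW.
  by move=> /(ler_wpM2r (ltW t0)); lra.
have lo : g * s / 16 <= Am - 2 * (g / 16 * s) by lra.
have gs0 : 0 < g * s by exact: mulr_gt0.
have h8 : g * s / 16 * p <= 2 * (g * g * s).
  by apply: le_trans up; apply: le_trans key; rewrite ler_wpM2r.
have h9 : p <= 32 * g.
  have : (g * s) * (p / 16) <= (g * s) * (2 * g) by lra.
  by rewrite ler_pM2l//; lra.
apply: (le_trans h9); rewrite ler_pdivrMr// in Je.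
have : 48 * g <= g * J * eps by rewrite -mulrA mulrC ler_pM2l// mulrC.
by rewrite gJ mul1r; lra.
Qed.

(** * Mean absolute value and anticoncentration of the isotropic walk *)

Section isotropic_walk.
Context (R : realType) (mu : probability (steps R) R).
Hypothesis mu_iid : iid_law mu.
Hypothesis mu_int1 : mu.-integrable setT (fun x => ((step x 0).1)%:E).
Hypothesis mu_int2 : mu.-integrable setT (fun x => ((step x 0).2)%:E).
Hypothesis mu_mean1 : \int[mu]_x (step x 0).1 = 0.
Hypothesis mu_mean2 : \int[mu]_x (step x 0).2 = 0.
Hypothesis mu_sq : mu.-integrable setT (fun x => (sqn (step x 0))%:E).
Hypothesis mu_var : forall e, sqn e = 1 -> \int[mu]_x (inner (step x 0) e ^+ 2) = 1.
Hypothesis mu_cov : forall e, \int[mu]_x (inner (step x 0) e * inner (step x 0) (perp e)) = 0.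
Implicit Types (v e : R * R) (x : steps R).

Definition absmean n v : R := \int[mu]_x `|inner (psum n x) v|.

Let Rcst (c : R) : \int[mu]_x (cst c x) = c.
Proof. by rewrite Rintegral_cst//= probability_setT mulr1. Qed.

Let icst (c : R) : mu.-integrable setT (EFin \o (cst c : steps R -> R)).
Proof. by apply: (@integrable_bounded _ _ _ _ _ `|c|). Qed.

Let cstD (c : R) f : mu.-integrable setT (EFin \o f) ->
  \int[mu]_x (c + f x) = c + \int[mu]_x f x.
Proof. by move=> fi; rewrite -[X in _ = X + _](Rcst c) -RintegralD//; exact: icst. Qed.

Let iproj n v := integrable_proj mu_iid mu_int1 mu_int2 n v.

Lemma mean_proj n v : \int[mu]_x inner (psum n x) v = 0.
Proof.
have [_ h] := @Rintegral_sum _ _ _ mu n (fun i x => inner (step x i) v)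
  (fun i => integrable_step mu_iid mu_int1 mu_int2 i v).
transitivity (\int[mu]_x (\sum_(i < n) inner (step x i) v)).
  by apply: eq_Rintegral => x _; rewrite inner_sum.
rewrite h big1// => i _.
rewrite -[RHS](mean_step mu_iid mu_int1 mu_int2 mu_mean1 mu_mean2 v).
have := @Rintegral_restep _ _ mu_iid (addn i) (fun x => inner (step x 0) v) (@addnI i).
move=> <-; last by apply: measurable_inner => //; exact: measurable_step.
by apply: eq_Rintegral => x _; rewrite step_restep addn0.
Qed.

Lemma posmean_absmean n v : posmean mu n v = absmean n v / 2.
Proof.
have i1 := integrable_norm (iproj n v).
rewrite -[absmean n v]addr0 -[X in _ + X](mean_proj n v) -RintegralD//.
rewrite mulrC -RintegralZl//; last exact: (integrableD measurableT i1 (iproj n v)).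
apply: eq_Rintegral => x _; rewrite indicE /posev.
have [s0|s0] := ltP 0 (inner (psum n x) v).
  by rewrite mem_set//= mulr1 gtr0_norm//; field.
by rewrite memNset /= ?mulr0 ?ler0_norm ?addNr ?mulr0//; apply/negP; rewrite -leNgt.
Qed.

(** A square equals its second-order Taylor polynomial, so the replacement is exact: it is used with
    constant 0. *)
Lemma lindeberg_sqr n e : (0 < n)%N -> sqn e = 1 ->
  \int[mu]_x (inner (psum n x) e ^+ 2) = n%:R.
Proof.
move=> n0 e1.
pose f (z : R * R) := z.1 ^+ 2.
have sf : smooth 0 f.
  exists (fun z => 2 * z.1), (fun=> 0), (fun=> 1), (fun=> 0), (fun=> 0) => [[z1 z2] [y1 y2]].
  by rewrite [leRHS]mul0r normr_le0 subr_eq0 /f /=; apply/eqP; ring.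
have mf : measurable_fun setT f by apply: measurable_funX; exact: measurable_fst.
have := lindeberg mu_iid mu_int1 mu_int2 mu_mean1 mu_mean2 mu_sq mu_var mu_cov n0 (lexx 0) mf
  (fun z => sqr_ge0 z.1) sf e1.
set h := (Num.sqrt _)^-1.
have h2 : n%:R * h ^+ 2 = 1 by rewrite exprVn sqr_sqrtr// divff// pnatr_eq0 -lt0n.
have it k z : iter k (rad h) f z = z.1 ^+ 2 + k%:R * h ^+ 2.
  elim: k z => [|k IH] z; first by rewrite mul0r addr0.
  by rewrite iterS /rad !IH /= -natr1; field.
rewrite it expr0n/= add0r h2 mul0r normr_le0 subr_eq0 => /eqP E.
transitivity (n%:R * \int[mu]_x f (h *: rot e (psum n x))); last by rewrite E mulr1.
rewrite -RintegralZl//.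
  apply: eq_Rintegral => x _; rewrite /f /= exprMn mulrA h2 mul1r//.
exact: (integrable_smooth_psum mu_iid mu_sq h n (lexx 0) mf sf e1).
Qed.

Lemma absmean_le n e : (0 < n)%N -> sqn e = 1 -> absmean n e <= Num.sqrt n%:R.
Proof.
move=> n0 e1; have s0 : 0 < Num.sqrt n%:R :> R by rewrite sqrtr_gt0 ltr0n.
have ss : Num.sqrt n%:R * Num.sqrt n%:R = n%:R :> R by rewrite -expr2 sqr_sqrtr.
have i1 := integrable_norm (iproj n e).
have i2 : mu.-integrable setT (EFin \o (fun x => inner (psum n x) e ^+ 2)).
  apply: (le_integrable measurableT _ _ (integrable_sqn_psum mu_iid mu_sq n)).
    by apply/measurable_EFinP; apply: measurable_funX; exact: measurable_proj.
  by move=> x _ /=; rewrite lee_fin !ger0_norm ?sqr_ge0 ?sqn_ge0// inner_sqr_le.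
have h : \int[mu]_x (2 * Num.sqrt n%:R * `|inner (psum n x) e|) <=
    \int[mu]_x (inner (psum n x) e ^+ 2 + cst n%:R x).
  apply: le_Rintegral => //.
  - exact: (integrableZl measurableT (2 * Num.sqrt n%:R) i1).
  - exact: (integrableD measurableT i2 (icst _)).
  - move=> x _; rewrite -[inner _ _ ^+ 2]real_normK ?num_real// (_ : cst _ x = Num.sqrt n%:R * Num.sqrt n%:R); last by rewrite ss.
    rewrite -subr_ge0 (_ : _ - _ = (`|inner (psum n x) e| - Num.sqrt n%:R) ^+ 2) ?sqr_ge0//.
    by rewrite /=; ring.
rewrite RintegralZl// RintegralD// Rcst lindeberg_sqr// -/(absmean n e) in h.
by rewrite -(ler_pM2l s0) ss; lra.
Qed.

Lemma absmean_srw (eta : R) : 0 < eta -> exists N, forall n, (N <= n)%N -> forall e, sqn e = 1 ->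
  `|absmean n e - srw_abs R n| <= eta * Num.sqrt n%:R.
Proof.
(* Three errors of size at most 1 occur: the smoothing for either walk and the replacement. Dividing
   by [a] brings them below [eta]; the summand 1 ensures a >= 1. *)
move=> eta0; pose a := 3 / eta + 1.
have a1 : 1 <= a by rewrite lerDr divr_ge0// ltW.
have a0 : 0 < a by exact: lt_le_trans a1.
have na := nice_scale a1 (@nice_sabs R).
have sf := smooth_ridge na; set K := 2 * _ in sf.
have K0 : 0 < K by rewrite !mulr_gt0 ?exprn_gt0.
have mf : measurable_fun setT (fun z : R * R => sabs (a * z.1)).
  apply: (measurableT_comp (continuous_measurable_fun (@sqrt_continuous R))).
  apply: measurable_funD => //; apply: measurable_funX; apply: measurable_funM => //.
have [N HN] := null_lind mu_int1 mu_int2 mu_sq (divr_gt0 ltr01 K0).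
exists N.+1 => n Nn e e1; have n0 : (0 < n)%N by exact: leq_trans Nn.
have := lindeberg mu_iid mu_int1 mu_int2 mu_mean1 mu_mean2 mu_sq mu_var mu_cov n0 (ltW K0) mf
  (fun z => ltW (sabs_gt0 _)) sf e1.
have i1 := integrable_smooth_psum mu_iid mu_sq (Num.sqrt n%:R)^-1 n (ltW K0) mf sf e1.
set h := (Num.sqrt _)^-1 in i1 * => L.
have s0 : 0 < Num.sqrt n%:R :> R by rewrite sqrtr_gt0 ltr0n.
have h0 : 0 < h by rewrite invr_gt0.
have L1 : K * lind mu n <= 1.
  have := HN n (ltnW Nn); rewrite ger0_norm ?lind_ge0// => l.
  by rewrite -ler_pdivlMl// mulrC.
have ah : 0 < a * h by exact: mulr_gt0.
have ahE t : `|a * (h * t)| = a * h * `|t| by rewrite mulrA normrM (gtr0_norm ah).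
pose F x := sabs (a * (h * inner (psum n x) e)).
have E1 : a * h * absmean n e <= \int[mu]_x F x <= a * h * absmean n e + 1.
  have i2 := integrableZl measurableT (a * h) (integrable_norm (iproj n e)).
  have i3 := integrableD measurableT i2 (icst 1).
  have q1 : \int[mu]_x (a * h * `|inner (psum n x) e|) = a * h * absmean n e.
    by rewrite RintegralZl//; exact: integrable_norm (iproj n e).
  rewrite -q1; apply/andP; split.
    by apply: le_Rintegral => // x _; rewrite -ahE; case/andP: (sabs_bounds (a * (h * inner (psum n x) e))).
  rewrite -[X in _ + X](Rcst 1) -RintegralD//.
  by apply: le_Rintegral => // x _; rewrite -ahE; case/andP: (sabs_bounds (a * (h * inner (psum n x) e))).
have E2 : a * h * srw_abs R n <= iter n (rad h) (fun z => sabs (a * z.1)) 0 <= a * h * srw_abs R n + 1.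
  rewrite (iter_rad_bavg h n (fun t => sabs (a * t))) /srw_abs -bavgZ -[X in _ + X](@bavg1 R n) -bavgD.
  apply/andP; split; apply: le_bavg => j _; rewrite add0r [(_ - _) * h]mulrC -ahE;
    by case/andP: (sabs_bounds (a * (h * (2 * j%:R - n%:R)))).
have D : `|a * h * (absmean n e - srw_abs R n)| <= 3.
  have L2 := le_trans L L1; rewrite ler_norml in L2; rewrite ler_norml.
  case/andP: E1 => E11 E12; case/andP: E2 => E21 E22; case/andP: L2 => L3 L4.
  by rewrite mulrBr; apply/andP; split; lra.
rewrite normrM (gtr0_norm ah) in D.
rewrite -(ler_pM2l ah); apply: (le_trans D).
have -> : a * h * (eta * Num.sqrt n%:R) = a * eta * (h * Num.sqrt n%:R) by ring.
rewrite /h mulVf ?gt_eqF// mulr1 /a mulrDl mul1r divfK ?gt_eqF//.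
by rewrite lerDl ltW.
Qed.

(** The b_k of the overview, by [kac_absmean]. *)
Definition kac (v : R * R) k : R := posmean mu k v / k%:R.

Lemma kac_absmean v k : kac v k = absmean k v / (2 * k%:R).
Proof. by rewrite /kac posmean_absmean invfM mulrA. Qed.

Lemma kac_ge0 v k : 0 <= kac v k.
Proof. by rewrite kac_absmean divr_ge0// Rintegral_ge0. Qed.

Lemma kac0 v : kac v 0%N = 0. Proof. by rewrite /kac invr0 mulr0. Qed.

Let half_div_sqrt n : (0 < n)%N -> Num.sqrt n%:R / (2 * n%:R) <= beta R n.
Proof.
move=> n0; have h := sqrt_inv_le_beta R n0.
have s0 : Num.sqrt n%:R != 0 :> R by rewrite gt_eqF// sqrtr_gt0 ltr0n.
have -> : Num.sqrt n%:R / (2 * n%:R) = (Num.sqrt n%:R)^-1 / 2 :> R.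
  by rewrite -[X in _ / (2 * X)](@sqr_sqrtr _ n%:R)//; field.
by lra.
Qed.

Lemma kac_le_beta v k : sqn v = 1 -> kac v k <= beta R k.
Proof.
move=> v1; case: k => [|k]; first by rewrite kac0 ltW// beta_gt0.
rewrite kac_absmean (le_trans _ (half_div_sqrt (ltn0Sn k)))//.
by rewrite ler_wpM2r ?invr_ge0// absmean_le.
Qed.

Lemma kac_asymptotics (eta : R) : 0 < eta -> exists N, forall n, (N <= n)%N ->
  forall e, sqn e = 1 -> `|kac e n - beta R n / Num.sqrt 2| <= eta * beta R n.
Proof.
move=> eta0; have eta20 : 0 < eta / 2 by rewrite divr_gt0.
have [N HN] := absmean_srw eta20.
have [N' HN'] := null_seqZ 8 (@null_seq_inv_sqrt R) eta20.
exists (maxn N N'.+1) => n; rewrite geq_max => /andP[Nn N'n] e e1.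
have n0 : (0 < n)%N by exact: leq_trans N'n.
have nR : 0 < n%:R :> R by rewrite ltr0n.
have b0 := beta_gt0 R n.
have h1 := HN n Nn e e1.
have h2 := beta_half R n0.
have s2 : Num.sqrt 2 * Num.sqrt 2 = 2 :> R by rewrite -expr2 sqr_sqrtr.
have s20 : 0 < Num.sqrt 2 :> R by rewrite sqrtr_gt0.
rewrite kac_absmean.
have -> : beta R n / Num.sqrt 2 = Num.sqrt 2 * beta R n / 2.
  by rewrite -[X in _ = _ / X]s2; field; rewrite gt_eqF.
have a1 : `|absmean n e / (2 * n%:R) - beta R n./2 / 2| <= eta / 2 * beta R n.
  have -> : absmean n e / (2 * n%:R) - beta R n./2 / 2 = (absmean n e - srw_abs R n) / (2 * n%:R).
    by rewrite srw_absE; field; rewrite gt_eqF.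
  rewrite normrM [X in _ * X]ger0_norm ?invr_ge0// ?mulr_ge0//.
  apply: le_trans (ler_wpM2l (ltW eta20) (half_div_sqrt n0)).
  by rewrite mulrA ler_wpM2r// invr_ge0 mulr_ge0.
have a2 : `|beta R n./2 / 2 - Num.sqrt 2 * beta R n / 2| <= eta / 2 * beta R n.
  rewrite -mulrBl normrM [X in _ * X]ger0_norm// ler_pdivrMr//.
  apply: (le_trans h2).
  have q1 : 4 / n%:R <= eta / 2.
    have N'e := HN' N' (leqnn _).
    rewrite ger0_norm in N'e; last by rewrite mulr_ge0// invr_ge0 sqrtr_ge0.
    apply: le_trans N'e.
    have t0 : 0 < Num.sqrt N'.+1%:R :> R by rewrite sqrtr_gt0 ltr0n.
    have tN : Num.sqrt N'.+1%:R <= n%:R :> R.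
      rewrite -[leRHS]ger0_norm// -sqrtr_sqr ler_wsqrtr// -natrX ler_nat.
      by apply: leq_trans N'n _; rewrite -[leqLHS]expn1 leq_pexp2l.
    have : n%:R^-1 <= (Num.sqrt N'.+1%:R)^-1 :> R by rewrite lef_pV2 ?posrE.
    have : 0 <= (Num.sqrt N'.+1%:R)^-1 :> R by rewrite invr_ge0 ltW.
    by move: (n%:R^-1) (_^-1) => x y; lra.
  have q2 : Num.sqrt 2 <= 2 :> R by nra.
  have q3 : 0 <= 4 / n%:R :> R by rewrite divr_ge0.
  rewrite mulrA [leRHS](_ : _ = (eta / 2 * 2) * beta R n); last by ring.
  by rewrite ler_pM2r// ler_pM// ltW.
apply: (le_trans (ler_distD (beta R n./2 / 2) _ _)); apply: (le_trans (lerD a1 a2)).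
by rewrite -mulrDl -splitr.
Qed.

Lemma absmean_asymptotics (eta : R) : 0 < eta -> exists N, forall n, (N <= n)%N ->
  forall e, sqn e = 1 -> `|absmean n e - Num.sqrt 2 * n%:R * beta R n| <= eta * Num.sqrt n%:R.
Proof.
move=> eta0; have eta20 : 0 < eta / 2 by rewrite divr_gt0.
have [N HN] := kac_asymptotics eta20; exists N.+1 => n Nn e e1.
have n0 : (0 < n)%N by exact: leq_trans Nn.
have nR : 0 < n%:R :> R by rewrite ltr0n.
have := HN n (ltnW Nn) e e1.
have s2 : Num.sqrt 2 * Num.sqrt 2 = 2 :> R by rewrite -expr2 sqr_sqrtr.
have s20 : 0 < Num.sqrt 2 :> R by rewrite sqrtr_gt0.
rewrite kac_absmean -(ler_pM2l (_ : 0 < 2 * n%:R)) ?mulr_gt0// => h.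
have n2 : 0 < 2 * n%:R :> R by rewrite mulr_gt0.
rewrite -{1}(gtr0_norm n2) -normrM in h.
have e2 : 2 * n%:R * (absmean n e / (2 * n%:R) - beta R n / Num.sqrt 2) =
    absmean n e - Num.sqrt 2 * n%:R * beta R n.
  have -> : beta R n / Num.sqrt 2 = Num.sqrt 2 * beta R n / 2.
    by rewrite -[X in _ = _ / X]s2; field; rewrite gt_eqF.
  by field; rewrite gt_eqF.
rewrite e2 in h.
apply: (le_trans h).
rewrite [leLHS](_ : _ = eta * (n%:R * beta R n)); last by field.
rewrite ler_pM2l//.
have nn : n%:R = Num.sqrt n%:R * Num.sqrt n%:R :> R by rewrite -expr2 sqr_sqrtr.
have sn : 0 < Num.sqrt n%:R :> R by rewrite sqrtr_gt0.
rewrite [X in X * _]nn -mulrA -[leRHS]mulr1 ler_pM2l//.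
apply: (@le_trans _ _ (Num.sqrt n%:R * (Num.sqrt n.+1%:R)^-1)).
  by rewrite ler_pM2l// beta_le_sqrt.
by rewrite ler_pdivrMr ?sqrtr_gt0// mul1r ler_wsqrtr// ler_nat.
Qed.

(** Given S_n, the mean modulus after m further centred steps is at least |S_n|, and also at least
    [absmean m v] minus |S_n|, moduli being those of the projections. On the strip the second bound
    exceeds |S_n| by at least [absmean m v - 2 * d]. *)
Lemma absmean_split n m v (d : R) :
  (absmean m v - 2 * d) * fine (mu [set x | `|inner (psum n x) v| <= d]) <=
  absmean (n + m) v - absmean n v.
Proof.
pose F (z : steps R * steps R) := `|inner (psum n z.1) v + inner (psum m z.2) v|.
pose A : set (steps R) := [set x | `|inner (psum n x) v| <= d].
have mn k : measurable_fun setT (fun x => inner (psum k x) v) := measurable_proj k v.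
have mA : measurable A.
  rewrite -[X in measurable X]setTI; apply: (measurable_fun_le (f := fun x => `|inner (psum n x) v|)) => //.
  exact: measurableT_comp.
have mF : measurable_fun setT F.
  rewrite /F; apply: measurableT_comp => //; apply: measurable_funD; first exact: (measurableT_comp (mn n) measurable_fst).
  exact: (measurableT_comp (mn m) measurable_snd).
have iF x : mu.-integrable setT (EFin \o (fun y => F (x, y))).
  have h := integrable_norm (integrableD measurableT (icst (inner (psum n x) v)) (iproj m v)).
  exact: h.
have -> : absmean (n + m) v = \int[mu]_x \int[mu]_y F (x, y).
  rewrite -(Rintegral_splice mu_iid (k := n))//.
  - by apply: eq_Rintegral => x _; rewrite /F /= psum_shiftn innerBl addrC subrK.
  - by move=> y x x' xx'; rewrite /F /= (psum_prefix (leqnn n) xx').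
  - by move=> z; exact: normr_ge0.
have mI : measurable_fun setT (fun x => \int[mu]_y F (x, y)).
  apply: (measurableT_comp (@fine_measurable R setT measurableT)).
  apply: (@measurable_fun_fubini_tonelli_F _ _ _ _ _ mu (EFin \o F)).
    exact/measurable_EFinP.
  by move=> z; rewrite lee_fin /F.
have iN k := integrable_norm (iproj k v).
have up x : \int[mu]_y F (x, y) <= `|inner (psum n x) v| + absmean m v.
  rewrite -(cstD _ (iN m)); apply: le_Rintegral => //; first exact: (integrableD measurableT (icst _) (iN m)).
  by move=> y _; exact: ler_normD.
have lo1 x : `|inner (psum n x) v| <= \int[mu]_y F (x, y).
  rewrite -[X in `|X|]addr0 -[X in _ + X](mean_proj m v) -(cstD _ (iproj m v)).
  apply: le_normr_Rintegral => //.
  exact: (integrableD measurableT (icst _) (iproj m v)).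
have lo2 x : absmean m v - `|inner (psum n x) v| <= \int[mu]_y F (x, y).
  rewrite lerBlDr addrC -(cstD _ (iF x)).
  apply: le_Rintegral => //; [exact: (iN m)|exact: (integrableD measurableT (icst _) (iF x))|].
  move=> y _; rewrite /F /=; have := ler_normB (inner (psum n x) v + inner (psum m y) v) (inner (psum n x) v).
  by rewrite addrAC subrr add0r addrC.
have iI : mu.-integrable setT (EFin \o (fun x => \int[mu]_y F (x, y))).
  apply: (le_integrable measurableT _ _ (integrableD measurableT (iN n) (icst (absmean m v)))).
    exact/measurable_EFinP.
  have I0 x : 0 <= \int[mu]_y F (x, y) by apply: Rintegral_ge0 => y _; exact: normr_ge0.
  have S0 x : 0 <= `|inner (psum n x) v| + absmean m v by rewrite addr_ge0// Rintegral_ge0.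
  by move=> x _; rewrite lee_fin /= (ger0_norm (I0 x)) (ger0_norm (S0 x)).
have iA := integrableZl measurableT (absmean m v - 2 * d) (integrable_indic mu mA).
rewrite -Rintegral_indic// -RintegralZl//; last exact: integrable_indic.
rewrite lerBrDr -RintegralD//; last exact: (iN n).
apply: le_Rintegral => //; first exact: (integrableD measurableT iA (iN n)).
move=> x _; rewrite indicE; have [xA|xA] := boolP (x \in A).
  have l2 := lo2 x; rewrite /= mulr1; move: xA; rewrite inE /A/= => xA; lra.
by rewrite /= mulr0 add0r.
Qed.

Lemma anticoncentration (eps : R) : 0 < eps -> exists2 d : R, 0 < d & exists N, forall n,
  (N <= n)%N -> forall v, sqn v = 1 ->
  fine (mu [set x | `|inner (psum n x) v| <= d * Num.sqrt n%:R]) <= eps.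
Proof.
move=> eps0.
pose J := (Num.bound (48 / eps)).+1.
have J48 : 48 / eps <= J%:R.
  rewrite ltW// (lt_trans (archi_boundP _)) ?ltr_nat//.
  by rewrite divr_ge0// ltW.
have JR : 0 < J%:R :> R by rewrite ltr0n.
have JR1 : 1 <= J%:R :> R by rewrite ler1n.
pose eta : R := (8 * J%:R ^+ 2)^-1.
have eta0 : 0 < eta by rewrite invr_gt0 mulr_gt0// exprn_gt0.
have [N HN] := absmean_asymptotics eta0.
exists (16 * J%:R)^-1; first by rewrite invr_gt0 mulr_gt0.
exists ((2 * N.+1) * J ^ 2)%N => n Nn v v1.
(* A stretch of n/J^2 steps: long enough to leave a strip of width sqrt n / (16 J), short enough to
   change E|S_n| little. *)
pose m := (n %/ J ^ 2)%N.
have J2 : (0 < J ^ 2)%N by rewrite expn_gt0.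
have mN : (2 * N.+1 <= m)%N by rewrite /m leq_divRL.
have mn : (m * J ^ 2 <= n)%N by exact: leq_trunc_div.
have nm : (n <= 2 * m * J ^ 2)%N.
  have := ltn_ceil n J2; rewrite -/m => h.
  by apply: leq_trans (ltnW h) _; rewrite leq_mul2r; apply/orP; right; move: mN; clear; lia.
have m0 : (0 < m)%N by exact: leq_trans mN.
have n0 : (0 < n)%N by apply: leq_trans mn; rewrite muln_gt0 m0.
have nN : (N <= n)%N.
  apply: leq_trans mn; apply: leq_trans (leq_pmulr m J2); move: mN; clear; lia.
set s := Num.sqrt n%:R; set t := Num.sqrt m%:R : R.
have s0 : 0 < s by rewrite sqrtr_gt0 ltr0n.
have t0 : 0 < t by rewrite sqrtr_gt0 ltr0n.
have ss : s * s = n%:R by rewrite -expr2 sqr_sqrtr.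
have tt : t * t = m%:R by rewrite -expr2 sqr_sqrtr.
have tJ : t * J%:R <= s.
  rewrite -(@ler_pXn2r _ 2)// ?nnegrE ?mulr_ge0 ?(ltW s0) ?(ltW t0)//.
  by rewrite exprMn !expr2 ss tt -!natrM ler_nat mulnn.
have sJ : s <= 2 * (t * J%:R).
  rewrite -(@ler_pXn2r _ 2)// ?nnegrE ?mulr_ge0 ?(ltW s0) ?(ltW t0)//.
  rewrite !exprMn !expr2 ss tt -!natrM ler_nat mulnn (leq_trans nm)//.
  by rewrite mulnA leq_mul2r leq_mul2r; apply/orP; right; apply/orP; right.
set p := fine _.
have p0 : 0 <= p by rewrite fine_ge0.
have key : (absmean m v - 2 * ((16 * J%:R)^-1 * s)) * p <= absmean (n + m) v - absmean n v.
  exact: absmean_split.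
have a1 := HN n nN v v1.
have a2 := HN (n + m)%N (leq_trans nN (leq_addr _ _)) v v1.
have Nm : (N <= m)%N.
  by apply: leq_trans mN; rewrite mul2n -addnn (leq_trans (leqnSn N))// leq_addr.
have a3 := HN m Nm v v1.
have r22 : Num.sqrt 2 * Num.sqrt 2 = 2 :> R by rewrite -expr2 sqr_sqrtr.
have r20 : 0 < Num.sqrt 2 :> R by rewrite sqrtr_gt0.
have b1 : beta R n * s <= 1.
  rewrite -ler_pdivlMr// mul1r (le_trans (beta_le_sqrt R n))// lef_pV2 ?posrE ?sqrtr_gt0 ?ltr0n//.
  by rewrite ler_wsqrtr// ler_nat.
have b2 : 1 <= 2 * (beta R m * t).
  have := ler_wpM2r (ltW t0) (sqrt_inv_le_beta R m0).
  by rewrite -/t mulVf ?gt_eqF// mulrA.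
have b3 : beta R (n + m) <= beta R n by apply: beta_mono; exact: leq_addr.
have mn' : (m <= n)%N by apply: leq_trans mn; exact: leq_pmulr.
have nmS : Num.sqrt (n + m)%:R <= 2 * s.
  rewrite -[2 * s]ger0_norm ?mulr_ge0 ?(ltW s0)// -sqrtr_sqr ler_wsqrtr//.
  have mnR : m%:R <= n%:R :> R by rewrite ler_nat.
  by rewrite exprMn !expr2 ss natrD; move: mnR (ler0n R n); lra.
have nmE : (n + m)%:R = n%:R + m%:R :> R by rewrite natrD.
exact: (@anticoncentration_bound _ J%:R s t (beta R n) (beta R (n + m)) (beta R m)
  (Num.sqrt (n + m)%:R) (Num.sqrt 2) p eps _ _ _ _ _ _
  ss tt nmE JR1 J48 eps0 s0 t0 tJ sJ p0 b1 b2 b3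
  (ltW (beta_gt0 R _)) (ltW (beta_gt0 R _)) nmS r22 r20 a1 a2 a3 key).
Qed.

End isotropic_walk.

(** * Equidistribution of the direction of the walk *)

Section cones.
Context (R : realType).
Implicit Types (v u w : R * R).

Definition turn (a : R) v : R * R :=
  (cos a * v.1 - sin a * v.2, cos a * v.2 + sin a * v.1).

Lemma sqn_turn a v : sqn (turn a v) = sqn v.
Proof.
transitivity ((cos a ^+ 2 + sin a ^+ 2) * sqn v); last by rewrite cos2Dsin2 mul1r.
by rewrite /turn /sqn /inner /=; ring.
Qed.

(** Counterclockwise of [u] and clockwise of [w]; for an opening angle between 0 and pi this is the
    open sector from [u] to [w]. *)
Definition cone u w : set (R * R) := [set z | 0 < inner z (perp u) /\ inner z (perp w) < 0].

Lemma measurable_lt d (T : measurableType d) (f g : T -> R) :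
  measurable_fun setT f -> measurable_fun setT g -> measurable [set t | f t < g t].
Proof.
move=> mf mg; have := measurable_fun_ltr mf mg measurableT (_ : measurable [set true]).
rewrite setTI (_ : _ @^-1` _ = [set t | f t < g t]); first by apply.
by apply/seteqP; split => t /=.
Qed.

Lemma measurable_cone d (T : measurableType d) (Z : T -> R * R) u w : measurable_fun setT Z ->
  measurable (Z @^-1` cone u w).
Proof.
move=> mZ; have mi v : measurable_fun setT (fun t => inner (Z t) v).
  by apply: measurable_inner => //; exact: measurable_cst.
by apply: measurableI; apply: measurable_lt.
Qed.

Lemma sstep_indic (A d p : R) : 0 < A -> 0 < d ->
  `|sstep (A * p) - (0 < p)%R%:R| <= (`|p| <= d)%R%:R + (A * d) ^- 2.
Proof.
move=> A0 d0; have Ad : 0 <= (A * d) ^- 2 by rewrite invr_ge0 sqr_ge0.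
have [pd|pd] := leP `|p| d.
  rewrite /= ler_wpDr//.
  have := sstep_ge0 (A * p); have := sstep_le1 (A * p).
  by case: (0 < p) => /= h1 h2; rewrite ler_norml; lra.
rewrite /= add0r.
have p0 : p != 0 by rewrite -normr_gt0 (lt_trans d0).
have Ap0 : A * p != 0 by rewrite mulf_neq0// gt_eqF.
have -> : (0 < p) = (0 < A * p) by rewrite pmulr_rgt0.
apply: (le_trans (sstep_far Ap0)).
rewrite lef_pV2 ?posrE ?exprn_even_gt0//; last by rewrite mulf_neq0 ?gt_eqF.
rewrite -[(A * p) ^+ 2]real_normK ?num_real// ler_pXn2r// ?nnegrE ?mulr_ge0 ?(ltW A0) ?(ltW d0)//.
by rewrite normrM (gtr0_norm A0) ler_pM2l// ltW.
Qed.

End cones.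

Section sectors.
Context (R : realType) (mu : probability (steps R) R).
Hypothesis mu_iid : iid_law mu.
Hypothesis mu_int1 : mu.-integrable setT (fun x => ((step x 0).1)%:E).
Hypothesis mu_int2 : mu.-integrable setT (fun x => ((step x 0).2)%:E).
Hypothesis mu_mean1 : \int[mu]_x (step x 0).1 = 0.
Hypothesis mu_mean2 : \int[mu]_x (step x 0).2 = 0.
Hypothesis mu_sq : mu.-integrable setT (fun x => (sqn (step x 0))%:E).
Hypothesis mu_var : forall e, sqn e = 1 -> \int[mu]_x (inner (step x 0) e ^+ 2) = 1.
Hypothesis mu_cov : forall e, \int[mu]_x (inner (step x 0) e * inner (step x 0) (perp e)) = 0.
Implicit Types (v e u w z : R * R) (x : steps R).

Let probI A : measurable A -> \int[mu]_x \1_A x = fine (mu A) := @Rintegral_indic _ _ _ mu A.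

(** The reference value in [lindeberg] does not depend on [e], so both probabilities are close to
    the same number. Smoothing the indicator of a sector costs the probability of strips around its
    two boundary lines, which [anticoncentration] makes small. *)
Lemma sector_prob (a eps : R) : 0 < eps -> exists N, forall n, (N <= n)%N -> forall e e',
  sqn e = 1 -> sqn e' = 1 ->
  `|fine (mu (psum n @^-1` cone e (turn a e))) -
    fine (mu (psum n @^-1` cone e' (turn a e')))| <= eps.
Proof.
move=> eps0; have e16 : 0 < eps / 16 by rewrite divr_gt0.
have [d d0 [N1 HN1]] := anticoncentration mu_iid mu_int1 mu_int2 mu_mean1 mu_mean2 mu_sq mu_var mu_cov e16.
(* Brings (A d)^-2 below eps/16 and keeps A >= 1. *)
pose A := 16 / (eps * d ^+ 2) + 1.
have d2 : 0 < d ^+ 2 by rewrite exprn_gt0.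
have A1 : 1 <= A by rewrite lerDr divr_ge0// mulr_ge0 ?(ltW eps0) ?(ltW d2).
have A0 : 0 < A by exact: lt_le_trans A1.
have Ad : (A * d) ^- 2 <= eps / 16.
  rewrite -[leRHS]invrK lef_pV2 ?posrE ?invr_gt0 ?exprn_gt0 ?mulr_gt0// invf_div.
  rewrite exprMn; apply: (@le_trans _ _ (A * d ^+ 2)).
    have -> : A * d ^+ 2 = 16 / eps + d ^+ 2 by rewrite /A; field; rewrite !gt_eqF.
    by rewrite lerDl ltW.
  by rewrite ler_pM2r// expr2 ler_peMr// ltW.
have na := nice_scale A1 (@nice_sstep R); set C := 8 * A ^+ 3 in na.
have C1 : 1 <= C by rewrite /C; have := exprn_ege1 3 A1; lra.
have bC (x : R) : `|sstep (A * x)| <= C.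
  by rewrite ger0_norm ?sstep_ge0// (le_trans (sstep_le1 _)).
(* In the frame of [v] and [perp v] this is the opposite of [perp (turn a v)]: the second boundary
   line becomes the same for all [v]. *)
pose b : R * R := (sin a, - cos a).
have b1 : sqn b = 1 by rewrite /sqn /inner /= mulrNN -!expr2 addrC cos2Dsin2.
have c1 : sqn (0, 1) = 1 :> R by rewrite /sqn /inner /= !mulr0 add0r mulr1.
have sf := smooth_product na na bC bC c1 b1.
set K := 8 * C ^+ 2 in sf; set f := (fun z : R * R => _) in sf.
have K0 : 0 < K by rewrite mulr_gt0// exprn_gt0// (lt_le_trans ltr01).
have [N2 HN2] := null_lind mu_int1 mu_int2 mu_sq (divr_gt0 e16 K0).
exists (maxn N1 N2).+1 => n Nn e e' e1 e'1.
have n0 : (0 < n)%N by exact: leq_trans Nn.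
have nN1 : (N1 <= n)%N by rewrite (leq_trans (leq_maxl N1 N2))// ltnW.
have nN2 : (N2 <= n)%N by rewrite (leq_trans (leq_maxr N1 N2))// ltnW.
have Kl : K * lind mu n <= eps / 16.
  have := HN2 n nN2; rewrite ger0_norm ?lind_ge0// => l.
  by rewrite -ler_pdivlMl// mulrC.
have ms : measurable_fun setT (@sstep R).
  have [dd _ _ _ _] := @nice_sstep R.
  by apply: continuous_measurable_fun => t; apply: differentiable_continuous;
    apply/derivable1_diffP; exact: (@ex_derive _ _ _ _ _ _ _ (dd t)).
have mf : measurable_fun setT f.
  by apply: measurable_funM; apply: (measurableT_comp ms); apply: measurable_funM => //;
    apply: measurable_inner => //; exact: measurable_cst.
have f0 z : 0 <= f z by rewrite mulr_ge0 ?sstep_ge0.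
set h := (Num.sqrt n%:R)^-1 : R.
have s0 : 0 < Num.sqrt n%:R :> R by rewrite sqrtr_gt0 ltr0n.
have h0 : 0 < h by rewrite invr_gt0.
have main v : sqn v = 1 -> `|iter n (rad h) f 0 - fine (mu (psum n @^-1` cone v (turn a v)))| <= eps / 2.
  move=> v1.
  have L := lindeberg mu_iid mu_int1 mu_int2 mu_mean1 mu_mean2 mu_sq mu_var mu_cov n0 (ltW K0) mf f0 sf v1.
  have i1 := integrable_smooth_psum mu_iid mu_sq h n (ltW K0) mf sf v1.
  have pt1 : sqn (perp (turn a v)) = 1 by rewrite sqn_perp sqn_turn.
  have pv1 : sqn (perp v) = 1 by rewrite sqn_perp.
  have q1 := HN1 n nN1 _ pv1; have q2 := HN1 n nN1 _ pt1.
  have mstrip w : measurable [set x : steps R | `|inner (psum n x) w| <= d * Num.sqrt n%:R].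
    rewrite -[X in measurable X]setTI; apply: measurable_fun_le => //.
    by apply: measurableT_comp => //; exact: measurable_proj.
  have mS := measurable_cone v (turn a v) (@measurable_psum R n).
  set S := _ @^-1` _ in mS *.
  set B1 := [set x | _] in q1; set B2 := [set x | _] in q2.
  have mB1 : measurable B1 by exact: mstrip.
  have mB2 : measurable B2 by exact: mstrip.
  have iB1 := integrable_indic mu mB1; have iB2 := integrable_indic mu mB2.
  have iS := integrable_indic mu mS.
  have ic : mu.-integrable setT (EFin \o (cst (2 * (A * d) ^- 2) : steps R -> R)).
    by apply: (@integrable_bounded _ _ _ _ _ `|2 * (A * d) ^- 2|).
  have D : `|\int[mu]_x f (h *: rot v (psum n x)) - fine (mu S)| <=
      fine (mu B1) + fine (mu B2) + 2 * (A * d) ^- 2.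
    rewrite -!probI// -RintegralB//.
    have iD := integrableB measurableT i1 iS.
    apply: (le_trans (le_normr_Rintegral measurableT iD)).
    have i12 := integrableD measurableT iB1 iB2.
    have <- : \int[mu]_x (\1_B1 x + \1_B2 x + cst (2 * (A * d) ^- 2) x) =
        \int[mu]_x \1_B1 x + \int[mu]_x \1_B2 x + 2 * (A * d) ^- 2.
      by rewrite RintegralD// RintegralD// Rintegral_cst//= probability_setT mulr1.
    apply: le_Rintegral => //; first exact: (integrable_norm iD).
      exact: (integrableD measurableT i12 ic).
    move=> x _; rewrite /f.
    set p := h * inner (psum n x) (perp v).
    set q := - (h * inner (psum n x) (perp (turn a v))).
    have -> : inner (h *: rot v (psum n x)) (0, 1) = p.
      by rewrite /p /rot /inner /GRing.scale /= mulr0 add0r mulr1.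
    have -> : inner (h *: rot v (psum n x)) b = q.
      by rewrite /q /b /rot /turn /inner /perp /GRing.scale /= /GRing.scale /=; ring.
    have p1 : (0 < p) = (0 < inner (psum n x) (perp v)) by rewrite /p pmulr_rgt0.
    have q3 : (0 < q) = (inner (psum n x) (perp (turn a v)) < 0).
      by rewrite /q -mulrN pmulr_rgt0// oppr_gt0.
    have eB w : `|h * inner (psum n x) w| <= d = (`|inner (psum n x) w| <= d * Num.sqrt n%:R).
      by rewrite normrM (gtr0_norm h0) /h mulrC ler_pdivrMr.
    have -> : \1_S x = (0 < p)%R%:R * (0 < q)%R%:R :> R.
      rewrite -natrM mulnb indicE; congr (nat_of_bool _)%:R.
      by apply/idP/andP; rewrite inE /S /cone /= p1 q3.
    have -> : \1_B1 x = (`|p| <= d)%R%:R :> R.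
      rewrite indicE; congr (nat_of_bool _)%:R.
      by rewrite /p eB; apply/idP/idP; rewrite inE.
    have -> : \1_B2 x = (`|q| <= d)%R%:R :> R.
      rewrite indicE; congr (nat_of_bool _)%:R.
      by rewrite /q normrN eB; apply/idP/idP; rewrite inE.
    have hp := sstep_indic p A0 d0; have hq := sstep_indic q A0 d0.
    have sp0 := sstep_ge0 (A * p); have sp1 := sstep_le1 (A * p).
    rewrite [leLHS](_ : _ = `|(sstep (A * p) - (0 < p)%R%:R) * (0 < q)%R%:R +
       sstep (A * p) * (sstep (A * q) - (0 < q)%R%:R)|); last by congr `|_|; ring.
    apply: (le_trans (ler_normD _ _)).
    rewrite [leRHS](_ : _ = (`|p| <= d)%R%:R + (A * d) ^- 2 + ((`|q| <= d)%R%:R + (A * d) ^- 2)); last first.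
      by rewrite /=; ring.
    apply: lerD; rewrite normrM.
      by apply: le_trans hp; rewrite ler_piMr//; case: (0 < q); rewrite ?normr1 ?normr0.
    by apply: le_trans hq; rewrite ler_piMl// ger0_norm.
  move: L D; rewrite -/h; move: (\int[mu]_x _) (iter _ _ _ _) (fine (mu S)) => X Y Z L D.
  apply: (le_trans (ler_distD X _ _)); rewrite distrC.
  lra.
rewrite (splitr eps); apply: (le_trans (ler_distD (iter n (rad h) f 0) _ _)).
by rewrite lerD ?main// distrC main.
Qed.

End sectors.

(** * Polar angles and equal sectors *)

Section circle.
Context (R : realType).
Implicit Types (t s r : R) (z u w : R * R).

Definition circ t : R * R := (cos t, sin t).

Lemma sqn_circ t : sqn (circ t) = 1.
Proof. by rewrite /sqn /inner /= -!expr2 cos2Dsin2. Qed.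

Lemma inner_circ t s : inner (circ t) (perp (circ s)) = sin (t - s).
Proof. by rewrite /inner /perp /= sinB; ring. Qed.

Lemma innerZl r u w : inner (r *: u) w = r * inner u w.
Proof. by rewrite innerC innerZr innerC. Qed.

Lemma turn_circ a t : turn a (circ t) = circ (t + a).
Proof. by congr pair; rewrite /= ?cosD ?sinD; ring. Qed.

Lemma polar z : z != 0 -> exists r t, [/\ 0 < r, 0 <= t < 2 * pi & z = r *: circ t].
Proof.
have pi0 := pi_gt0 R.
move=> z0; have s0 := sqn_gt0 z0; set r := Num.sqrt (sqn z).
have r0 : 0 < r by rewrite sqrtr_gt0.
have rr : r ^+ 2 = z.1 ^+ 2 + z.2 ^+ 2 by rewrite sqr_sqrtr ?sqn_ge0// /sqn /inner !expr2.
have c1 : (z.1 / r) ^+ 2 + (z.2 / r) ^+ 2 = 1.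
  by rewrite !exprMn -mulrDl -rr -exprMn divff ?expr1n// gt_eqF.
have cb : -1 <= z.1 / r <= 1.
  have : (z.1 / r) ^+ 2 <= 1 by rewrite -c1 lerDl sqr_ge0.
  by rewrite -ler_norml -{1}(expr1n R 2) -[X in X <= _ -> _]real_normK ?num_real// ler_pXn2r ?nnegrE.
have ca : cos (acos (z.1 / r)) = z.1 / r by rewrite acosK// in_itv.
have sa : sin (acos (z.1 / r)) = `|z.2 / r|.
  by rewrite sin_acos// -c1 addrAC subrr add0r sqrtr_sqr.
have a0 := acos_ge0 cb; have a1 := acos_lepi cb.
have zE t : cos t = z.1 / r -> sin t = z.2 / r -> z = r *: circ t.
  move=> ct st; rewrite /circ ct st [LHS]surjective_pairing.
  by congr pair; rewrite /GRing.scale /= /GRing.scale /=; field; rewrite gt_eqF.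
have [z20|z20] := leP 0 (z.2 / r).
  exists r, (acos (z.1 / r)); split=> //; first by rewrite a0 /=; lra.
  by apply: zE => //; rewrite sa ger0_norm.
have aN0 : acos (z.1 / r) != 0.
  apply/eqP => e; move: sa; rewrite e sin0 => /esym/eqP.
  by rewrite normr_eq0 lt_eqF.
have a0' : 0 < acos (z.1 / r) by rewrite lt_neqAle eq_sym aN0.
exists r, (2 * pi - acos (z.1 / r)); split=> //; first by apply/andP; split; lra.
have p2 : 2 * pi = pi *+ 2 :> R by rewrite mulr_natl.
apply: zE; first by rewrite p2 cosB cos2pi sin2pi ca; ring.
by rewrite p2 sinB cos2pi sin2pi sa ltr0_norm//; ring.
Qed.

Lemma sin_gt0_lt s : 0 <= s < 2 * pi -> 0 < sin s -> 0 < s < pi.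
Proof.
have pi0 := pi_gt0 R.
move=> /andP[s0 s2] ss; apply/andP; split.
  by rewrite lt_neqAle s0 andbT; apply: contraTneq ss => <-; rewrite sin0 ltxx.
rewrite ltNge; apply: contraTN ss => ps; rewrite -leNgt.
have := @sin_ge0_pi R (s - pi); rewrite sinB sinpi cospi => h.
have /h : 0 <= s - pi <= pi by apply/andP; split; lra.
lra.
Qed.

(** Angles live in [0, 2 pi), and s + a <= 2 pi keeps the sector from crossing the cut; an angle t
    below s is excluded by adding a full turn. *)
Lemma cone_circ a s t r : 0 < a < pi -> 0 <= s -> s + a <= 2 * pi -> 0 <= t < 2 * pi -> 0 < r ->
  cone (circ s) (circ (s + a)) (r *: circ t) <-> s < t < s + a.
Proof.
have pi0 := pi_gt0 R.
move=> /andP[a0 ap] s0 sa /andP[t0 t2] r0.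
rewrite /cone /= !innerZl !inner_circ pmulr_rgt0// pmulr_rlt0//; split; last first.
  move=> /andP[st ts]; split; first by rewrite sin_gt0_pi//; lra.
  rewrite -oppr_gt0 -sinN sin_gt0_pi//; lra.
case=> h1 h2.
have red q : 0 <= q < 2 * pi -> 0 < sin q -> sin (q - a) < 0 -> 0 < q < a.
  move=> qb q1 q2; have /andP[q0 qp] := sin_gt0_lt qb q1; rewrite q0 /=.
  rewrite ltNge; apply: contraTN q2 => aq; rewrite -leNgt sin_ge0_pi//; lra.
have [st|st] := leP s t.
  have := red (t - s); rewrite -addrA -opprD => /(_ _ h1 h2) h.
  have /h : 0 <= t - s < 2 * pi by lra.
  lra.
have e1 : sin (t - s + 2 * pi) = sin (t - s) by rewrite mulr_natl sinD2pi.
have e2 : sin (t - s + 2 * pi - a) = sin (t - (s + a)).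
  by rewrite (_ : _ - a = t - (s + a) + 2 * pi); [rewrite mulr_natl sinD2pi|ring].
have := red (t - s + 2 * pi); rewrite e1 e2 => /(_ _ h1 h2) h.
have /h : 0 <= t - s + 2 * pi < 2 * pi by lra.
lra.
Qed.

Variable N : nat.
Hypothesis N3 : (2 < N)%N.

(** With at least three arcs each is shorter than pi, as [cone_circ] requires. *)
Definition arc : R := 2 * pi / N%:R.
Definition theta j : R := j%:R * arc.
Definition sector j := cone (circ (theta j)) (circ (theta j.+1)).

Let NR : 0 < N%:R :> R. Proof. by rewrite ltr0n; apply: leq_trans N3. Qed.

Lemma arc_bounds : 0 < arc < pi.
Proof.
have pi0 := pi_gt0 R.
rewrite divr_gt0 ?mulr_gt0//= ltr_pdivrMr// mulrC ltr_pM2l//.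
by rewrite -[2]/(2%:R) ltr_nat.
Qed.

Lemma thetaS j : theta j.+1 = theta j + arc.
Proof. by rewrite /theta -natr1 mulrDl mul1r. Qed.

Lemma thetaN : theta N = 2 * pi.
Proof. by rewrite /theta /arc mulrC divfK// gt_eqF. Qed.

Lemma theta_le i j : (i <= j)%N -> theta i <= theta j.
Proof. by move=> ij; rewrite ler_wpM2r ?ler_nat//; have /andP[/ltW] := arc_bounds. Qed.

Lemma theta_ge0 j : 0 <= theta j.
Proof. by rewrite mulr_ge0//; have /andP[/ltW] := arc_bounds. Qed.

Lemma theta_cover n t : 0 <= t < theta n -> exists2 j, (j < n)%N & theta j <= t < theta j.+1.
Proof.
elim: n => [|n IH]; first by rewrite /theta mul0r => /andP[h1 h2]; have := le_lt_trans h1 h2; rewrite ltxx.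
move=> /andP[t0 tn]; have [h|h] := ltP t (theta n); last by exists n => //; rewrite h.
by have [|j jn jt] := IH; [rewrite t0|exists j => //; exact: ltnW].
Qed.

Lemma sector_circ j t r : (j < N)%N -> 0 <= t < 2 * pi -> 0 < r ->
  sector j (r *: circ t) <-> theta j < t < theta j.+1.
Proof.
move=> jN t2 r0; rewrite /sector thetaS.
apply: cone_circ => //; [exact: arc_bounds|exact: theta_ge0|].
by rewrite -thetaS -thetaN theta_le.
Qed.

Lemma sector_sum_circ t r : 0 <= t < 2 * pi -> 0 < r -> (forall j, (j < N)%N -> t != theta j) ->
  \sum_(j < N) \1_(sector j) (r *: circ t) = 1 :> R.
Proof.
move=> t2 r0 tn.
have [|j jN jt] := @theta_cover N t; first by rewrite thetaN.
have jt' : theta j < t < theta j.+1.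
  by move/andP: jt => [h1 ->]; rewrite andbT lt_neqAle h1 andbT eq_sym tn.
rewrite (bigD1 (Ordinal jN))//= big1 ?addr0.
  by rewrite indicE mem_set//; apply/sector_circ.
move=> i ij; rewrite indicE memNset// => /(sector_circ (ltn_ord i) t2 r0) /andP[h1 h2].
move: ij; rewrite -val_eqE /= neq_ltn => /orP[ij|ji].
  have := theta_le ij; move/andP: jt' => []; lra.
have := theta_le ji; move/andP: jt' => []; lra.
Qed.

Lemma sector_sum z : (forall j, (j < N)%N -> inner z (perp (circ (theta j))) != 0) ->
  \sum_(j < N) \1_(sector j) z = 1 :> R.
Proof.
move=> zn; have N0 : (0 < N)%N by exact: leq_trans N3.
have z0 : z != 0 by apply: contraNneq (zn 0%N N0) => ->; rewrite inner0l.
have [r [t [r0 t2 zE]]] := polar z0.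
rewrite zE; apply: sector_sum_circ => // j jN.
by apply: contraNneq (zn j jN) => e; rewrite zE innerZl inner_circ e subrr sin0 mulr0.
Qed.

(** One estimate for two applications: [Z] is S_n under the law of the walk, and then the point of
    the circle at a uniform angle. *)
Variables (d : measure_display) (T : measurableType d) (P : probability T R) (Z : T -> R * R).
Hypothesis mZ : measurable_fun setT Z.
Hypothesis ae_sum : {ae P, forall x, \sum_(j < N) \1_(Z @^-1` sector j) x = 1 :> R}.
Variables (G : R * R -> R) (C omega : R).
Hypothesis mG : measurable_fun setT (fun x => G (Z x)).
Hypothesis GC : forall z, `|G z| <= C.
Hypothesis GZ : forall r z, 0 < r -> G (r *: z) = G z.
Hypothesis Gosc : forall j t, (j < N)%N -> theta j <= t <= theta j.+1 ->
  `|G (circ t) - G (circ (theta j))| <= omega.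

Let S j := Z @^-1` sector j.
Let mS j : measurable (S j). Proof. exact: measurable_cone. Qed.
Let pS j := fine (P (S j)).

Lemma sector_prob_sum : \sum_(j < N) pS j = 1.
Proof.
rewrite (sum_prob_ae (B := setT))//; first by rewrite probability_setT.
by apply: filterS ae_sum => x ->; rewrite indicT.
Qed.

Let S_osc x j : (j < N)%N -> Z x != 0 -> S j x -> `|G (Z x) - G (circ (theta j))| <= omega.
Proof.
move=> jN z0; have [r [t [r0 t2 zE]]] := polar z0.
rewrite /S /= zE => /(sector_circ jN t2 r0) /andP[h1 h2].
by rewrite GZ// Gosc// (ltW h1) ltW.
Qed.

Let S_neq0 x j : S j x -> Z x != 0.
Proof. by case=> h _; apply: contraTneq h => ->; rewrite inner0l ltxx. Qed.

Lemma sector_mean :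
  `|\int[P]_x G (Z x) - \sum_(j < N) G (circ (theta j)) * pS j| <= omega.
Proof.
pose Gj j := G (circ (theta j)).
have C0 : 0 <= C by exact: le_trans (GC 0).
have iG : P.-integrable setT (EFin \o (fun x => G (Z x))) by exact: integrable_bounded.
have iS j : P.-integrable setT (EFin \o (\1_(S j) : T -> R)) by exact: integrable_indic.
have iGS j : P.-integrable setT (EFin \o (fun x => Gj j * \1_(S j) x)).
  exact: (integrableZl measurableT (Gj j) (iS j)).
have [j1 j2] := Rintegral_sum N iGS.
have <- : \int[P]_x (\sum_(j < N) Gj j * \1_(S j) x) = \sum_(j < N) Gj j * pS j.
  rewrite j2; apply: eq_bigr => j _; by rewrite RintegralZl// Rintegral_indic.
rewrite -RintegralB//.
pose H x := \sum_(j < N) \1_(S j) x * (G (Z x) - Gj j).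
have iH1 j : P.-integrable setT (EFin \o (fun x => \1_(S j) x * (G (Z x) - Gj j))).
  apply: (@integrable_bounded _ _ _ _ _ (C + C)).
    by apply: measurable_funM; [exact: measurable_indic|apply: measurable_funB].
  move=> x; rewrite normrM -[leRHS]mul1r ler_pM//.
    by rewrite indicE; case: (_ \in _); rewrite ?normr1 ?normr0.
  by rewrite (le_trans (ler_normB _ _))// lerD// GC.
have [iH _] := Rintegral_sum N iH1.
have -> : \int[P]_x (G (Z x) - \sum_(j < N) Gj j * \1_(S j) x) = \int[P]_x H x.
  apply: ae_eq_Rintegral.
  - by apply/measurable_EFinP; exact: (measurable_int P (integrableB measurableT iG j1)).
  - by apply/measurable_EFinP; exact: (measurable_int P iH).
  apply: filterS ae_sum => x hx; rewrite -[G (Z x)]mul1r -hx mulr_suml -sumrB.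
  by apply: eq_bigr => j _; rewrite mulrBr [\1_(S j) x * Gj j]mulrC.
apply: (le_trans (le_normr_Rintegral measurableT iH)).
have [k1 k2] := Rintegral_sum N iS.
have k3 := integrableZl measurableT omega k1.
have kE : \int[P]_x (omega * \sum_(j < N) \1_(S j) x) = omega.
  rewrite RintegralZl// k2 -[RHS]mulr1 -[in RHS]sector_prob_sum; congr (_ * _).
  by apply: eq_bigr => j _; rewrite Rintegral_indic.
rewrite -[leRHS]kE; apply: le_Rintegral => //; first exact: integrable_norm.
move=> x _; rewrite mulr_sumr (le_trans (ler_norm_sum _ _ _))//; apply: ler_sum => j _.
rewrite indicE; have [xS|xS] := boolP (x \in S j); last by rewrite mul0r normr0 mulr0.
move: xS; rewrite inE mul1r mulr1 => xS; exact: S_osc (ltn_ord j) (S_neq0 xS) xS.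
Qed.

(** The sector probabilities sum to 1, so a common approximate value [p] is itself within [delta] of
    1/N; the mean of [G] is then close to a Riemann sum. *)
Lemma sector_mean_equidistributed (p delta : R) :
  (forall j, (j < N)%N -> `|pS j - p| <= delta) ->
  `|\int[P]_x G (Z x) - N%:R^-1 * \sum_(j < N) G (circ (theta j))| <= omega + C * (N%:R * (delta + delta)).
Proof.
move=> hp.
have hN : `|1 - N%:R * p| <= N%:R * delta.
  rewrite -{1}sector_prob_sum [N%:R * p](_ : _ = \sum_(j < N) p); last first.
    by rewrite sumr_const card_ord mulr_natl.
  rewrite -sumrB (le_trans (ler_norm_sum _ _ _))//.
  rewrite [leRHS](_ : _ = \sum_(j < N) delta); last by rewrite sumr_const card_ord mulr_natl.
  by apply: ler_sum => j _; exact: hp.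
have hp' : `|N%:R^-1 - p| <= delta.
  rewrite -(ler_pM2l NR) -{1}(gtr0_norm NR) -normrM mulrBr divff ?gt_eqF//.
apply: (le_trans (ler_distD (\sum_(j < N) G (circ (theta j)) * pS j) _ _)).
rewrite lerD ?sector_mean// mulr_sumr -sumrB (le_trans (ler_norm_sum _ _ _))//.
rewrite [leRHS](_ : _ = \sum_(j < N) C * (delta + delta)); last first.
  by rewrite sumr_const card_ord -[RHS]mulr_natl mulrCA.
apply: ler_sum => j _; rewrite [_^-1 * _]mulrC -mulrBr normrM ler_pM//.
by rewrite (le_trans (ler_distD p _ _))// lerD ?hp// distrC.
Qed.

End circle.

Section uniform_angle.
Context (R : realType).
Implicit Types (t s : R).

Let unif : probability (measurableTypeR R) R := uniform_prob (@twopi_gt0 R).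

Lemma uniform_angleE A : measurable A ->
  unif A = (((2 * pi)^-1)%R%:E * lebesgue_measure (A `&` `[0%R, (2 * pi)%R]%classic))%E.
Proof.
move=> mA; rewrite /unif /= /uniform_prob integral_uniform_pdf.
rewrite (eq_integral (fun=> (2 * pi)^-1%:E)); last first.
  move=> x; rewrite inE => -[_]; rewrite /= in_itv /= /uniform_pdf => ->.
  by rewrite subr0.
by rewrite integral_cst//; exact: measurableI.
Qed.

Lemma measurable_circ : measurable_fun setT (@circ R).
Proof.
by apply: measurable_fun_pair; apply: continuous_measurable_fun; [exact: continuous_cos|exact: continuous_sin].
Qed.

Variable N : nat.
Hypothesis N3 : (2 < N)%N.

Lemma uniform_angle_sector j : (j < N)%N -> fine (unif (@circ R @^-1` sector N j)) = N%:R^-1.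
Proof.
move=> jN; have pi0 := pi_gt0 R; have NR : 0 < N%:R :> R by rewrite ltr0n (leq_trans _ N3).
rewrite uniform_angleE; last exact: measurable_cone measurable_circ.
have -> : @circ R @^-1` sector N j `&` `[0, 2 * pi] = `]theta R N j, theta R N j.+1[%classic.
  apply/seteqP; split => t; rewrite /= !in_itv/=.
    (* The closed interval also contains the angle 2 pi, the same point as the angle 0, which lies
       in no open sector. *)
    move=> [ts /andP[t0 t2]]; move: t2; rewrite le_eqVlt => /orP[/eqP te|t2].
      have := @sector_circ R N N3 j 0 1 jN; rewrite lexx mulr_gt0//= ltr01 => /(_ isT isT).
      have c0 : circ 0 = circ t by rewrite te /circ mulr_natl cos2pi sin2pi cos0 sin0.
      rewrite scale1r c0 => -[h _].
      by have := h ts; rewrite ltNge theta_ge0.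
    have := @sector_circ R N N3 j t 1 jN; rewrite t0 t2 ltr01 scale1r => /(_ isT isT) [h _].
    exact: h.
  move=> /andP[h1 h2].
  have t0 : 0 <= t by rewrite ltW// (le_lt_trans (theta_ge0 R N3 j)).
  have t2 : t < 2 * pi by rewrite -(thetaN R N3) (lt_le_trans h2)// theta_le.
  split; last by rewrite t0 ltW.
  have := @sector_circ R N N3 j t 1 jN; rewrite t0 t2 ltr01 scale1r => /(_ isT isT) [_ h].
  by apply: h; rewrite h1.
rewrite lebesgue_measure_itv/= lte_fin thetaS ltrDl.
have /andP[a0 _] := arc_bounds R N3; rewrite a0 -EFinD -EFinM /=.
by rewrite addrAC subrr add0r /arc mulrA mulVf ?mul1r// gt_eqF// mulr_gt0.
Qed.

Lemma uniform_angle_sum : {ae unif, forall t, \sum_(j < N) \1_(@circ R @^-1` sector N j) t = 1 :> R}.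
Proof.
pose Z := [set t | (exists2 j, (j <= N)%N & t = theta R N j)] `|` ~` `[0, 2 * pi]%classic.
have cZ : countable [set t | exists2 j, (j <= N)%N & t = theta R N j].
  apply: (@sub_countable _ _ _ (range (theta R N))).
    by apply: subset_card_le => t [j _ ->]; exists j.
  exact: card_image_le.
have mF : measurable [set t | exists2 j, (j <= N)%N & t = theta R N j].
  exact: countable_measurable.
have mZ : measurable Z.
  by apply: measurableU => //; apply: measurableC; exact: measurable_itv.
exists Z; split => //.
  rewrite uniform_angleE// /Z setIUl setICl setU0.
  rewrite (_ : lebesgue_measure _ = 0%E) ?mule0//.
  apply: countable_lebesgue_measure0.
  by apply: sub_countable cZ; apply: subset_card_le; exact: subIsetl.
move=> t /= h; apply: contrapT => /not_orP [tn /contrapT].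
rewrite /= in_itv /= => /andP[t0 t2]; apply: h.
have tj j : (j <= N)%N -> t != theta R N j.
  by move=> jN; apply/eqP => e; apply: tn; exists j.
have := @sector_sum_circ R N N3 t 1; rewrite scale1r; apply => //.
  rewrite t0 lt_neqAle t2 andbT -(thetaN R N3); exact: tj.
by move=> j jN; apply: tj; exact: ltnW.
Qed.

End uniform_angle.

Section modulus.
Context (R : realType).

(** Uniform continuity on [0, 2 pi], by compactness in its near-covering form, evaluated at the
    division points. *)
Lemma uniform_modulus (g : R -> R) (omega : R) : continuous g -> 0 < omega ->
  exists N0, forall N, (N0 <= N)%N -> (2 < N)%N -> forall j t, (j < N)%N ->
  theta R N j <= t <= theta R N j.+1 -> `|g t - g (theta R N j)| <= omega.
Proof.
move=> cg o0; have pi0 := pi_gt0 R.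
pose P N s := forall t, `|t - s| <= arc R N -> `|g t - g s| <= omega.
have o2 : 0 < omega / 2 by rewrite divr_gt0.
have cpt := @segment_compact R 0 (2 * pi).
have := (compact_near_coveringP _).1 cpt nat \oo P _.
case=> [x _|N0 _ HN].
  have /cvgrPdist_le/(_ _ o2) := cg x.
  move=> /nbhs_ballP[e /= e0 He].
  have e2 : 0 < e / 2 by rewrite divr_gt0.
  exists (ball x (e / 2), [set n | (Num.bound (2 * pi / (e / 2)) <= n)%N]).
    split; first exact: nbhsx_ballx.
    by exists (Num.bound (2 * pi / (e / 2))).
  move=> [s n] [/= xs ns] t ts.
  have q0 : 0 <= 2 * pi / (e / 2) by rewrite divr_ge0 ?mulr_ge0// ltW.
  have nb : 2 * pi / (e / 2) < n%:R by apply: lt_le_trans (archi_boundP q0) _; rewrite ler_nat.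
  have n0 : 0 < n%:R :> R by exact: le_lt_trans q0 nb.
  have an : arc R n < e / 2 by rewrite /arc ltr_pdivrMr// [ltRHS]mulrC -ltr_pdivrMr.
  have hs := He s; have ht := He t.
  rewrite (splitr omega) (le_trans (ler_distD (g x) _ _))//.
  rewrite /ball /= in xs.
  apply: lerD; last by apply: hs; rewrite /ball /=; lra.
  rewrite distrC; apply: ht; rewrite /ball /=.
  rewrite (le_lt_trans (ler_distD s _ _))// (splitr e) ltrD//.
  by rewrite distrC (le_lt_trans ts).
exists N0 => N NN N3 j t jN /andP[t1 t2].
apply: (HN N NN (theta R N j)).
  rewrite /= in_itv /= theta_ge0//= -(thetaN R N3) theta_le//; exact: ltnW.
by rewrite ger0_norm ?subr_ge0// lerBlDl -thetaS.
Qed.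

End modulus.

Section direction.
Context (R : realType).
Implicit Types (v z : R * R) (r t : R).

(** At 0 the value is 0, since the inverse of 0 is 0; elsewhere it is the unit vector along [z]. *)
Definition dir z : R * R := (Num.sqrt (sqn z))^-1 *: z.

Lemma dir_scale r z : 0 < r -> dir (r *: z) = dir z.
Proof.
move=> r0; rewrite /dir sqnZ sqrtrM ?sqr_ge0// sqrtr_sqr gtr0_norm// scalerA.
by congr (_ *: _); rewrite invfM mulrAC mulVf ?mul1r// gt_eqF.
Qed.

Lemma dir_unit z : sqn z = 1 -> dir z = z.
Proof. by move=> z1; rewrite /dir z1 sqrtr1 invr1 scale1r. Qed.

Lemma dir_circ t : dir (circ t) = circ t.
Proof. by rewrite dir_unit// sqn_circ. Qed.

Lemma dir_neq0 z : z != 0 -> sqn (dir z) = 1.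
Proof.
move=> z0; have s0 := sqn_gt0 z0.
by rewrite sqnZ exprVn sqr_sqrtr ?sqn_ge0// mulVf// gt_eqF.
Qed.

Lemma dir0 : dir 0 = 0. Proof. by rewrite /dir scaler0. Qed.

Lemma perp_dir z : perp (dir z) = (Num.sqrt (sqn z))^-1 *: perp z.
Proof. by apply: injective_projections => //=; rewrite scalerN. Qed.

Lemma measurable_funV_ge0 d (T : measurableType d) (g : T -> R) :
  measurable_fun setT g -> (forall x, 0 <= g x) -> measurable_fun setT (fun x => (g x)^-1).
Proof.
move=> mg g0; rewrite (_ : (fun x => _) = (fun x => g x `^ (-1))).
  exact: (measurableT_comp (measurable_powR (-1)) mg).
by apply/funext => x; rewrite powR_inv1.
Qed.

Lemma measurable_dir : measurable_fun setT dir.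
Proof.
have mq : measurable_fun setT (fun z : R * R => (Num.sqrt (sqn z))^-1).
  apply: measurable_funV_ge0 => [|z]; last exact: sqrtr_ge0.
  apply: (measurableT_comp (continuous_measurable_fun (@sqrt_continuous R))).
  by apply: measurable_inner.
by apply: measurable_fun_pair; apply: measurable_funM.
Qed.

End direction.

(** * Averages of continuous functions of the direction *)

Section angular_limit.
Context (R : realType) (mu : probability (steps R) R).
Hypothesis mu_iid : iid_law mu.
Hypothesis mu_null : forall (v : R * R) (c : R), v != 0 ->
  mu [set x | inner (step x 0) v = c] = 0%E.
Hypothesis mu_int1 : mu.-integrable setT (fun x => ((step x 0).1)%:E).
Hypothesis mu_int2 : mu.-integrable setT (fun x => ((step x 0).2)%:E).
Hypothesis mu_mean1 : \int[mu]_x (step x 0).1 = 0.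
Hypothesis mu_mean2 : \int[mu]_x (step x 0).2 = 0.
Hypothesis mu_sq : mu.-integrable setT (fun x => (sqn (step x 0))%:E).
Hypothesis mu_var : forall e, sqn e = 1 -> \int[mu]_x (inner (step x 0) e ^+ 2) = 1.
Hypothesis mu_cov : forall e, \int[mu]_x (inner (step x 0) e * inner (step x 0) (perp e)) = 0.

Let unif : probability (measurableTypeR R) R := uniform_prob (@twopi_gt0 R).

(** Both integrals are compared with the same Riemann sum over N sectors. First N is chosen from the
    modulus of continuity, then [dl] small enough for N sectors, and only then n. *)
Lemma angular_limit (F : R * R -> R) (C e : R) : measurable_fun setT F ->
  (forall v, sqn v = 1 \/ v = 0 -> `|F v| <= C) -> continuous (fun t => F (circ t)) -> 0 < e ->
  exists n0, forall n, (n0 <= n)%N ->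
  `|\int[mu]_x F (dir (psum n x)) - \int[unif]_t F (circ t)| <= e.
Proof.
move=> mF FC cF e0; pose G z := F (dir z).
have C0 : 0 <= C by exact: le_trans (FC 0 (or_intror erefl)).
have GC z : `|G z| <= C.
  apply: FC; have [->|z0] := eqVneq z 0; [by right; rewrite dir0|by left; exact: dir_neq0].
have GZ r z : 0 < r -> G (r *: z) = G z by move=> r0; rewrite /G dir_scale.
have Gc t : G (circ t) = F (circ t) by rewrite /G dir_circ.
have mG : measurable_fun setT G by exact: (measurableT_comp mF (@measurable_dir R)).
have e4 : 0 < e / 4 by rewrite divr_gt0.
have [N0 HN0] := uniform_modulus cF e4.
pose N := (maxn N0 3); have N3 : (2 < N)%N by rewrite /N leq_max orbT.
have NN0 : (N0 <= N)%N by exact: leq_maxl.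
have osc j t : (j < N)%N -> theta R N j <= t <= theta R N j.+1 ->
    `|G (circ t) - G (circ (theta R N j))| <= e / 4.
  by move=> jN jt; rewrite !Gc HN0.
have NR : 0 < N%:R :> R by rewrite ltr0n (leq_trans _ N3).
pose dl := e / (4 * (2 * C + 1) * N%:R).
have dl0 : 0 < dl by rewrite divr_gt0// !mulr_gt0//; lra.
have [n1 Hn1] := sector_prob mu_iid mu_int1 mu_int2 mu_mean1 mu_mean2 mu_sq mu_var mu_cov (arc R N) dl0.
exists n1.+1 => n nn.
have n0 : (0 < n)%N by exact: leq_trans nn.
have secE j : sector N j = cone (circ (theta R N j)) (turn (arc R N) (circ (theta R N j))).
  by rewrite turn_circ -thetaS.
have walk_ae : {ae mu, forall x, \sum_(j < N) \1_(psum n @^-1` sector N j) x = 1 :> R}.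
  have h : {ae mu, forall x, forall j, inner (psum n x) (perp (circ (theta R N j))) != 0}.
    apply/ae_foralln => j.
    have v0 : perp (circ (theta R N j)) != 0 by rewrite perp_eq0 unit_neq0// sqn_circ.
    have := psum_null mu_iid mu_null v0 n0; apply: filterS => x.
    by rewrite psum0 inner0l eq_sym.
  by apply: filterS h => x hx; rewrite -[RHS](sector_sum N3 (fun j _ => hx j)).
have d1 := sector_mean_equidistributed N3 (@measurable_psum R n) walk_ae
  (measurableT_comp mG (@measurable_psum R n)) GC GZ osc
  (p := fine (mu (psum n @^-1` sector N 0))) (delta := dl).
have hsum : {ae unif, forall t, \sum_(j < N) \1_(@circ R @^-1` sector N j) t = 1 :> R}.
  exact: uniform_angle_sum.
have d2 := sector_mean_equidistributed (P := unif) N3 (@measurable_circ R) hsum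
  (measurableT_comp mG (@measurable_circ R)) GC GZ osc
  (p := N%:R^-1) (delta := 0).
have b1 : `|\int[mu]_x F (dir (psum n x)) - N%:R^-1 * \sum_(j < N) G (circ (theta R N j))| <=
    e / 4 + C * (N%:R * (dl + dl)).
  by apply: d1 => j jN; rewrite !secE; apply: Hn1; rewrite ?sqn_circ// ltnW.
have b2 : `|\int[unif]_t F (circ t) - N%:R^-1 * \sum_(j < N) G (circ (theta R N j))| <= e / 4.
  rewrite (_ : \int[unif]_t F (circ t) = \int[unif]_t G (circ t)); last first.
    by apply: eq_Rintegral => t _; rewrite Gc.
  rewrite (_ : e / 4 = e / 4 + C * (N%:R * (0 + 0))); last by rewrite addr0 !mulr0 addr0.
  by apply: d2 => j jN; rewrite uniform_angle_sector// subrr normr0.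
have b3 : C * (N%:R * (dl + dl)) <= e / 4.
  have -> : C * (N%:R * (dl + dl)) = 2 * C / (2 * C + 1) * (e / 4).
    by rewrite /dl; field; rewrite !gt_eqF//=; lra.
  by rewrite -[leRHS]mul1r ler_pM2r// ler_pdivrMr ?mul1r; lra.
apply: (le_trans (ler_distD (N%:R^-1 * \sum_(j < N) G (circ (theta R N j))) _ _)).
rewrite [X in _ + X]distrC; lra.
Qed.

Lemma stay_scale n r v : 0 < r -> stay n (r *: v) = stay n v :> set (steps R).
Proof.
move=> r0; apply/seteqP; split => x h j jn; have := h j jn; by rewrite innerZr pmulr_rge0.
Qed.

Lemma stayp_scale n r v : 0 < r -> stayp mu n (r *: v) = stayp mu n v.
Proof. by move=> r0; rewrite /stayp stay_scale. Qed.

Lemma staymean_scale n r v : 0 < r -> staymean mu n (r *: v) = r * staymean mu n v.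
Proof.
move=> r0; rewrite /staymean -RintegralZl//.
  by apply: eq_Rintegral => x _; rewrite stay_scale// innerZr mulrA.
apply: integrable_mul_indic; first exact: measurable_stay.
exact: (integrable_proj mu_iid mu_int1 mu_int2).
Qed.

Lemma staymean_ge0 n v : 0 <= staymean mu n v.
Proof.
apply: Rintegral_ge0 => x _; rewrite indicE.
have [xs|_] := boolP (x \in stay n v); last by rewrite mulr0.
by rewrite mulr1; move: xs; rewrite inE; apply.
Qed.

Lemma measurable_staymean n : measurable_fun setT (staymean mu n : R * R -> R).
Proof.
pose F (z : (R * R) * steps R) := inner (psum n z.2) z.1 *
  \1_[set z : (R * R) * steps R | stay n z.1 z.2] z.
have mF : measurable_fun setT F.
  apply: measurable_funM; last by apply: measurable_indic; exact: measurable_stay_graph.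
  apply: measurable_inner => //.
  exact: (measurableT_comp (measurable_psum n) measurable_snd).
rewrite (_ : staymean mu n = fun v => \int[mu]_x F (v, x)); last first.
  apply/funext => v; apply: eq_Rintegral => x _; rewrite /F /= !indicE; congr (_ * (nat_of_bool _)%:R).
apply: (measurableT_comp (@fine_measurable R setT measurableT)).
apply: (@measurable_fun_fubini_tonelli_F _ _ _ _ _ mu (EFin \o F)).
  exact/measurable_EFinP.
move=> [v x]; rewrite lee_fin /F /= indicE.
have [xs|_] := boolP (_ \in _); last by rewrite mulr0.
by rewrite mulr1; move: xs; rewrite inE; apply.
Qed.

(** Almost surely none of S_1, ..., S_n is orthogonal to the limit direction, so the finitely many
    signs, and with them the indicator, are eventually constant along a sequence of directions; 1 +
    |S_n|^2 dominates. *)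
Lemma continuous_staymean n (w1 w2 : R -> R) : continuous w1 -> continuous w2 ->
  (forall t, sqn (w1 t, w2 t) = 1) -> continuous (fun t => staymean mu n (w1 t, w2 t)).
Proof.
move=> c1 c2 w1E t; apply/(@cvg_nbhsP _ R^o) => u ut.
have u1 : w1 (u k) @[k --> \oo] --> w1 t by exact: (continuous_cvg _ (c1 t) ut).
have u2 : w2 (u k) @[k --> \oo] --> w2 t by exact: (continuous_cvg _ (c2 t) ut).
have ui z : inner z (w1 (u k), w2 (u k)) @[k --> \oo] --> inner z (w1 t, w2 t).
  by apply: cvgD; apply: cvgMr.
have i1 := integrable_sqn_psum mu_iid mu_sq n.
have mP v : measurable_fun setT (fun x : steps R => inner (psum n x) v * \1_(stay n v) x).
  by apply: measurable_funM; [exact: measurable_proj|apply: measurable_indic; exact: measurable_stay].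
apply: (dominated_Rintegral (g := fun x => 1 + sqn (psum n x))).
- by move=> k; exact: mP.
- exact: mP.
- have h : {ae mu, forall x, forall j, inner (psum j.+1 x) (w1 t, w2 t) != 0}.
    apply/ae_foralln => j; have v0 := unit_neq0 (w1E t).
    have := psum_null mu_iid mu_null v0 (ltn0Sn j); apply: filterS => x.
    by rewrite psum0 inner0l eq_sym.
  apply: filterS h => x hx; apply: cvgM; first exact: ui.
  have near_j (j : 'I_n.+1) : \forall k \near \oo,
      (0 <= inner (psum j x) (w1 (u k), w2 (u k))) = (0 <= inner (psum j x) (w1 t, w2 t)).
    case: j => -[|j] jn /=; first by apply: nearW => k; rewrite psum0 !inner0l.
    have := hx j; rewrite neq_lt => /orP[hn|hp].
      apply: filterS (cvgr_lt _ (ui (psum j.+1 x)) 0 hn) => k hk.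
      by rewrite leNgt hk leNgt hn.
    apply: filterS (cvgr_gt _ (ui (psum j.+1 x)) 0 hp) => k hk.
    by rewrite (ltW hk) (ltW hp).
  have near_all : \forall k \near \oo, forall j : 'I_n.+1,
      (0 <= inner (psum j x) (w1 (u k), w2 (u k))) = (0 <= inner (psum j x) (w1 t, w2 t)).
    exact: filter_forall.
  apply: cvg_near_cst; apply: filterS near_all => k hk.
  rewrite !indicE; congr (nat_of_bool _)%:R; apply/idP/idP; rewrite !inE => hs j jn.
    by have := hs j jn; rewrite (hk (Ordinal (jn : (j < n.+1)%N))).
  by have := hs j jn; rewrite -(hk (Ordinal (jn : (j < n.+1)%N))).
- have ic : mu.-integrable setT (EFin \o (cst 1 : steps R -> R)).
    by apply: (@integrable_bounded _ _ _ _ _ 1) => // x; rewrite normr1.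
  exact: (integrableD measurableT ic i1).
- move=> k x; rewrite normrM -[leRHS]mulr1 ler_pM//; last first.
    by rewrite indicE; case: (_ \in _); rewrite ?normr1 ?normr0.
  have := inner_sqr_le (psum n x) (w1E (u k)); rewrite -[_ ^+ 2]real_normK ?num_real//.
  move: `|_| (sqn _) => a b ab; nra.
Qed.

End angular_limit.

(** * Averages over the direction of the walk *)

Lemma ae_le_Rintegral d (T : measurableType d) (R : realType) (P : probability T R) (f g : T -> R) :
  P.-integrable setT (EFin \o f) -> P.-integrable setT (EFin \o g) ->
  {ae P, forall x, f x <= g x} -> \int[P]_x f x <= \int[P]_x g x.
Proof.
move=> fi gi fg; rewrite -subr_ge0 -RintegralB//.
have gf := integrableB measurableT gi fi.
have mgf : measurable_fun setT (fun x => g x - f x).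
  by apply/measurable_EFinP; exact: (measurable_int P gf).
rewrite (@ae_eq_Rintegral _ _ _ _ _ (fun x => `|g x - f x|))//.
- by apply: Rintegral_ge0 => x _; exact: normr_ge0.
- exact: measurableT_comp.
- by apply: filterS fg => x h; rewrite ger0_norm// subr_ge0.
Qed.

Section renewal_directions.
Context (R : realType) (mu : probability (steps R) R).
Hypothesis mu_iid : iid_law mu.
Hypothesis mu_null : forall (v : R * R) (c : R), v != 0 ->
  mu [set x | inner (step x 0) v = c] = 0%E.
Hypothesis mu_int1 : mu.-integrable setT (fun x => ((step x 0).1)%:E).
Hypothesis mu_int2 : mu.-integrable setT (fun x => ((step x 0).2)%:E).
Hypothesis mu_mean1 : \int[mu]_x (step x 0).1 = 0.
Hypothesis mu_mean2 : \int[mu]_x (step x 0).2 = 0.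
Hypothesis mu_sq : mu.-integrable setT (fun x => (sqn (step x 0))%:E).
Hypothesis mu_var : forall e, sqn e = 1 -> \int[mu]_x (inner (step x 0) e ^+ 2) = 1.
Hypothesis mu_cov : forall e, \int[mu]_x (inner (step x 0) e * inner (step x 0) (perp e)) = 0.

Let I := {v : R * R | sqn v = 1}.

Let sqnN1 (v : I) : sqn (- sval v) = 1.
Proof. by rewrite sqnN (svalP v). Qed.

Let opp (v : I) : I := exist _ (- sval v) (sqnN1 v).
Let oppK v : opp (opp v) = v.
Proof. case: v => v v1; rewrite /opp; apply: eq_exist => /=; exact: opprK. Qed.

Let q (v : I) n := stayp mu n (sval v).
Let M (v : I) n := staymean mu n (sval v).
Let b (v : I) k := kac mu (sval v) k.
(** The supremum of these relative errors over all unit directions serves as the uniform error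
    sequence of the renewal comparison. *)
Let dev k := [set `|b v k - beta R k / Num.sqrt 2| / beta R k | v in [set: I]].
Let eps k := sup (dev k).

Let neq0 (v : I) : sval v != 0.
Proof. exact: unit_neq0 (svalP v). Qed.

Let q_conv v n : conv (q (opp v)) (q v) n = 1.
Proof. exact: (stayp_conv mu_iid mu_null mu_int1 mu_int2 n (neq0 v)). Qed.

Let b_conv v n : \sum_(k < n.+1) b v k = conv (M v) (q (opp v)) n.
Proof.
rewrite /conv -(mean_wmax_conv mu_iid mu_null mu_int1 mu_int2 n (neq0 v)).
by rewrite (mean_wmax mu_iid mu_int1 mu_int2) big_ord_recl /b kac0 add0r.
Qed.

Let q0 v : q v 0%N = 1. Proof. exact: stayp0. Qed.
Let q_ge0 v n : 0 <= q v n. Proof. exact: stayp_ge0. Qed.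
Let q_mono v n m : (n <= m)%N -> q v m <= q v n.
Proof. exact: stayp_noninc. Qed.
Let M0 v : M v 0%N = 0. Proof. exact: staymean0. Qed.
Let M_mono v n m : (n <= m)%N -> M v n <= M v m.
Proof. exact: (staymean_nondec mu_iid mu_int1 mu_int2 mu_mean1 mu_mean2). Qed.
Let b0 v : b v 0%N = 0. Proof. exact: kac0. Qed.
Let b_ge0 v k : 0 <= b v k.
Proof. exact: (kac_ge0 mu_iid mu_int1 mu_int2 mu_mean1 mu_mean2). Qed.
Let b_le v k : b v k <= beta R k.
Proof. exact: (kac_le_beta mu_iid mu_int1 mu_int2 mu_mean1 mu_mean2 mu_sq mu_var mu_cov k (svalP v)). Qed.

Let dev_ub k : ubound (dev k) 2.
Proof.
move=> _ [v _ <-]; have b0' := beta_gt0 R k.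
rewrite ler_pdivrMr// (le_trans (ler_normB _ _))// mulrDl mul1r ger0_norm//.
rewrite lerD ?b_le// ger0_norm ?divr_ge0 ?sqrtr_ge0 ?(ltW b0')//.
rewrite ler_piMr ?(ltW b0')// invf_le1 ?sqrtr_gt0//.
by rewrite -[leLHS](@sqrtr1 R) ler_wsqrtr// ler1n.
Qed.

Let dev0 k : dev k !=set0.
Proof.
have e1 : sqn (1, 0) = 1 :> R by rewrite /sqn /inner /= mulr0 addr0 mulr1.
pose v : I := exist _ (1, 0) e1.
by exists (`|b v k - beta R k / Num.sqrt 2| / beta R k); exists v.
Qed.

Let b_beta v k : (0 < k)%N -> `|b v k - beta R k / Num.sqrt 2| <= eps k * beta R k.
Proof.
move=> k0; rewrite -ler_pdivrMr ?beta_gt0//; apply: ub_le_sup.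
  by exists 2; exact: dev_ub.
by exists v.
Qed.

Let eps_ge0 n : 0 <= eps n.
Proof.
have [y yd] := dev0 n; apply: (@le_trans _ _ y).
  by case: yd => v _ <-; rewrite divr_ge0// ltW// beta_gt0.
by apply: ub_le_sup => //; exists 2; exact: dev_ub.
Qed.

Let eps0 : null_seq eps.
Proof.
move=> e e0; have [N HN] := kac_asymptotics mu_iid mu_int1 mu_int2 mu_mean1 mu_mean2 mu_sq mu_var mu_cov e0.
exists N => n nN; rewrite ger0_norm//; apply: ge_sup => [|_ [v _ <-]]; first exact: dev0.
by rewrite ler_pdivrMr ?beta_gt0//; exact: (HN n nN _ (svalP v)).
Qed.

(** For unit [v] the mean loss at exit from the half-plane of [v], identified with [Rfun] in
    [Rfun_ladmean]. *)
Definition ladmean v : R := sup (range (fun n => staymean mu n v)).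

Lemma stayp_le_beta : exists2 C : R, 0 < C & forall v, sqn v = 1 ->
  forall n, stayp mu n v <= C * beta R n.
Proof.
have [C C0 H] := q_upper oppK q_conv b_conv q0 q_ge0 q_mono M0 M_mono b_ge0 b_le eps0 b_beta.
by exists C => // v v1 n; have [h _] := H (exist _ v v1); exact: h.
Qed.

Lemma staymean_lower : exists K (c : R), 0 < c /\ forall v, sqn v = 1 ->
  forall n, (K <= n)%N -> c <= staymean mu n v.
Proof.
have [K [c [_ c0 H]]] := M_lower q_conv b_conv q0 q_ge0 M_mono b_ge0 eps0 b_beta.
by exists K, c; split=> // v v1 n Kn; exact: (H (exist _ v v1)).
Qed.

Lemma ladmean_bounds : exists c C : R, [/\ 0 < c, 0 < C & forall v, sqn v = 1 -> c <= ladmean v <= C].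
Proof.
have [c [C [c0 C0 H]]] := Mlim_bounds oppK q_conv b_conv q0 q_ge0 q_mono M0 M_mono b_ge0 b_le eps0 b_beta.
by exists c, C; split=> // v v1; exact: (H (exist _ v v1)).
Qed.

Lemma staymean_le_ladmean v n : sqn v = 1 -> staymean mu n v <= ladmean v.
Proof.
move=> v1; exact: (Mlim_ub oppK q_conv b_conv q0 q_ge0 q_mono M0 M_mono b_ge0 b_le eps0 b_beta (exist _ v v1)).
Qed.

Lemma ladmean_opp v : sqn v = 1 -> ladmean v * ladmean (- v) = 2^-1.
Proof.
move=> v1; exact: (Mlim_opp oppK q_conv b_conv q0 q_ge0 q_mono M0 M_mono b0 b_ge0 b_le eps0 eps_ge0 b_beta (exist _ v v1)).
Qed.

Lemma cvg_staymean v : sqn v = 1 -> (fun n => staymean mu n v) @ \oo --> ladmean v.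
Proof.
move=> v1; apply: nondecreasing_cvgn.
  by move=> n m nm; exact: (M_mono (exist _ v v1)).
by exists (ladmean v) => _ [n _ <-]; exact: staymean_le_ladmean.
Qed.

Lemma stayp_sum_lower K (e : R) : 0 < e -> exists N0, forall v, sqn v = 1 -> forall N, (N0 <= N)%N ->
  (Num.sqrt 2 * staymean mu K v - e) * betasum R N <= \sum_(m < N.+1) stayp mu m v.
Proof.
move=> e0; have [N0 H] := qsum_lower oppK q_conv b_conv q0 q_ge0 q_mono M0 M_mono b0 b_ge0 b_le eps0 eps_ge0 b_beta K e0.
by exists N0 => v v1 N NN; exact: (H (exist _ v v1)).
Qed.

Lemma stayp_sum_upper K (e : R) : 0 < e -> exists N0, forall v, sqn v = 1 -> forall N, (N0 <= N)%N ->
  staymean mu K (- v) * \sum_(m < N.+1) stayp mu m v <= ((Num.sqrt 2)^-1 + e) * betasum R N.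
Proof.
move=> e0; have [N0 H] := qsum_upper oppK b_conv q_ge0 M0 M_mono b0 eps0 eps_ge0 b_beta K e0.
by exists N0 => v v1 N NN; exact: (H (exist _ v v1)).
Qed.

Let unif : probability (measurableTypeR R) R := uniform_prob (@twopi_gt0 R).

Let u1 t : sqn (perp (circ t)) = 1 :> R.
Proof. by rewrite sqn_perp sqn_circ. Qed.

Let mc : measurable_fun setT (fun t => perp (circ t) : R * R).
Proof. exact: (measurable_perp (@measurable_circ R)). Qed.

Definition mean_ladmean : R := \int[unif]_t ladmean (perp (circ t)).

Lemma measurable_ladmean_circ : measurable_fun setT (fun t => ladmean (perp (circ t))).
Proof.
apply: (measurable_fun_cvg (h := fun n t => staymean mu n (perp (circ t)))).
  by move=> n; exact: (measurableT_comp (@measurable_staymean R mu n) mc).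
by move=> t _; exact: cvg_staymean.
Qed.

Let uN1 t : sqn (- perp (circ t)) = 1 :> R.
Proof. by rewrite sqnN. Qed.

Let opp_perp (v : R * R) : - perp v = (v.2, - v.1).
Proof. by rewrite /perp; congr pair; rewrite /= opprK. Qed.

Let mopp : measurable_fun setT (fun v : R * R => - perp v).
Proof.
rewrite (_ : (fun v => _) = (fun v : R * R => (v.2, - v.1))).
  by apply: measurable_fun_pair => //; apply: measurableT_comp.
by apply/funext => v; rewrite opp_perp.
Qed.

Let mperp : measurable_fun setT (fun v : R * R => perp v).
Proof. exact: measurable_perp. Qed.

Lemma staymean_at0 n : staymean mu n 0 = 0.
Proof.
rewrite /staymean; transitivity (\int[mu]_x (cst 0 x : R)); last by rewrite Rintegral_cst// mul0r.
by apply: eq_Rintegral => x _; rewrite innerC inner0l mul0r.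
Qed.

Let perp0 : perp 0 = 0 :> R * R. Proof. by rewrite /perp /= oppr0. Qed.

Lemma cvg_mean_staymean :
  (fun K => \int[unif]_t staymean mu K (perp (circ t))) @ \oo --> mean_ladmean.
Proof.
have [c [C [c0 C0 H]]] := ladmean_bounds.
apply: (dominated_Rintegral (g := cst C)).
- by move=> n; exact: (measurableT_comp (@measurable_staymean R mu n) mc).
- exact: measurable_ladmean_circ.
- by apply: aeW => t; exact: cvg_staymean.
- by apply: (@integrable_bounded _ _ _ _ _ `|C|).
- move=> n t; rewrite ger0_norm ?staymean_ge0// (le_trans (staymean_le_ladmean n (u1 t)))//.
  by case/andP: (H _ (u1 t)).
Qed.

Lemma cvg_mean_inv_staymean :
  (fun K => \int[unif]_t (staymean mu K (- perp (circ t)))^-1) @ \oo --> 2 * mean_ladmean.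
Proof.
have [c [C [c0 C0 H]]] := ladmean_bounds.
have [K0 [c' [c'0 H']]] := staymean_lower.
have i1 : unif.-integrable setT (EFin \o (fun t => ladmean (perp (circ t)))).
  apply: (@integrable_bounded _ _ _ _ _ C); first exact: measurable_ladmean_circ.
  by move=> t; case/andP: (H _ (u1 t)) => h1 h2; rewrite ger0_norm// (le_trans (ltW c0)).
have -> : 2 * mean_ladmean = \int[unif]_t (2 * ladmean (perp (circ t))) by rewrite RintegralZl.
(* From [K0] on the truncated means are bounded away from 0, so their inverses are dominated by a
   constant. *)
rewrite -(cvg_shiftn K0).
apply: (dominated_Rintegral (g := cst c'^-1)).
- move=> n; apply: measurable_funV_ge0 => [|t]; last exact: staymean_ge0.
  exact: (measurableT_comp (@measurable_staymean R mu _) (measurableT_comp mopp (@measurable_circ R))).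
- by apply: measurable_funM => //; exact: measurable_ladmean_circ.
- apply: aeW => t.
  have e : 2 * ladmean (perp (circ t)) = (ladmean (- perp (circ t)))^-1.
    have h := ladmean_opp (u1 t); have /andP[h1 _] := H _ (uN1 t).
    have h0 : ladmean (- perp (circ t)) != 0 by rewrite gt_eqF// (lt_le_trans c0).
    by apply: (mulIf h0); rewrite mulVf// -mulrA h divff.
  rewrite e; apply: cvgV.
    by rewrite gt_eqF//; have /andP[h1 _] := H _ (uN1 t); exact: lt_le_trans h1.
  have := cvg_staymean (uN1 t); by rewrite -(cvg_shiftn K0).
- by apply: (@integrable_bounded _ _ _ _ _ `|c'^-1|).
- move=> n t; have h := H' _ (uN1 t) (n + K0)%N (leq_addl _ _).
  rewrite ger0_norm ?invr_ge0 ?staymean_ge0// lef_pV2 ?posrE//; exact: lt_le_trans h.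
Qed.

Let stayp_dir m z : z != 0 -> stayp mu m (perp (dir z)) = stayp mu m (perp z).
Proof. by move=> z0; rewrite perp_dir stayp_scale// invr_gt0 sqrtr_gt0 sqn_gt0. Qed.

Let sweep_int k N : mu.-integrable setT (EFin \o (fun x => \sum_(m < N.+1) stayp mu m (perp (psum k x)))) /\
  \sum_(m < N.+1) sweep mu k m = \int[mu]_x (\sum_(m < N.+1) stayp mu m (perp (psum k x))).
Proof.
have i m : mu.-integrable setT (EFin \o (fun x => stayp mu m (perp (psum k x)))).
  apply: (@integrable_bounded _ _ _ _ _ 1); first exact: measurable_stayp_perp.
  by move=> x; exact: stayp_bound.
by have [i1 i2] := Rintegral_sum N.+1 i.
Qed.

Let walk_neq0 k : (0 < k)%N -> {ae mu, forall x, psum k x != 0}.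
Proof. exact: (psum_neq0 mu_iid mu_null). Qed.

Let continuous_opp_sin : continuous (fun t : R => - sin t).
Proof. by move=> t; apply: cvgN; exact: continuous_sin. Qed.

Let continuous_opp_cos : continuous (fun t : R => - cos t).
Proof. by move=> t; apply: cvgN; exact: continuous_cos. Qed.

Let cpc K : continuous (fun t => staymean mu K (perp (circ t))).
Proof.
by apply: (continuous_staymean mu_iid mu_null mu_sq (w1 := fun t => - sin t) (w2 := cos)) => //; exact: continuous_cos.
Qed.

Let cnpc K : continuous (fun t => staymean mu K (- perp (circ t))).
Proof.
rewrite (_ : (fun t => _) = (fun t => staymean mu K (sin t, - cos t))).
  apply: (continuous_staymean mu_iid mu_null mu_sq (w1 := sin) (w2 := fun t => - cos t)) => //; first exact: continuous_sin.
  by move=> t; rewrite -[RHS](sqn_circ t) /sqn /inner /= mulrNN addrC.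
by apply/funext => t; rewrite opp_perp.
Qed.

(** For fixed K the bound [stayp_sum_lower] is uniform in the direction and may be averaged over
    that of S_k; [angular_limit] then carries the average to the circle, where K was chosen large
    beforehand. *)
Lemma sweep_sum_lower (e : R) : 0 < e -> exists k0 N0, forall k N, (k0 <= k)%N -> (N0 <= N)%N ->
  (Num.sqrt 2 * mean_ladmean - e) * betasum R N <= \sum_(m < N.+1) sweep mu k m.
Proof.
move=> e0; have e3 : 0 < e / 3 by rewrite divr_gt0.
have e6 : 0 < e / 6 by rewrite divr_gt0.
have [c [C [c0 C0 H]]] := ladmean_bounds.
have [K _ HK] : exists2 K, True & mean_ladmean - e / 6 <= \int[unif]_t staymean mu K (perp (circ t)).
  have /cvgrPdist_le/(_ _ e6) [K _ HK] := cvg_mean_staymean.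
  by exists K => //; have := HK K (leqnn K); rewrite ler_norml => /andP[_]; lra.
have [N0 HN0] := stayp_sum_lower K e3.
pose F v := staymean mu K (perp v).
have mF : measurable_fun setT F by exact: (measurableT_comp (@measurable_staymean R mu K) mperp).
have FC v : sqn v = 1 \/ v = 0 -> `|F v| <= C.
  rewrite ger0_norm ?staymean_ge0// => -[v1|->]; last by rewrite /F perp0 staymean_at0 ltW.
  have v1' : sqn (perp v) = 1 by rewrite sqn_perp.
  by rewrite (le_trans (staymean_le_ladmean K v1'))//; case/andP: (H _ v1').
have [k1 Hk1] := angular_limit mu_iid mu_null mu_int1 mu_int2 mu_mean1 mu_mean2 mu_sq mu_var mu_cov mF FC (@cpc K) e6.
exists k1.+1, N0 => k N kk NN; have k0 : (0 < k)%N by exact: leq_trans kk.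
have [i1 ->] := sweep_int k N.
have D0 := betasum_gt0 R N.
have h1 := Hk1 k (ltnW kk).
have iF : mu.-integrable setT (EFin \o (fun x => F (dir (psum k x)))).
  apply: (@integrable_bounded _ _ _ _ _ C).
    exact: (measurableT_comp mF (measurableT_comp (@measurable_dir R) (@measurable_psum R k))).
  move=> x; apply: FC; have [->|z0] := eqVneq (psum k x) 0; [by right; rewrite dir0|by left; exact: dir_neq0].
have iF2 := integrableZl measurableT (Num.sqrt 2 * betasum R N) iF.
have ic : mu.-integrable setT (EFin \o (cst (- (e / 3 * betasum R N)) : steps R -> R)).
  by apply: (@integrable_bounded _ _ _ _ _ `|- (e / 3 * betasum R N)|).
have iF3 := integrableD measurableT iF2 ic.
have E : \int[mu]_x (Num.sqrt 2 * betasum R N * F (dir (psum k x)) + cst (- (e / 3 * betasum R N)) x) =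
    (Num.sqrt 2 * \int[mu]_x F (dir (psum k x)) - e / 3) * betasum R N.
  by rewrite RintegralD// RintegralZl// Rintegral_cst//= probability_setT mulr1; ring.
apply: le_trans (ae_le_Rintegral iF3 i1 _); last first.
  apply: filterS (walk_neq0 k0) => x x0.
  have u : sqn (perp (dir (psum k x))) = 1 by rewrite sqn_perp dir_neq0.
  have := HN0 _ u N NN; rewrite -/(F _).
  have -> : \sum_(m < N.+1) stayp mu m (perp (dir (psum k x))) = \sum_(m < N.+1) stayp mu m (perp (psum k x)).
    by apply: eq_bigr => m _; rewrite stayp_dir.
  by move: (\sum_(_ < _) _) (F _) => S f /=; rewrite mulrBl mulrAC.
rewrite E ler_pM2r//.
have r2 : 0 < Num.sqrt 2 :> R by rewrite sqrtr_gt0.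
have r22 : Num.sqrt 2 * Num.sqrt 2 = 2 :> R by rewrite -expr2 sqr_sqrtr.
have r2l : Num.sqrt 2 <= 2 :> R by nra.
have h2 : mean_ladmean - e / 3 <= \int[mu]_x F (dir (psum k x)).
  by move: h1; rewrite ler_norml => /andP[h1 _]; move: h1 HK; rewrite /F; lra.
have := ler_wpM2l (ltW r2) h2.
have : Num.sqrt 2 * (e / 3) <= 2 * (e / 3) by rewrite ler_pM2r.
lra.
Qed.

Lemma sweep_sum_upper (e : R) : 0 < e -> exists k0 N0, forall k N, (k0 <= k)%N -> (N0 <= N)%N ->
  \sum_(m < N.+1) sweep mu k m <= (Num.sqrt 2 * mean_ladmean + e) * betasum R N.
Proof.
move=> e0.
have [c [C [c0 C0 H]]] := ladmean_bounds.
have L0 : 0 <= mean_ladmean.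
  by apply: Rintegral_ge0 => t _; case/andP: (H _ (u1 t)) => h _; exact: le_trans (ltW c0) h.
(* Chosen so that (1/sqrt 2 + e1)(2 L + 2 e2) is within e of sqrt 2 L, where L is [mean_ladmean]; e2
   <= 1 takes care of the product e1 e2. *)
pose e2 := Num.min 1 (e / 8); pose e1 := e / (8 * (mean_ladmean + 1)).
have e20 : 0 < e2 by rewrite lt_min ltr01 divr_gt0.
have e10 : 0 < e1 by rewrite divr_gt0// mulr_gt0// ltr_wpDl.
have [K0 [c' [c'0 H']]] := staymean_lower.
have [K K0K HK] : exists2 K, (K0 <= K)%N & \int[unif]_t (staymean mu K (- perp (circ t)))^-1 <= 2 * mean_ladmean + e2.
  have /cvgrPdist_le/(_ _ e20) [K _ HK] := cvg_mean_inv_staymean.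
  exists (maxn K0 K); first exact: leq_maxl.
  by have := HK (maxn K0 K) (leq_maxr _ _); rewrite ler_norml => /andP[]; lra.
have [N0 HN0] := stayp_sum_upper K e10.
pose F v := (staymean mu K (- perp v))^-1.
have mF : measurable_fun setT F.
  apply: measurable_funV_ge0 => [|v]; last exact: staymean_ge0.
  exact: (measurableT_comp (@measurable_staymean R mu K) mopp).
have vu (v : R * R) : sqn v = 1 -> sqn (- perp v) = 1 by move=> v1; rewrite sqnN sqn_perp.
have FC v : sqn v = 1 \/ v = 0 -> `|F v| <= c'^-1.
  rewrite ger0_norm ?invr_ge0 ?staymean_ge0// => -[v1|->]; last first.
    by rewrite /F perp0 oppr0 staymean_at0 invr0 invr_ge0 ltW.
  have h := H' _ (vu v v1) K K0K.
  by rewrite lef_pV2 ?posrE//; exact: lt_le_trans h.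
have cF : continuous (fun t => F (circ t)).
  move=> t; apply: cvgV; last exact: cnpc.
  by rewrite gt_eqF// (lt_le_trans c'0)// H'.
have [k1 Hk1] := angular_limit mu_iid mu_null mu_int1 mu_int2 mu_mean1 mu_mean2 mu_sq mu_var mu_cov mF FC cF e20.
exists k1.+1, N0 => k N kk NN; have k0 : (0 < k)%N by exact: leq_trans kk.
have [i1 ->] := sweep_int k N.
have D0 := betasum_gt0 R N.
have h1 := Hk1 k (ltnW kk).
have iF : mu.-integrable setT (EFin \o (fun x => F (dir (psum k x)))).
  apply: (@integrable_bounded _ _ _ _ _ c'^-1).
    exact: (measurableT_comp mF (measurableT_comp (@measurable_dir R) (@measurable_psum R k))).
  move=> x; apply: FC; have [->|z0] := eqVneq (psum k x) 0; [by right; rewrite dir0|by left; exact: dir_neq0].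
pose a := ((Num.sqrt 2)^-1 + e1) * betasum R N.
have iF2 := integrableZl measurableT a iF.
apply: (le_trans (ae_le_Rintegral i1 iF2 _)).
  apply: filterS (walk_neq0 k0) => x x0.
  have u : sqn (perp (dir (psum k x))) = 1 by rewrite sqn_perp dir_neq0.
  have := HN0 _ u N NN.
  have -> : \sum_(m < N.+1) stayp mu m (perp (dir (psum k x))) = \sum_(m < N.+1) stayp mu m (perp (psum k x)).
    by apply: eq_bigr => m _; rewrite stayp_dir.
  have h := H' _ (vu _ (dir_neq0 x0)) K K0K.
  have sp : 0 < staymean mu K (- perp (dir (psum k x))) by exact: lt_le_trans h.
  by rewrite -/a /= /F ler_pdivlMr// mulrC.
rewrite RintegralZl// /a mulrAC ler_pM2r//.
have h2 : \int[mu]_x F (dir (psum k x)) <= 2 * mean_ladmean + 2 * e2.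
  by move: h1; rewrite ler_norml => /andP[_ h1]; move: h1 HK; rewrite /F; lra.
have r2 : 0 < (Num.sqrt 2)^-1 :> R by rewrite invr_gt0 sqrtr_gt0.
have r22 : (Num.sqrt 2)^-1 * 2 = Num.sqrt 2 :> R.
  by rewrite -[X in _ * X](@sqr_sqrtr _ 2)// expr2 mulKf// gt_eqF// sqrtr_gt0.
have r1 : (Num.sqrt 2)^-1 <= 1 :> R.
  by rewrite invf_le1 ?sqrtr_gt0// -[leLHS](@sqrtr1 R) ler_wsqrtr// ler1n.
apply: (le_trans (ler_wpM2l (addr_ge0 (ltW r2) (ltW e10)) h2)).
have q1 : e1 * (mean_ladmean + 1) = e / 8.
  by rewrite /e1; field; rewrite gt_eqF// ltr_wpDl.
have q2 : e2 <= 1 by rewrite /e2 ge_min lexx.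
have q3 : e2 <= e / 8 by rewrite /e2 ge_min lexx orbT.
have q4 : (Num.sqrt 2)^-1 * e2 <= 1 * e2 by rewrite ler_wpM2r// ltW.
have q5 : e1 * e2 <= e1 * 1 by rewrite ler_pM2l.
have -> : ((Num.sqrt 2)^-1 + e1) * (2 * mean_ladmean + 2 * e2) =
  ((Num.sqrt 2)^-1 * 2) * mean_ladmean + 2 * ((Num.sqrt 2)^-1 * e2) + 2 * (e1 * mean_ladmean) + 2 * (e1 * e2) by ring.
rewrite r22; lra.
Qed.

Lemma mean_ladmean_gt0 : 0 < mean_ladmean.
Proof.
have [c [C [c0 C0 H]]] := ladmean_bounds.
have i1 : unif.-integrable setT (EFin \o (fun t => ladmean (perp (circ t)))).
  apply: (@integrable_bounded _ _ _ _ _ C); first exact: measurable_ladmean_circ.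
  by move=> t; case/andP: (H _ (u1 t)) => h1 h2; rewrite ger0_norm// (le_trans (ltW c0)).
apply: (lt_le_trans c0); rewrite (_ : c = \int[unif]_t (cst c t)); last first.
  by rewrite Rintegral_cst//= probability_setT mulr1.
apply: le_Rintegral => //; first by apply: (@integrable_bounded _ _ _ _ _ `|c|).
by move=> t _; case/andP: (H _ (u1 t)).
Qed.

Lemma sweep_le_beta : exists2 C : R, 0 < C & forall k m, (0 < k)%N -> sweep mu k m <= C * beta R m.
Proof.
have [C C0 H] := stayp_le_beta; exists C => // k m k0.
have -> : C * beta R m = \int[mu]_x (cst (C * beta R m) x) by rewrite Rintegral_cst//= probability_setT mulr1.
apply: ae_le_Rintegral.
- apply: (@integrable_bounded _ _ _ _ _ 1); first exact: measurable_stayp_perp.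
  by move=> x; exact: stayp_bound.
- by apply: (@integrable_bounded _ _ _ _ _ `|C * beta R m|).
- apply: filterS (walk_neq0 k0) => x x0; rewrite -stayp_dir//; apply: H.
  by rewrite sqn_perp dir_neq0.
Qed.

Lemma sweep_noninc k m m' : (m <= m')%N -> sweep mu k m' <= sweep mu k m.
Proof.
have i n : mu.-integrable setT (EFin \o (fun x => stayp mu n (perp (psum k x)))).
  apply: (@integrable_bounded _ _ _ _ _ 1); first exact: measurable_stayp_perp.
  by move=> x; exact: stayp_bound.
by move=> mm; apply: le_Rintegral => // x _; exact: stayp_noninc.
Qed.

Lemma sweep_ge0 k m : 0 <= sweep mu k m.
Proof. by apply: Rintegral_ge0 => x _; exact: stayp_ge0. Qed.

End renewal_directions.

(** * From partial sums to terms *)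

Section monotone_density.
Context (R : realType).
Implicit Types (u : nat -> R) (e : R).
Local Notation be := (beta R).
Local Notation D := (betasum R).

Lemma block_sum u m h : \sum_(i < (m + h).+1) u i = \sum_(i < m.+1) u i + \sum_(i < h) u (m.+1 + i)%N.
Proof. by rewrite -addSn big_split_ord. Qed.

Lemma block_bounds u m h : (forall i j, (i <= j)%N -> u j <= u i) ->
  h%:R * u (m + h)%N <= \sum_(i < (m + h).+1) u i - \sum_(i < m.+1) u i <= h%:R * u m.
Proof.
move=> mu; rewrite block_sum addrC addrA addNr add0r.
have c (y : R) : h%:R * y = \sum_(i < h) y by rewrite sumr_const card_ord mulr_natl.
rewrite !c; apply/andP; split; apply: ler_sum => i _; apply: mu.
  by rewrite addSn -addnS leq_add2l.
by rewrite addSn -addnS leq_addr.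
Qed.

Lemma beta_antimono i j : (i <= j)%N -> be j <= be i.
Proof. exact: beta_mono. Qed.

Lemma betasum_mono i j : (i <= j)%N -> D i <= D j.
Proof.
move=> ij; rewrite -(subnKC ij) -subr_ge0; have /andP[h _] := block_bounds i (j - i) beta_antimono.
by apply: le_trans h; rewrite mulr_ge0// ltW// beta_gt0.
Qed.

Lemma beta_ratio i j : (i <= j)%N -> (2 * i%:R + 1) * be i <= (2 * j%:R + 1) * be j.
Proof. by move=> ij; rewrite -!betasumE betasum_mono. Qed.

(** A block of length h, about m/J, after m: its sum is at most h a_m by monotonicity, while D grows
    on it by at least h beta_(m+h). The change of beta across the block costs a factor 1 - 1/J, and
    the error e of sums of order m beta_m is amplified by J on dividing by h. [density_upper] uses
    the block before m. *)
Lemma density_lower (l e J m h bm bmh a Smh Sm Dmh Dm : R) :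
  0 < l -> 0 < e -> 2 <= J -> 1 <= h -> J * h <= m -> m <= 2 * (J * h) -> 0 < bm -> 0 < bmh -> bmh <= bm ->
  (2 * m + 1) * bm <= (2 * (m + h) + 1) * bmh ->
  Dm = (2 * m + 1) * bm -> Dmh = (2 * (m + h) + 1) * bmh ->
  h * bmh <= Dmh - Dm -> Smh - Sm <= h * a ->
  (l - e) * Dmh <= Smh -> Sm <= (l + e) * Dm -> (l * (1 - J^-1) - 14 * (J * e)) * bm <= a.
Proof.
move=> l0 e0 J2 h1 Jh mJ b0 b'0 bb br eD eD' hD hS S1 S2.
have h0 : 0 < h by lra.
have J0 : 0 < J by lra.
have m2h : 2 * h <= m by apply: le_trans Jh; rewrite ler_pM2r.
have t1 : Dmh + Dm <= 7 * (m * bm).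
  have q1 : Dmh <= (2 * (m + h) + 1) * bm by rewrite eD' ler_wpM2l//; lra.
  have q2 : (2 * (m + h) + 1) * bm <= (4 * m) * bm by rewrite ler_pM2r//; lra.
  have q3 : (2 * m + 1) * bm <= (3 * m) * bm by rewrite ler_pM2r//; lra.
  rewrite eD; lra.
have t2 : m * bm <= 2 * (J * h) * bm by rewrite ler_pM2r.
have t3 : (1 - J^-1) * bm <= bmh.
  have p : 0 < 2 * (m + h) + 1 by lra.
  rewrite -(ler_pM2l p); apply: le_trans br.
  rewrite mulrA ler_pM2r//.
  have q : 2 * h <= (2 * (m + h) + 1) * J^-1.
    by rewrite ler_pdivlMr//; nra.
  lra.
have t4 : l * (h * ((1 - J^-1) * bm)) <= l * (h * bmh) by rewrite !ler_pM2l.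
have t5 : l * (h * bmh) <= l * (Dmh - Dm) by rewrite ler_pM2l.
have t6 : e * (Dmh + Dm) <= e * (14 * (J * h * bm)) by rewrite ler_pM2l//; lra.
by rewrite -(ler_pM2l h0); lra.
Qed.

Lemma density_upper (l e J m h bm bmh a Smh Sm Dmh Dm : R) :
  0 < l -> 0 < e -> 2 <= J -> 1 <= h -> J * h <= m -> m <= 2 * (J * h) -> 0 < bm -> 0 < bmh ->
  (2 * (m - h) + 1) * bmh <= (2 * m + 1) * bm ->
  Dm = (2 * m + 1) * bm -> Dmh = (2 * (m - h) + 1) * bmh ->
  Dm - Dmh <= h * bmh -> h * a <= Sm - Smh ->
  (l - e) * Dmh <= Smh -> Sm <= (l + e) * Dm -> a <= (l * (1 + 2 / J) + 12 * (J * e)) * bm.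
Proof.
move=> l0 e0 J2 h1 Jh mJ b0 b'0 br eD eD' hD hS S1 S2.
have h0 : 0 < h by lra.
have J0 : 0 < J by lra.
have m2h : 2 * h <= m by apply: le_trans Jh; rewrite ler_pM2r.
have t1 : Dmh + Dm <= 6 * (m * bm).
  have q3 : (2 * m + 1) * bm <= (3 * m) * bm by rewrite ler_pM2r//; lra.
  rewrite eD' eD; lra.
have t2 : m * bm <= 2 * (J * h) * bm by rewrite ler_pM2r.
have t3 : bmh <= (1 + 2 / J) * bm.
  have p : 0 < 2 * (m - h) + 1 by lra.
  rewrite -(ler_pM2l p); apply: (le_trans br).
  rewrite mulrA ler_pM2r//.
  have q : 2 * h <= (2 * (m - h) + 1) * (2 / J).
    by rewrite mulrA ler_pdivlMr//; nra.
  lra.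
have t4 : l * (h * bmh) <= l * (h * ((1 + 2 / J) * bm)) by rewrite !ler_pM2l.
have t5 : l * (Dm - Dmh) <= l * (h * bmh) by rewrite ler_pM2l.
have t6 : e * (Dmh + Dm) <= e * (12 * (J * h * bm)) by rewrite ler_pM2l//; lra.
by rewrite -(ler_pM2l h0); lra.
Qed.

Variables (a : nat -> nat -> R) (l C : R).
Hypothesis l0 : 0 < l.
Hypothesis a_ge0 : forall k m, 0 <= a k m.
Hypothesis a_mono : forall k i j, (i <= j)%N -> a k j <= a k i.
Hypothesis C0 : 0 < C.
Hypothesis a_le : forall k m, (0 < k)%N -> a k m <= C * be m.
Hypothesis sum_lower : forall e, 0 < e -> exists k0 N0, forall k N, (k0 <= k)%N -> (N0 <= N)%N ->
  (l - e) * D N <= \sum_(m < N.+1) a k m.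
Hypothesis sum_upper : forall e, 0 < e -> exists k0 N0, forall k N, (k0 <= k)%N -> (N0 <= N)%N ->
  \sum_(m < N.+1) a k m <= (l + e) * D N.

(** A Tauberian step, uniform in k: J is taken large first, to make l/J small, and the precision of
    the partial sums is then chosen relative to 1/J. *)
Lemma monotone_density e : 0 < e -> exists k0 m0, forall k m, (k0 <= k)%N -> (m0 <= m)%N ->
  `|a k m - l * be m| <= e * be m.
Proof.
move=> e0; pose J := (Num.bound (4 * l / e)).+2.
have J2 : 2 <= J%:R :> R by rewrite (ler_nat _ 2).
have J0 : 0 < J%:R :> R by lra.
have lJ : l / J%:R <= e / 4.
  have h0 : 0 <= 4 * l / e by rewrite divr_ge0 ?mulr_ge0// ltW.
  have h1 : 4 * l / e <= J%:R by rewrite ltW// (lt_le_trans (archi_boundP h0))// ler_nat; lia.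
  rewrite ler_pdivrMr//; rewrite ler_pdivrMr// in h1; lra.
(* Makes the amplified error 14 J e' equal to e/2, and 12 J e' smaller still. *)
pose e' := e / (28 * J%:R).
have e'0 : 0 < e' by rewrite divr_gt0// mulr_gt0.
have Je' : J%:R * e' = e / 28 by rewrite /e'; field; rewrite gt_eqF.
have [k1 [N1 H1]] := sum_lower e'0; have [k2 [N2 H2]] := sum_upper e'0.
exists (maxn k1 k2), (maxn J (2 * maxn N1 N2)) => k m.
rewrite !geq_max => /andP[kk1 kk2] /andP[mJ mN].
pose h := (m %/ J)%N.
have Jp : (0 < J)%N by [].
have h1 : (1 <= h)%N by rewrite /h divn_gt0.
have hm : (h * J <= m)%N by exact: leq_trunc_div.
have mh : (m < h.+1 * J)%N by exact: ltn_ceil.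
have h2 : (2 * h <= m)%N by apply: leq_trans hm; rewrite mulnC leq_mul2l orbT.
have hle : (h <= m)%N by move: h2; clear; lia.
have N1m : (N1 <= m)%N by move: mN; clear; lia.
have N2m : (N2 <= m)%N by move: mN; clear; lia.
have N1h : (N1 <= m - h)%N by move: mN h2; clear; lia.
have hR : 1 <= h%:R :> R by rewrite (ler_nat _ 1).
have JhR : J%:R * h%:R <= m%:R :> R by rewrite -natrM ler_nat mulnC.
have mJR : m%:R <= 2 * (J%:R * h%:R) :> R.
  rewrite -!natrM ler_nat (leq_trans (ltnW mh))// (mulnC J) mulnA leq_mul2r; apply/orP; right.
  move: h1; clear; lia.
have bm := beta_gt0 R m.
have eD := betasumE R m.
have lo : (l * (1 - J%:R^-1) - 14 * (J%:R * e')) * be m <= a k m.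
  have bmh := beta_gt0 R (m + h)%N.
  have r := @beta_ratio m (m + h) (leq_addr _ _).
  have eD' := betasumE R (m + h)%N.
  have /andP[q1 _] := block_bounds m h beta_antimono.
  have /andP[_ q2] := block_bounds m h (a_mono k).
  have S1 := H1 k (m + h)%N kk1 (leq_trans N1m (leq_addr _ _)).
  have S2 := H2 k m kk2 N2m.
  rewrite natrD in r eD'.
  exact: (density_lower l0 e'0 J2 hR JhR mJR bm bmh (beta_antimono (leq_addr h m)) r eD eD' q1 q2 S1 S2).
have up : a k m <= (l * (1 + 2 / J%:R) + 12 * (J%:R * e')) * be m.
  have bmh := beta_gt0 R (m - h)%N.
  have r := @beta_ratio (m - h) m (leq_subr _ _).
  have eD' := betasumE R (m - h)%N.
  have /andP[_ q1] := block_bounds (m - h) h beta_antimono.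
  have /andP[q2 _] := block_bounds (m - h) h (a_mono k).
  rewrite subnK// in q1 q2.
  have S1 := H1 k (m - h)%N kk1 N1h.
  have S2 := H2 k m kk2 N2m.
  rewrite natrB// in r eD'.
  exact: (density_upper l0 e'0 J2 hR JhR mJR bm bmh r eD eD' q1 q2 S1 S2).
rewrite ler_norml; apply/andP; split.
  have : (l - e) * be m <= (l * (1 - J%:R^-1) - 14 * (J%:R * e')) * be m.
    by rewrite ler_pM2r// Je' mulrBr mulr1; lra.
  lra.
have : (l * (1 + 2 / J%:R) + 12 * (J%:R * e')) * be m <= (l + e) * be m.
  rewrite ler_pM2r// Je' mulrDr mulr1 (_ : l * (2 / J%:R) = 2 * (l / J%:R)); [lra|ring].
lra.
Qed.

Definition harmonic n : R := \sum_(k < n) k.+1%:R^-1.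

Lemma harmonic_upper n : harmonic n.+1 <= 1 + ln n.+1%:R.
Proof.
elim: n => [|n IH]; first by rewrite /harmonic big_ord_recr big_ord0 /= add0r invr1 ln1 addr0.
rewrite /harmonic big_ord_recr /= -/(harmonic n.+1).
have p1 : 0 < n.+1%:R :> R by rewrite ltr0n.
have p2 : 0 < n.+2%:R :> R by rewrite ltr0n.
have : ln (n.+1%:R / n.+2%:R) <= - n.+2%:R^-1 :> R.
  have -> : n.+1%:R / n.+2%:R = 1 + (- n.+2%:R^-1) :> R.
    by have e : n.+2%:R = n.+1%:R + 1 :> R; [rewrite natr1|rewrite e in p2 *; field; rewrite gt_eqF].
  by apply: le_ln1Dx; rewrite ltrN2 invf_lt1// ltr1n.
rewrite ln_div ?posrE//; move: (ln _) (ln _) (_^-1) IH => x y z; lra.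
Qed.

Lemma harmonic_lower n : ln n.+1%:R <= harmonic n.
Proof.
elim: n => [|n IH]; first by rewrite /harmonic big_ord0 ln1.
rewrite /harmonic big_ord_recr /= -/(harmonic n).
have p1 : 0 < n.+1%:R :> R by rewrite ltr0n.
have p2 : 0 < n.+2%:R :> R by rewrite ltr0n.
have : ln (n.+2%:R / n.+1%:R) <= n.+1%:R^-1 :> R.
  have -> : n.+2%:R / n.+1%:R = 1 + n.+1%:R^-1 :> R.
    by have e : n.+2%:R = n.+1%:R + 1 :> R; [rewrite natr1|rewrite e; field; rewrite gt_eqF].
  by apply: le_ln1Dx; rewrite (lt_le_trans (ltrN10 _))// invr_ge0.
rewrite ln_div ?posrE//; move: (ln _) (ln _) (_^-1) IH => x y z; lra.
Qed.

Lemma ln_unbounded (A : R) : exists N, forall n, (N <= n)%N -> A <= ln n%:R :> R.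
Proof.
exists (Num.bound (expR A)) => n Nn.
have h : expR A < n%:R by apply: lt_le_trans (archi_boundP (expR_ge0 A)) _; rewrite ler_nat.
by rewrite -[leLHS]expRK ler_ln ?posrE ?expR_gt0 ?(ltW h)// (lt_trans (expR_gt0 A)).
Qed.

Definition weighted_sum n : R := \sum_(k < n) k.+1%:R^-1 * a k.+1 (n - k.+1).
Definition beta_sum n : R := \sum_(k < n) k.+1%:R^-1 * be (n - k.+1).

Let be_ge0 n : 0 <= be n. Proof. exact/ltW/beta_gt0. Qed.

Lemma beta_sum_lower n : (0 < n)%N -> be n * ln n%:R <= beta_sum n.
Proof.
move=> n0; apply: (@le_trans _ _ (be n * harmonic n)).
  rewrite ler_pM2l ?beta_gt0// (le_trans _ (harmonic_lower n))//.
  by rewrite ler_ln ?posrE ?ltr0n// ler_nat.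
rewrite /harmonic mulr_sumr; apply: ler_sum => k _.
by rewrite mulrC ler_wpM2l ?invr_ge0// beta_antimono// leq_subr.
Qed.

Lemma sum_beta_rev n : \sum_(k < n) be (n - k.+1) <= 3 * n%:R * be n.
Proof.
case: n => [|n]; first by rewrite big_ord0 mulr0 mul0r.
rewrite (reindex_inj rev_ord_inj) /=.
apply: (@le_trans _ _ (D n.+1)).
  rewrite betasumS -[leLHS]addr0 lerD//.
  by apply: ler_sum => k _; rewrite subSS subKn// -ltnS.
rewrite betasumE ler_pM2r ?beta_gt0// -[n.+1%:R]natr1.
by have := ler0n R n; lra.
Qed.

(** Split at k = n/J. Below, beta_(n-k) is at most (1 + 2/J) beta_n and the harmonic sum yields the
    logarithm; above, 1/k is at most J/n and the sum of the betas is of order n beta_n, without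
    logarithm. *)
Lemma beta_sum_upper n (J : nat) : (2 <= J)%N -> (J <= n)%N ->
  beta_sum n <= be n * ((1 + 2 / J%:R) * (1 + ln n%:R) + 3 * J%:R).
Proof.
move=> J2 Jn; have n0 : (0 < n)%N by exact: leq_trans (ltnW J2) Jn.
have J0 : (0 < J)%N by exact: leq_trans J2.
pose h := (n %/ J)%N.
have hm : (h * J <= n)%N by exact: leq_trunc_div.
have mh : (n < h.+1 * J)%N by exact: ltn_ceil.
have h2 : (2 * h <= n)%N by apply: leq_trans hm; rewrite mulnC leq_mul2l J2 orbT.
have hn : (h <= n)%N by lia.
have JR : 0 < J%:R :> R by rewrite ltr0n.
have nR : 0 < n%:R :> R by rewrite ltr0n.
have b1 : be (n - h) <= (1 + 2 / J%:R) * be n.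
  have r := @beta_ratio (n - h) n (leq_subr _ _).
  rewrite natrB// in r.
  have h2R : 2 * h%:R <= n%:R :> R by rewrite -natrM ler_nat.
  have JhR : J%:R * h%:R <= n%:R :> R by rewrite -natrM ler_nat mulnC.
  have J2R : 2 <= J%:R :> R by rewrite (ler_nat _ 2).
  have h0 : 0 <= h%:R :> R by [].
  have p : 0 < 2 * (n%:R - h%:R) + 1 :> R by lra.
  rewrite -(ler_pM2l p); apply: (le_trans r).
  rewrite mulrA ler_pM2r ?beta_gt0//.
  have q : 2 * h%:R <= (2 * (n%:R - h%:R) + 1) * (2 / J%:R) :> R.
    by rewrite mulrA ler_pdivlMr//; nra.
  lra.
have tm (k : 'I_n) : k.+1%:R^-1 * be (n - k.+1) <=
    (1 + 2 / J%:R) * be n * k.+1%:R^-1 + J%:R / n%:R * be (n - k.+1).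
  have [kh|hk] := leqP k.+1 h.
    apply: ler_wpDr; first by rewrite mulr_ge0// divr_ge0.
    rewrite mulrC ler_wpM2r ?invr_ge0// (le_trans _ b1)// beta_antimono//.
    exact: leq_sub2l.
  apply: ler_wpDl.
    by rewrite !mulr_ge0// ?invr_ge0// addr_ge0// divr_ge0.
  rewrite ler_wpM2r// -[leRHS]invf_div lef_pV2 ?posrE ?divr_gt0 ?ltr0n//.
  rewrite ler_pdivrMr// -natrM ler_nat (leq_trans (ltnW mh))// leq_mul2r.
  by rewrite hk orbT.
apply: (@le_trans _ _ (\sum_(k < n) ((1 + 2 / J%:R) * be n * k.+1%:R^-1 + J%:R / n%:R * be (n - k.+1)))).
  by apply: ler_sum.
rewrite big_split /= -!mulr_sumr -/(harmonic n).
have c0 : 0 <= (1 + 2 / J%:R) * be n by rewrite mulr_ge0// addr_ge0// divr_ge0.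
have H : harmonic n <= 1 + ln n%:R by case: n n0 {Jn h hm mh h2 hn nR b1 tm c0} => // n _; exact: harmonic_upper.
have s1 := ler_wpM2l c0 H.
have c1 : 0 <= J%:R / n%:R :> R by rewrite divr_ge0.
have s2 := ler_wpM2l c1 (sum_beta_rev n).
have e2 : J%:R / n%:R * (3 * n%:R * be n) = 3 * J%:R * be n by field; rewrite gt_eqF.
rewrite e2 in s2; apply: (le_trans (lerD s1 s2)).
by rewrite le_eqVlt; apply/orP; left; apply/eqP; ring.
Qed.

Lemma count_lt n m : \sum_(k < n) (k < m)%N%:R <= m%:R :> R.
Proof.
suff -> : \sum_(k < n) (k < m)%N%:R = (minn n m)%:R :> R by rewrite ler_nat geq_minr.
elim: n => [|n IH]; first by rewrite big_ord0 min0n.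
rewrite big_ord_recr /= IH -natrD; congr _%:R.
by case: ltnP => h; lia.
Qed.

(** The density estimate fails for k below [k0] and for n - k below [m0], a bounded number of terms.
    The crude bound by C beta makes each of them of order beta_n: in the first case n - k is
    comparable to n, in the second 1/k <= 2/n <= 4 beta_n. *)
Lemma weighted_sum_error e : 0 < e -> exists A, exists N, forall n, (N <= n)%N ->
  `|weighted_sum n - l * beta_sum n| <= e * beta_sum n + A * be n.
Proof.
move=> e0; have [k0 [m0 H]] := monotone_density e0.
pose C' := C + l; have C'0 : 0 <= C' by rewrite addr_ge0// ltW.
exists (C' * (2 * k0%:R + 4 * m0%:R)), (2 * k0 + 2 * m0).+1 => n nN.
have n0 : (0 < n)%N by exact: leq_trans nN.
have nR : 0 < n%:R :> R by rewrite ltr0n.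
have bn := beta_gt0 R n.
rewrite /weighted_sum /beta_sum mulr_sumr -sumrB (le_trans (ler_norm_sum _ _ _))//.
have tm (k : 'I_n) : `|k.+1%:R^-1 * a k.+1 (n - k.+1) - l * (k.+1%:R^-1 * be (n - k.+1))| <=
    e * (k.+1%:R^-1 * be (n - k.+1)) + (C' * (2 * be n) * (k < k0)%N%:R +
    C' * (4 * be n) * (n - k.+1 < m0)%N%:R).
  rewrite mulrCA -mulrBr normrM ger0_norm ?invr_ge0//.
  have ki : 0 <= k.+1%:R^-1 :> R by rewrite invr_ge0.
  have k1 : k.+1%:R^-1 <= 1 :> R by rewrite invf_le1 ?ltr0n// (ler_nat _ 1).
  have bm := be_ge0 (n - k.+1).
  have t0 : 0 <= e * (k.+1%:R^-1 * be (n - k.+1)) by rewrite !mulr_ge0// ltW.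
  have u0 : 0 <= C' * (2 * be n) * (k < k0)%N%:R by rewrite !mulr_ge0// ltW.
  have w0 : 0 <= C' * (4 * be n) * (n - k.+1 < m0)%N%:R by rewrite !mulr_ge0// ltW.
  have crude : `|a k.+1 (n - k.+1) - l * be (n - k.+1)| <= C' * be (n - k.+1).
    rewrite (le_trans (ler_normB _ _))// mulrDl ger0_norm// ger0_norm ?mulr_ge0 ?(ltW l0)//.
    by rewrite lerD// a_le.
  have [kk|kk] := leqP k0 k; last first.
    apply: le_trans (_ : _ <= C' * (2 * be n)) _; last by rewrite [_ * true%:R]mulr1 addrCA lerDl addr_ge0.
    apply: (le_trans (ler_wpM2l ki crude)).
    rewrite mulrCA ler_wpM2l//.
    have r := @beta_ratio (n - k.+1) n (leq_subr _ _).
    have kn : (k.+1 <= n)%N by [].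
    rewrite natrB// in r.
    have h2R : 2 * k.+1%:R <= n%:R :> R.
      by rewrite -natrM ler_nat (leq_trans _ (ltnW nN))// (leq_trans _ (leq_addr _ _))// leq_mul2l.
    apply: (@le_trans _ _ (be (n - k.+1))); first by rewrite ler_piMl.
    have p : 0 < 2 * (n%:R - k.+1%:R) + 1 :> R by have := ler0n R k.+1; lra.
    rewrite -(ler_pM2l p); apply: (le_trans r); rewrite mulrA ler_pM2r//; lra.
  have [mm|mm] := leqP m0 (n - k.+1); last first.
    apply: le_trans (_ : _ <= C' * (4 * be n)) _; last by rewrite [_ * true%:R]mulr1 [_ * false%:R]mulr0 add0r lerDr.
    apply: (le_trans (ler_wpM2l ki crude)).
    rewrite mulrCA ler_wpM2l//.
    apply: (@le_trans _ _ k.+1%:R^-1); first by rewrite ler_piMr// beta_le1.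
    have nk : n%:R <= 2 * k.+1%:R :> R.
      by rewrite -natrM ler_nat; move: nN mm; clear; lia.
    have q1 : k.+1%:R^-1 <= 2 * n%:R^-1 :> R.
      by rewrite -[2 in leRHS]invrK -invfM lef_pV2 ?posrE ?mulr_gt0 ?invr_gt0 ?ltr0n//; lra.
    have q2 := sqrt_inv_le_beta R n0.
    have q3 : n%:R^-1 <= (Num.sqrt n%:R)^-1 :> R.
      rewrite lef_pV2 ?posrE ?sqrtr_gt0//.
      rewrite -[leRHS]ger0_norm// -sqrtr_sqr ler_wsqrtr// expr2 ler_peMr//.
      by rewrite (ler_nat _ 1).
    apply: (le_trans q1); rewrite (_ : 4 * be n = 2 * (2 * be n)); last by ring.
    by rewrite ler_pM2l// (le_trans q3 q2).
  rewrite ![_ * false%:R]mulr0 !addr0 [leRHS]mulrCA.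
  by apply: ler_wpM2l => //; exact: H (leqW kk) mm.
apply: (@le_trans _ _ (\sum_(k < n) (e * (k.+1%:R^-1 * be (n - k.+1)) + (C' * (2 * be n) * (k < k0)%N%:R +
    C' * (4 * be n) * (n - k.+1 < m0)%N%:R)))).
  by apply: ler_sum.
rewrite !big_split /= -!mulr_sumr lerD2l.
have r1 := count_lt n k0.
have r2 : \sum_(k < n) (n - k.+1 < m0)%N%:R <= m0%:R :> R.
  apply: le_trans (count_lt n m0); rewrite [leRHS](reindex_inj rev_ord_inj) /=.
  by apply: ler_sum.
have c1 : 0 <= C' * (2 * be n) by rewrite !mulr_ge0// ltW.
have c2 : 0 <= C' * (4 * be n) by rewrite !mulr_ge0// ltW.
have := ler_wpM2l c1 r1; have := ler_wpM2l c2 r2; lra.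
Qed.

Lemma weighted_sum_asymptotics e : 0 < e -> exists N, forall n, (N <= n)%N ->
  `|weighted_sum n - l * (be n * ln n%:R)| <= e * (be n * ln n%:R).
Proof.
move=> e0; have e8 : 0 < e / 8 by rewrite divr_gt0.
have [A [N1 HA]] := weighted_sum_error e8.
pose J := (Num.bound (8 * l / e)).+2.
have lJ : 2 * (l / J%:R) <= e / 4.
  have h0 : 0 <= 8 * l / e by rewrite divr_ge0 ?mulr_ge0// ltW.
  have J0 : 0 < J%:R :> R by rewrite ltr0n.
  have h1 : 8 * l / e <= J%:R by rewrite ltW// (lt_le_trans (archi_boundP h0))// ler_nat; lia.
  rewrite mulrA ler_pdivrMr//; rewrite ler_pdivrMr// in h1; lra.
pose B := (e / 8 + l) * (2 + 3 * J%:R) + `|A|.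
have [N2 HN2] := ln_unbounded (2 * B / e).
have [N3 HN3] := ln_unbounded 0.
exists (maxn (maxn N1 N2) (maxn N3 J)) => n; rewrite !geq_max => /andP[/andP[nN1 nN2] /andP[nN3 nJ]].
have n0 : (0 < n)%N by exact: leq_trans nJ.
have bn := beta_gt0 R n.
have lnn := HN3 n nN3; have lnB := HN2 n nN2; have err := HA n nN1.
have Tl := beta_sum_lower n0.
have Tu := @beta_sum_upper n J isT nJ.
have J2 : (0 <= 2 / J%:R :> R) && (2 / J%:R <= 1 :> R).
  by rewrite divr_ge0//= ler_pdivrMr ?ltr0n// mul1r (ler_nat _ 2).
have Tu' : beta_sum n <= be n * ln n%:R + 2 / J%:R * (be n * ln n%:R) + be n * (2 + 3 * J%:R).
  apply: (le_trans Tu).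
  have : be n * (2 / J%:R) <= be n * 1 by rewrite ler_pM2l//; case/andP: J2.
  lra.
set X := be n * ln n%:R in Tl Tu' *.
have X0 : 0 <= X by rewrite mulr_ge0.
have BX : be n * B <= e / 2 * X.
  rewrite /X mulrCA ler_pM2l//; rewrite ler_pdivrMr// in lnB; lra.
have h1 : `|weighted_sum n - l * X| <= `|weighted_sum n - l * beta_sum n| + l * (beta_sum n - X).
  apply: (le_trans (ler_distD (l * beta_sum n) _ _)); rewrite lerD2l -mulrBr normrM.
  by rewrite (gtr0_norm l0) ger0_norm// subr_ge0.
apply: (le_trans h1).
have Ab : A * be n <= `|A| * be n by rewrite ler_pM2r// ler_norm.
have t1 : e / 8 * beta_sum n <= e / 8 * (2 * X + be n * (2 + 3 * J%:R)).
  rewrite ler_pM2l//; apply: (le_trans Tu').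
  have : 2 / J%:R * X <= 1 * X by rewrite ler_wpM2r//; case/andP: J2.
  lra.
have t2 : l * (beta_sum n - X) <= 2 * (l / J%:R) * X + l * (be n * (2 + 3 * J%:R)).
  have : beta_sum n - X <= 2 / J%:R * X + be n * (2 + 3 * J%:R) by lra.
  move=> /(ler_wpM2l (ltW l0)) g; rewrite [leRHS]mulrDr in g.
  by rewrite (_ : 2 * (l / J%:R) * X = l * (2 / J%:R * X)); last by ring.
have t3 : 2 * (l / J%:R) * X <= e / 4 * X by rewrite ler_wpM2r.
have BE : be n * B = (e / 8 + l) * (be n * (2 + 3 * J%:R)) + `|A| * be n by rewrite /B; ring.
rewrite BE in BX.
move: (be n * (2 + 3 * J%:R)) (`|A| * be n) (A * be n) BX Ab t1 t2 t3 err => Y Z Z' BX Ab t1 t2 t3 err.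
lra.
Qed.

(** The Wallis bounds place pi n beta_n^2 between 1 - 1/n and 1. *)
Lemma cvg_sqrt_beta : (fun n : nat => Num.sqrt (pi * n%:R) * be n) @ \oo --> (1 : R).
Proof.
have pi0 := pi_gt0 R.
apply/cvgrPdist_le => e e0; exists (Num.bound e^-1) => // n /= ne.
have ei : 0 <= e^-1 by rewrite invr_ge0 ltW.
have nb : e^-1 < n%:R by apply: lt_le_trans (archi_boundP ei) _; rewrite ler_nat.
have n0 : 0 < n%:R :> R by exact: le_lt_trans ei nb.
have w1 := beta_wallis_lower R n; have w2 := beta_wallis_upper R n.
set y := _ * be n.
have y0 : 0 <= y by rewrite mulr_ge0 ?sqrtr_ge0.
have yy : y ^+ 2 = pi * n%:R * be n ^+ 2 by rewrite exprMn sqr_sqrtr// mulr_ge0 ?ltW.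
have pn : 0 < pi * n%:R :> R by exact: mulr_gt0.
have d0 : 0 < 2 * n%:R + 1 :> R by lra.
have y1 : y ^+ 2 <= 1.
  rewrite yy (le_trans (ler_wpM2l (ltW pn) w2))//.
  rewrite mulrA ler_pdivrMr ?mul1r ?mulr_gt0 ?exprn_gt0//.
  rewrite -mulrA ler_pM2l//; nra.
have y2 : 1 - n%:R^-1 <= y ^+ 2.
  rewrite yy (le_trans _ (ler_wpM2l (ltW pn) w1))//.
  rewrite mulrA ler_pdivlMr ?mulr_gt0//.
  rewrite (_ : pi * n%:R * 2 = pi * (2 * n%:R)); last by ring.
  rewrite mulrCA ler_pM2l//.
  have -> : (1 - n%:R^-1) * (2 * n%:R + 1) = 2 * n%:R + 1 - 2 - n%:R^-1 :> R by field; rewrite gt_eqF.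
  have : 0 < n%:R^-1 :> R by rewrite invr_gt0.
  lra.
have yl : y <= 1 by rewrite -(@ler_pXn2r _ 2)// ?nnegrE// expr1n.
have ninv : n%:R^-1 <= e by rewrite -[leRHS]invrK lef_pV2 ?posrE ?invr_gt0// ltW.
rewrite ger0_norm; last by rewrite subr_ge0.
have : y ^+ 2 <= y by rewrite expr2 ler_piMr.
lra.
Qed.

Lemma cvg_weighted_sum :
  (fun n : nat => weighted_sum n / (l * (ln n%:R / Num.sqrt (pi * n%:R)))) @ \oo --> (1 : R).
Proof.
have pi0 := pi_gt0 R.
have h : (fun n : nat => weighted_sum n / (l * (be n * ln n%:R))) @ \oo --> (1 : R).
  apply/cvgrPdist_le => e e0.
  have [N HN] := weighted_sum_asymptotics (mulr_gt0 e0 l0).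
  have [N' HN'] := ln_unbounded 1.
  exists (maxn N N') => // n /=; rewrite geq_max => /andP[nN nN'].
  have lnn : 0 < ln n%:R :> R by exact: lt_le_trans (HN' n nN').
  have X0 : 0 < l * (be n * ln n%:R) by rewrite !mulr_gt0// beta_gt0.
  rewrite -(ler_pM2l X0) -{1}(gtr0_norm X0) -normrM mulrBr mulr1 (mulrC _ (_ / _)) divfK ?gt_eqF//.
  rewrite distrC; apply: (le_trans (HN n nN)); rewrite le_eqVlt; apply/orP; left; apply/eqP; ring.
rewrite -[X in _ --> X](mulr1 1).
have hc : ((fun n : nat => weighted_sum n / (l * (be n * ln n%:R))) \*
    (fun n : nat => Num.sqrt (pi * n%:R) * be n)) @ \oo --> (1 * 1 : R).
  exact: cvgM h cvg_sqrt_beta.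
apply: cvg_trans hc; apply: near_eq_cvg.
have [N' HN'] := ln_unbounded 1.
exists (maxn N' 1) => // n /=; rewrite geq_max => /andP[nN' n0].
have lnn : 0 < ln n%:R :> R by exact: lt_le_trans (HN' n nN').
have bn := beta_gt0 R n.
have s0 : 0 < Num.sqrt (pi * n%:R) :> R by rewrite sqrtr_gt0 mulr_gt0// ltr0n.
by rewrite /=; field; rewrite !gt_eqF.
Qed.

End monotone_density.

(** * Asymptotics for isotropic steps *)

Section nohull_asymptotics.
Context (R : realType) (mu : probability (steps R) R).
Hypothesis mu_iid : iid_law mu.
Hypothesis mu_null : forall (v : R * R) (c : R), v != 0 ->
  mu [set x | inner (step x 0) v = c] = 0%E.
Hypothesis mu_int1 : mu.-integrable setT (fun x => ((step x 0).1)%:E).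
Hypothesis mu_int2 : mu.-integrable setT (fun x => ((step x 0).2)%:E).
Hypothesis mu_mean1 : \int[mu]_x (step x 0).1 = 0.
Hypothesis mu_mean2 : \int[mu]_x (step x 0).2 = 0.
Hypothesis mu_sq : mu.-integrable setT (fun x => (sqn (step x 0))%:E).
Hypothesis mu_var : forall e, sqn e = 1 -> \int[mu]_x (inner (step x 0) e ^+ 2) = 1.
Hypothesis mu_cov : forall e, \int[mu]_x (inner (step x 0) e * inner (step x 0) (perp e)) = 0.

Let lad_gt0 := mean_ladmean_gt0 mu_iid mu_null mu_int1 mu_int2 mu_mean1 mu_mean2 mu_sq mu_var mu_cov.

Lemma cvg_prob_nohull :
  (fun n : nat => fine (mu (nohull n)) /
     (Num.sqrt 2 * mean_ladmean mu * (ln n%:R / Num.sqrt (pi * n%:R)))) @ \oo --> (1 : R).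
Proof.
have l0 : 0 < Num.sqrt 2 * mean_ladmean mu by rewrite mulr_gt0 ?sqrtr_gt0.
have [C C0 aC] := sweep_le_beta mu_iid mu_null mu_int1 mu_int2 mu_mean1 mu_mean2 mu_sq mu_var mu_cov.
have h := @cvg_weighted_sum R (sweep mu) _ C l0 (sweep_ge0 mu) (fun k i j => @sweep_noninc R mu k i j) C0 aC
  (sweep_sum_lower mu_iid mu_null mu_int1 mu_int2 mu_mean1 mu_mean2 mu_sq mu_var mu_cov)
  (sweep_sum_upper mu_iid mu_null mu_int1 mu_int2 mu_mean1 mu_mean2 mu_sq mu_var mu_cov).
apply: cvg_trans h; apply: near_eq_cvg; exists 1%N => // n /= n0.
by rewrite (prob_nohull mu_iid mu_null n0).
Qed.

Let ladir z := ladmean mu (perp (dir z)).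

Let perp0 : perp 0 = 0 :> R * R. Proof. by rewrite /perp /= oppr0. Qed.

Lemma ladmean0 : ladmean mu 0 = 0.
Proof.
transitivity (sup [set (0 : R)]); last exact: sup1.
congr sup; by apply/seteqP; split => [_ [n _ <-]|_ ->]; [|exists 0%N => //]; rewrite staymean_at0.
Qed.

Lemma cvg_staymean_dir z : (fun n => staymean mu n (perp (dir z))) @ \oo --> ladir z.
Proof.
have [->|z0] := eqVneq z 0.
  rewrite /ladir dir0 perp0 ladmean0.
  by rewrite (_ : (fun n => _) = cst 0); [exact: cvg_cst|apply/funext => n; rewrite staymean_at0].
apply: (cvg_staymean mu_iid mu_null mu_int1 mu_int2 mu_mean1 mu_mean2 mu_sq mu_var mu_cov).
by rewrite sqn_perp dir_neq0.
Qed.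

Lemma cvg_staymean_perp z :
  (fun n => staymean mu n (perp z)) @ \oo --> Num.sqrt (sqn z) * ladir z.
Proof.
have [->|z0] := eqVneq z 0.
  rewrite /sqn inner0l sqrtr0 mul0r perp0.
  by rewrite (_ : (fun n => _) = cst 0); [exact: cvg_cst|apply/funext => n; rewrite staymean_at0].
have s0 : 0 < Num.sqrt (sqn z) by rewrite sqrtr_gt0 sqn_gt0.
rewrite (_ : (fun n => _) = (fun n => Num.sqrt (sqn z) * staymean mu n (perp (dir z)))).
  by apply: cvgMr; exact: cvg_staymean_dir.
apply/funext => n; rewrite perp_dir staymean_scale ?invr_gt0// mulrA divff ?mul1r// gt_eqF//.
Qed.

Lemma measurable_ladmean_dir : measurable_fun setT ladir.
Proof.
apply: (measurable_fun_cvg (h := fun n z => staymean mu n (perp (dir z)))).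
  move=> n; apply: (measurableT_comp (@measurable_staymean R mu n)).
  exact: measurable_perp (@measurable_dir R).
by move=> z _; exact: cvg_staymean_dir.
Qed.

Lemma ladmean_dir_bounded : exists C, forall z, `|ladir z| <= C.
Proof.
have [c [C [c0 C0 H]]] := ladmean_bounds mu_iid mu_null mu_int1 mu_int2 mu_mean1 mu_mean2 mu_sq mu_var mu_cov.
exists C => z; have h : forall n, 0 <= staymean mu n (perp (dir z)) <= C.
  move=> n; rewrite staymean_ge0/=; have [->|z0] := eqVneq z 0.
    by rewrite dir0 perp0 staymean_at0 ltW.
  have u1 : sqn (perp (dir z)) = 1 by rewrite sqn_perp dir_neq0.
  have /andP[_] := H _ u1; apply: le_trans.
  exact: (staymean_le_ladmean mu_iid mu_null mu_int1 mu_int2 mu_mean1 mu_mean2 mu_sq mu_var mu_cov).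
have lc := @cvg_staymean_dir z.
rewrite ger0_norm.
  by apply: (cvgr_to_le lc); exists 0%N => // n _; have /andP[] := h n.
by apply: (cvgr_to_ge lc); exists 0%N => // n _; have /andP[] := h n.
Qed.

End nohull_asymptotics.

(** * Reduction to isotropic steps *)

Section planar_matrices.
Context (R : realType).
Implicit Types (u v w e : R * R) (M N S A : 'M[R]_2).

Lemma ord2_cases (P : 'I_2 -> Prop) : P 0 -> P 1 -> forall i, P i.
Proof.
move=> P0 P1 [[|[|//]] h]; [rewrite (_ : Ordinal h = 0)//|rewrite (_ : Ordinal h = 1)//]; exact/val_inj.
Qed.

Lemma det_mx2 M : \det M = M 0 0 * M 1 1 - M 0 1 * M 1 0.
Proof.
rewrite (expand_det_row _ 0) !big_ord_recl big_ord0 addr0 /cofactor !det_mx11 !mxE /=.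
rewrite (_ : lift 0 0 = 1 :> 'I_2); last exact/val_inj.
rewrite (_ : lift 1 0 = 0 :> 'I_2); last exact/val_inj.
by rewrite expr0 expr1 mul1r mulN1r mulrN.
Qed.

Lemma matrix2P M N : M 0 0 = N 0 0 -> M 0 1 = N 0 1 -> M 1 0 = N 1 0 -> M 1 1 = N 1 1 -> M = N.
Proof.
move=> h00 h01 h10 h11; apply/matrixP => i j.
by move: i; apply: ord2_cases; move: j; apply: ord2_cases.
Qed.

Lemma mulmx2E M N i j : (M *m N) i j = M i 0 * N 0 j + M i 1 * N 1 j.
Proof. by rewrite mxE !big_ord_recl big_ord0 addr0; congr (_ + M i _ * N _ j); exact/val_inj. Qed.

Lemma mxact_mul M N u : mxact (M *m N) u = mxact M (mxact N u).
Proof. by rewrite /mxact !mulmx2E /=; congr pair; ring. Qed.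

Lemma mxact1 u : mxact 1%:M u = u.
Proof. by case: u => a b; rewrite /mxact !mxE /= !mul1r !mul0r addr0 add0r. Qed.

Lemma mxactD M u v : mxact M (u + v) = mxact M u + mxact M v.
Proof. by rewrite /mxact /=; apply: injective_projections => /=; ring. Qed.

Lemma mxact0 M : mxact M 0 = 0.
Proof. by rewrite /mxact /=; apply: injective_projections => /=; ring. Qed.

Lemma inner_mxact M u v : inner (mxact M u) v = inner u (mxact M^T v).
Proof. by rewrite /inner /mxact /= !mxE; ring. Qed.

Lemma mxact_neq0 M N u : N *m M = 1%:M -> u != 0 -> mxact M u != 0.
Proof.
by move=> NM; apply: contra => /eqP Mu; rewrite -(mxact1 u) -NM mxact_mul Mu mxact0.
Qed.

Lemma inner_mxact_perp M v w :
  inner (mxact M w) (perp (mxact M v)) = \det M * inner w (perp v).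
Proof. by rewrite det_mx2 /inner /mxact /perp /=; ring. Qed.

Lemma first_ray_mxact M v w : 0 < \det M -> first_ray v w -> first_ray (mxact M v) (mxact M w).
Proof.
move=> M0; rewrite /first_ray inner_mxact_perp => -[h|[h1 h2]]; first by left; rewrite mulr_gt0.
right; rewrite h1 mulr0; split=> //.
have v0 : v != 0 by apply/eqP => v0; move: h2; rewrite v0 innerC inner0l ltxx.
have Mu : M \in unitmx by rewrite unitmxE unitfE gt_eqF.
have Mv : 0 < sqn (mxact M v) by rewrite sqn_gt0// (mxact_neq0 (mulVmx Mu)).
rewrite -(pmulr_rgt0 _ (sqn_gt0 v0)).
(* Expansion of |v|^2 w in the orthogonal basis v, perp v; here the second coefficient is 0. *)
rewrite (_ : _ * _ = inner w v * sqn (mxact M v) + inner w (perp v) * inner (mxact M (perp v)) (mxact M v)).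
  by rewrite h1 mul0r addr0 mulr_gt0.
by rewrite /sqn /inner /mxact /perp /=; ring.
Qed.

Lemma perp_inner v w : inner (perp v) (perp w) = inner v w.
Proof. by rewrite /inner /perp /=; ring. Qed.

Lemma first_ray_perp v w : first_ray (perp v) (perp w) <-> first_ray v w.
Proof. by rewrite /first_ray !perp_inner. Qed.

Lemma posdef_det S : S^T = S -> (forall u, u != 0 -> 0 < inner (mxact S u) u) -> 0 < S 0 0 /\ 0 < \det S.
Proof.
move=> ST Sp; have s01 : S 1 0 = S 0 1 by rewrite -[in LHS]ST mxE.
have a0 : 0 < S 0 0.
  have e0 : (1, 0) != 0 :> R * R by rewrite xpair_eqE oner_eq0.
  have := Sp _ e0; rewrite /inner /mxact /=; lra.
split=> //; have v0 : (S 0 1, - S 0 0) != 0 :> R * R by rewrite xpair_eqE oppr_eq0 [S 0 0 == 0](gt_eqF a0) andbF.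
have := Sp _ v0; rewrite (_ : inner _ _ = S 0 0 * \det S) ?pmulr_rgt0//.
by rewrite det_mx2 /inner /mxact /= s01; ring.
Qed.

(* By Cayley-Hamilton [(S + s)^2 = (tr S + 2 s) S] when [s^2 = det S]. *)
Lemma spd_sqrt_exists S : S^T = S -> (forall u, u != 0 -> 0 < inner (mxact S u) u) ->
  exists A, spd_sqrt_of S A.
Proof.
move=> ST Sp; have [a0 d0] := posdef_det ST Sp.
have s01 : S 1 0 = S 0 1 by rewrite -[in LHS]ST mxE.
pose s := Num.sqrt (\det S); have s0 : 0 < s by rewrite sqrtr_gt0.
have ss : s * s = S 0 0 * S 1 1 - S 0 1 * S 0 1.
  by rewrite -expr2 sqr_sqrtr ?(ltW d0)// det_mx2 s01.
have c0 : 0 < S 1 1.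
  have e0 : (0, 1) != 0 :> R * R by rewrite xpair_eqE oner_eq0 andbF.
  have := Sp _ e0; rewrite /inner /mxact /=; lra.
pose t := Num.sqrt (S 0 0 + S 1 1 + 2 * s).
have t2 : 0 < S 0 0 + S 1 1 + 2 * s by rewrite !addr_gt0 ?mulr_gt0.
have t0 : 0 < t by rewrite sqrtr_gt0.
have tt : t^-1 * t^-1 * (S 0 0 + S 1 1 + 2 * s) = 1.
  by rewrite -invfM -expr2 sqr_sqrtr ?(ltW t2)// mulVf// gt_eqF.
exists (t^-1 *: (S + s%:M)); split.
- by rewrite linearZ /= linearD /= ST tr_scalar_mx.
- move=> u u0.
  have -> : inner (mxact (t^-1 *: (S + s%:M)) u) u = t^-1 * (inner (mxact S u) u + s * sqn u).
    by rewrite /sqn /inner /mxact !mxE /=; ring.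
  by rewrite mulr_gt0 ?invr_gt0// addr_gt0 ?Sp// mulr_gt0// sqn_gt0.
- have e (x y : R) : y = x * (S 0 0 + S 1 1 + 2 * s) -> t^-1 * t^-1 * y = x.
    by move=> ->; rewrite mulrCA tt mulr1.
  apply: matrix2P; rewrite mulmx2E !mxE /= ?mulr1n ?mulr0n ?addr0.
  + rewrite s01 (_ : _ + _ = t^-1 * t^-1 * ((S 0 0 + s) * (S 0 0 + s) + S 0 1 * S 0 1)); last by ring.
    by apply: e; rewrite (_ : S 0 1 * S 0 1 = S 0 0 * S 1 1 - s * s); [ring|rewrite ss; ring].
  + rewrite (_ : _ + _ = t^-1 * t^-1 * ((S 0 0 + s) * S 0 1 + S 0 1 * (S 1 1 + s))); last by ring.
    by apply: e; ring.
  + rewrite s01 (_ : _ + _ = t^-1 * t^-1 * (S 0 1 * (S 0 0 + s) + (S 1 1 + s) * S 0 1)); last by ring.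
    by apply: e; ring.
  + rewrite s01 (_ : _ + _ = t^-1 * t^-1 * (S 0 1 * S 0 1 + (S 1 1 + s) * (S 1 1 + s))); last by ring.
    by apply: e; rewrite (_ : S 0 1 * S 0 1 = S 0 0 * S 1 1 - s * s); [ring|rewrite ss; ring].
Qed.

Lemma affine_line_inner u (c : R) : u != 0 -> affine_line [set z | inner z u = c].
Proof.
move=> u0; have s0 := sqn_gt0 u0; exists ((c / sqn u) *: u), (perp u); split.
  by rewrite perp_eq0.
apply/seteqP; split => z /=.
  move=> zu; exists (inner z (perp u) / sqn u) => //.
  rewrite -zu; have s1 : sqn u != 0 by rewrite gt_eqF.
  apply: injective_projections => /=; rewrite /GRing.scale /= /GRing.scale /=;
    by move: s1; rewrite /sqn /inner /perp /= => s1; field.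
move=> [t _ <-]; rewrite innerDl !innerZl -/(sqn u) divfK ?gt_eqF//.
by rewrite innerC inner_perp_self mulr0 addr0.
Qed.

End planar_matrices.

Section real_integrals.
Context d (T : measurableType d) (R : realType) (P : probability T R).
Implicit Types g h : T -> R.

Lemma integrable_scale (a : R) g : P.-integrable setT (EFin \o g) ->
  P.-integrable setT (EFin \o (fun w => a * g w)).
Proof.
move=> gi; rewrite (_ : _ \o _ = (fun w => a%:E * (EFin \o g) w)%E); last by apply/funext.
exact: integrableZl.
Qed.

Lemma integrable_add g h : P.-integrable setT (EFin \o g) -> P.-integrable setT (EFin \o h) ->
  P.-integrable setT (EFin \o (fun w => g w + h w)).
Proof.
move=> gi hi; rewrite (_ : _ \o _ = (fun w => (EFin \o g) w + (EFin \o h) w)%E); last by apply/funext.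
exact: integrableD.
Qed.

End real_integrals.

(** * The whitened walk and the function R *)

Section isotropic_law.
Context d (T : measurableType d) (R : realType) (P : probability T R).
Variable X : nat -> {RV P >-> (R * R)%type}.
Hypothesis Xindep : mutually_independent X.
Hypothesis Xid : identically_distributed X.
Hypothesis Xline : forall h : set (R * R), affine_line h -> P (X 0%N @^-1` h) = 0%E.
Hypothesis XL2 : forall i : 'I_2, component i \o X 0%N \in Lfun P 2%:E.
Hypothesis Xmean : forall i : 'I_2, 'E_P[component i \o X 0%N]%E = 0%E.
Implicit Types (u v e z : R * R) (w : T).

Let S := covmx X.
Let f (i : 'I_2) : T -> R := component i \o X 0%N.
Let mX i : measurable_fun setT (X i).
Proof. exact: measurable_funPT. Qed.

Let prod_int i j : P.-integrable setT (EFin \o (fun w => f i w * f j w)).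
Proof.
apply/Lfun1_integrable.
exact: (Lfun2_mul_Lfun1 (XL2 i) (XL2 j)).
Qed.

Let coord_int i : P.-integrable setT (EFin \o f i).
Proof.
apply/Lfun1_integrable.
by apply: (Lfun_subset12 _ (XL2 i)); rewrite fin_num_measure.
Qed.

Let covE i j : S i j = \int[P]_w (f i w * f j w).
Proof.
rewrite /S mxE unlock !Xmean /= unlock /Rintegral; congr fine; apply: eq_integral => w _.
by congr EFin; rewrite -[f i w]subr0 -[f j w]subr0.
Qed.

Let S_sym : S^T = S.
Proof. by apply/matrixP => i j; rewrite mxE !covE; apply: eq_Rintegral => w _; rewrite mulrC. Qed.

Lemma integrable_inner u : P.-integrable setT (EFin \o (fun w => inner (X 0%N w) u)).
Proof.
have h := integrable_add (integrable_scale u.1 (coord_int 0)) (integrable_scale u.2 (coord_int 1)).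
by congr (P.-integrable setT _): h; apply/funext => w; rewrite /= /inner /f /component /=; congr EFin; ring.
Qed.

Lemma mean_inner u : \int[P]_w inner (X 0%N w) u = 0.
Proof.
have m i : \int[P]_w f i w = 0 by have := Xmean i; rewrite unlock /Rintegral => ->.
transitivity (\int[P]_w (u.1 * f 0 w + u.2 * f 1 w)).
  by apply: eq_Rintegral => w _; rewrite /inner /f /component /=; ring.
rewrite RintegralD//; [|exact: integrable_scale (coord_int 0)|exact: integrable_scale (coord_int 1)].
rewrite !RintegralZl//.
by rewrite !m !mulr0 addr0.
Qed.

Let quadE u v w : inner (X 0%N w) u * inner (X 0%N w) v =
  u.1 * v.1 * (f 0 w * f 0 w) + (u.1 * v.2 + u.2 * v.1) * (f 0 w * f 1 w) + u.2 * v.2 * (f 1 w * f 1 w).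
Proof. by rewrite /inner /f /component /=; ring. Qed.

Let quad_int2 (a b : R) : P.-integrable setT (EFin \o (fun w => a * (f 0 w * f 0 w) + b * (f 0 w * f 1 w))).
Proof. exact: (integrable_add (integrable_scale a (prod_int 0 0)) (integrable_scale b (prod_int 0 1))). Qed.

Lemma integrable_quad u v :
  P.-integrable setT (EFin \o (fun w => inner (X 0%N w) u * inner (X 0%N w) v)).
Proof.
have h := integrable_add (quad_int2 (u.1 * v.1) (u.1 * v.2 + u.2 * v.1)) (integrable_scale (u.2 * v.2) (prod_int 1 1)).
by congr (P.-integrable setT _): h; apply/funext => w; rewrite /= quadE.
Qed.

Lemma mean_quad u v : \int[P]_w (inner (X 0%N w) u * inner (X 0%N w) v) = inner (mxact S u) v.
Proof.
under eq_Rintegral do rewrite quadE.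
rewrite RintegralD//; last exact: integrable_scale (prod_int 1 1).
rewrite RintegralD//; [|exact: integrable_scale (prod_int 0 0)|exact: integrable_scale (prod_int 0 1)].
rewrite !RintegralZl//.
rewrite -!covE; have s01 : S 1 0 = S 0 1 by rewrite -[in LHS]S_sym mxE.
by rewrite /inner /mxact /= s01; ring.
Qed.

(** A vanishing variance along [u] would put X_1 almost surely on the line orthogonal to [u], which
    has probability 0. *)
Lemma cov_posdef u : u != 0 -> 0 < inner (mxact S u) u.
Proof.
move=> u0; rewrite -mean_quad lt_neqAle; apply/andP; split; last first.
  by apply: Rintegral_ge0 => w _; rewrite -expr2 sqr_ge0.
apply/eqP => h0.
have q0 w : (0 <= (inner (X 0%N w) u * inner (X 0%N w) u)%:E)%E by rewrite lee_fin -expr2 sqr_ge0.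
have qi := integrable_quad u u; have mq := measurable_int P qi.
have : (\int[P]_w `|(inner (X 0%N w) u * inner (X 0%N w) u)%:E| = 0)%E.
  under eq_integral do rewrite gee0_abs//.
  by rewrite -[LHS]fineK ?(integrable_fin_num _ qi)//; congr EFin; exact: esym h0.
move/(ae_eq_integral_abs P measurableT mq) => [N [mN N0 hN]].
have l0 := Xline (affine_line_inner 0 u0).
have : P setT = 0%E.
  apply/eqP; rewrite -measure_le0 -[leRHS](add0e 0%E).
  rewrite -[X in (_ <= X + _)%E]l0 -N0.
  have ml : measurable (X 0%N @^-1` [set z | inner z u = 0]).
    rewrite -[_ @^-1` _]setTI (_ : _ @^-1` _ = (fun w => inner (X 0%N w) u) @^-1` [set 0])//.
    by apply: (measurable_inner (mX 0) (measurable_cst u)).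
  apply: le_trans; last exact: (measureU2 P ml mN).
  apply: le_measure; rewrite ?inE//; first exact: measurableU.
  move=> w _; have [h|h] := eqVneq (inner (X 0%N w) u) 0; first by left.
  right; apply: hN => /= /(_ Logic.I) [] /eqP; rewrite mulf_eq0 orbb => /eqP h'.
  by rewrite h' eqxx in h.
by rewrite probability_setT => /eqP; rewrite onee_eq0.
Qed.

Let B := mxinvsqrt S.

Lemma mxsqrt_cov : spd_sqrt_of S (mxsqrt S).
Proof. exact: (xgetPex 0 (spd_sqrt_exists S_sym cov_posdef)). Qed.

Let A_det : 0 < \det (mxsqrt S).
Proof. by have [AT Ap _] := mxsqrt_cov; have [] := posdef_det AT Ap. Qed.

Let A_unit : mxsqrt S \in unitmx.
Proof. by rewrite unitmxE unitfE gt_eqF. Qed.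

Let B_sym : B^T = B.
Proof. by have [AT _ _] := mxsqrt_cov; rewrite /B /mxinvsqrt trmx_inv AT. Qed.

Let B_det : 0 < \det B.
Proof. by rewrite /B /mxinvsqrt det_inv invr_gt0. Qed.

Let AB : mxsqrt S *m B = 1%:M. Proof. exact: mulmxV. Qed.

Let mxact_B_neq0 u : u != 0 -> mxact B u != 0.
Proof. exact: (mxact_neq0 AB). Qed.

Lemma cov_invsqrt u v : inner (mxact S (mxact B u)) (mxact B v) = inner u v.
Proof.
have [_ _ AA] := mxsqrt_cov.
rewrite innerC inner_mxact B_sym -!mxact_mul -AA -!mulmxA AB mulmx1.
by rewrite mulVmx// mxact1 innerC.
Qed.

(* The additional quarter turn [perp] replaces the directions [v] of the theorem
   by the normals [perp v], which is how they enter [mean_ladmean]. *)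
Definition isotropic_steps w : steps R := fun i => perp (mxact B (X i w)).
Let Y := isotropic_steps.

Let inner_stepY w i v : inner (step (Y w) i) v = inner (X i w) (mxact B (- perp v)).
Proof.
transitivity (inner (mxact B (X i w)) (- perp v)); last by rewrite inner_mxact B_sym.
by rewrite /step /Y /isotropic_steps /inner /perp /=; ring.
Qed.

Let measurable_L : measurable_fun setT (fun z => perp (mxact B z)).
Proof.
apply: measurable_perp; apply: measurable_fun_pair => /=; apply: measurable_funD;
  by apply: measurable_funM.
Qed.

Lemma measurable_isotropic_steps : measurable_fun setT Y.
Proof. by apply: measurable_steps => i; exact: (measurableT_comp measurable_L (mX i)). Qed.

Definition isotropic_law : probability (steps R) R :=
  distribution P (mfun_Sub (mem_set measurable_isotropic_steps) : {mfun T >-> steps R}).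
Let mu := isotropic_law.

Let muE A : mu A = P (Y @^-1` A). Proof. by []. Qed.

Let law_integral (F : steps R -> R) : measurable_fun setT F ->
  P.-integrable setT (EFin \o (F \o Y)) ->
  mu.-integrable setT (EFin \o F) /\ \int[mu]_x F x = \int[P]_w F (Y w).
Proof.
move=> mF iF; have mEF : measurable_fun setT (EFin \o F) by exact/measurable_EFinP.
split; first exact: (@integrable_pushforward _ _ _ _ _ Y measurable_isotropic_steps P setT (EFin \o F) mEF iF measurableT).
congr fine.
exact: (@integral_pushforward _ _ _ _ _ Y measurable_isotropic_steps P setT (EFin \o F) mEF iF measurableT).
Qed.

Lemma isotropic_iid : iid_law mu.
Proof.
move=> n D mD; pose E i := (fun z => perp (mxact B z)) @^-1` D i.
have mE i : measurable (E i) by rewrite -[E i]setTI; exact: measurable_L.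
pose J := [fset i in iota 0 n]%fset.
have JE i : (i \in J) = (i < n)%N by rewrite !inE/= mem_iota.
rewrite muE; transitivity (P (\bigcap_(i in [set` J]) (X i @^-1` E i))).
  congr (P _); apply/seteqP; split => w /= h i.
    by move=> iJ; apply: h; rewrite -JE.
  by move=> ilt; apply: h; have := ilt; rewrite -JE.
rewrite Xindep//; transitivity (\prod_(i <- iota 0 n) P (X i @^-1` E i))%E.
  apply: perm_big; apply: uniq_perm; [exact: fset_uniq|exact: iota_uniq|].
  by move=> i; rewrite JE mem_iota.
have -> : iota 0 n = index_iota 0 n by rewrite /index_iota subn0.
rewrite big_mkord; apply: eq_bigr => i _; rewrite muE.
exact: (Xid i (mE i)).
Qed.

Lemma isotropic_null v (c : R) : v != 0 -> mu [set x | inner (step x 0) v = c] = 0%E.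
Proof.
move=> v0; have n0 : mxact B (- perp v) != 0 by rewrite mxact_B_neq0// oppr_eq0 perp_eq0.
rewrite muE -(Xline (affine_line_inner c n0)); congr (P _).
by apply/seteqP; split => w /=; rewrite inner_stepY.
Qed.

Let m_step v : measurable_fun setT (fun x : steps R => inner (step x 0) v).
Proof. by apply: measurable_inner => //; exact: measurable_step. Qed.

Let law_inner v : mu.-integrable setT (EFin \o (fun x => inner (step x 0) v)) /\
  \int[mu]_x inner (step x 0) v = 0.
Proof.
have e : (fun x => inner (step x 0) v) \o Y = (fun w => inner (X 0%N w) (mxact B (- perp v))).
  by apply/funext => w /=; rewrite inner_stepY.
have [|h1 h2] := law_integral (m_step v); first by rewrite e; exact: integrable_inner.
split=> //; rewrite h2; under eq_Rintegral do rewrite inner_stepY.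
exact: mean_inner.
Qed.

Let law_quad u v : mu.-integrable setT (EFin \o (fun x => inner (step x 0) u * inner (step x 0) v)) /\
  \int[mu]_x (inner (step x 0) u * inner (step x 0) v) = inner u v.
Proof.
have mq : measurable_fun setT (fun x : steps R => inner (step x 0) u * inner (step x 0) v) by exact: measurable_funM.
have e : (fun x => inner (step x 0) u * inner (step x 0) v) \o Y =
    (fun w => inner (X 0%N w) (mxact B (- perp u)) * inner (X 0%N w) (mxact B (- perp v))).
  by apply/funext => w /=; rewrite !inner_stepY.
have [|h1 h2] := law_integral mq; first by rewrite e; exact: integrable_quad.
split=> //; rewrite h2; under eq_Rintegral do rewrite !inner_stepY.
by rewrite mean_quad cov_invsqrt /inner /perp /=; ring.
Qed.

Let coord1 z : inner z (1, 0) = z.1. Proof. by rewrite /inner /= mulr1 mulr0 addr0. Qed.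
Let coord2 z : inner z (0, 1) = z.2. Proof. by rewrite /inner /= mulr1 mulr0 add0r. Qed.

Lemma isotropic_int1 : mu.-integrable setT (fun x => ((step x 0).1)%:E).
Proof. by have [h _] := law_inner (1, 0); congr (mu.-integrable setT _): h; apply/funext => x /=; rewrite coord1. Qed.

Lemma isotropic_int2 : mu.-integrable setT (fun x => ((step x 0).2)%:E).
Proof. by have [h _] := law_inner (0, 1); congr (mu.-integrable setT _): h; apply/funext => x /=; rewrite coord2. Qed.

Lemma isotropic_mean1 : \int[mu]_x (step x 0).1 = 0.
Proof. by have [_ <-] := law_inner (1, 0); apply: eq_Rintegral => x _; rewrite coord1. Qed.

Lemma isotropic_mean2 : \int[mu]_x (step x 0).2 = 0.
Proof. by have [_ <-] := law_inner (0, 1); apply: eq_Rintegral => x _; rewrite coord2. Qed.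

Lemma isotropic_sq : mu.-integrable setT (fun x => (sqn (step x 0))%:E).
Proof.
have [h1 _] := law_quad (1, 0) (1, 0); have [h2 _] := law_quad (0, 1) (0, 1).
have h := integrable_add h1 h2; congr (mu.-integrable setT _): h.
by apply/funext => x /=; rewrite !coord1 !coord2.
Qed.

Lemma isotropic_var e : sqn e = 1 -> \int[mu]_x (inner (step x 0) e ^+ 2) = 1.
Proof.
move=> e1; have [_ h] := law_quad e e; rewrite -[RHS]e1 -[RHS]h.
by apply: eq_Rintegral => x _; rewrite expr2.
 Qed.

Lemma isotropic_cov e : \int[mu]_x (inner (step x 0) e * inner (step x 0) (perp e)) = 0.
Proof. by have [_ ->] := law_quad e (perp e); exact: inner_perp_self. Qed.

Let perpD u v : perp (u + v) = perp u + perp v.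
Proof. by apply: injective_projections => //=; rewrite opprD. Qed.

Lemma psum_isotropic k w : psum k (Y w) = perp (mxact B (walk X k w)).
Proof.
elim: k => [|k IH]; first by rewrite psum0 /walk big_ord0 mxact0 /perp /= oppr0.
by rewrite psumS IH /walk big_ord_recr /= mxactD perpD.
Qed.

Lemma walk_hull_isotropic n : (0 < n)%N ->
  [set w | ~ walk_hull X n w 0] = Y @^-1` nohull n.
Proof.
move=> n0; apply/seteqP; split => w /=.
  move=> /(zero_notin_hullP (fun k => walk X k w) n0)[k [kn h]]; exists k; split => // j jn.
  by rewrite !psum_isotropic; apply/first_ray_perp/first_ray_mxact => //; exact: h.
move=> [k [kn h]]; apply/(zero_notin_hullP (fun k => walk X k w) n0); exists k; split => // j jn.
have := h j jn; rewrite !psum_isotropic => /first_ray_perp /(first_ray_mxact A_det).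
by rewrite -!mxact_mul AB !mxact1.
Qed.

Lemma prob_walk_hull n : (0 < n)%N -> P [set w | ~ walk_hull X n w 0] = mu (nohull n).
Proof. by move=> n0; rewrite walk_hull_isotropic. Qed.

Let isotropic_hyps (Q : Prop) :
  (iid_law mu -> (forall v c, v != 0 -> mu [set x | inner (step x 0) v = c] = 0%E) ->
   mu.-integrable setT (fun x => ((step x 0).1)%:E) -> mu.-integrable setT (fun x => ((step x 0).2)%:E) ->
   \int[mu]_x (step x 0).1 = 0 -> \int[mu]_x (step x 0).2 = 0 ->
   mu.-integrable setT (fun x => (sqn (step x 0))%:E) ->
   (forall e, sqn e = 1 -> \int[mu]_x (inner (step x 0) e ^+ 2) = 1) ->
   (forall e, \int[mu]_x (inner (step x 0) e * inner (step x 0) (perp e)) = 0) -> Q) -> Q.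
Proof.
apply; [exact: isotropic_iid|exact: isotropic_null|exact: isotropic_int1|exact: isotropic_int2|
  exact: isotropic_mean1|exact: isotropic_mean2|exact: isotropic_sq|exact: isotropic_var|exact: isotropic_cov].
Qed.

Section exit.
Variable v : R * R.
Let u := mxact B v.
Let loss w := - inner (walk_at_exit X u w) u.
Let st n w := stay n (perp v) (Y w).

Let inner_walk k w : inner (psum k (Y w)) (perp v) = inner (walk X k w) u.
Proof. by rewrite psum_isotropic perp_inner inner_mxact B_sym. Qed.

Let walk_at_exitE n w : st n w -> ~ st n.+1 w -> walk_at_exit X u w = walk X n.+1 w.
Proof.
move=> sn sn1; have ex : walk X n.+1 w \notin half_plane u.
  apply/negP; rewrite inE => h; apply: sn1 => j; rewrite leq_eqVlt => /orP[/eqP->|].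
    by rewrite inner_walk.
  by rewrite ltnS; exact: sn.
rewrite /walk_at_exit /exit_time; case: pselect => [h|[]]; last by exists n.+1.
case: (ex_minnP h) => k /andP[k1 hk] kmin; congr (walk X _ w); apply/eqP; rewrite eqn_leq.
rewrite kmin//= ltnNge; apply/negP => kn; move/negP: hk; apply; rewrite inE /half_plane /=.
by rewrite -inner_walk; exact: sn.
Qed.

Let walk_at_exit0 w : (forall n, st n w) -> walk_at_exit X u w = 0.
Proof.
move=> h; rewrite /walk_at_exit /exit_time; case: pselect => [ex|//].
by exfalso; have [k /andP[_ /negP]] := ex; apply; rewrite inE /half_plane /= -inner_walk; exact: (h k).
Qed.

(** The loss incurred by leaving at time m + 1. These are the increments in [staymean_incr], so the
    loss up to time n has mean [staymean n]. *)
Let term m (x : steps R) : R :=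
  - inner (psum m.+1 x) (perp v) * \1_(stay m (perp v) `\` stay m.+1 (perp v)) x.

Let loss_before n w := \sum_(m < n) term m (Y w).

Let loss_beforeE n w : (st n w -> loss_before n w = 0) /\ (~ st n w -> loss_before n w = loss w).
Proof.
elim: n => [|n [IH1 IH2]].
  by split => [_|[]]; rewrite /loss_before ?big_ord0// /st stay0.
rewrite /loss_before big_ord_recr /= -/(loss_before n w) /term indicE; split => h.
  have hn : st n w by exact: stayS_sub h.
  by rewrite IH1// memNset ?mulr0 ?addr0// => -[].
have [hn|hn] := pselect (st n w); last first.
  by rewrite IH2// memNset ?mulr0 ?addr0// => -[].
rewrite IH1// mem_set; last by split.
by rewrite mulr1 add0r /loss (walk_at_exitE hn h) inner_walk.
Qed.

Let term_ge0 m x : 0 <= term m x.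
Proof.
rewrite /term indicE; case: (boolP (_ \in _)); rewrite ?mulr0//.
rewrite inE mulr1 => -[h1 h2]; rewrite oppr_ge0 leNgt; apply/negP => h3; apply: h2 => j.
by rewrite leq_eqVlt => /orP[/eqP->|]; [exact: ltW|rewrite ltnS; exact: h1].
Qed.

Let mterm m : measurable_fun setT (term m).
Proof.
apply: measurable_funM; first by apply: measurableT_comp => //; exact: measurable_proj.
by apply: measurable_indic; apply: measurableD; exact: measurable_stay.
Qed.

Let term_int m : mu.-integrable setT (EFin \o term m).
Proof.
apply: isotropic_hyps => iid null int1 int2 _ _ _ _ _.
apply: integrable_mul_indic; first by apply: measurableD; exact: measurable_stay.
have := integrable_scale (-1) (integrable_proj iid int1 int2 m.+1 (perp v)).
by congr (mu.-integrable setT _); apply/funext => x /=; rewrite mulN1r.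
Qed.

Let sum_term n : staymean mu n (perp v) = \int[mu]_x \sum_(m < n) term m x.
Proof.
have [_ ->] := @Rintegral_sum _ _ _ mu n term term_int.
elim: n => [|n IH]; first by rewrite staymean0 big_ord0.
rewrite big_ord_recr /= -IH; apply: isotropic_hyps => iid null int1 int2 mean1 mean2 _ _ _.
exact: (staymean_incr iid int1 int2 mean1 mean2).
Qed.

Let m_loss_before n : measurable_fun setT (loss_before n).
Proof.
by apply: measurable_sum => m; exact: (measurableT_comp (mterm m) measurable_isotropic_steps).
Qed.

Let loss_before_int n : (\int[P]_w (loss_before n w)%:E)%E = (staymean mu n (perp v))%:E.
Proof.
have [h _] := @Rintegral_sum _ _ _ mu n term term_int.
rewrite sum_term /Rintegral fineK; last exact: (integrable_fin_num measurableT h).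
have mE : measurable_fun setT (EFin \o (fun x => \sum_(m < n) term m x)) by exact: (measurable_int mu h).
rewrite [RHS](@ge0_integral_pushforward _ _ _ _ _ Y measurable_isotropic_steps P setT)//.
by move=> x _; rewrite lee_fin sumr_ge0.
Qed.

Let loss_before_mono w : nondecreasing_seq (fun n => (loss_before n w)%:E).
Proof.
apply/nondecreasing_seqP => n; rewrite lee_fin /loss_before big_ord_recr /= lerDl.
exact: term_ge0.
Qed.

(** After the exit the truncated loss is constant. If the walk never exits, all truncations vanish,
    in agreement with the convention in [walk_at_exit]. *)
Let loss_before_cvg w : (fun n => (loss_before n w)%:E) @ \oo --> (loss w)%:E.
Proof.
have [[N h]|h] := pselect (exists N, ~ st N w).
  apply: cvg_near_cst; exists N => // n /= Nn.
  rewrite (proj2 (loss_beforeE n w))//.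
  by move=> hn; apply: h; exact: stayS_sub hn.
have hs n : st n w by apply: contrapT => hn; apply: h; exists n.
apply: cvg_near_cst; exists 0%N => // n _.
rewrite (proj1 (loss_beforeE n w))//.
by rewrite /loss walk_at_exit0// inner0l oppr0.
Qed.

(** Monotone convergence from the truncated losses, whose means are the increasing [staymean];
    finiteness of the mean loss is a result here. *)
Let loss_integral : (\int[P]_w (loss w)%:E)%E = (Num.sqrt (sqn v) * ladmean mu (perp (dir v)))%:E.
Proof.
have mE n : measurable_fun setT (fun w => (loss_before n w)%:E) by exact/measurable_EFinP.
have mono := @cvg_monotone_convergence _ _ _ P setT measurableT (fun n w => (loss_before n w)%:E) mE.
have -> : (\int[P]_w (loss w)%:E)%E = (\int[P]_w limn (fun n => (loss_before n w)%:E))%E.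
  by apply: eq_integral => w _; apply/esym/cvg_lim => //; exact: loss_before_cvg.
apply: (@cvg_unique _ _ ((fun n => \int[P]_w (loss_before n w)%:E)%E @ \oo)) => //.
  apply: mono => [n w _|w _]; last exact: loss_before_mono.
  by rewrite lee_fin sumr_ge0.
rewrite (_ : (fun n => _) = EFin \o (fun n => staymean mu n (perp v))).
  apply: cvg_EFin; first by exists 0%N.
  apply: isotropic_hyps => h1 h2 h3 h4 h5 h6 h7 h8 h9.
  exact: (cvg_staymean_perp h1 h2 h3 h4 h5 h6 h7 h8 h9).
by apply/funext => n; rewrite loss_before_int.
Qed.

(** By [cov_invsqrt] the normalising factor at u = Sigma^(-1/2) v is |v|, which cancels the length
    in the mean loss. At v = 0 both sides are 0 by convention. *)
Lemma Rfun_ladmean : Rfun X u = (ladmean mu (perp (dir v)))%:E.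
Proof.
rewrite /Rfun cov_invsqrt -/(sqn v) unlock.
have l0 w : 0 <= loss w.
  have [[N h]|h] := pselect (exists N, ~ st N w).
    by rewrite -(proj2 (loss_beforeE N w))// sumr_ge0.
  by rewrite /loss walk_at_exit0 ?inner0l ?oppr0// => n; apply: contrapT => hn; apply: h; exists n.
have -> : (- (\int[P]_w (inner (walk_at_exit X u w) u)%:E) = \int[P]_w (loss w)%:E)%E.
  rewrite (_ : \int[P]_w _ = \int[P]_w (- (loss w)%:E))%E.
    by rewrite integral_ge0N ?oppeK// => w _; rewrite lee_fin.
  by apply: eq_integral => w _; rewrite -EFinN /loss opprK.
rewrite loss_integral -EFinM; congr EFin.
have [->|v0] := eqVneq v 0.
  by rewrite /sqn inner0l sqrtr0 !mul0r dir0 /perp /= oppr0 ladmean0.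
by rewrite mulrC mulrA mulVf ?mul1r// gt_eqF// sqrtr_gt0 sqn_gt0.
Qed.

End exit.

Section uniform_direction.
Context d' (T' : measurableType d') (P' : probability T' R).
Variable U : {RV P' >-> (R * R)%type}.
Hypothesis Uunif : forall A : set (R * R), measurable A -> distribution P' U A = uniform_circle A.

Local Notation unif := (uniform_prob (@twopi_gt0 R) : probability (measurableTypeR R) R).

Let F z : R := ladmean mu (perp (dir z)).

Let mF : measurable_fun setT F.
Proof.
apply: isotropic_hyps => h1 h2 h3 h4 h5 h6 h7 h8 h9.
exact: (measurable_ladmean_dir h1 h2 h3 h4 h5 h6 h7 h8 h9).
Qed.

Lemma Rfun_uniform : (fun t : T' => Rfun X (mxact B (U t))) = (fun t => (F (U t))%:E).
Proof. by apply/funext => t; rewrite Rfun_ladmean. Qed.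

Let F_bounded : exists C, forall z, `|F z| <= C.
Proof.
apply: isotropic_hyps => h1 h2 h3 h4 h5 h6 h7 h8 h9.
exact: (ladmean_dir_bounded h1 h2 h3 h4 h5 h6 h7 h8 h9).
Qed.

Let mU : measurable_fun setT U. Proof. exact: measurable_funPT. Qed.

Lemma Rfun_integrable : P'.-integrable setT (fun t : T' => Rfun X (mxact B (U t))).
Proof.
rewrite Rfun_uniform; have [C FC] := F_bounded.
by apply: (@integrable_bounded _ _ _ P' (F \o U) C) => [|t]; [exact: (measurableT_comp mF mU)|exact: FC].
Qed.

Lemma mean_Rfun : (\int[P']_t Rfun X (mxact B (U t)))%E = (mean_ladmean mu)%:E.
Proof.
rewrite Rfun_uniform; have [C FC] := F_bounded.
have mEF : measurable_fun setT (EFin \o F) by exact/measurable_EFinP.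
have iU : P'.-integrable setT (EFin \o (F \o U)).
  by apply: (@integrable_bounded _ _ _ P' (F \o U) C) => [|t]; [exact: (measurableT_comp mF mU)|exact: FC].
have mc : measurable_fun setT (@circ R : measurableTypeR R -> R * R) := @measurable_circ R.
have ic : unif.-integrable setT (EFin \o (F \o @circ R)).
  by apply: (@integrable_bounded _ _ _ unif (F \o @circ R) C) => [|t]; [exact: (measurableT_comp mF mc)|exact: FC].
transitivity (\int[distribution P' U]_z (F z)%:E)%E.
  exact/esym/(@integral_pushforward _ _ _ _ _ U mU P' setT (EFin \o F) mEF iU measurableT).
transitivity (\int[pushforward unif (@circ R)]_z (F z)%:E)%E.
  by apply: eq_measure_integral => A mA _; exact: Uunif.
rewrite (@integral_pushforward _ _ (measurableTypeR R) _ R (@circ R) mc unif setT (EFin \o F) mEF ic measurableT).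
have fe : (EFin \o F) \o @circ R = EFin \o (fun t => ladmean mu (perp (circ t))).
  by apply/funext => t; rewrite /= /F dir_circ.
have ie : unif.-integrable setT (EFin \o (fun t => ladmean mu (perp (circ t)))) by rewrite -fe.
rewrite preimage_setT fe.
by rewrite /mean_ladmean /Rintegral fineK//; exact: (integrable_fin_num measurableT ie).
Qed.

End uniform_direction.

Lemma mean_ladmean_isotropic_gt0 : 0 < mean_ladmean mu.
Proof.
apply: isotropic_hyps => h1 h2 h3 h4 h5 h6 h7 h8 h9.
exact: (mean_ladmean_gt0 h1 h2 h3 h4 h5 h6 h7 h8 h9).
Qed.

Lemma cvg_prob_walk_hull :
  (fun n : nat => fine (P [set w | ~ walk_hull X n w 0]) /
     (Num.sqrt 2 * mean_ladmean mu * (ln n%:R / Num.sqrt (pi * n%:R)))) @ \oo --> (1 : R).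
Proof.
have h : (fun n : nat => fine (mu (nohull n)) /
     (Num.sqrt 2 * mean_ladmean mu * (ln n%:R / Num.sqrt (pi * n%:R)))) @ \oo --> (1 : R).
  apply: isotropic_hyps => h1 h2 h3 h4 h5 h6 h7 h8 h9.
  exact: (cvg_prob_nohull h1 h2 h3 h4 h5 h6 h7 h8 h9).
by apply: cvg_trans h; apply: near_eq_cvg; exists 1%N => // n /= n0; rewrite prob_walk_hull.
Qed.

End isotropic_law.

Theorem theorem2 (R : realType)
  (d : measure_display) (T : measurableType d) (P : probability T R)
  (X : nat -> {RV P >-> (R * R)%type})
  (d' : measure_display) (T' : measurableType d') (P' : probability T' R)
  (U : {RV P' >-> (R * R)%type})
  (Xindep : mutually_independent X)
  (Xid : identically_distributed X)
  (Xline : forall h : set (R * R), affine_line h -> P (X 0%N @^-1` h) = 0%E)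
  (XL2 : forall i : 'I_2, component i \o X 0%N \in Lfun P 2%:E)
  (Xmean : forall i : 'I_2, 'E_P[component i \o X 0%N]%E = 0%E)
  (Uunif : forall B : set (R * R), measurable B ->
     distribution P' U B = uniform_circle B) :
  let RU := fun w => Rfun X (mxact (mxinvsqrt (covmx X)) (U w)) in
  let ER := (\int[P']_w RU w)%E in
  [/\ P'.-integrable setT RU,
      (0 < ER)%E &
      (fun n : nat =>
         fine (P [set w | ~ walk_hull X n w 0]) /
         (Num.sqrt 2 * fine ER * (ln n%:R / Num.sqrt (pi * n%:R))))
        @ \oo --> (1 : R)].
Proof.
move=> RU ER.
have ERE : ER = (mean_ladmean (isotropic_law X))%:E by exact: mean_Rfun.
split.
- exact: Rfun_integrable.
- by rewrite ERE lte_fin; exact: mean_ladmean_isotropic_gt0.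
- by rewrite ERE; exact: cvg_prob_walk_hull.
Qed.
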